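(* Let $r:\mathbb R\to\mathbb R$ be such that $v=r'$ is twice continuously differentiable with $|v(t)|+|v'(t)|+|v''(t)|\le C$ for all $t$, and such that $\beta=v/c$ satisfies $\check\beta\le|\beta(t)|\le\hat\epsilon_1<1$ for all $t\in\mathbb R$, for some constants $\check\beta>0$, $\hat\epsilon_1<1$. Let $\hat{\mathbf r}(t)=(0,0,r(t))$. Then for any $T_-<T_+$ there exist sequences $a_n$, $R_n$, $\chi_n$ and potentials $\varphi_n$ such that the KG equations (with logarithmic nonlinearity) are localized in $\hat\Omega_n$, and there exists a sequence of solutions $\psi_n$ of these KG equations which concentrates at $\hat{\mathbf r}$.
   Context: Fix constants $c>0$, $m>0$ and a real charge $q\neq0$. For parameters $\chi>0$, $a>0$ and a real electric potential $\varphi(t,\mathbf x)$, $\mathbf x\in\mathbb R^3$, the KG equation with logarithmic nonlinearity is $-c^{-2}\tilde\partial_t^2\psi+\Delta\psi-G_a'(|\psi|^2)\psi-\kappa_0^2\psi=0$, where $\tilde\partial_t=\partial_t+\mathrm iq\varphi/\chi$, $\kappa_0=mc/\chi$, $G_a(s)=-a^{-2}s[\ln(a^3s)+\ln\pi^{3/2}+2]$ for $s\ge0$, so $G_a'(s)=-a^{-2}\ln(\pi^{3/2}a^3s)-3a^{-2}$. Put $a_C=\chi/(mc)$. Energy density $\mathcal E=\frac{\chi^2}{2m}[c^{-2}|\tilde\partial_t\psi|^2+|\nabla\psi|^2+G_a(|\psi|^2)+\kappa_0^2|\psi|^2]$. $\nabla_{0,\mathbf x}=(c^{-1}\partial_t,\partial_1,\partial_2,\partial_3)$.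 For $R_n\to0$: $\Omega_n(t)=\{|\mathbf x-\hat{\mathbf r}(t)|\le R_n\}$, $\hat\Omega_n=\{(t,\mathbf x):t\in[T_-,T_+],\mathbf x\in\Omega_n(t)\}$. Localized KG equations: $a_n\to0$, $\chi_n\to0$, $a_{C,n}/a_n\le C$, $R_n/a_n\to\infty$; $\varphi_n\in C^2(\hat\Omega_n)$ with $\sup_{\hat\Omega_n}(|\varphi_n|+|\nabla_{0,\mathbf x}\varphi_n|)\le C$ uniformly in $n$; and a limit $\varphi_\infty(t,\mathbf x)=\varphi_\infty(t,\hat{\mathbf r}(t))+(\mathbf x-\hat{\mathbf r}(t))\cdot\nabla\varphi_\infty(t)$ with $\sup_{\hat\Omega_n}(|\varphi_n-\varphi_\infty|+|\nabla_{0,\mathbf x}(\varphi_n-\varphi_\infty)|)\to0$ and $|\varphi_\infty(t,\hat{\mathbf r}(t))|,|\nabla\varphi_\infty(t)|,|\partial_t\nabla\varphi_\infty(t)|\le C$ on $[T_-,T_+]$. Concentrating solutions: $\psi_n\in C^2(\hat\Omega_n)$ solving KG with $(\chi_n,a_n,\varphi_n)$ in $\hat\Omega_n$ such that (i) $\max_t\int_{\Omega_n(t)}[a_C^2|\nabla_{0,\mathbf x}\psi_n|^2+a_C^2|G_a(|\psi_n|^2)|+|\psi_n|^2]d^3x\le C$; (ii) $\max_t\int_{\partial\Omega_n(t)}[\text{same integrand}]d^2\sigma\to0$; (iii) $\bar{\mathcal E}_n(t)=\int_{\Omega_n(t)}\mathcal E_nd^3x\ge c_0>0$ for $n\ge n_0$,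 $t\in[T_-,T_+]$; (iv) there is $t_0\in[T_-,T_+]$ with $\bar{\mathcal E}_n(t_0)$ convergent. *)

(* Defs.v *)
From Stdlib Require Import Reals Lra.
From Coquelicot Require Import Coquelicot.
Open Scope R_scope.

Definition P3 := (R * R * R)%type.
Definition p1 (x : P3) : R := fst (fst x).
Definition p2 (x : P3) : R := snd (fst x).
Definition p3 (x : P3) : R := snd x.
Definition mk3 (a b c : R) : P3 := (a, b, c).
Definition sub3 (x y : P3) : P3 := mk3 (p1 x - p1 y) (p2 x - p2 y) (p3 x - p3 y).
Definition add3 (x y : P3) : P3 := mk3 (p1 x + p1 y) (p2 x + p2 y) (p3 x + p3 y).
Definition scal3 (k : R) (x : P3) : P3 := mk3 (k * p1 x) (k * p2 x) (k * p3 x).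
Definition dot3 (x y : P3) : R := p1 x * p1 y + p2 x * p2 y + p3 x * p3 y.
Definition norm3 (x : P3) : R := sqrt (dot3 x x).

Definition getc (i : nat) (x : P3) : R :=
  match i with 1%nat => p1 x | 2%nat => p2 x | _ => p3 x end.
Definition setc (i : nat) (x : P3) (s : R) : P3 :=
  match i with
  | 1%nat => mk3 s (p2 x) (p3 x)
  | 2%nat => mk3 (p1 x) s (p3 x)
  | _ => mk3 (p1 x) (p2 x) s
  end.

Definition partial (i : nat) (f : R -> P3 -> R) (t : R) (x : P3) : R :=
  match i with
  | O => Derive (fun s => f s x) t
  | _ => Derive (fun s => f t (setc i x s)) (getc i x)
  end.
Definition ex_partial (i : nat) (f : R -> P3 -> R) (t : R) (x : P3) : Prop :=
  match i with
  | O => ex_derive (fun s => f s x) t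
  | _ => ex_derive (fun s => f t (setc i x s)) (getc i x)
  end.

Definition cont_within (S : R -> P3 -> Prop) (g : R -> P3 -> R) : Prop :=
  forall t x, S t x -> forall eps, 0 < eps -> exists delta, 0 < delta /\
    forall t' x', S t' x' -> Rabs (t' - t) < delta -> norm3 (sub3 x' x) < delta ->
      Rabs (g t' x' - g t x) < eps.

Definition C2_on (S : R -> P3 -> Prop) (f : R -> P3 -> R) : Prop :=
  cont_within S f /\
  (forall i, (i <= 3)%nat ->
     (forall t x, S t x -> ex_partial i f t x) /\ cont_within S (partial i f)) /\
  (forall i j, (i <= 3)%nat -> (j <= 3)%nat ->
     (forall t x, S t x -> ex_partial j (partial i f) t x) /\
     cont_within S (partial j (partial i f))).

Definition cpartial (i : nat) (f : R -> P3 -> C) (t : R) (x : P3) : C :=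
  (partial i (fun t x => Re (f t x)) t x, partial i (fun t x => Im (f t x)) t x).
Definition C2_on_C (S : R -> P3 -> Prop) (f : R -> P3 -> C) : Prop :=
  C2_on S (fun t x => Re (f t x)) /\ C2_on S (fun t x => Im (f t x)).

Definition grad0_norm (c : R) (f : R -> P3 -> R) (t : R) (x : P3) : R :=
  sqrt ((partial 0 f t x / c) ^ 2 + partial 1 f t x ^ 2
        + partial 2 f t x ^ 2 + partial 3 f t x ^ 2).
Definition grad_sq (f : R -> P3 -> C) (t : R) (x : P3) : R :=
  Cmod (cpartial 1 f t x) ^ 2 + Cmod (cpartial 2 f t x) ^ 2 + Cmod (cpartial 3 f t x) ^ 2.
Definition grad0_sq (c : R) (f : R -> P3 -> C) (t : R) (x : P3) : R :=
  (Cmod (cpartial 0 f t x) / c) ^ 2 + grad_sq f t x.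

Definition Ga (a s : R) : R :=
  - / a ^ 2 * s * (ln (a ^ 3 * s) + ln (Rpower PI (3 / 2)) + 2).
Definition dGa (a s : R) : R :=
  - / a ^ 2 * ln (Rpower PI (3 / 2) * a ^ 3 * s) - 3 / a ^ 2.

Definition covdt (q chi : R) (phi : R -> P3 -> R) (psi : R -> P3 -> C)
  (t : R) (x : P3) : C :=
  Cplus (cpartial 0 psi t x) (Cmult (0, q * phi t x / chi) (psi t x)).
Definition lap (psi : R -> P3 -> C) (t : R) (x : P3) : C :=
  Cplus (cpartial 1 (cpartial 1 psi) t x)
    (Cplus (cpartial 2 (cpartial 2 psi) t x) (cpartial 3 (cpartial 3 psi) t x)).

Definition solves_KG (c m q chi a : R) (phi : R -> P3 -> R) (psi : R -> P3 -> C)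
  (S : R -> P3 -> Prop) : Prop :=
  forall t x, S t x ->
    Cplus (Cplus (Cplus
      (Cmult (RtoC (- / c ^ 2)) (covdt q chi phi (covdt q chi phi psi) t x))
      (lap psi t x))
      (Copp (Cmult (RtoC (dGa a (Cmod (psi t x) ^ 2))) (psi t x))))
      (Copp (Cmult (RtoC ((m * c / chi) ^ 2)) (psi t x))) = RtoC 0.

Definition energy_density (c m q chi a : R) (phi : R -> P3 -> R) (psi : R -> P3 -> C)
  (t : R) (x : P3) : R :=
  chi ^ 2 / (2 * m) *
   ((Cmod (covdt q chi phi psi t x) / c) ^ 2 + grad_sq psi t x
    + Ga a (Cmod (psi t x) ^ 2) + (m * c / chi) ^ 2 * Cmod (psi t x) ^ 2).

(* Lebesgue integral d^3x over the closed ball of radius rr centred at x0, written as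
   an iterated (Riemann) integral; all integrands used below are continuous on the ball *)
Definition ball_int (x0 : P3) (rr : R) (f : P3 -> R) : R :=
  RInt (fun y1 =>
    RInt (fun y2 =>
      RInt (fun y3 => f (mk3 y1 y2 y3))
        (p3 x0 - sqrt (rr ^ 2 - (y1 - p1 x0) ^ 2 - (y2 - p2 x0) ^ 2))
        (p3 x0 + sqrt (rr ^ 2 - (y1 - p1 x0) ^ 2 - (y2 - p2 x0) ^ 2)))
      (p2 x0 - sqrt (rr ^ 2 - (y1 - p1 x0) ^ 2))
      (p2 x0 + sqrt (rr ^ 2 - (y1 - p1 x0) ^ 2)))
    (p1 x0 - rr) (p1 x0 + rr).

Definition sphere_int (x0 : P3) (rr : R) (f : P3 -> R) : R :=
  RInt (fun th =>
    RInt (fun ph =>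
      rr ^ 2 * sin th *
        f (add3 x0 (scal3 rr (mk3 (sin th * cos ph) (sin th * sin ph) (cos th)))))
      0 (2 * PI))
    0 PI.

Definition rhat (r : R -> R) (t : R) : P3 := mk3 0 0 (r t).
Definition Omega_hat (r : R -> R) (Tm Tp Rn : R) (t : R) (x : P3) : Prop :=
  Tm <= t <= Tp /\ norm3 (sub3 x (rhat r t)) <= Rn.

Definition localized_KG (c m : R) (r : R -> R) (Tm Tp : R)
  (a Rs chi : nat -> R) (phi : nat -> R -> P3 -> R) : Prop :=
  (forall n, 0 < a n /\ 0 < chi n /\ 0 < Rs n) /\
  is_lim_seq Rs 0 /\
  is_lim_seq a 0 /\ is_lim_seq chi 0 /\
  is_lim_seq (fun n => Rs n / a n) p_infty /\
  exists C : R,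
    (forall n, (chi n / (m * c)) / a n <= C) /\
    (forall n, C2_on (Omega_hat r Tm Tp (Rs n)) (phi n)) /\
    (forall n t x, Omega_hat r Tm Tp (Rs n) t x ->
       Rabs (phi n t x) + grad0_norm c (phi n) t x <= C) /\
    exists (phiinf : R -> P3 -> R) (f0 : R -> R) (g : R -> P3),
      (forall t x, phiinf t x = f0 t + dot3 (sub3 x (rhat r t)) (g t)) /\
      (forall t, ex_derive f0 t /\ ex_derive (fun s => p1 (g s)) t /\
                 ex_derive (fun s => p2 (g s)) t /\ ex_derive (fun s => p3 (g s)) t) /\
      (forall t, Tm <= t <= Tp ->
         Rabs (f0 t) <= C /\ norm3 (g t) <= C /\
         norm3 (mk3 (Derive (fun s => p1 (g s)) t) (Derive (fun s => p2 (g s)) t)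
                    (Derive (fun s => p3 (g s)) t)) <= C) /\
      (forall eps, 0 < eps -> exists N, forall n, (N <= n)%nat ->
         forall t x, Omega_hat r Tm Tp (Rs n) t x ->
           Rabs (phi n t x - phiinf t x)
           + grad0_norm c (fun t x => phi n t x - phiinf t x) t x <= eps).

Definition conc_integrand (c m chi a : R) (psi : R -> P3 -> C) (t : R) (x : P3) : R :=
  (chi / (m * c)) ^ 2 * grad0_sq c psi t x
  + (chi / (m * c)) ^ 2 * Rabs (Ga a (Cmod (psi t x) ^ 2))
  + Cmod (psi t x) ^ 2.

Definition concentrating (c m q : R) (r : R -> R) (Tm Tp : R)
  (a Rs chi : nat -> R) (phi : nat -> R -> P3 -> R) (psi : nat -> R -> P3 -> C) : Prop :=
  (forall n, C2_on_C (Omega_hat r Tm Tp (Rs n)) (psi n) /\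
             solves_KG c m q (chi n) (a n) (phi n) (psi n) (Omega_hat r Tm Tp (Rs n))) /\
  (exists C, forall n t, Tm <= t <= Tp ->
     ball_int (rhat r t) (Rs n) (conc_integrand c m (chi n) (a n) (psi n) t) <= C) /\
  (forall eps, 0 < eps -> exists N, forall n, (N <= n)%nat -> forall t, Tm <= t <= Tp ->
     sphere_int (rhat r t) (Rs n) (conc_integrand c m (chi n) (a n) (psi n) t) <= eps) /\
  (exists c0 n0, 0 < c0 /\ forall n t, (n0 <= n)%nat -> Tm <= t <= Tp ->
     c0 <= ball_int (rhat r t) (Rs n)
             (energy_density c m q (chi n) (a n) (phi n) (psi n) t)) /\
  (exists t0, Tm <= t0 <= Tp /\
     ex_finite_lim_seq (fun n => ball_int (rhat r t0) (Rs n)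
             (energy_density c m q (chi n) (a n) (phi n) (psi n) t0))).

(* Main.v *)
Require Import Defs.
From Stdlib Require Import Reals Lra Lia ClassicalEpsilon.
From Coquelicot Require Import Coquelicot.
Open Scope R_scope.

(* A charge with Gaussian profile. Put kap = m c / chi, y = x3 - r(t) and look for
     psi = const * exp (- (x1^2 + x2^2) / (2 a^2)) * exp (lamp(t) - y^2 / (2 a^2)) * exp (i kap S(t, y)).
   For Gaussians the logarithmic nonlinearity cancels the Laplacian of the transversal factors, and the KG
   equation splits into a continuity equation and a mass-shell relation E^2 - P^2 = 1 + Mass / kap^2 for
   P = S_y and the gauge-invariant energy E. Parametrizing the mass shell by the rapidity leaves one scalar
   first-order equation, solved by characteristics on a strip |y| < L uniformly in kap; its solution is an
   O(kap^-2) perturbation of E = gamma, P = - gamma v / c. The potential phi is then read off from E, P and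
   S_t: up to O(kap^-2) it is affine in y, with the slope m (gamma v)' / q that makes the charge follow r.
   This costs derivatives, so r is first replaced by a moving average much closer to r than a.
   With a = R^2 and 1 / kap small compared with a^2, the Gaussian gives all the energy estimates; the convergence
   of the energies at one time is obtained by passing to a subsequence. *)

(** The order of the choices shapes the proof. The strip width [L] and the constants of the final
    estimates depend only on [c], [m], [q], [eps1] and the common bound on [v], [v1], [v2]; the
    accuracy then fixes [a], [a] fixes the averaging step, and [/ kap ^ 2] comes last. Averaging
    keeps the bounds on [v], [v1], [v2], but the bounds on higher derivatives may explode as the
    step shrinks. They enter only through constants multiplied by [/ kap ^ 2], which is harmless if
    these constants are uniform in [kap]: hence the parameter [d] in the classes below. The strip is
    narrow because the slope of the characteristics varies in time at a rate governed by the
    acceleration, and they must not cross; the Gaussian is far narrower still. The derivatives are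
    counted backwards: [phi] contains the time derivative of a primitive of [P] and must be [C^2],
    so [P] has to be [C^3]; the transport equation has first derivatives of the mass term as source,
    so that term has to be [C^4]; it contains the second derivative of the velocity, which is merely
    continuous at the outset. *)

Definition cont2 (u : R -> R -> R) (s y : R) : Prop :=
  continuous (fun p : R * R => u (fst p) (snd p)) (s, y).

Definition open2 (U : R -> R -> Prop) : Prop :=
  forall s y, U s y -> locally (s, y) (fun p : R * R => U (fst p) (snd p)).

(* [CB D U k u]: the family [u d], [d] in [D], is [C^k] on [U] and its derivatives up to order [k] are
   bounded uniformly in [d]. In [CM] the function itself may be unbounded. *)
Fixpoint CB (D : R -> Prop) (U : R -> R -> Prop) (k : nat) (u : R -> R -> R -> R) : Prop :=
  (forall d s y, D d -> U s y -> cont2 (u d) s y) /\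
  (exists K, forall d s y, D d -> U s y -> Rabs (u d s y) <= K) /\
  match k with
  | O => True
  | S k' => exists us uy : R -> R -> R -> R,
      (forall d s y, D d -> U s y -> is_derive (fun x => u d x y) s (us d s y)) /\
      (forall d s y, D d -> U s y -> is_derive (fun x => u d s x) y (uy d s y)) /\
      CB D U k' us /\ CB D U k' uy
  end.

Definition CM (D : R -> Prop) (U : R -> R -> Prop) (k : nat) (u : R -> R -> R -> R) : Prop :=
  (forall d s y, D d -> U s y -> cont2 (u d) s y) /\
  match k with
  | O => True
  | S k' => exists us uy : R -> R -> R -> R,
      (forall d s y, D d -> U s y -> is_derive (fun x => u d x y) s (us d s y)) /\
      (forall d s y, D d -> U s y -> is_derive (fun x => u d s x) y (uy d s y)) /\
      CB D U k' us /\ CB D U k' uy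
  end.

Lemma continuous_pair_l (f : R -> R) (s y : R) :
  continuous f s -> continuous (fun p : R * R => f (fst p)) (s, y).
Proof.
  intro H; apply (continuous_comp (fun p : R * R => fst p) f); [apply continuous_fst | exact H].
Qed.

Lemma cont2_comp (u a b : R -> R -> R) (s y : R) :
  cont2 u (a s y) (b s y) -> cont2 a s y -> cont2 b s y ->
  cont2 (fun s y => u (a s y) (b s y)) s y.
Proof.
  intros Hu Ha Hb. unfold cont2.
  exact (continuous_comp_2 (fun p : R * R => a (fst p) (snd p)) (fun p => b (fst p) (snd p)) u (s, y)
    Ha Hb Hu).
Qed.

Lemma cont2_slice_l (u : R -> R -> R) (s y : R) :
  cont2 u s y -> continuous (fun x => u x y) s.
Proof.
  intro H.
  apply (continuous_comp_2 (fun x : R => x) (fun _ : R => y) u s);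
   [apply continuous_id | apply continuous_const | exact H].
Qed.

Lemma cont2_slice_r (u : R -> R -> R) (s y : R) :
  cont2 u s y -> continuous (fun x => u s x) y.
Proof.
  intro H.
  apply (continuous_comp_2 (fun _ : R => s) (fun x : R => x) u y);
   [apply continuous_const | apply continuous_id | exact H].
Qed.

Lemma open2_slice_l (U : R -> R -> Prop) (s y : R) :
  open2 U -> U s y -> locally s (fun x => U x y).
Proof.
  intros HU H. destruct (HU s y H) as [e He]. exists e. intros x Hx.
  apply (He (x, y)). split; [exact Hx | apply ball_center].
Qed.

Lemma open2_slice_r (U : R -> R -> Prop) (s y : R) :
  open2 U -> U s y -> locally y (fun x => U s x).
Proof.
  intros HU H. destruct (HU s y H) as [e He]. exists e. intros x Hx.
  apply (He (s, x)). split; [apply ball_center | exact Hx].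
Qed.

Lemma cont2_ext (U : R -> R -> Prop) (u v : R -> R -> R) (s y : R) :
  open2 U -> U s y -> (forall s y, U s y -> u s y = v s y) -> cont2 u s y -> cont2 v s y.
Proof.
  intros HU H E Hu. unfold cont2.
  apply continuous_ext_loc with (2 := Hu).
  generalize (HU s y H). apply filter_imp. intros p Hp. apply E, Hp.
Qed.

(* Only the partial derivative in the first variable has to be continuous. *)
Lemma is_derive_comp2 (u us : R -> R -> R) (uy : R) (a b : R -> R) (x la lb : R) :
  locally (a x, b x) (fun p : R * R => is_derive (fun z => u z (snd p)) (fst p) (us (fst p) (snd p))) ->
  is_derive (fun z => u (a x) z) (b x) uy ->
  cont2 us (a x) (b x) ->
  is_derive a x la -> is_derive b x lb ->
  is_derive (fun x => u (a x) (b x)) x (us (a x) (b x) * la + uy * lb).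
Proof.
  intros H1 H2 H3 Ha Hb.
  apply is_derive_Reals.
  apply (derivable_pt_lim_comp_2d u a b x (us (a x) (b x)) uy la lb);
   [| apply is_derive_Reals, Ha | apply is_derive_Reals, Hb].
  apply filterdiff_differentiable_pt_lim.
  exact (is_derive_filterdiff u (a x) (b x) us uy H1 H2 H3).
Qed.

(** * Closure properties of the classes [CB] and [CM] *)

Section Class.
Variables (D : R -> Prop) (U : R -> R -> Prop).
Hypothesis HU : open2 U.

Lemma CB_cont k u : CB D U k u -> forall d s y, D d -> U s y -> cont2 (u d) s y.
Proof. destruct k; intros [H _]; exact H. Qed.

Lemma CB_bound k u : CB D U k u -> exists K, forall d s y, D d -> U s y -> Rabs (u d s y) <= K.
Proof. destruct k; intros [_ [H _]]; exact H. Qed.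

Lemma CB_bound_pos k u : CB D U k u ->
  exists K, 0 < K /\ forall d s y, D d -> U s y -> Rabs (u d s y) <= K.
Proof.
  intro H. destruct (CB_bound k u H) as [K HK]. exists (Rabs K + 1). split.
  - generalize (Rabs_pos K); lra.
  - intros d s y Hd Hs. generalize (HK d s y Hd Hs) (Rle_abs K); lra.
Qed.

Lemma CB_S k u : CB D U (S k) u -> CB D U k u.
Proof.
  revert u; induction k as [|k IH]; intros u [Hc [Hb [us [uy [H1 [H2 [H3 H4]]]]]]].
  - split; [exact Hc | split; [exact Hb | exact I]].
  - split; [exact Hc | split; [exact Hb |]]. exists us, uy. auto.
Qed.

Lemma CB_le j k u : (j <= k)%nat -> CB D U k u -> CB D U j u.
Proof.
  intros Hjk H. induction Hjk as [|k _ IH]; [exact H | apply IH, CB_S, H].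
Qed.

Lemma CB_ext k u v : (forall d s y, D d -> U s y -> u d s y = v d s y) -> CB D U k u -> CB D U k v.
Proof.
  intros E H.
  assert (Hc : forall d s y, D d -> U s y -> cont2 (v d) s y).
  { intros d s y Hd Hs. apply (cont2_ext U (u d)); auto. apply (CB_cont k u H); auto. }
  assert (Hb : exists K, forall d s y, D d -> U s y -> Rabs (v d s y) <= K).
  { destruct (CB_bound k u H) as [K HK]. exists K. intros. rewrite <- E; auto. }
  destruct k.
  - split; [exact Hc | split; [exact Hb | exact I]].
  - destruct H as [_ [_ [us [uy [H1 [H2 [H3 H4]]]]]]].
    split; [exact Hc | split; [exact Hb |]]. exists us, uy. refine (conj _ (conj _ (conj _ _))); auto.
    + intros d s y Hd Hs. apply is_derive_ext_loc with (2 := H1 d s y Hd Hs).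
      generalize (open2_slice_l U s y HU Hs). apply filter_imp. intros; apply E; auto.
    + intros d s y Hd Hs. apply is_derive_ext_loc with (2 := H2 d s y Hd Hs).
      generalize (open2_slice_r U s y HU Hs). apply filter_imp. intros; apply E; auto.
Qed.

Lemma CB_const k c : CB D U k (fun _ _ _ => c).
Proof.
  revert c; induction k as [|k IH]; intro c;
   (split; [intros; apply continuous_const | split; [exists (Rabs c); intros; apply Rle_refl |]]).
  - exact I.
  - exists (fun _ _ _ => 0), (fun _ _ _ => 0). refine (conj _ (conj _ (conj _ _))); auto;
    intros; apply (is_derive_const (K := R_AbsRing) (V := R_NormedModule)).
Qed.

Lemma CB_plus k u v : CB D U k u -> CB D U k v -> CB D U k (fun d s y => u d s y + v d s y).
Proof.
  revert u v; induction k as [|k IH]; intros u v Hu Hv;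
  (split; [intros d s y Hd Hs;
     apply (continuous_plus (V := R_NormedModule) (fun p : R * R => u d (fst p) (snd p)) (fun p => v d (fst p) (snd p)));
     [eapply CB_cont; eassumption | eapply CB_cont; eassumption] | split;
     [destruct (CB_bound _ _ Hu) as [K HK]; destruct (CB_bound _ _ Hv) as [K' HK'];
      exists (K + K'); intros d s y Hd Hs; eapply Rle_trans; [apply Rabs_triang |];
      apply Rplus_le_compat; auto |]]).
  - exact I.
  - destruct Hu as [_ [_ [us [uy [H1 [H2 [H3 H4]]]]]]].
    destruct Hv as [_ [_ [vs [vy [G1 [G2 [G3 G4]]]]]]].
    exists (fun d s y => us d s y + vs d s y), (fun d s y => uy d s y + vy d s y).
    (refine (conj _ (conj _ (conj _ _))); auto; intros).
    + apply (is_derive_plus (V := R_NormedModule) (fun x => u d x y) (fun x => v d x y)); auto.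
    + apply (is_derive_plus (V := R_NormedModule) (fun x => u d s x) (fun x => v d s x)); auto.
Qed.

Lemma CB_mult k u v : CB D U k u -> CB D U k v -> CB D U k (fun d s y => u d s y * v d s y).
Proof.
  revert u v; induction k as [|k IH]; intros u v Hu Hv;
  (split; [intros d s y Hd Hs;
     apply (continuous_mult (K := R_AbsRing) (fun p : R * R => u d (fst p) (snd p)) (fun p => v d (fst p) (snd p)));
     [eapply CB_cont; eassumption | eapply CB_cont; eassumption] | split;
     [destruct (CB_bound _ _ Hu) as [K HK]; destruct (CB_bound _ _ Hv) as [K' HK'];
      exists (K * K'); intros d s y Hd Hs; rewrite Rabs_mult;
      apply Rmult_le_compat; auto using Rabs_pos |]]).
  - exact I.
  - pose proof (CB_S _ _ Hu) as Hu'. pose proof (CB_S _ _ Hv) as Hv'.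
    destruct Hu as [_ [_ [us [uy [H1 [H2 [H3 H4]]]]]]].
    destruct Hv as [_ [_ [vs [vy [G1 [G2 [G3 G4]]]]]]].
    exists (fun d s y => us d s y * v d s y + u d s y * vs d s y),
           (fun d s y => uy d s y * v d s y + u d s y * vy d s y).
    (refine (conj _ (conj _ (conj _ _))); auto using CB_plus; intros).
    + apply (is_derive_mult (fun x => u d x y) (fun x => v d x y)); auto. intros; apply Rmult_comm.
    + apply (is_derive_mult (fun x => u d s x) (fun x => v d s x)); auto. intros; apply Rmult_comm.
Qed.

Lemma CB_opp k u : CB D U k u -> CB D U k (fun d s y => - u d s y).
Proof.
  intro H. apply CB_ext with (fun d s y => -1 * u d s y); [intros; ring |].
  apply CB_mult; [apply CB_const | exact H].
Qed.

Lemma CB_minus k u v : CB D U k u -> CB D U k v -> CB D U k (fun d s y => u d s y - v d s y).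
Proof. intros; apply CB_plus; [| apply CB_opp]; auto. Qed.

Lemma CB_pow k u n : CB D U k u -> CB D U k (fun d s y => u d s y ^ n).
Proof.
  intro H; induction n as [|n IH]; simpl; [apply CB_const | apply CB_mult; auto].
Qed.

Lemma CB_chain0 (f : R -> R) u :
  CB D U 0 u -> (forall d s y, D d -> U s y -> continuous f (u d s y)) ->
  (exists K, forall d s y, D d -> U s y -> Rabs (f (u d s y)) <= K) ->
  CB D U 0 (fun d s y => f (u d s y)).
Proof.
  intros Hu Hf Hb. split; [| split; [exact Hb | exact I]].
  intros d s y Hd Hs. unfold cont2.
  apply (continuous_comp (fun p : R * R => u d (fst p) (snd p)) f); [apply (CB_cont _ _ Hu) | apply Hf]; auto.
Qed.

(** The induction step shared by the closure lemmas for inverse, exponential, sine, cosine and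
    logarithm: order [S k] of [f u] is reduced to order [k] of [f u] and of [f' u], and [f'] is
    always a function that the induction already covers. *)
Lemma CB_chainS (f f' : R -> R) k u :
  CB D U (S k) u -> CB D U k (fun d s y => f (u d s y)) ->
  (forall d s y, D d -> U s y -> is_derive f (u d s y) (f' (u d s y))) ->
  CB D U k (fun d s y => f' (u d s y)) -> CB D U (S k) (fun d s y => f (u d s y)).
Proof.
  intros Hu H0 Hf Hf'. destruct Hu as [_ [_ [us [uy [H1 [H2 [H3 H4]]]]]]].
  split; [exact (CB_cont _ _ H0) | split; [exact (CB_bound _ _ H0) |]].
  exists (fun d s y => us d s y * f' (u d s y)), (fun d s y => uy d s y * f' (u d s y)).
  (refine (conj _ (conj _ (conj _ _))); auto using CB_mult; intros).
  - apply (is_derive_comp (K := R_AbsRing) (V := R_NormedModule) f (fun x => u d x y)); auto.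
  - apply (is_derive_comp (K := R_AbsRing) (V := R_NormedModule) f (fun x => u d s x)); auto.
Qed.

Lemma CB_inv k u : CB D U k u ->
  (exists c, 0 < c /\ forall d s y, D d -> U s y -> c <= Rabs (u d s y)) ->
  CB D U k (fun d s y => / u d s y).
Proof.
  intros Hu [c [Hc Hl]].
  assert (Hn : forall d s y, D d -> U s y -> u d s y <> 0).
  { intros d s y Hd Hs E. specialize (Hl d s y Hd Hs). rewrite E, Rabs_R0 in Hl. lra. }
  revert u Hu Hl Hn; induction k as [|k IH]; intros u Hu Hl Hn.
  - apply (CB_chain0 Rinv u Hu).
    + intros. apply (ex_derive_continuous Rinv). eexists. auto_derive; auto.
    + exists (/ c). intros. rewrite Rabs_inv. apply Rinv_le_contravar; auto.
  - apply (CB_chainS Rinv (fun x => - / (x ^ 2))); auto.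
    + apply IH; auto using CB_S.
    + intros. auto_derive; auto. field; auto.
    + apply CB_opp. apply CB_ext with (fun d s y => (/ u d s y) ^ 2).
      { intros. rewrite pow_inv; auto. }
      apply CB_pow, IH; auto using CB_S.
Qed.

Lemma CB_exp k u : CB D U k u -> CB D U k (fun d s y => exp (u d s y)).
Proof.
  revert u; induction k as [|k IH]; intros u Hu.
  - apply (CB_chain0 exp u Hu).
    + intros. apply (ex_derive_continuous exp). eexists. auto_derive; auto.
    + destruct (CB_bound _ _ Hu) as [K HK]. exists (exp K). intros.
      rewrite Rabs_right by (left; apply exp_pos).
      assert (u d s y <= K) by (eapply Rle_trans; [apply Rle_abs | auto]).
      destruct H1 as [H1|H1]; [left; apply exp_increasing; auto | rewrite H1; lra].
  - apply (CB_chainS exp exp); auto using CB_S. intros. auto_derive; auto. ring.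
Qed.

Lemma CB_sin_cos k u : CB D U k u ->
  CB D U k (fun d s y => sin (u d s y)) /\ CB D U k (fun d s y => cos (u d s y)).
Proof.
  revert u; induction k as [|k IH]; intros u Hu.
  - split; [apply (CB_chain0 sin u Hu) | apply (CB_chain0 cos u Hu)].
    + intros. apply (ex_derive_continuous sin). eexists. auto_derive; auto.
    + exists 1; intros; apply Rabs_le, SIN_bound.
    + intros. apply (ex_derive_continuous cos). eexists. auto_derive; auto.
    + exists 1; intros; apply Rabs_le, COS_bound.
  - destruct (IH u (CB_S _ _ Hu)). split.
    + apply (CB_chainS sin cos); auto. intros. auto_derive; auto. ring.
    + apply (CB_chainS cos (fun x => - sin x)); auto using CB_opp. intros. auto_derive; auto. ring.
Qed.

Lemma CB_ln k u : CB D U k u ->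
  (exists c, 0 < c /\ forall d s y, D d -> U s y -> c <= u d s y) ->
  CB D U k (fun d s y => ln (u d s y)).
Proof.
  intros Hu [c [Hc Hl]].
  assert (Hp : forall d s y, D d -> U s y -> 0 < u d s y).
  { intros d s y Hd Hs. specialize (Hl d s y Hd Hs). lra. }
  revert u Hu Hl Hp; induction k as [|k IH]; intros u Hu Hl Hp.
  - apply (CB_chain0 ln u Hu).
    + intros. apply (ex_derive_continuous ln). eexists. auto_derive; auto.
    + destruct (CB_bound_pos _ _ Hu) as [K [HK0 HK]]. exists (Rabs (ln c) + Rabs (ln K)). intros.
      assert (u d s y <= K) by (eapply Rle_trans; [apply Rle_abs | auto]).
      assert (ln c <= ln (u d s y)) by (apply ln_le; auto).
      assert (ln (u d s y) <= ln K) by (apply ln_le; auto).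
      generalize (Rle_abs (ln K)) (Rle_abs (- ln c)) (Rabs_pos (ln K)) (Rabs_pos (ln c)).
      rewrite Rabs_Ropp. intros. apply Rabs_le. lra.
  - apply (CB_chainS ln Rinv); auto.
    + apply IH; auto using CB_S.
    + intros. auto_derive; auto. field. apply Rgt_not_eq, Hp; auto.
    + apply CB_inv; auto using CB_S. exists c. split; auto. intros.
      eapply Rle_trans; [| apply Rle_abs]. auto.
Qed.

Lemma CB_sqrt k u : CB D U k u ->
  (exists c, 0 < c /\ forall d s y, D d -> U s y -> c <= u d s y) ->
  CB D U k (fun d s y => sqrt (u d s y)).
Proof.
  intros Hu Hc.
  apply CB_ext with (fun d s y => exp (/ 2 * ln (u d s y))).
  - destruct Hc as [c [Hc Hl]]. intros d s y Hd Hs. specialize (Hl d s y Hd Hs).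
    rewrite <- (Rpower_sqrt (u d s y)) by lra. reflexivity.
  - apply CB_exp, CB_mult; [apply CB_const | apply CB_ln; auto].
Qed.

Lemma CM_cont k u : CM D U k u -> forall d s y, D d -> U s y -> cont2 (u d) s y.
Proof. intros [H _]; exact H. Qed.

Lemma CM_S k u : CM D U (S k) u -> CM D U k u.
Proof.
  intros [Hc [us [uy [H1 [H2 [H3 H4]]]]]]. split; [exact Hc |].
  destruct k; [exact I |]. exists us, uy. auto using CB_S.
Qed.

End Class.

Lemma CB_restrict (D D' : R -> Prop) (U U' : R -> R -> Prop) k u :
  (forall d, D' d -> D d) -> (forall s y, U' s y -> U s y) -> CB D U k u -> CB D' U' k u.
Proof.
  intros HD HU. revert u; induction k as [|k IH]; intros u [Hc [[K HK] H]];
  (split; [intros; apply Hc; auto | split; [exists K; auto |]]).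
  - exact I.
  - destruct H as [us [uy [H1 [H2 [H3 H4]]]]]. exists us, uy. auto 10.
Qed.

(** The inner functions are only required to be in [CM] because the maps substituted later
    (characteristics, their inverses, the shift to the moving frame) grow linearly in time.
    Boundedness survives since in the chain rule only derivatives of [a] and [b] occur as
    factors. *)
Lemma CB_comp (D : R -> Prop) (U V : R -> R -> Prop) k u a b :
  open2 U -> open2 V ->
  (forall d s y, D d -> U s y -> V (a d s y) (b d s y)) ->
  CB D V k u -> CM D U k a -> CM D U k b -> CB D U k (fun d s y => u d (a d s y) (b d s y)).
Proof.
  intros HU HV Hab. revert u a b Hab; induction k as [|k IH]; intros u a b Hab Hu Ha Hb;
  (split; [intros d s y Hd Hs; apply cont2_comp; [apply (CB_cont D V _ _ Hu); auto | apply (CM_cont _ _ _ _ Ha); auto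
     | apply (CM_cont _ _ _ _ Hb); auto] |
   split; [destruct (CB_bound D V _ _ Hu) as [K HK]; exists K; auto |]]).
  - exact I.
  - pose proof (CM_S _ _ _ _ Ha) as Ha'. pose proof (CM_S _ _ _ _ Hb) as Hb'.
    destruct Hu as [_ [_ [us [uy [H1 [H2 [H3 H4]]]]]]].
    destruct Ha as [_ [as_ [ay [A1 [A2 [A3 A4]]]]]].
    destruct Hb as [_ [bs [by_ [B1 [B2 [B3 B4]]]]]].
    exists (fun d s y => us d (a d s y) (b d s y) * as_ d s y + uy d (a d s y) (b d s y) * bs d s y),
           (fun d s y => us d (a d s y) (b d s y) * ay d s y + uy d (a d s y) (b d s y) * by_ d s y).
    assert (L : forall d s y, D d -> U s y -> locally (a d s y, b d s y)
      (fun p : R * R => is_derive (fun z => u d z (snd p)) (fst p) (us d (fst p) (snd p)))).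
    { intros d s y Hd Hs. generalize (HV _ _ (Hab d s y Hd Hs)). apply filter_imp. intros; auto. }
    refine (conj _ (conj _ (conj _ _))).
    + intros d s y Hd Hs.
      apply (is_derive_comp2 (u d) (us d) (uy d (a d s y) (b d s y)) (fun x => a d x y) (fun x => b d x y)); auto.
      apply (CB_cont D V _ _ H3); auto.
    + intros d s y Hd Hs.
      apply (is_derive_comp2 (u d) (us d) (uy d (a d s y) (b d s y)) (fun x => a d s x) (fun x => b d s x)); auto.
      apply (CB_cont D V _ _ H3); auto.
    + apply CB_plus; apply CB_mult; auto.
    + apply CB_plus; apply CB_mult; auto.
Qed.

(** Heine's theorem on the compact segment over [[-Y, Y]] at the fixed parameter [s0]: continuity at
    the points of that segment is enough. *)
Lemma cont2_unif (f : R -> R -> R) (s0 Y : R) :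
  (forall x, Rabs x <= Y -> cont2 f s0 x) ->
  forall eps, 0 < eps -> exists eta, 0 < eta /\
    forall s x, Rabs (s - s0) < eta -> Rabs x <= Y -> Rabs (f s x - f s0 x) < eps.
Proof.
  intros H eps He.
  destruct (uniform_continuity_2d_1d' f (- Y) Y s0) with (eps := mkposreal eps He) as [eta Heta].
  - intros x Hx. apply continuity_2d_pt_filterlim. apply H. apply Rabs_le. lra.
  - exists eta. split; [apply cond_pos |]. intros s x Hs Hx.
    apply Rabs_le_between in Hx. apply Rabs_def2 in Hs. generalize (cond_pos eta). intro.
    apply (Heta x s0 x s); try lra. rewrite Rminus_diag, Rabs_R0. lra.
Qed.

(** * Integrals and Gronwall's lemma on a strip around the axis *)

Section Strip.
Variable L : R.

Definition strip (_ y : R) : Prop := Rabs y < L.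

Lemma Rabs_near (y y' e : R) : Rabs (y' - y) < e - Rabs y -> Rabs y' < e.
Proof.
  intro H. generalize (Rabs_triang (y' - y) y). replace (y' - y + y) with y' by ring. lra.
Qed.

Lemma strip_open : open2 strip.
Proof.
  intros s y H. assert (He : 0 < L - Rabs y) by (unfold strip in H; lra).
  exists (mkposreal _ He). intros [s' y'] [_ H2]. exact (Rabs_near y y' L H2).
Qed.

Definition SC (f : R -> R) : Prop := forall x, Rabs x < L -> continuous f x.
Definition SC2 (u : R -> R -> R) : Prop := forall s y, Rabs y < L -> cont2 u s y.

Lemma SC2_SC u s : SC2 u -> SC (u s).
Proof. intros H x Hx. apply (cont2_slice_r u), H, Hx. Qed.

Lemma between_0 (x y : R) : Rmin 0 y <= x <= Rmax 0 y -> Rabs x <= Rabs y.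
Proof.
  unfold Rmin, Rmax; destruct (Rle_dec 0 y); intros.
  - rewrite !Rabs_right; lra.
  - rewrite !Rabs_left1; lra.
Qed.

Lemma SC_ex_RInt f y : SC f -> Rabs y < L -> ex_RInt f 0 y.
Proof.
  intros H Hy. apply (ex_RInt_continuous (V := R_CompleteNormedModule)).
  intros z Hz. apply H. apply Rle_lt_trans with (2 := Hy), between_0, Hz.
Qed.

Lemma is_derive_RInt_strip f y : SC f -> Rabs y < L -> is_derive (fun x => RInt f 0 x) y (f y).
Proof.
  intros H Hy. apply (is_derive_RInt (V := R_NormedModule) f (fun x => RInt f 0 x) 0).
  - generalize (open2_slice_r strip 0 y strip_open Hy). apply filter_imp.
    intros x Hx. apply (RInt_correct (V := R_CompleteNormedModule)), SC_ex_RInt; auto.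
  - apply H, Hy.
Qed.

Lemma abs_RInt_strip f y M : SC f -> Rabs y < L ->
  (forall x, Rabs x <= Rabs y -> Rabs (f x) <= M) -> Rabs (RInt f 0 y) <= M * Rabs y.
Proof.
  intros H Hy HM. destruct (Rle_dec 0 y) as [Hp|Hn].
  - eapply Rle_trans; [apply (abs_RInt_le_const f 0 y M); auto |].
    + apply SC_ex_RInt; auto.
    + intros. apply HM, between_0. rewrite Rmin_left, Rmax_right; lra.
    + rewrite (Rabs_right y) by lra. lra.
  - rewrite <- (opp_RInt_swap (V := R_CompleteNormedModule) f).
    2: { apply ex_RInt_swap, SC_ex_RInt; auto. }
    unfold opp; simpl. rewrite Rabs_Ropp.
    eapply Rle_trans; [apply (abs_RInt_le_const f y 0 M); [lra | |] |].
    + apply ex_RInt_swap, SC_ex_RInt; auto.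
    + intros. apply HM, between_0. rewrite Rmin_right, Rmax_left; lra.
    + rewrite (Rabs_left y) by lra. lra.
Qed.

Lemma RInt_exp_pos (M lam y : R) : 0 < lam -> 0 <= y ->
  is_RInt (fun x => M * exp (lam * x)) 0 y (M / lam * (exp (lam * y) - 1)).
Proof.
  intros Hl Hy.
  replace (M / lam * (exp (lam * y) - 1)) with
    (minus (M / lam * exp (lam * y)) (M / lam * exp (lam * 0))).
  - apply (is_RInt_derive (V := R_CompleteNormedModule) (fun x => M / lam * exp (lam * x))).
    + intros. auto_derive; auto. field. lra.
    + intros. apply (ex_derive_continuous (K := R_AbsRing) (V := R_NormedModule)). auto_derive; auto.
  - unfold minus, plus, opp; simpl. rewrite Rmult_0_r, exp_0. ring.
Qed.

(** Against the weight [exp (lam * Rabs x)] integration gains the factor [/ lam]. With [lam] a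
    suitable multiple of the Lipschitz constant, the integral operators below become contractions
    with factor one half on the whole strip, whatever its width. *)
Lemma abs_RInt_strip_exp f y M lam : SC f -> Rabs y < L -> 0 < lam ->
  (forall x, Rabs x <= Rabs y -> Rabs (f x) <= M * exp (lam * Rabs x)) ->
  Rabs (RInt f 0 y) <= M / lam * (exp (lam * Rabs y) - 1).
Proof.
  intros H Hy Hl HM.
  assert (P : forall g z, SC g -> 0 <= z -> z < L ->
    (forall x, 0 <= x <= z -> Rabs (g x) <= M * exp (lam * x)) ->
    Rabs (RInt g 0 z) <= M / lam * (exp (lam * z) - 1)).
  { intros g z Hg Hz HzL HMg.
    assert (Eg : ex_RInt g 0 z) by (apply SC_ex_RInt; auto; rewrite Rabs_right; lra).
    eapply Rle_trans; [apply abs_RInt_le; auto |].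
    rewrite <- (is_RInt_unique _ _ _ _ (RInt_exp_pos M lam z Hl Hz)).
    apply RInt_le; auto.
    - apply (ex_RInt_norm g); auto.
    - eexists; apply RInt_exp_pos; auto.
    - intros; apply HMg; lra. }
  destruct (Rle_dec 0 y) as [Hp|Hn].
  - rewrite (Rabs_right y) in * by lra. apply P; auto.
    intros x Hx. specialize (HM x). rewrite (Rabs_right x) in HM by lra. apply HM; lra.
  - rewrite (Rabs_left y) in * by lra.
    (* The case of negative [y] is reflected to the positive side. *)
    assert (E : RInt f 0 y = - RInt (fun x => f (- x)) 0 (- y)).
    { transitivity (RInt f (-1 * 0 + 0) (-1 * - y + 0)); [f_equal; ring |].
      rewrite <- (RInt_comp_lin (V := R_CompleteNormedModule) f (-1) 0 0 (- y)).
      - rewrite <- (RInt_opp (V := R_CompleteNormedModule)).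
        + apply RInt_ext. intros x _. unfold scal, opp; simpl; unfold mult; simpl.
          replace (-1 * x + 0) with (- x) by ring. ring.
        + apply (SC_ex_RInt (fun x => f (- x))); [| rewrite Rabs_Ropp, Rabs_left; lra].
          intros x Hx. apply (continuous_comp (fun x => - x) f).
          * apply (continuous_opp (V := R_NormedModule) (fun x => x)), continuous_id.
          * apply H. rewrite Rabs_Ropp; auto.
      - replace (-1 * 0 + 0) with 0 by ring. replace (-1 * - y + 0) with y by ring.
        apply SC_ex_RInt; auto. rewrite Rabs_left; lra. }
    rewrite E, Rabs_Ropp. apply P; try lra.
    + intros x Hx. apply (continuous_comp (fun x => - x) f).
      * apply (continuous_opp (V := R_NormedModule) (fun x => x)), continuous_id.
      * apply H. rewrite Rabs_Ropp; auto.
    + intros x Hx. specialize (HM (- x)). rewrite Rabs_Ropp in HM.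
      rewrite (Rabs_right x) in HM by lra. apply HM; lra.
Qed.

Lemma SC_bounded f y : SC f -> Rabs y < L ->
  exists N, 0 <= N /\ forall x, Rabs x <= Rabs y -> f x <= N.
Proof.
  intros H Hy.
  destruct (continuity_ab_maj f (- Rabs y) (Rabs y)) as [M [HM _]].
  - generalize (Rabs_pos y); lra.
  - intros c Hc. apply continuity_pt_filterlim. apply H.
    apply Rle_lt_trans with (2 := Hy), Rabs_le, Hc.
  - exists (Rabs (f M)). split; [apply Rabs_pos |]. intros x Hx.
    apply Rabs_le_between in Hx. eapply Rle_trans; [apply HM; lra | apply Rle_abs].
Qed.

(** Inserting the bound [(2 * a + N * (/ 2) ^ j) * exp (2 * K * Rabs x)] in the hypothesis halves
    the term with [N], and [j] is arbitrary. This bootstrap starts from any local bound [N] and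
    costs a factor 2 in the amplitude and in the exponent compared with the sharp inequality. *)
Lemma gronwall n a K : 0 <= a -> 0 < K -> SC n ->
  (forall y, Rabs y < L -> 0 <= n y) ->
  (forall y, Rabs y < L -> n y <= a + K * Rabs (RInt n 0 y)) ->
  forall y, Rabs y < L -> n y <= 2 * a * exp (2 * K * Rabs y).
Proof.
  intros Ha HK Hn Hp H y Hy.
  destruct (SC_bounded n y Hn Hy) as [N [HN Hb]].
  assert (C : forall j x, Rabs x <= Rabs y -> n x <= (2 * a + N * (/ 2) ^ j) * exp (2 * K * Rabs x)).
  { induction j as [|j IH]; intros x Hx.
    - simpl. assert (1 <= exp (2 * K * Rabs x)).
      { rewrite <- exp_0. destruct (Req_dec (2 * K * Rabs x) 0) as [->|]; [lra |].
        left; apply exp_increasing. assert (0 <= 2 * K * Rabs x); [| lra].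
        apply Rmult_le_pos; [lra | apply Rabs_pos]. }
      specialize (Hb x Hx). nra.
    - assert (Hx' : Rabs x < L) by lra.
      eapply Rle_trans; [apply H; auto |].
      assert (B : Rabs (RInt n 0 x) <= (2 * a + N * (/ 2) ^ j) / (2 * K) * (exp (2 * K * Rabs x) - 1)).
      { apply abs_RInt_strip_exp; auto; [lra |]. intros z Hz.
        rewrite Rabs_right; [apply IH; lra | apply Rle_ge, Hp; lra]. }
      apply Rmult_le_compat_l with (r := K) in B; [| lra].
      replace (K * ((2 * a + N * (/ 2) ^ j) / (2 * K) * (exp (2 * K * Rabs x) - 1)))
        with ((a + N * (/ 2) ^ j / 2) * (exp (2 * K * Rabs x) - 1)) in B by (field; lra).
      simpl. assert (0 <= N * (/ 2) ^ j) by (apply Rmult_le_pos; [lra | apply pow_le; lra]).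
      generalize (exp_pos (2 * K * Rabs x)); intro.
      assert (1 <= exp (2 * K * Rabs x)).
      { rewrite <- exp_0. destruct (Req_dec (2 * K * Rabs x) 0) as [->|]; [lra |].
        left; apply exp_increasing. assert (0 <= 2 * K * Rabs x); [| lra].
        apply Rmult_le_pos; [lra | apply Rabs_pos]. }
      nra. }
  apply le_epsilon. intros eps He.
  set (E := exp (2 * K * Rabs y)). assert (HE : 0 < E) by apply exp_pos.
  destruct (pow_lt_1_zero (/ 2)) with (y := eps / (N + 1) / E) as [j Hj].
  - rewrite Rabs_right; lra.
  - apply Rdiv_lt_0_compat; auto. apply Rdiv_lt_0_compat; lra.
  - specialize (Hj j (Nat.le_refl j)). specialize (C j y (Rle_refl _)). fold E in C.
    rewrite Rabs_right in Hj by (apply Rle_ge, pow_le; lra).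
    eapply Rle_trans; [exact C |].
    assert (N * (/ 2) ^ j * E <= eps); [| lra].
    apply Rmult_lt_compat_r with (r := E) in Hj; auto.
    replace (eps / (N + 1) / E * E) with (eps / (N + 1)) in Hj by (field; lra).
    apply Rmult_lt_compat_r with (r := N + 1) in Hj; [| lra].
    replace (eps / (N + 1) * (N + 1)) with eps in Hj by (field; lra).
    assert (0 <= (/ 2) ^ j) by (apply pow_le; lra). nra.
Qed.

(** The increment is split into a change of the integrand at a fixed endpoint, small uniformly on
    [[-Y, Y]] by [cont2_unif], and a change of the endpoint for the fixed integrand [f s0]. *)
Lemma SC2_RInt f : SC2 f -> SC2 (fun s y => RInt (f s) 0 y).
Proof.
  intros H s0 y0 Hy0. unfold cont2.
  apply (filterlim_locally (F := locally (s0, y0))). intros eps. simpl.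
  set (Y := (Rabs y0 + L) / 2).
  assert (HY : Rabs y0 < Y < L) by (unfold Y; lra).
  assert (HY0 : 0 < Y) by (generalize (Rabs_pos y0); lra).
  destruct (cont2_unif f s0 Y) with (eps := eps / 2 / Y) as [eta [Heta Hu]].
  { intros x Hx. apply H. lra. }
  { apply Rdiv_lt_0_compat; auto. generalize (cond_pos eps); lra. }
  assert (Hc : continuous (fun y => RInt (f s0) 0 y) y0).
  { apply (ex_derive_continuous (K := R_AbsRing) (V := R_NormedModule)). eexists. apply is_derive_RInt_strip; auto. apply SC2_SC, H. }
  assert (He2 : 0 < eps / 2) by (generalize (cond_pos eps); lra).
  pose proof (proj1 (filterlim_locally _ _) Hc (mkposreal _ He2)) as Hc'.
  assert (Hy1 : locally y0 (fun y => Rabs y < Y)).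
  { assert (He : 0 < Y - Rabs y0) by lra.
    exists (mkposreal _ He). intros y' H2. exact (Rabs_near y0 y' Y H2). }
  assert (Hs1 : locally s0 (fun s => Rabs (s - s0) < eta)).
  { exists (mkposreal _ Heta). intros s' H2. exact H2. }
  destruct (filter_and _ _ Hc' Hy1) as [e1 G1]. destruct Hs1 as [e2 G2].
  assert (Main : forall s y : R, Rabs (s - s0) < e2 -> Rabs (y - y0) < e1 ->
    Rabs (RInt (f s) 0 y - RInt (f s0) 0 y0) < eps).
  2: { exists (mkposreal _ (Rmin_stable_in_posreal e1 e2)).
    intros [s y] [B1 B2]. apply Main.
    - eapply Rlt_le_trans; [exact B1 | apply Rmin_r].
    - eapply Rlt_le_trans; [exact B2 | apply Rmin_l]. }
  intros s y B1 B2.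
  specialize (G2 s B1). destruct (G1 y B2) as [G3 G4].
  assert (G5 : Rabs (RInt (f s0) 0 y - RInt (f s0) 0 y0) < eps / 2) by exact G3.
  assert (HyL : Rabs y < L) by lra.
  assert (E : RInt (f s) 0 y - RInt (f s0) 0 y = RInt (fun x => f s x - f s0 x) 0 y).
  { symmetry. apply (RInt_minus (V := R_CompleteNormedModule)); apply SC_ex_RInt; auto; apply SC2_SC, H. }
  assert (B : Rabs (RInt (f s) 0 y - RInt (f s0) 0 y) <= eps / 2 / Y * Rabs y).
  { rewrite E. apply abs_RInt_strip; auto.
    - intros x Hx. apply (continuous_minus (V := R_NormedModule) (f s) (f s0)); apply SC2_SC; auto.
    - intros x Hx. left. apply Hu; auto. lra. }
  assert (eps / 2 / Y * Rabs y <= eps / 2).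
  { apply Rmult_le_reg_r with Y; auto.
    replace (eps / 2 / Y * Rabs y * Y) with (eps / 2 * Rabs y) by (field; lra). nra. }
  replace (RInt (f s) 0 y - RInt (f s0) 0 y0) with
    ((RInt (f s) 0 y - RInt (f s0) 0 y) + (RInt (f s0) 0 y - RInt (f s0) 0 y0)) by ring.
  eapply Rle_lt_trans; [apply Rabs_triang |]. lra.
Qed.

End Strip.

(** * Parameter-dependent differential equations *)

Lemma half_pow_small (B eps : R) : 0 <= B -> 0 < eps -> exists n, B * (/ 2) ^ n < eps.
Proof.
  intros HB He. destruct (pow_lt_1_zero (/ 2)) with (y := eps / (B + 1)) as [j Hj].
  - rewrite Rabs_right; lra.
  - apply Rdiv_lt_0_compat; lra.
  - exists j. specialize (Hj j (Nat.le_refl j)). rewrite Rabs_right in Hj by (apply Rle_ge, pow_le; lra).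
    apply Rmult_lt_compat_r with (r := B + 1) in Hj; [| lra].
    replace (eps / (B + 1) * (B + 1)) with eps in Hj by (field; lra).
    assert (0 <= (/ 2) ^ j) by (apply pow_le; lra). nra.
Qed.

Lemma half_pow_zero (x B : R) : 0 <= B -> (forall n, Rabs x <= B * (/ 2) ^ n) -> x = 0.
Proof.
  intros HB H. destruct (Req_dec x 0) as [|Hx]; auto. exfalso.
  destruct (half_pow_small B (Rabs x) HB (Rabs_pos_lt x Hx)) as [n Hn].
  specialize (H n). lra.
Qed.

Lemma geometric_limit (a : nat -> R) (A : R) :
  (forall n, Rabs (a (S n) - a n) <= A * (/ 2) ^ n) ->
  forall n, Rabs (real (Lim_seq a) - a n) <= 2 * A * (/ 2) ^ n.
Proof.
  intro H.
  assert (HA : 0 <= A). { specialize (H O). simpl in H. generalize (Rabs_pos (a 1%nat - a O)). lra. }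
  assert (T : forall n m, Rabs (a (n + m)%nat - a n) <= 2 * A * (/ 2) ^ n).
  (* The partial geometric sum with its factor [1 - (/ 2) ^ m] is kept, since the induction on [m]
     does not close for the bare bound. *)
  { intros n m. assert (Q : Rabs (a (n + m)%nat - a n) <= 2 * A * (/ 2) ^ n * (1 - (/ 2) ^ m)).
    { induction m as [|m IH].
      - rewrite Nat.add_0_r, Rminus_diag, Rabs_R0. simpl. lra.
      - replace (a (n + S m)%nat - a n) with ((a (S (n + m)) - a (n + m)%nat) + (a (n + m)%nat - a n))
          by (rewrite Nat.add_succ_r; ring).
        eapply Rle_trans; [apply Rabs_triang |]. specialize (H (n + m)%nat).
        rewrite pow_add in H. simpl. lra. }
    assert (0 <= (/ 2) ^ m) by (apply pow_le; lra).
    assert (0 <= 2 * A * (/ 2) ^ n) by (apply Rmult_le_pos; [lra | apply pow_le; lra]). nra. }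
  assert (C : ex_finite_lim_seq a).
  { apply ex_lim_seq_cauchy_corr. intros eps.
    destruct (half_pow_small (2 * A) (eps / 2)) as [N HN]; [lra | generalize (cond_pos eps); lra |].
    exists N. intros n m Hn Hm.
    replace n with (N + (n - N))%nat by lia. replace m with (N + (m - N))%nat by lia.
    generalize (T N (n - N)%nat) (T N (m - N)%nat). intros T1 T2.
    replace (a (N + (n - N))%nat - a (N + (m - N))%nat) with
      ((a (N + (n - N))%nat - a N) - (a (N + (m - N))%nat - a N)) by ring.
    eapply Rle_lt_trans; [apply Rabs_triang |]. rewrite Rabs_Ropp. lra. }
  intros n. apply Lim_seq_correct' in C.
  apply (is_lim_seq_incr_n a n) in C.
  assert (C2 : is_lim_seq (fun m => Rabs (a (m + n)%nat - a n)) (Rabs (real (Lim_seq a) - a n))).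
  { apply (is_lim_seq_abs (fun m => a (m + n)%nat - a n) (Finite (real (Lim_seq a) - a n))).
    apply is_lim_seq_minus'; [exact C | apply is_lim_seq_const]. }
  apply (is_lim_seq_le (fun m => Rabs (a (m + n)%nat - a n)) (fun _ => 2 * A * (/ 2) ^ n) _ _
    ) with (2 := C2) (3 := is_lim_seq_const _).
  intros m. rewrite Nat.add_comm. apply T.
Qed.

Lemma SC2_uniform_limit L (u : nat -> R -> R -> R) (v : R -> R -> R) (B : R) :
  0 <= B -> (forall n, SC2 L (u n)) ->
  (forall n s y, Rabs y < L -> Rabs (v s y - u n s y) <= B * (/ 2) ^ n) -> SC2 L v.
Proof.
  intros HB Hu H s y Hy. apply (filterlim_locally (F := locally (s, y))). intros eps.
  assert (He : 0 < eps / 3) by (generalize (cond_pos eps); lra).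
  destruct (half_pow_small B (eps / 3) HB He) as [n Hn].
  pose proof (proj1 (filterlim_locally _ _) (Hu n s y Hy) (mkposreal _ He)) as Hc.
  generalize (filter_and _ _ Hc (strip_open L s y Hy)). apply filter_imp.
  assert (Main : forall s' y', Rabs (u n s' y' - u n s y) < eps / 3 -> Rabs y' < L ->
    Rabs (v s' y' - v s y) < eps).
  { intros s' y' H1 H2. generalize (H n s y Hy) (H n s' y' H2). intros Q1 Q2.
    replace (v s' y' - v s y) with ((v s' y' - u n s' y') + (u n s' y' - u n s y) - (v s y - u n s y)) by ring.
    eapply Rle_lt_trans; [apply Rabs_triang |]. rewrite Rabs_Ropp.
    eapply Rle_lt_trans; [apply Rplus_le_compat_r, Rabs_triang |]. lra. }
  intros [s' y'] [H1 H2]. exact (Main s' y' H1 H2).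
Qed.

(** The evolution variable is [y], started at 0 in both directions; [s] is a parameter on which the
    right-hand sides and the initial values may depend. This is the form of the characteristic
    system, where [s] is the time at which a characteristic leaves the axis [y = 0]. *)
Fixpoint picard_iter (F1 F2 : R -> R -> R -> R -> R) (z1 z2 : R -> R) (n : nat) :
  (R -> R -> R) * (R -> R -> R) :=
  match n with
  | O => (fun s _ => z1 s, fun s _ => z2 s)
  | S n => let p := picard_iter F1 F2 z1 z2 n in
     (fun s y => z1 s + RInt (fun x => F1 s x (fst p s x) (snd p s x)) 0 y,
      fun s y => z2 s + RInt (fun x => F2 s x (fst p s x) (snd p s x)) 0 y)
  end.

(** [Lim_seq] and [real] are total, so the limit can be named before convergence is known;
    [picard_limit] shows that it is a genuine limit on the strip. *)
Definition picard1 F1 F2 z1 z2 (s y : R) : R :=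
  real (Lim_seq (fun n => fst (picard_iter F1 F2 z1 z2 n) s y)).
Definition picard2 F1 F2 z1 z2 (s y : R) : R :=
  real (Lim_seq (fun n => snd (picard_iter F1 F2 z1 z2 n) s y)).

Lemma SC_minus L f g : SC L f -> SC L g -> SC L (fun x => f x - g x).
Proof. intros Hf Hg x Hx. apply (continuous_minus (V := R_NormedModule) f g); auto. Qed.

Lemma RInt_minus_strip L f g y : SC L f -> SC L g -> Rabs y < L ->
  RInt f 0 y - RInt g 0 y = RInt (fun x => f x - g x) 0 y.
Proof.
  intros Hf Hg Hy. symmetry.
  apply (RInt_minus (V := R_CompleteNormedModule)); apply (SC_ex_RInt L); auto.
Qed.

Lemma Rplus_minus_swap_add (z a b : R) : z + a - (z + b) = a - b.
Proof. ring. Qed.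

Section Picard.
Variables (L : R) (F1 F2 : R -> R -> R -> R -> R) (z1 z2 : R -> R) (K K0 : R).
Hypothesis HL : 0 < L.
Hypothesis HK : 0 < K.
Hypothesis Hz1 : forall s, continuous z1 s.
Hypothesis Hz2 : forall s, continuous z2 s.
Hypothesis HF1 : forall u w, SC2 L u -> SC2 L w -> SC2 L (fun s y => F1 s y (u s y) (w s y)).
Hypothesis HF2 : forall u w, SC2 L u -> SC2 L w -> SC2 L (fun s y => F2 s y (u s y) (w s y)).
Hypothesis Lip1 : forall s y u w u' w', Rabs y < L ->
  Rabs (F1 s y u w - F1 s y u' w') <= K * (Rabs (u - u') + Rabs (w - w')).
Hypothesis Lip2 : forall s y u w u' w', Rabs y < L ->
  Rabs (F2 s y u w - F2 s y u' w') <= K * (Rabs (u - u') + Rabs (w - w')).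
Hypothesis B1 : forall s y, Rabs y < L -> Rabs (F1 s y (z1 s) (z2 s)) <= K0.
Hypothesis B2 : forall s y, Rabs y < L -> Rabs (F2 s y (z1 s) (z2 s)) <= K0.

Let u n := fst (picard_iter F1 F2 z1 z2 n).
Let w n := snd (picard_iter F1 F2 z1 z2 n).

Lemma picard_init_cont (z : R -> R) (f : R -> R -> R) :
  (forall s, continuous z s) -> SC2 L f -> SC2 L (fun s y => z s + RInt (f s) 0 y).
Proof.
  intros Hz Hf s y Hy.
  apply (continuous_plus (V := R_NormedModule) (fun p : R * R => z (fst p)) (fun p => RInt (f (fst p)) 0 (snd p))).
  - apply continuous_pair_l, Hz.
  - apply (SC2_RInt L f Hf s y Hy).
Qed.

Lemma picard_iter_cont n : SC2 L (u n) /\ SC2 L (w n).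
Proof.
  induction n as [|n [IH1 IH2]].
  - split; intros s y Hy; apply continuous_pair_l; auto.
  - split.
    + apply (picard_init_cont z1 (fun s x => F1 s x (u n s x) (w n s x))); auto.
    + apply (picard_init_cont z2 (fun s x => F2 s x (u n s x) (w n s x))); auto.
Qed.

(** With the weight [exp (4 * K * Rabs y)] each component of the next step is at most a quarter of
    the sum of the previous ones, by [abs_RInt_strip_exp]; the two quarters make the factor one
    half. *)
Lemma picard_iter_step n s y : Rabs y < L ->
  Rabs (u (S n) s y - u n s y) + Rabs (w (S n) s y - w n s y) <=
    2 * K0 * L * (/ 2) ^ n * exp (4 * K * Rabs y).
Proof.
  revert y; induction n as [|n IH]; intros y Hy.
  - assert (G : forall F, SC2 L (fun s y => F s y (z1 s) (z2 s)) ->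
       (forall s y, Rabs y < L -> Rabs (F s y (z1 s) (z2 s)) <= K0) ->
       Rabs (RInt (fun x => F s x (z1 s) (z2 s)) 0 y) <= K0 * L).
    { intros F HF HB. eapply Rle_trans; [apply (abs_RInt_strip L); auto |].
      - apply (SC2_SC L (fun s y => F s y (z1 s) (z2 s)) s HF).
      - intros x Hx. apply HB. lra.
      - apply Rmult_le_compat_l; [| lra].
        eapply Rle_trans; [apply Rabs_pos | apply (HB s y Hy)]. }
    destruct (picard_iter_cont 0) as [C1 C2].
    pose proof (G F1 (HF1 _ _ C1 C2) B1) as G1. pose proof (G F2 (HF2 _ _ C1 C2) B2) as G2.
    unfold u, w; simpl.
    rewrite !Rplus_minus_l.
    assert (1 <= exp (4 * K * Rabs y)).
    { rewrite <- exp_0. destruct (Req_dec (4 * K * Rabs y) 0) as [->|]; [lra |].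
      left; apply exp_increasing. assert (0 <= 4 * K * Rabs y); [| lra].
      apply Rmult_le_pos; [lra | apply Rabs_pos]. }
    assert (0 <= K0 * L) by (eapply Rle_trans; [apply Rabs_pos | exact G1]).
    nra.
  - destruct (picard_iter_cont n) as [C1 C2]. destruct (picard_iter_cont (S n)) as [C3 C4].
    assert (G : forall F, (forall u w, SC2 L u -> SC2 L w -> SC2 L (fun s y => F s y (u s y) (w s y))) ->
       (forall s y u w u' w', Rabs y < L ->
          Rabs (F s y u w - F s y u' w') <= K * (Rabs (u - u') + Rabs (w - w'))) ->
       Rabs (RInt (fun x => F s x (u (S n) s x) (w (S n) s x)) 0 y - RInt (fun x => F s x (u n s x) (w n s x)) 0 y)
         <= K * (2 * K0 * L * (/ 2) ^ n) / (4 * K) * (exp (4 * K * Rabs y) - 1)).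
    { intros F HF HLip.
      assert (S1 : SC L (fun x => F s x (u (S n) s x) (w (S n) s x)))
        by (apply (SC2_SC L (fun s x => F s x (u (S n) s x) (w (S n) s x))); auto).
      assert (S2 : SC L (fun x => F s x (u n s x) (w n s x)))
        by (apply (SC2_SC L (fun s x => F s x (u n s x) (w n s x))); auto).
      rewrite (RInt_minus_strip L) by auto.
      apply (abs_RInt_strip_exp L); auto using SC_minus; [lra |].
      intros x Hx. eapply Rle_trans; [apply HLip; lra |].
      rewrite Rmult_assoc. apply Rmult_le_compat_l; [lra |]. apply IH. lra. }
    pose proof (G F1 HF1 Lip1) as G1. pose proof (G F2 HF2 Lip2) as G2.
    change (u (S (S n)) s y) with (z1 s + RInt (fun x => F1 s x (u (S n) s x) (w (S n) s x)) 0 y).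
    change (w (S (S n)) s y) with (z2 s + RInt (fun x => F2 s x (u (S n) s x) (w (S n) s x)) 0 y).
    change (u (S n) s y) with (z1 s + RInt (fun x => F1 s x (u n s x) (w n s x)) 0 y).
    change (w (S n) s y) with (z2 s + RInt (fun x => F2 s x (u n s x) (w n s x)) 0 y).
    rewrite !Rplus_minus_swap_add.
    replace (K * (2 * K0 * L * (/ 2) ^ n) / (4 * K)) with (2 * K0 * L * (/ 2) ^ n / 4) in G1, G2
      by (field; lra).
    assert (0 <= 2 * K0 * L * (/ 2) ^ n).
    { apply Rmult_le_pos; [| apply pow_le; lra].
      assert (0 <= K0) by (eapply Rle_trans; [apply Rabs_pos | apply (B1 s y Hy)]). nra. }
    generalize (exp_pos (4 * K * Rabs y)). intro.
    simpl. nra.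
Qed.

Lemma picard_limit n s y : Rabs y < L ->
  Rabs (picard1 F1 F2 z1 z2 s y - u n s y) <= 4 * K0 * L * exp (4 * K * L) * (/ 2) ^ n /\
  Rabs (picard2 F1 F2 z1 z2 s y - w n s y) <= 4 * K0 * L * exp (4 * K * L) * (/ 2) ^ n.
Proof.
  intros Hy.
  assert (P : forall n, Rabs (u (S n) s y - u n s y) + Rabs (w (S n) s y - w n s y) <=
    2 * K0 * L * exp (4 * K * L) * (/ 2) ^ n).
  { intros m. eapply Rle_trans; [apply picard_iter_step; auto |].
    assert (0 <= 2 * K0 * L * (/ 2) ^ m).
    { apply Rmult_le_pos; [| apply pow_le; lra].
      assert (0 <= K0) by (eapply Rle_trans; [apply Rabs_pos | apply (B1 s y Hy)]). nra. }
    assert (exp (4 * K * Rabs y) <= exp (4 * K * L)).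
    { left. apply exp_increasing. apply Rmult_lt_compat_l; lra. }
    nra. }
  replace (4 * K0 * L * exp (4 * K * L) * (/ 2) ^ n) with (2 * (2 * K0 * L * exp (4 * K * L)) * (/ 2) ^ n) by ring.
  split.
  - apply (geometric_limit (fun n => u n s y)). intros m.
    generalize (P m) (Rabs_pos (w (S m) s y - w m s y)). lra.
  - apply (geometric_limit (fun n => w n s y)). intros m.
    generalize (P m) (Rabs_pos (u (S m) s y - u m s y)). lra.
Qed.

(** The fields are globally Lipschitz, so the solution lives on the whole strip. The integral
    equations hold because their defect is at most a constant times [(/ 2) ^ n] for every [n]:
    compare the limit with the iterate [S n] on the left and with the iterate [n] under the
    integral. *)
Theorem picard_solution :
  SC2 L (picard1 F1 F2 z1 z2) /\ SC2 L (picard2 F1 F2 z1 z2) /\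
  forall s y, Rabs y < L ->
    picard1 F1 F2 z1 z2 s y =
      z1 s + RInt (fun x => F1 s x (picard1 F1 F2 z1 z2 s x) (picard2 F1 F2 z1 z2 s x)) 0 y /\
    picard2 F1 F2 z1 z2 s y =
      z2 s + RInt (fun x => F2 s x (picard1 F1 F2 z1 z2 s x) (picard2 F1 F2 z1 z2 s x)) 0 y.
Proof.
  set (v1 := picard1 F1 F2 z1 z2). set (v2 := picard2 F1 F2 z1 z2).
  set (B := 4 * K0 * L * exp (4 * K * L)).
  assert (HB : 0 <= B).
  { unfold B. assert (0 <= K0).
    { eapply Rle_trans; [apply Rabs_pos | apply (B1 0 0)]. rewrite Rabs_R0; auto. }
    apply Rmult_le_pos; [nra | left; apply exp_pos]. }
  assert (C1 : SC2 L v1).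
  { apply (SC2_uniform_limit L u v1 B HB); [apply picard_iter_cont | intros; apply picard_limit; auto]. }
  assert (C2 : SC2 L v2).
  { apply (SC2_uniform_limit L w v2 B HB); [apply picard_iter_cont | intros; apply picard_limit; auto]. }
  split; [exact C1 | split; [exact C2 |]]. intros s y Hy.
  assert (G : forall F (z : R -> R) (v : R -> R -> R) (it : nat -> R -> R -> R),
    (forall u w, SC2 L u -> SC2 L w -> SC2 L (fun s y => F s y (u s y) (w s y))) ->
    (forall s y u w u' w', Rabs y < L ->
          Rabs (F s y u w - F s y u' w') <= K * (Rabs (u - u') + Rabs (w - w'))) ->
    (forall n, it (S n) s y = z s + RInt (fun x => F s x (u n s x) (w n s x)) 0 y) ->
    (forall n, Rabs (v s y - it n s y) <= B * (/ 2) ^ n) ->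
    v s y = z s + RInt (fun x => F s x (v1 s x) (v2 s x)) 0 y).
  { intros F z v it HF HLip Hit Hv. apply Rminus_diag_uniq.
    apply (half_pow_zero _ (B + K * (2 * B) * L)).
    { assert (0 <= K * (2 * B) * L); [apply Rmult_le_pos; [apply Rmult_le_pos |] |]; lra. }
    intros n. specialize (Hv (S n)). rewrite Hit in Hv.
    destruct (picard_iter_cont n) as [D1 D2].
    assert (Q : Rabs (RInt (fun x => F s x (u n s x) (w n s x)) 0 y - RInt (fun x => F s x (v1 s x) (v2 s x)) 0 y)
       <= K * (2 * B) * (/ 2) ^ n * Rabs y).
    { assert (S1 : SC L (fun x => F s x (u n s x) (w n s x)))
        by (apply (SC2_SC L (fun s x => F s x (u n s x) (w n s x))); auto).
      assert (S2 : SC L (fun x => F s x (v1 s x) (v2 s x)))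
        by (apply (SC2_SC L (fun s x => F s x (v1 s x) (v2 s x))); auto).
      rewrite (RInt_minus_strip L) by auto. apply (abs_RInt_strip L); auto using SC_minus.
      intros x Hx. assert (Hx' : Rabs x < L) by lra. eapply Rle_trans; [apply HLip; auto |].
      destruct (picard_limit n s x Hx') as [P1 P2]. fold v1 v2 B in P1, P2.
      rewrite (Rabs_minus_sym (u n s x)), (Rabs_minus_sym (w n s x)).
      rewrite !Rmult_assoc. apply Rmult_le_compat_l; lra. }
    replace (v s y - (z s + RInt (fun x => F s x (v1 s x) (v2 s x)) 0 y)) with
      ((v s y - (z s + RInt (fun x => F s x (u n s x) (w n s x)) 0 y)) +
       (RInt (fun x => F s x (u n s x) (w n s x)) 0 y - RInt (fun x => F s x (v1 s x) (v2 s x)) 0 y)) by ring.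
    eapply Rle_trans; [apply Rabs_triang |].
    simpl in Hv. assert (0 <= (/ 2) ^ n) by (apply pow_le; lra).
    assert (K * (2 * B) * (/ 2) ^ n * Rabs y <= K * (2 * B) * (/ 2) ^ n * L).
    { apply Rmult_le_compat_l; [| lra]. apply Rmult_le_pos; auto. apply Rmult_le_pos; lra. }
    assert (0 <= B * (/ 2) ^ n) by (apply Rmult_le_pos; lra). lra. }
  split.
  - apply (G F1 z1 v1 u); auto. intros; apply picard_limit; auto.
  - apply (G F2 z2 v2 w); auto. intros; apply picard_limit; auto.
Qed.

End Picard.

Lemma SC_mono L L' f : L' <= L -> SC L f -> SC L' f.
Proof. intros H Hf x Hx. apply Hf. lra. Qed.

Lemma SC_abs L f : SC L f -> SC L (fun x => Rabs (f x)).
Proof. intros H x Hx. apply (continuous_comp f Rabs); [auto | apply continuous_Rabs]. Qed.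

Lemma SC_plus L f g : SC L f -> SC L g -> SC L (fun x => f x + g x).
Proof. intros Hf Hg x Hx. apply (continuous_plus (V := R_NormedModule) f g); auto. Qed.

Lemma SC_mult L f g : SC L f -> SC L g -> SC L (fun x => f x * g x).
Proof. intros Hf Hg x Hx. apply (continuous_mult (K := R_AbsRing) f g); auto. Qed.

Lemma SC_const L c : SC L (fun _ => c).
Proof. intros x _. apply continuous_const. Qed.

Lemma SC2_plus L u v : SC2 L u -> SC2 L v -> SC2 L (fun s y => u s y + v s y).
Proof.
  intros Hu Hv s y Hy.
  apply (continuous_plus (V := R_NormedModule) (fun p : R * R => u (fst p) (snd p)) (fun p => v (fst p) (snd p)));
  [apply Hu | apply Hv]; auto.
Qed.

Lemma SC2_mult L u v : SC2 L u -> SC2 L v -> SC2 L (fun s y => u s y * v s y).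
Proof.
  intros Hu Hv s y Hy.
  apply (continuous_mult (K := R_AbsRing) (fun p : R * R => u (fst p) (snd p)) (fun p => v (fst p) (snd p)));
  [apply Hu | apply Hv]; auto.
Qed.

Lemma RInt_plus_strip L f g y : SC L f -> SC L g -> Rabs y < L ->
  RInt f 0 y + RInt g 0 y = RInt (fun x => f x + g x) 0 y.
Proof.
  intros Hf Hg Hy. symmetry.
  apply (RInt_plus (V := R_CompleteNormedModule)); apply (SC_ex_RInt L); auto.
Qed.

Lemma RInt_scal_strip L c f y : SC L f -> Rabs y < L ->
  c * RInt f 0 y = RInt (fun x => c * f x) 0 y.
Proof.
  intros Hf Hy. symmetry.
  apply (RInt_scal (V := R_CompleteNormedModule)); apply (SC_ex_RInt L); auto.
Qed.

Lemma abs_RInt_strip_le L f g y : SC L f -> SC L g -> Rabs y < L ->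
  (forall x, Rabs x < L -> Rabs (f x) <= g x) -> Rabs (RInt f 0 y) <= Rabs (RInt g 0 y).
Proof.
  intros Hf Hg Hy H.
  assert (P : forall a b, a <= b -> ex_RInt f a b -> ex_RInt g a b ->
    (forall x, a < x < b -> Rabs (f x) <= g x) -> Rabs (RInt f a b) <= Rabs (RInt g a b)).
  { intros a b Hab Ef Eg Hx. eapply Rle_trans; [apply abs_RInt_le; auto |].
    eapply Rle_trans; [| apply Rle_abs]. apply RInt_le; auto. apply (ex_RInt_norm f); auto. }
  assert (Ef : ex_RInt f 0 y) by (apply (SC_ex_RInt L); auto).
  assert (Eg : ex_RInt g 0 y) by (apply (SC_ex_RInt L); auto).
  destruct (Rle_dec 0 y).
  - apply P; auto. intros. apply H. rewrite Rabs_right in *; lra.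
  - rewrite <- (opp_RInt_swap (V := R_CompleteNormedModule) f) by (apply ex_RInt_swap; auto).
    rewrite <- (opp_RInt_swap (V := R_CompleteNormedModule) g) by (apply ex_RInt_swap; auto).
    unfold opp; simpl. rewrite !Rabs_Ropp. apply P; auto using ex_RInt_swap; [lra |].
    intros. apply H. rewrite Rabs_left in *; lra.
Qed.

Lemma abs_RInt_strip_affine L f n y K M : SC L f -> SC L n -> Rabs y < L -> 0 <= M -> 0 <= K ->
  (forall x, Rabs x < L -> Rabs (f x) <= K * n x + M) ->
  Rabs (RInt f 0 y) <= K * Rabs (RInt n 0 y) + M * L.
Proof.
  intros Hf Hn Hy HM HK H.
  assert (S1 : SC L (fun x => K * n x)) by (apply SC_mult; [apply SC_const | auto]).
  eapply Rle_trans.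
  - apply (abs_RInt_strip_le L f (fun x => K * n x + M)); auto. apply SC_plus; auto. apply SC_const.
  - rewrite <- (RInt_plus_strip L) by (auto; apply SC_const).
    eapply Rle_trans; [apply Rabs_triang |]. apply Rplus_le_compat.
    + rewrite <- (RInt_scal_strip L) by auto. rewrite Rabs_mult, (Rabs_right K) by lra. lra.
    + eapply Rle_trans; [apply (abs_RInt_strip L _ _ M); auto; [apply SC_const |] |].
      * intros. rewrite Rabs_right; lra.
      * apply Rmult_le_compat_l; lra.
Qed.

(** Differentiability in the parameter is made uniform in [y]: the mean value theorem turns the
    increment into a value of [a'] at an intermediate parameter, and [a'] is uniformly continuous
    over [[-Y, Y]]. *)
Lemma unif_diff (L : R) (a a' : R -> R -> R) (s Y eps : R) :
  SC2 L a' -> (forall s y, Rabs y < L -> is_derive (fun x => a x y) s (a' s y)) ->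
  Y < L -> 0 < eps ->
  locally (0 : R) (fun h : R => forall y, Rabs y <= Y ->
    Rabs (a (s + h) y - a s y - h * a' s y) <= eps * Rabs h).
Proof.
  intros Ha' Hd HY He.
  destruct (cont2_unif a' s Y) with (eps := eps) as [eta [Heta H]]; auto.
  { intros x Hx. apply Ha'. lra. }
  exists (mkposreal _ Heta). intros h Hh y Hy.
  assert (Hh' : Rabs h < eta). { rewrite <- (Rminus_0_r h). exact Hh. }
  assert (HyL : Rabs y < L) by lra.
  destruct (MVT_cor4 (fun x => a x y) (fun x => a' x y) s (Rabs h)) with (b := s + h) as [c [E Hc]].
  - intros; apply Hd; auto.
  - rewrite Rplus_minus_l. lra.
  - rewrite Rplus_minus_l in E, Hc. rewrite E.
    replace (a' c y * h - h * a' s y) with ((a' c y - a' s y) * h) by ring.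
    rewrite Rabs_mult. apply Rmult_le_compat_r; [apply Rabs_pos |]. left. apply H; lra.
Qed.

Lemma unif_cont (L : R) (a : R -> R -> R) (s Y eps : R) :
  SC2 L a -> Y < L -> 0 < eps ->
  locally (0 : R) (fun h : R => forall y, Rabs y <= Y -> Rabs (a (s + h) y - a s y) <= eps).
Proof.
  intros Ha HY He.
  destruct (cont2_unif a s Y) with (eps := eps) as [eta [Heta H]]; auto.
  { intros x Hx. apply Ha. lra. }
  exists (mkposreal _ Heta). intros h Hh y Hy.
  assert (Hh' : Rabs h < eta). { rewrite <- (Rminus_0_r h). exact Hh. }
  left. apply H; auto. rewrite Rplus_minus_l. auto.
Qed.

Lemma is_derive_of_little_o (f : R -> R) (s l : R) :
  (forall eps, 0 < eps -> locally (0 : R) (fun h : R => Rabs (f (s + h) - f s - h * l) <= eps * Rabs h)) ->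
  is_derive f s l.
Proof.
  intro H. split; [apply (is_linear_scal_l (K := R_AbsRing) (V := R_NormedModule) l) |].
  intros x Hx. apply (is_filter_lim_locally_unique (K := R_AbsRing) (V := R_NormedModule)) in Hx. subst x.
  intros eps. destruct (H eps (cond_pos eps)) as [eta Heta].
  exists eta. intros y Hy.
  assert (G : Rabs (f (s + (y - s)) - f s - (y - s) * l) <= eps * Rabs (y - s)).
  { apply Heta. change (Rabs ((y - s) - 0) < eta). rewrite Rminus_0_r. exact Hy. }
  rewrite Rplus_minus in G. exact G.
Qed.

(* Differentiation of a solution with respect to its parameter: the difference quotients obey the
   variational equation up to a uniformly small error, so Gronwall's lemma applies. *)
Lemma ode_param_derive (L : R) (f1 f2 x1 x2 : R -> R -> R) (z1 z2 : R -> R) (s : R)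
  (A11 A12 A21 A22 b1 b2 e1 e2 : R -> R) (c1 c2 K : R) :
  0 < L -> 0 < K ->
  (forall s, SC L (f1 s)) -> (forall s, SC L (f2 s)) ->
  (forall s, SC L (x1 s)) -> (forall s, SC L (x2 s)) ->
  (forall s y, Rabs y < L -> x1 s y = z1 s + RInt (f1 s) 0 y) ->
  (forall s y, Rabs y < L -> x2 s y = z2 s + RInt (f2 s) 0 y) ->
  (forall h, z1 (s + h) - z1 s = h * c1) -> (forall h, z2 (s + h) - z2 s = h * c2) ->
  SC L A11 -> SC L A12 -> SC L A21 -> SC L A22 -> SC L b1 -> SC L b2 -> SC L e1 -> SC L e2 ->
  (forall y, Rabs y < L -> Rabs (A11 y) <= K /\ Rabs (A12 y) <= K /\ Rabs (A21 y) <= K /\ Rabs (A22 y) <= K) ->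
  (forall y, Rabs y < L -> e1 y = c1 + RInt (fun x => A11 x * e1 x + A12 x * e2 x + b1 x) 0 y) ->
  (forall y, Rabs y < L -> e2 y = c2 + RInt (fun x => A21 x * e1 x + A22 x * e2 x + b2 x) 0 y) ->
  (forall Y eps, Y < L -> 0 < eps -> locally (0 : R) (fun h : R => forall y, Rabs y <= Y ->
     let d1 := x1 (s + h) y - x1 s y in let d2 := x2 (s + h) y - x2 s y in
     Rabs (f1 (s + h) y - f1 s y - A11 y * d1 - A12 y * d2 - h * b1 y) <= eps * (Rabs h + Rabs d1 + Rabs d2) /\
     Rabs (f2 (s + h) y - f2 s y - A21 y * d1 - A22 y * d2 - h * b2 y) <= eps * (Rabs h + Rabs d1 + Rabs d2))) ->
  forall y, Rabs y < L -> is_derive (fun s => x1 s y) s (e1 y) /\ is_derive (fun s => x2 s y) s (e2 y).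
Proof.
  intros HL HK Sf1 Sf2 Sx1 Sx2 X1 X2 Z1 Z2 S11 S12 S21 S22 Sb1 Sb2 Se1 Se2 HA E1 E2 Hrem y Hy.
  (* The hypothesis on the remainders is uniform only on compact parts of the strip, so Gronwall's
     lemma is applied on the smaller strip of width [L'], with [L' < Y < L]. *)
  set (L' := (Rabs y + L) / 2). set (Y := (L' + L) / 2).
  assert (HL' : Rabs y < L' /\ L' < Y /\ Y < L) by (unfold Y, L'; lra).
  assert (HL'0 : 0 < L') by (generalize (Rabs_pos y); lra).
  assert (LL : L' <= L) by lra.
  assert (Zb : exists Z, 0 <= Z /\ forall x, Rabs x <= Y -> Rabs (e1 x) + Rabs (e2 x) <= Z).
  { destruct (SC_bounded L (fun x => Rabs (e1 x) + Rabs (e2 x)) Y) as [Z [HZ HZb]].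
    - apply SC_plus; apply SC_abs; auto.
    - rewrite Rabs_right; lra.
    - exists Z. split; auto. intros x Hx. apply HZb. rewrite (Rabs_right Y); lra. }
  destruct Zb as [Z [HZ HZb]].
  (* This is the factor that [gronwall] yields for the initial term
     [2 * eps * (1 + Z) * Rabs h * L'] and the rate [2 * K + 2], after division by [eps * Rabs h];
     it does not depend on [eps] or [h]. *)
  set (Q := 4 * (1 + Z) * L' * exp (2 * (2 * K + 2) * L')).
  assert (HQ : 0 < Q).
  { unfold Q. apply Rmult_lt_0_compat; [nra | apply exp_pos]. }
  assert (Main : forall eps, 0 < eps -> eps <= 1 -> locally (0 : R) (fun h : R =>
    Rabs (x1 (s + h) y - x1 s y - h * e1 y) + Rabs (x2 (s + h) y - x2 s y - h * e2 y) <= eps * Q * Rabs h)).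
  { intros eps He He1. generalize (Hrem Y eps (proj2 (proj2 HL')) He). apply filter_imp. intros h Hh.
    set (r1 := fun x => x1 (s + h) x - x1 s x - h * e1 x).
    set (r2 := fun x => x2 (s + h) x - x2 s x - h * e2 x).
    set (n := fun x => Rabs (r1 x) + Rabs (r2 x)).
    assert (Sr1 : SC L r1).
    { apply SC_minus; [apply SC_minus |]; auto. apply SC_mult; auto using SC_const. }
    assert (Sr2 : SC L r2).
    { apply SC_minus; [apply SC_minus |]; auto. apply SC_mult; auto using SC_const. }
    assert (Sn : SC L n) by (apply SC_plus; apply SC_abs; auto).
    (* One estimate for both components: the remainder of either one is controlled by the integral
       of the sum [n] of both remainders plus an error of size [eps * Rabs h]. Replacing increments
       of the solution by [r1 + h * e1] and [r2 + h * e2] is what produces the extra 1 in the rate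
       and the factor [1 + Z]. *)
    assert (G : forall f z xx A1 A2 b e c,
      (forall s, SC L (f s)) -> SC L A1 -> SC L A2 -> SC L b ->
      (forall s y, Rabs y < L -> xx s y = z s + RInt (f s) 0 y) -> z (s + h) - z s = h * c ->
      (forall y, Rabs y < L -> e y = c + RInt (fun x => A1 x * e1 x + A2 x * e2 x + b x) 0 y) ->
      (forall y, Rabs y < L -> Rabs (A1 y) <= K /\ Rabs (A2 y) <= K) ->
      (forall x, Rabs x <= Y -> Rabs (f (s + h) x - f s x - A1 x * (x1 (s + h) x - x1 s x) - A2 x * (x2 (s + h) x - x2 s x) - h * b x)
         <= eps * (Rabs h + Rabs (x1 (s + h) x - x1 s x) + Rabs (x2 (s + h) x - x2 s x))) ->
      forall x, Rabs x < L' ->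
        Rabs (xx (s + h) x - xx s x - h * e x) <= (K + 1) * Rabs (RInt n 0 x) + eps * (1 + Z) * Rabs h * L').
    { intros f z xx A1 A2 b e c Sf SA1 SA2 Sb Hxx Hz He' HA' Hr x Hx.
      assert (HxL : Rabs x < L) by lra.
      rewrite !Hxx, He' by auto.
      replace (z (s + h) + RInt (f (s + h)) 0 x - (z s + RInt (f s) 0 x) - h * (c + RInt (fun x => A1 x * e1 x + A2 x * e2 x + b x) 0 x))
        with ((z (s + h) - z s - h * c) + (RInt (f (s + h)) 0 x - RInt (f s) 0 x) - h * RInt (fun x => A1 x * e1 x + A2 x * e2 x + b x) 0 x)
        by (apply Rminus_diag_uniq; set (I1 := RInt (f (s + h)) 0 x : R); set (I2 := RInt (f s) 0 x : R);
            set (I3 := RInt (fun x => A1 x * e1 x + A2 x * e2 x + b x) 0 x : R); ring).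
      rewrite Hz, Rminus_diag, Rplus_0_l.
      assert (SAe : SC L (fun x => A1 x * e1 x + A2 x * e2 x + b x)).
      { apply SC_plus; auto. apply SC_plus; apply SC_mult; auto. }
      rewrite (RInt_minus_strip L) by auto.
      rewrite (RInt_scal_strip L) by auto.
      rewrite (RInt_minus_strip L); auto using SC_minus, SC_mult, SC_const.
      apply abs_RInt_strip_affine; try lra.
      - apply (SC_mono L); auto. apply SC_minus; auto using SC_minus, SC_mult, SC_const.
      - apply (SC_mono L); auto.
      - apply Rmult_le_pos; [apply Rmult_le_pos; lra | apply Rabs_pos].
      - intros t Ht. assert (HtY : Rabs t <= Y) by lra. assert (HtL : Rabs t < L) by lra.
        specialize (Hr t HtY). destruct (HA' t HtL) as [HA1 HA2]. specialize (HZb t HtY).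
        replace (f (s + h) t - f s t - h * (A1 t * e1 t + A2 t * e2 t + b t)) with
          ((f (s + h) t - f s t - A1 t * (x1 (s + h) t - x1 s t) - A2 t * (x2 (s + h) t - x2 s t) - h * b t)
           + A1 t * r1 t + A2 t * r2 t) by (unfold r1, r2; ring).
        assert (D1 : Rabs (x1 (s + h) t - x1 s t) <= Rabs (r1 t) + Rabs h * Rabs (e1 t)).
        { replace (x1 (s + h) t - x1 s t) with (r1 t + h * e1 t) by (unfold r1; ring).
          rewrite <- Rabs_mult. apply Rabs_triang. }
        assert (D2 : Rabs (x2 (s + h) t - x2 s t) <= Rabs (r2 t) + Rabs h * Rabs (e2 t)).
        { replace (x2 (s + h) t - x2 s t) with (r2 t + h * e2 t) by (unfold r2; ring).
          rewrite <- Rabs_mult. apply Rabs_triang. }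
        eapply Rle_trans; [apply Rabs_triang |]. eapply Rle_trans; [apply Rplus_le_compat_r, Rabs_triang |].
        rewrite !Rabs_mult. unfold n.
        assert (P1 : Rabs (A1 t) * Rabs (r1 t) <= K * Rabs (r1 t)) by (apply Rmult_le_compat_r; [apply Rabs_pos | auto]).
        assert (P2 : Rabs (A2 t) * Rabs (r2 t) <= K * Rabs (r2 t)) by (apply Rmult_le_compat_r; [apply Rabs_pos | auto]).
        assert (P3 : Rabs h * Rabs (e1 t) + Rabs h * Rabs (e2 t) <= Rabs h * Z).
        { rewrite <- Rmult_plus_distr_l. apply Rmult_le_compat_l; [apply Rabs_pos | auto]. }
        generalize (Rabs_pos (r1 t)) (Rabs_pos (r2 t)). intros.
        assert (P4 : eps * (Rabs h + Rabs (x1 (s + h) t - x1 s t) + Rabs (x2 (s + h) t - x2 s t))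
           <= eps * (Rabs h + Rabs h * Z + (Rabs (r1 t) + Rabs (r2 t)))) by (apply Rmult_le_compat_l; lra).
        nra. }
    assert (N : forall x, Rabs x < L' -> n x <= 2 * eps * (1 + Z) * Rabs h * L' + (2 * K + 2) * Rabs (RInt n 0 x)).
    { intros x Hx. unfold n at 1, r1, r2.
      assert (T1 := G f1 z1 x1 A11 A12 b1 e1 c1 Sf1 S11 S12 Sb1 X1 (Z1 h) E1
         (fun y Hy => conj (proj1 (HA y Hy)) (proj1 (proj2 (HA y Hy)))) (fun t Ht => proj1 (Hh t Ht)) x Hx).
      assert (T2 := G f2 z2 x2 A21 A22 b2 e2 c2 Sf2 S21 S22 Sb2 X2 (Z2 h) E2
         (fun y Hy => proj2 (proj2 (HA y Hy))) (fun t Ht => proj2 (Hh t Ht)) x Hx).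
      lra. }
    pose proof (Rabs_pos h) as Hhp.
    assert (Gr := gronwall L' n (2 * eps * (1 + Z) * Rabs h * L') (2 * K + 2)).
    assert (Gr' : n y <= 2 * (2 * eps * (1 + Z) * Rabs h * L') * exp (2 * (2 * K + 2) * Rabs y)).
    { apply Gr; try lra.
      - apply Rmult_le_pos; [| lra]. apply Rmult_le_pos; [| auto]. nra.
      - apply (SC_mono L); auto.
      - intros. unfold n. generalize (Rabs_pos (r1 y0)) (Rabs_pos (r2 y0)). lra.
      - exact N. }
    fold (r1 y) (r2 y). fold (n y). eapply Rle_trans; [exact Gr' |].
    assert (exp (2 * (2 * K + 2) * Rabs y) <= exp (2 * (2 * K + 2) * L')).
    { left. apply exp_increasing. apply Rmult_lt_compat_l; lra. }
    unfold Q.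
    replace (eps * (4 * (1 + Z) * L' * exp (2 * (2 * K + 2) * L')) * Rabs h) with
      (2 * (2 * eps * (1 + Z) * Rabs h * L') * exp (2 * (2 * K + 2) * L')) by ring.
    apply Rmult_le_compat_l; auto.
    assert (0 <= eps * (1 + Z)) by nra.
    assert (0 <= eps * (1 + Z) * Rabs h) by (apply Rmult_le_pos; auto). nra. }
  assert (Fin : forall eps, 0 < eps -> locally (0 : R) (fun h : R =>
    Rabs (x1 (s + h) y - x1 s y - h * e1 y) <= eps * Rabs h /\ Rabs (x2 (s + h) y - x2 s y - h * e2 y) <= eps * Rabs h)).
  { intros eps He. 
    assert (He' : 0 < Rmin 1 (eps / Q)) by (apply Rmin_pos; [lra | apply Rdiv_lt_0_compat; auto]).
    generalize (Main _ He' (Rmin_l _ _)). apply filter_imp. intros h Hh.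
    assert (B : Rmin 1 (eps / Q) * Q <= eps).
    { apply Rle_trans with (eps / Q * Q); [apply Rmult_le_compat_r; [lra | apply Rmin_r] | right; field; lra]. }
    assert (Rmin 1 (eps / Q) * Q * Rabs h <= eps * Rabs h) by (apply Rmult_le_compat_r; [apply Rabs_pos | auto]).
    generalize (Rabs_pos (x1 (s + h) y - x1 s y - h * e1 y)) (Rabs_pos (x2 (s + h) y - x2 s y - h * e2 y)). lra. }
  split; apply is_derive_of_little_o; intros eps He; generalize (Fin eps He); apply filter_imp; tauto.
Qed.

Lemma SC2_of_CB (D : R -> Prop) L k u d : CB D (strip L) k u -> D d -> SC2 L (u d).
Proof. intros H Hd s y Hy. apply (CB_cont D (strip L) k u H); auto. Qed.

Lemma Rabs_lin_comb_le (a b x y K : R) : Rabs a <= K -> Rabs b <= K ->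
  Rabs (a * x + b * y) <= K * (Rabs x + Rabs y).
Proof.
  intros Ha Hb. eapply Rle_trans; [apply Rabs_triang |]. rewrite !Rabs_mult, Rmult_plus_distr_l.
  apply Rplus_le_compat; (apply Rmult_le_compat_r; [apply Rabs_pos | auto]).
Qed.

(** * Linear systems depending on parameters *)

Section Linear.
Variables (D : R -> Prop) (L : R).
Hypothesis HL : 0 < L.

Definition lin_solution (A11 A12 A21 A22 b1 b2 x1 x2 : R -> R -> R -> R) (c1 c2 : R) : Prop :=
  forall d, D d -> SC2 L (x1 d) /\ SC2 L (x2 d) /\ forall s y, Rabs y < L ->
    x1 d s y = c1 + RInt (fun x => A11 d s x * x1 d s x + A12 d s x * x2 d s x + b1 d s x) 0 y /\
    x2 d s y = c2 + RInt (fun x => A21 d s x * x1 d s x + A22 d s x * x2 d s x + b2 d s x) 0 y.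

Section Fixed.
Variables A11 A12 A21 A22 : R -> R -> R -> R.

Lemma lin_ex k b1 b2 c1 c2 :
  CB D (strip L) k A11 -> CB D (strip L) k A12 -> CB D (strip L) k A21 -> CB D (strip L) k A22 ->
  CB D (strip L) k b1 -> CB D (strip L) k b2 ->
  exists x1 x2, lin_solution A11 A12 A21 A22 b1 b2 x1 x2 c1 c2.
Proof.
  intros H11 H12 H21 H22 Hb1 Hb2.
  destruct (CB_bound_pos _ _ _ _ H11) as [K11 [P11 B11]].
  destruct (CB_bound_pos _ _ _ _ H12) as [K12 [P12 B12]].
  destruct (CB_bound_pos _ _ _ _ H21) as [K21 [P21 B21]].
  destruct (CB_bound_pos _ _ _ _ H22) as [K22 [P22 B22]].
  destruct (CB_bound_pos _ _ _ _ Hb1) as [Kb1 [Pb1 Bb1]].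
  destruct (CB_bound_pos _ _ _ _ Hb2) as [Kb2 [Pb2 Bb2]].
  set (K := K11 + K12 + K21 + K22).
  set (K0 := K * (Rabs c1 + Rabs c2) + Kb1 + Kb2).
  exists (fun d => picard1 (fun s x u w => A11 d s x * u + A12 d s x * w + b1 d s x)
                    (fun s x u w => A21 d s x * u + A22 d s x * w + b2 d s x) (fun _ => c1) (fun _ => c2)).
  exists (fun d => picard2 (fun s x u w => A11 d s x * u + A12 d s x * w + b1 d s x)
                    (fun s x u w => A21 d s x * u + A22 d s x * w + b2 d s x) (fun _ => c1) (fun _ => c2)).
  intros d Hd.
  refine (picard_solution L (fun s x u w => A11 d s x * u + A12 d s x * w + b1 d s x)
    (fun s x u w => A21 d s x * u + A22 d s x * w + b2 d s x) (fun _ => c1) (fun _ => c2) K K0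
    HL _ (fun s => continuous_const c1 s) (fun s => continuous_const c2 s) _ _ _ _ _ _).
  - unfold K; lra.
  - intros. apply SC2_plus; [apply SC2_plus; apply SC2_mult |]; auto; eapply SC2_of_CB; eauto.
  - intros. apply SC2_plus; [apply SC2_plus; apply SC2_mult |]; auto; eapply SC2_of_CB; eauto.
  - intros s y u w u' w' Hy.
    replace (A11 d s y * u + A12 d s y * w + b1 d s y - (A11 d s y * u' + A12 d s y * w' + b1 d s y))
      with (A11 d s y * (u - u') + A12 d s y * (w - w')) by ring.
    specialize (B11 d s y Hd Hy). specialize (B12 d s y Hd Hy). apply Rabs_lin_comb_le; unfold K; lra.
  - intros s y u w u' w' Hy.
    replace (A21 d s y * u + A22 d s y * w + b2 d s y - (A21 d s y * u' + A22 d s y * w' + b2 d s y))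
      with (A21 d s y * (u - u') + A22 d s y * (w - w')) by ring.
    specialize (B21 d s y Hd Hy). specialize (B22 d s y Hd Hy). apply Rabs_lin_comb_le; unfold K; lra.
  - intros s y Hy. eapply Rle_trans; [apply Rabs_triang |].
    specialize (B11 d s y Hd Hy). specialize (B12 d s y Hd Hy). specialize (Bb1 d s y Hd Hy).
    generalize (Rabs_lin_comb_le (A11 d s y) (A12 d s y) c1 c2 K). unfold K0. intro Q.
    assert (Rabs (A11 d s y * c1 + A12 d s y * c2) <= K * (Rabs c1 + Rabs c2)) by (apply Q; unfold K; lra). lra.
  - intros s y Hy. eapply Rle_trans; [apply Rabs_triang |].
    specialize (B21 d s y Hd Hy). specialize (B22 d s y Hd Hy). specialize (Bb2 d s y Hd Hy).
    generalize (Rabs_lin_comb_le (A21 d s y) (A22 d s y) c1 c2 K). unfold K0. intro Q.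
    assert (Rabs (A21 d s y * c1 + A22 d s y * c2) <= K * (Rabs c1 + Rabs c2)) by (apply Q; unfold K; lra). lra.
Qed.

(** What matters is the uniformity in [d]: Gronwall's lemma uses only the common bounds of the
    coefficients. *)
Lemma lin_CB0 b1 b2 x1 x2 c1 c2 :
  CB D (strip L) 0 A11 -> CB D (strip L) 0 A12 -> CB D (strip L) 0 A21 -> CB D (strip L) 0 A22 ->
  CB D (strip L) 0 b1 -> CB D (strip L) 0 b2 ->
  lin_solution A11 A12 A21 A22 b1 b2 x1 x2 c1 c2 ->
  CB D (strip L) 0 x1 /\ CB D (strip L) 0 x2.
Proof.
  intros H11 H12 H21 H22 Hb1 Hb2 HX.
  destruct (CB_bound_pos _ _ _ _ H11) as [K11 [P11 B11]].
  destruct (CB_bound_pos _ _ _ _ H12) as [K12 [P12 B12]].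
  destruct (CB_bound_pos _ _ _ _ H21) as [K21 [P21 B21]].
  destruct (CB_bound_pos _ _ _ _ H22) as [K22 [P22 B22]].
  destruct (CB_bound_pos _ _ _ _ Hb1) as [Kb1 [Pb1 Bb1]].
  destruct (CB_bound_pos _ _ _ _ Hb2) as [Kb2 [Pb2 Bb2]].
  set (K := K11 + K12 + K21 + K22).
  set (a := Rabs c1 + Rabs c2 + (Kb1 + Kb2) * L).
  assert (Ha : 0 <= a).
  { unfold a. generalize (Rabs_pos c1) (Rabs_pos c2). nra. }
  assert (Bd : forall d s y, D d -> Rabs y < L -> Rabs (x1 d s y) + Rabs (x2 d s y) <= 2 * a * exp (2 * (2 * K) * L)).
  { intros d s y Hd Hy. destruct (HX d Hd) as [C1 [C2 E]].
    set (n := fun x => Rabs (x1 d s x) + Rabs (x2 d s x)).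
    assert (Sn : SC L n) by (apply SC_plus; apply SC_abs; apply SC2_SC; auto).
    assert (T : forall A1 A2 b c Kb, CB D (strip L) 0 A1 -> CB D (strip L) 0 A2 -> CB D (strip L) 0 b ->
      0 < Kb -> (forall y, Rabs y < L -> Rabs (A1 d s y) <= K /\ Rabs (A2 d s y) <= K /\ Rabs (b d s y) <= Kb) ->
      forall y, Rabs y < L -> Rabs (c + RInt (fun x => A1 d s x * x1 d s x + A2 d s x * x2 d s x + b d s x) 0 y)
        <= Rabs c + (K * Rabs (RInt n 0 y) + Kb * L)).
    { intros A1 A2 b c Kb HA1 HA2 Hb HKb HB z Hz. eapply Rle_trans; [apply Rabs_triang |].
      apply Rplus_le_compat_l. apply abs_RInt_strip_affine; auto; try (unfold K; lra).
      - apply SC_plus; [apply SC_plus; apply SC_mult |]; try (apply SC2_SC; auto; eapply SC2_of_CB; eauto).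
      - intros x Hx. destruct (HB x Hx) as [Q1 [Q2 Q3]]. eapply Rle_trans; [apply Rabs_triang |].
        apply Rplus_le_compat; auto. apply Rabs_lin_comb_le; auto. }
    assert (G := gronwall L n a (2 * K)).
    eapply Rle_trans; [apply G; auto |].
    - unfold K; lra.
    - intros. unfold n. generalize (Rabs_pos (x1 d s y0)) (Rabs_pos (x2 d s y0)). lra.
    - intros z Hz. unfold n at 1. destruct (E s z Hz) as [E1 E2]. rewrite E1, E2.
      assert (T1 := T A11 A12 b1 c1 Kb1 H11 H12 Hb1 Pb1).
      assert (T2 := T A21 A22 b2 c2 Kb2 H21 H22 Hb2 Pb2).
      eapply Rle_trans; [apply Rplus_le_compat; [apply T1 | apply T2]; auto |].
      + intros w Hw. specialize (B11 d s w Hd Hw). specialize (B12 d s w Hd Hw). specialize (Bb1 d s w Hd Hw).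
        unfold K; lra.
      + intros w Hw. specialize (B21 d s w Hd Hw). specialize (B22 d s w Hd Hw). specialize (Bb2 d s w Hd Hw).
        unfold K; lra.
      + unfold a. right. set (I1 := Rabs (RInt n 0 z)). ring.
    - apply Rmult_le_compat_l; [lra |]. left. apply exp_increasing.
      apply Rmult_lt_compat_l; auto. unfold K; lra. }
  split; (split; [| split; [| exact I]]).
  - intros. apply HX; auto.
  - eexists. intros d s y Hd Hy. specialize (Bd d s y Hd Hy).
    eapply Rle_trans; [| exact Bd]. generalize (Rabs_pos (x2 d s y)). lra.
  - intros. apply HX; auto.
  - eexists. intros d s y Hd Hy. specialize (Bd d s y Hd Hy).
    eapply Rle_trans; [| exact Bd]. generalize (Rabs_pos (x1 d s y)). lra.
Qed.

Lemma is_derive_of_integral (f x : R -> R) (c y : R) : SC L f -> Rabs y < L ->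
  (forall y, Rabs y < L -> x y = c + RInt f 0 y) -> is_derive x y (f y).
Proof.
  intros Hf Hy E. apply is_derive_ext_loc with (fun y => c + RInt f 0 y).
  - generalize (open2_slice_r (strip L) 0 y (strip_open L) Hy). apply filter_imp.
    intros z Hz. symmetry; apply E, Hz.
  - replace (f y) with (0 + f y) by ring.
    apply (is_derive_plus (V := R_NormedModule) (fun _ => c) (fun y => RInt f 0 y)).
    + apply (is_derive_const (K := R_AbsRing) (V := R_NormedModule)).
    + apply (is_derive_RInt_strip L); auto.
Qed.

Lemma remainder_linear (A A' x : R -> R -> R) (s Y eps : R) :
  SC2 L A -> SC2 L A' -> SC2 L x ->
  (forall s y, Rabs y < L -> is_derive (fun x => A x y) s (A' s y)) -> Y < L -> 0 < eps ->
  locally (0 : R) (fun h : R => forall y, Rabs y <= Y ->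
    Rabs (A (s + h) y * x (s + h) y - A s y * x s y - A s y * (x (s + h) y - x s y) - h * (A' s y * x s y))
      <= eps * (Rabs h + Rabs (x (s + h) y - x s y))).
Proof.
  intros HA HA' Hx Hd HY He.
  set (Y' := Rmax Y 0).
  assert (HY' : Y <= Y' /\ 0 <= Y' /\ Y' < L).
  { unfold Y'. split; [apply Rmax_l | split; [apply Rmax_r | apply Rmax_lub_lt; auto]]. }
  destruct (SC_bounded L (fun y => Rabs (x s y)) Y') as [X [HX HXb]].
  - apply SC_abs, SC2_SC, Hx.
  - rewrite Rabs_right; lra.
  - rewrite (Rabs_right Y') in HXb by lra.
    assert (He' : 0 < eps / (X + 1)) by (apply Rdiv_lt_0_compat; lra).
    generalize (filter_and _ _ (unif_diff L A A' s Y _ HA' Hd HY He') (unif_cont L A s Y eps HA HY He)).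
    apply filter_imp. intros h [H1 H2] y Hy.
    specialize (H1 y Hy). specialize (H2 y Hy).
    assert (HXy : Rabs (x s y) <= X) by (apply HXb; lra).
    replace (A (s + h) y * x (s + h) y - A s y * x s y - A s y * (x (s + h) y - x s y) - h * (A' s y * x s y))
      with ((A (s + h) y - A s y - h * A' s y) * x s y + (A (s + h) y - A s y) * (x (s + h) y - x s y)) by ring.
    eapply Rle_trans; [apply Rabs_triang |]. rewrite !Rabs_mult, Rmult_plus_distr_l.
    apply Rplus_le_compat; [| apply Rmult_le_compat_r; [apply Rabs_pos | auto]].
    eapply Rle_trans; [apply Rmult_le_compat; [apply Rabs_pos | apply Rabs_pos | exact H1 | exact HXy] |].
    replace (eps / (X + 1) * Rabs h * X) with (eps * Rabs h * (X / (X + 1))) by (field; lra).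
    assert (X / (X + 1) <= 1).
    { apply Rmult_le_reg_r with (X + 1); [lra |]. unfold Rdiv. rewrite Rmult_assoc, Rinv_l; lra. }
    assert (0 <= eps * Rabs h) by (apply Rmult_le_pos; [lra | apply Rabs_pos]). nra.
Qed.

End Fixed.
End Linear.

Lemma Rabs_triang3 (a b c : R) : Rabs (a + b + c) <= Rabs a + Rabs b + Rabs c.
Proof. eapply Rle_trans; [apply Rabs_triang |]. generalize (Rabs_triang a b). lra. Qed.

(** Induction on [k]. The derivative of the solution in the parameter [s] solves a system with the
    same matrix, source [A_s x + b_s] and initial value zero. By induction [x] is of order [k],
    hence so is this source, and the induction hypothesis applied once more gives order [k] of the
    derivative. The derivative in [y] is the right-hand side of the system itself. *)
Lemma lin_CB (D : R -> Prop) (L : R) (HL : 0 < L) A11 A12 A21 A22 k : forall b1 b2 x1 x2 c1 c2,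
  CB D (strip L) k A11 -> CB D (strip L) k A12 -> CB D (strip L) k A21 -> CB D (strip L) k A22 ->
  CB D (strip L) k b1 -> CB D (strip L) k b2 ->
  lin_solution D L A11 A12 A21 A22 b1 b2 x1 x2 c1 c2 ->
  CB D (strip L) k x1 /\ CB D (strip L) k x2.
Proof.
  induction k as [|k IH]; intros b1 b2 x1 x2 c1 c2 H11 H12 H21 H22 Hb1 Hb2 HX.
  { apply (lin_CB0 D L HL A11 A12 A21 A22 b1 b2 x1 x2 c1 c2); auto. }
  destruct (IH b1 b2 x1 x2 c1 c2) as [X1 X2]; auto using CB_S.
  pose proof (CB_S _ _ _ _ H11) as H11'. pose proof (CB_S _ _ _ _ H12) as H12'.
  pose proof (CB_S _ _ _ _ H21) as H21'. pose proof (CB_S _ _ _ _ H22) as H22'.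
  pose proof (CB_S _ _ _ _ Hb1) as Hb1'. pose proof (CB_S _ _ _ _ Hb2) as Hb2'.
  destruct (CB_bound_pos _ _ _ _ H11) as [K11 [P11 B11]].
  destruct (CB_bound_pos _ _ _ _ H12) as [K12 [P12 B12]].
  destruct (CB_bound_pos _ _ _ _ H21) as [K21 [P21 B21]].
  destruct (CB_bound_pos _ _ _ _ H22) as [K22 [P22 B22]].
  destruct H11 as [_ [_ [A11s [? [D11 [_ [C11 _]]]]]]].
  destruct H12 as [_ [_ [A12s [? [D12 [_ [C12 _]]]]]]].
  destruct H21 as [_ [_ [A21s [? [D21 [_ [C21 _]]]]]]].
  destruct H22 as [_ [_ [A22s [? [D22 [_ [C22 _]]]]]]].
  destruct Hb1 as [_ [_ [b1s [? [Db1 [_ [Cb1 _]]]]]]].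
  destruct Hb2 as [_ [_ [b2s [? [Db2 [_ [Cb2 _]]]]]]].
  set (b1' := fun d s y => A11s d s y * x1 d s y + A12s d s y * x2 d s y + b1s d s y).
  set (b2' := fun d s y => A21s d s y * x1 d s y + A22s d s y * x2 d s y + b2s d s y).
  assert (Hb1s : CB D (strip L) k b1') by (apply CB_plus; auto; apply CB_plus; apply CB_mult; auto).
  assert (Hb2s : CB D (strip L) k b2') by (apply CB_plus; auto; apply CB_plus; apply CB_mult; auto).
  (* The candidate for the derivative is constructed as a solution of the variational equation;
     [ode_param_derive] then identifies it. The initial values are zero because [c1] and [c2] do not
     depend on [s]. *)
  destruct (lin_ex D L HL A11 A12 A21 A22 k b1' b2' 0 0) as [e1 [e2 HE]]; auto.
  destruct (IH b1' b2' e1 e2 0 0) as [E1 E2]; auto.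
  assert (SCb : forall A d s, CB D (strip L) k A -> D d -> SC L (A d s)).
  { intros A d s HA Hd. apply SC2_SC. eapply SC2_of_CB; eauto. }
  assert (SCf : forall A1 A2 b d s, CB D (strip L) k A1 -> CB D (strip L) k A2 -> CB D (strip L) k b -> D d ->
    SC L (fun x => A1 d s x * x1 d s x + A2 d s x * x2 d s x + b d s x)).
  { intros. apply SC_plus; [apply SC_plus; apply SC_mult |]; apply SCb; auto. }
  assert (DD : forall d s y, D d -> Rabs y < L ->
    is_derive (fun s => x1 d s y) s (e1 d s y) /\ is_derive (fun s => x2 d s y) s (e2 d s y)).
  { intros d s y Hd Hy. destruct (HX d Hd) as [Cx1 [Cx2 EX]]. destruct (HE d Hd) as [Ce1 [Ce2 EE]].
    apply (ode_param_derive L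
      (fun s x => A11 d s x * x1 d s x + A12 d s x * x2 d s x + b1 d s x)
      (fun s x => A21 d s x * x1 d s x + A22 d s x * x2 d s x + b2 d s x)
      (x1 d) (x2 d) (fun _ => c1) (fun _ => c2) s (A11 d s) (A12 d s) (A21 d s) (A22 d s)
      (b1' d s) (b2' d s) (e1 d s) (e2 d s) 0 0 (K11 + K12 + K21 + K22)); auto; try lra;
      try (intros; apply SCb; auto; fail); try (intros; apply SCf; auto; fail).
    - intros s' z Hz. apply EX; auto.
    - intros s' z Hz. apply EX; auto.
    - intros; ring.
    - intros; ring.
    - intros z Hz. specialize (B11 d s z Hd Hz). specialize (B12 d s z Hd Hz).
      specialize (B21 d s z Hd Hz). specialize (B22 d s z Hd Hz). lra.
    - intros z Hz. apply EE; auto.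
    - intros z Hz. apply EE; auto.
    - intros Y eps HY He. assert (He3 : 0 < eps / 3) by lra.
      assert (S2 : forall A, CB D (strip L) k A -> SC2 L (A d)) by (intros; eapply SC2_of_CB; eauto).
      assert (R11 := remainder_linear L HL (A11 d) (A11s d) (x1 d) s Y (eps / 3) (S2 _ H11') (S2 _ C11) (S2 _ X1) (fun s y H => D11 d s y Hd H) HY He3).
      assert (R12 := remainder_linear L HL (A12 d) (A12s d) (x2 d) s Y (eps / 3) (S2 _ H12') (S2 _ C12) (S2 _ X2) (fun s y H => D12 d s y Hd H) HY He3).
      assert (R21 := remainder_linear L HL (A21 d) (A21s d) (x1 d) s Y (eps / 3) (S2 _ H21') (S2 _ C21) (S2 _ X1) (fun s y H => D21 d s y Hd H) HY He3).
      assert (R22 := remainder_linear L HL (A22 d) (A22s d) (x2 d) s Y (eps / 3) (S2 _ H22') (S2 _ C22) (S2 _ X2) (fun s y H => D22 d s y Hd H) HY He3).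
      assert (Rb1 := unif_diff L (b1 d) (b1s d) s Y (eps / 3) (S2 _ Cb1) (fun s y H => Db1 d s y Hd H) HY He3).
      assert (Rb2 := unif_diff L (b2 d) (b2s d) s Y (eps / 3) (S2 _ Cb2) (fun s y H => Db2 d s y Hd H) HY He3).
      generalize (filter_and _ _ (filter_and _ _ R11 (filter_and _ _ R12 Rb1))
                                 (filter_and _ _ R21 (filter_and _ _ R22 Rb2))).
      apply filter_imp. intros h [[Q11 [Q12 Qb1]] [Q21 [Q22 Qb2]]] z Hz d1 d2.
      specialize (Q11 z Hz). specialize (Q12 z Hz). specialize (Q21 z Hz). specialize (Q22 z Hz).
      specialize (Qb1 z Hz). specialize (Qb2 z Hz). fold d1 in Q11, Q21. fold d2 in Q12, Q22.
      generalize (Rabs_pos d1) (Rabs_pos d2) (Rabs_pos h); intros.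
      split.
      + match type of Q11 with Rabs ?a <= _ => match type of Q12 with Rabs ?b <= _ => match type of Qb1 with Rabs ?c <= _ =>
          eapply Rle_trans with (Rabs a + Rabs b + Rabs c) end end end.
        * eapply Rle_trans; [| apply Rabs_triang3]. right; f_equal. unfold b1', d1, d2. ring.
        * nra.
      + match type of Q21 with Rabs ?a <= _ => match type of Q22 with Rabs ?b <= _ => match type of Qb2 with Rabs ?c <= _ =>
          eapply Rle_trans with (Rabs a + Rabs b + Rabs c) end end end.
        * eapply Rle_trans; [| apply Rabs_triang3]. right; f_equal. unfold b2', d1, d2. ring.
        * nra. }
  split.
  - split; [exact (CB_cont _ _ _ _ X1) | split; [exact (CB_bound _ _ _ _ X1) |]].
    exists e1, (fun d s x => A11 d s x * x1 d s x + A12 d s x * x2 d s x + b1 d s x).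
    refine (conj _ (conj _ (conj _ _))); auto.
    + intros; apply DD; auto.
    + intros d s y Hd Hy. apply (is_derive_of_integral L (fun x => A11 d s x * x1 d s x + A12 d s x * x2 d s x + b1 d s x) _ c1); auto.
      intros; apply HX; auto.
    + apply CB_plus; auto; apply CB_plus; apply CB_mult; auto.
  - split; [exact (CB_cont _ _ _ _ X2) | split; [exact (CB_bound _ _ _ _ X2) |]].
    exists e2, (fun d s x => A21 d s x * x1 d s x + A22 d s x * x2 d s x + b2 d s x).
    refine (conj _ (conj _ (conj _ _))); auto.
    + intros; apply DD; auto.
    + intros d s y Hd Hy. apply (is_derive_of_integral L (fun x => A21 d s x * x1 d s x + A22 d s x * x2 d s x + b2 d s x) _ c2); auto.
      intros; apply HX; auto.
    + apply CB_plus; auto; apply CB_plus; apply CB_mult; auto.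
Qed.

Lemma RInt_ext_R (f g : R -> R) (a b : R) :
  (forall x, f x = g x :> R) -> RInt f a b = RInt g a b.
Proof. intro H. apply RInt_ext. intros; apply H. Qed.

Lemma lin_CB_scalar (D : R -> Prop) (L : R) (HL : 0 < L) A b x c k :
  CB D (strip L) k A -> CB D (strip L) k b ->
  (forall d, D d -> SC2 L (x d)) ->
  (forall d s y, D d -> Rabs y < L -> x d s y = c + RInt (fun z => A d s z * x d s z + b d s z) 0 y) ->
  CB D (strip L) k x.
Proof.
  intros HA Hb Hx E.
  apply (lin_CB D L HL A (fun _ _ _ => 0) (fun _ _ _ => 0) (fun _ _ _ => 0) k b (fun _ _ _ => 0) x (fun _ _ _ => 0) c 0);
    auto; try apply CB_const.
  intros d Hd. split; [auto | split].
  - intros s y Hy. apply continuous_const.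
  - intros s y Hy. split.
    + rewrite E by auto. apply Rplus_eq_compat_l, RInt_ext_R. intros; ring.
    + transitivity (0 + RInt (fun _ => 0) 0 y).
      * rewrite (RInt_const (V := R_CompleteNormedModule)). unfold scal; simpl; unfold mult; simpl. ring.
      * apply Rplus_eq_compat_l, RInt_ext_R. intros; ring.
Qed.

(** A primitive solves the linear equation with coefficient zero and source [u], so differentiation
    under the integral sign is a case of [lin_CB_scalar]. *)
Lemma CB_RInt (D : R -> Prop) (L : R) (HL : 0 < L) u k :
  CB D (strip L) k u -> CB D (strip L) k (fun d s y => RInt (u d s) 0 y).
Proof.
  intros Hu. apply (lin_CB_scalar D L HL (fun _ _ _ => 0) u _ 0 k); auto.
  - apply CB_const.
  - intros. apply SC2_RInt. eapply SC2_of_CB; eauto.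
  - intros. rewrite Rplus_0_l. apply RInt_ext_R. intros; ring.
Qed.

(** * Characteristics *)

(** The hyperbolic tangent. With the rapidity [w] as unknown and the velocity [th w], the
    characteristic system is globally Lipschitz; with the velocity itself its right-hand side would
    contain the polynomial factor [1 - q ^ 2]. *)
Definition th (x : R) : R := 1 - 2 * / (exp (2 * x) + 1).

Lemma is_derive_th x : is_derive th x (1 - th x ^ 2).
Proof.
  unfold th. auto_derive; [generalize (exp_pos (2 * x)); lra |].
  field. generalize (exp_pos (2 * x)); lra.
Qed.

Lemma th_bound x : Rabs (th x) <= 1.
Proof.
  unfold th. generalize (exp_pos (2 * x)); intro.
  assert (0 < / (exp (2 * x) + 1)) by (apply Rinv_0_lt_compat; lra).
  assert (/ (exp (2 * x) + 1) * (exp (2 * x) + 1) = 1) by (field; lra).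
  apply Rabs_le. split; nra.
Qed.

Lemma th_0 : th 0 = 0.
Proof. unfold th. rewrite Rmult_0_r, exp_0. field. Qed.

Lemma lipschitz_of_derive (f f' : R -> R) K :
  (forall x, is_derive f x (f' x)) -> (forall x, Rabs (f' x) <= K) ->
  forall x y, Rabs (f x - f y) <= K * Rabs (x - y).
Proof.
  intros Hd HK x y. apply (bounded_variation f f' K y x). intros; split; auto.
Qed.

Lemma taylor_quadratic (f f' : R -> R) K :
  (forall x, is_derive f x (f' x)) -> (forall x y, Rabs (f' x - f' y) <= K * Rabs (x - y)) ->
  0 <= K -> forall x y, Rabs (f y - f x - f' x * (y - x)) <= K * (Rabs (y - x) * Rabs (y - x)).
Proof.
  intros Hd HK HK0 x y.
  destruct (MVT_cor4 f f' x (Rabs (y - x))) with (b := y) as [c [E Hc]]; [auto | lra |].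
  rewrite E. replace (f' c * (y - x) - f' x * (y - x)) with ((f' c - f' x) * (y - x)) by ring.
  rewrite Rabs_mult, <- Rmult_assoc. apply Rmult_le_compat_r; [apply Rabs_pos |].
  eapply Rle_trans; [apply HK |]. apply Rmult_le_compat_l; auto.
Qed.

Lemma th_lipschitz x y : Rabs (th x - th y) <= 1 * Rabs (x - y).
Proof.
  apply (lipschitz_of_derive th (fun x => 1 - th x ^ 2)); [apply is_derive_th |].
  intros z. generalize (th_bound z). intro H. apply Rabs_le_between in H. apply Rabs_le. nra.
Qed.

Lemma th_taylor x y : Rabs (th y - th x - (1 - th x ^ 2) * (y - x)) <= 2 * (Rabs (y - x) * Rabs (y - x)).
Proof.
  apply (taylor_quadratic th (fun x => 1 - th x ^ 2)); [apply is_derive_th | | lra].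
  intros a b. replace (1 - th a ^ 2 - (1 - th b ^ 2)) with ((th b + th a) * (th b - th a)) by ring.
  rewrite Rabs_mult. generalize (th_lipschitz b a) (th_bound a) (th_bound b) (Rabs_triang (th b) (th a)).
  rewrite (Rabs_minus_sym b a). intros. apply Rmult_le_compat; try apply Rabs_pos; lra.
Qed.

Lemma CB_th D U k u : open2 U -> CB D U k u -> CB D U k (fun d s y => th (u d s y)).
Proof.
  intros HU Hu. unfold th. apply CB_minus; auto; [apply CB_const |]. apply CB_mult; [apply CB_const |].
  apply CB_inv; auto.
  - apply CB_plus; [| apply CB_const]. apply CB_exp, CB_mult; auto. apply CB_const.
  - exists 1. split; [lra |]. intros. generalize (exp_pos (2 * u d s y)). intro. rewrite Rabs_right; lra.
Qed.

Lemma is_derive_id_R (x : R) : is_derive (fun z : R => z) x 1.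
Proof. apply (is_derive_id (K := R_AbsRing)). Qed.

Lemma is_derive_const_R (c x : R) : is_derive (fun _ : R => c) x 0.
Proof. apply (is_derive_const (K := R_AbsRing) (V := R_NormedModule)). Qed.

Lemma CM_y D U k : CM D U k (fun _ _ y => y).
Proof.
  split; [intros; apply continuous_snd |]. destruct k; [exact I |].
  exists (fun _ _ _ => 0), (fun _ _ _ => 1).
  refine (conj _ (conj _ (conj _ _))); try apply CB_const; intros; [apply is_derive_const_R | apply is_derive_id_R].
Qed.

Lemma CB_y D L k : CB D (strip L) k (fun _ _ y => y).
Proof.
  assert (H : forall d s y : R, D d -> strip L s y -> cont2 (fun _ y => y) s y) by (intros; apply continuous_snd).
  assert (H' : exists K, forall d s y : R, D d -> strip L s y -> Rabs y <= K).
  { exists L. unfold strip. intros; lra. }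
  destruct k; (split; [exact H | split; [exact H' |]]); [exact I |].
  exists (fun _ _ _ => 0), (fun _ _ _ => 1).
  refine (conj _ (conj _ (conj _ _))); try apply CB_const; intros; [apply is_derive_const_R | apply is_derive_id_R].
Qed.

Lemma CB_lipschitz D L k u : CB D (strip L) (S k) u ->
  exists K, 0 < K /\ forall d s s' y, D d -> Rabs y < L -> Rabs (u d s y - u d s' y) <= K * Rabs (s - s').
Proof.
  intros [_ [_ [us [_ [H1 [_ [H3 _]]]]]]]. destruct (CB_bound_pos _ _ _ _ H3) as [K [HK HB]].
  exists K. split; auto. intros d s s' y Hd Hy.
  apply (lipschitz_of_derive (fun x => u d x y) (fun x => us d x y)); auto.
Qed.

Section Flow.
Variables (D : R -> Prop) (L : R) (N : nat).
Hypothesis HL : 0 < L.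
Variables e1 d1 e2 d2 : R -> R -> R -> R.
Hypothesis He1 : CB D (strip L) (S (S N)) e1.
Hypothesis Hd1 : CB D (strip L) (S (S N)) d1.
Hypothesis He2 : CB D (strip L) (S (S N)) e2.
Hypothesis Hd2 : CB D (strip L) (S (S N)) d2.

Definition flow_field (e d : R -> R -> R -> R) (dl y u w : R) : R := e dl u y + d dl u y * th w.

(** [T dl s y] is the time at which the characteristic that starts at time [s] on the axis [y = 0]
    reaches [y], and [W dl s y] is the rapidity it carries there, starting from 0. *)
Definition flow_solution (T W : R -> R -> R -> R) : Prop :=
  forall dl, D dl -> SC2 L (T dl) /\ SC2 L (W dl) /\ forall s y, Rabs y < L ->
    T dl s y = s + RInt (fun x => flow_field e1 d1 dl x (T dl s x) (W dl s x)) 0 y /\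
    W dl s y = 0 + RInt (fun x => flow_field e2 d2 dl x (T dl s x) (W dl s x)) 0 y.

Lemma flow_field_SC2 k e d dl u w : CB D (strip L) k e -> CB D (strip L) k d -> D dl -> SC2 L u -> SC2 L w ->
  SC2 L (fun s y => flow_field e d dl y (u s y) (w s y)).
Proof.
  intros He Hd Hdl Hu Hw. unfold flow_field.
  assert (C : forall f, CB D (strip L) k f -> SC2 L (fun s y => f dl (u s y) y)).
  { intros f Hf s y Hy. apply (cont2_comp (f dl) u (fun _ y => y)).
    - apply (SC2_of_CB D L k f dl Hf Hdl); auto.
    - apply Hu; auto.
    - apply continuous_snd. }
  apply SC2_plus; auto. apply SC2_mult; auto. intros s y Hy.
  apply (continuous_comp (fun p : R * R => w (fst p) (snd p)) th); [apply Hw; auto |].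
  apply (ex_derive_continuous (K := R_AbsRing) (V := R_NormedModule)). eexists; apply is_derive_th.
Qed.

Lemma flow_ex : exists T W, flow_solution T W.
Proof.
  destruct (CB_lipschitz D L _ e1 He1) as [Ke1 [Pe1 Le1]].
  destruct (CB_lipschitz D L _ e2 He2) as [Ke2 [Pe2 Le2]].
  destruct (CB_lipschitz D L _ d1 Hd1) as [Kd1 [Pd1 Ld1]].
  destruct (CB_lipschitz D L _ d2 Hd2) as [Kd2 [Pd2 Ld2]].
  destruct (CB_bound_pos _ _ _ _ He1) as [Me1 [Qe1 Be1]].
  destruct (CB_bound_pos _ _ _ _ He2) as [Me2 [Qe2 Be2]].
  destruct (CB_bound_pos _ _ _ _ Hd1) as [Md1 [Qd1 Bd1]].
  destruct (CB_bound_pos _ _ _ _ Hd2) as [Md2 [Qd2 Bd2]].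
  set (K := Ke1 + Ke2 + Kd1 + Kd2 + Md1 + Md2). set (K0 := Me1 + Me2 + Md1 + Md2).
  assert (LipG : forall e d dl Ke Kd Md y u w u' w', D dl -> Rabs y < L ->
    (forall s s', Rabs (e dl s y - e dl s' y) <= Ke * Rabs (s - s')) ->
    (forall s s', Rabs (d dl s y - d dl s' y) <= Kd * Rabs (s - s')) ->
    (forall s, Rabs (d dl s y) <= Md) -> 0 < Ke -> 0 < Kd -> 0 < Md -> Ke + Kd <= K -> Md <= K ->
    Rabs (flow_field e d dl y u w - flow_field e d dl y u' w') <= K * (Rabs (u - u') + Rabs (w - w'))).
  { intros e d dl Ke Kd Md y u w u' w' Hdl Hy H1 H2 H3 P1 P2 P3 Q1 Q2. unfold flow_field.
    replace (e dl u y + d dl u y * th w - (e dl u' y + d dl u' y * th w')) with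
      ((e dl u y - e dl u' y) + (d dl u y - d dl u' y) * th w + d dl u' y * (th w - th w')) by ring.
    eapply Rle_trans; [apply Rabs_triang3 |]. rewrite !Rabs_mult.
    specialize (H1 u u'). specialize (H2 u u'). specialize (H3 u').
    generalize (th_bound w) (th_lipschitz w w') (Rabs_pos (u - u')) (Rabs_pos (w - w')) (Rabs_pos (th w))
      (Rabs_pos (d dl u y - d dl u' y)) (Rabs_pos (d dl u' y)) (Rabs_pos (th w - th w')). intros.
    assert (Rabs (d dl u y - d dl u' y) * Rabs (th w) <= Kd * Rabs (u - u') * 1) by (apply Rmult_le_compat; lra).
    assert (Rabs (d dl u' y) * Rabs (th w - th w') <= Md * (1 * Rabs (w - w'))) by (apply Rmult_le_compat; lra).
    nra. }
  exists (fun dl => picard1 (fun s x u w => flow_field e1 d1 dl x u w) (fun s x u w => flow_field e2 d2 dl x u w) (fun s => s) (fun _ => 0)).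
  exists (fun dl => picard2 (fun s x u w => flow_field e1 d1 dl x u w) (fun s x u w => flow_field e2 d2 dl x u w) (fun s => s) (fun _ => 0)).
  intros dl Hdl.
  refine (picard_solution L (fun s x u w => flow_field e1 d1 dl x u w) (fun s x u w => flow_field e2 d2 dl x u w) (fun s => s) (fun _ => 0) K K0
    HL _ (fun s => continuous_id s) (fun s => continuous_const 0 s) _ _ _ _ _ _).
  - unfold K; lra.
  - intros. eapply flow_field_SC2; eauto.
  - intros. eapply flow_field_SC2; eauto.
  - intros s y u w u' w' Hy. apply (LipG e1 d1 dl Ke1 Kd1 Md1); auto; unfold K; lra.
  - intros s y u w u' w' Hy. apply (LipG e2 d2 dl Ke2 Kd2 Md2); auto; unfold K; lra.
  - intros s y Hy. unfold flow_field. rewrite th_0, Rmult_0_r, Rplus_0_r.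
    eapply Rle_trans; [apply Be1; auto |]. unfold K0; lra.
  - intros s y Hy. unfold flow_field. rewrite th_0, Rmult_0_r, Rplus_0_r.
    eapply Rle_trans; [apply Be2; auto |]. unfold K0; lra.
Qed.

(** Second-order Taylor estimate of the field in both unknowns at once. Being quadratic in the
    increments, the remainder becomes the little-o term demanded by [ode_param_derive] once the
    increments are uniformly small. *)
Lemma remainder_flow (e d et dt : R -> R -> R) (Ke M y u w u' w' : R) :
  Rabs y < L -> 0 < Ke -> 0 < M ->
  (forall s, is_derive (fun x => e x y) s (et s y)) -> (forall s, is_derive (fun x => d x y) s (dt s y)) ->
  (forall s s', Rabs (et s y - et s' y) <= Ke * Rabs (s - s')) ->
  (forall s s', Rabs (dt s y - dt s' y) <= Ke * Rabs (s - s')) ->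
  (forall s, Rabs (d s y) <= M) -> (forall s, Rabs (dt s y) <= M) ->
  Rabs (e u' y + d u' y * th w' - (e u y + d u y * th w) - (et u y + dt u y * th w) * (u' - u)
     - d u y * (1 - th w ^ 2) * (w' - w)) <=
    (2 * Ke + 3 * M) * (Rabs (u' - u) + Rabs (w' - w)) * (Rabs (u' - u) + Rabs (w' - w)).
Proof.
  intros Hy HKe HM De Dd Le Ld Bd Bdt.
  replace (e u' y + d u' y * th w' - (e u y + d u y * th w) - (et u y + dt u y * th w) * (u' - u)
     - d u y * (1 - th w ^ 2) * (w' - w)) with
   (((e u' y - e u y - et u y * (u' - u)) + (d u' y - d u y - dt u y * (u' - u)) * th w')
    + dt u y * (u' - u) * (th w' - th w) + d u y * (th w' - th w - (1 - th w ^ 2) * (w' - w))) by ring.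
  assert (T1 := taylor_quadratic (fun x => e x y) (fun x => et x y) Ke De Le (Rlt_le _ _ HKe) u u').
  assert (T2 := taylor_quadratic (fun x => d x y) (fun x => dt x y) Ke Dd Ld (Rlt_le _ _ HKe) u u').
  cbv beta in T1, T2.
  assert (T3 := th_taylor w w'). assert (T4 := th_lipschitz w' w). assert (T5 := th_bound w').
  specialize (Bd u). specialize (Bdt u).
  eapply Rle_trans; [apply Rabs_triang3 |]. 
  eapply Rle_trans; [apply Rplus_le_compat_r, Rplus_le_compat_r, Rabs_triang |]. rewrite !Rabs_mult.
  set (X := Rabs (u' - u)) in *. set (Y := Rabs (w' - w)) in *.
  assert (0 <= X) by apply Rabs_pos. assert (0 <= Y) by apply Rabs_pos.
  assert (Q2 : Rabs (d u' y - d u y - dt u y * (u' - u)) * Rabs (th w') <= Ke * (X * X) * 1)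
    by (apply Rmult_le_compat; auto using Rabs_pos).
  assert (Q3 : Rabs (dt u y) * X * Rabs (th w' - th w) <= M * X * (1 * Y)).
  { apply Rmult_le_compat; auto using Rabs_pos.
    - apply Rmult_le_pos; auto using Rabs_pos.
    - apply Rmult_le_compat_r; auto. }
  assert (Q4 : Rabs (d u y) * Rabs (th w' - th w - (1 - th w ^ 2) * (w' - w)) <= M * (2 * (Y * Y)))
    by (apply Rmult_le_compat; auto using Rabs_pos).
  assert (0 <= X * Y) by nra. assert (0 <= X * X) by nra. assert (0 <= Y * Y) by nra.
  assert (0 <= Ke * (X * Y)) by nra. assert (0 <= Ke * (X * X)) by nra. assert (0 <= Ke * (Y * Y)) by nra.
  assert (0 <= M * (X * Y)) by nra. assert (0 <= M * (X * X)) by nra. assert (0 <= M * (Y * Y)) by nra.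
  nra.
Qed.

Section Regularity.
Variables T W : R -> R -> R -> R.
Hypothesis HTW : flow_solution T W.

Lemma flow_CB0 : CB D (strip L) 0 W.
Proof.
  split; [intros; apply HTW; auto | split; [| exact I]].
  destruct (CB_bound_pos _ _ _ _ He2) as [Me2 [Qe2 Be2]].
  destruct (CB_bound_pos _ _ _ _ Hd2) as [Md2 [Qd2 Bd2]].
  exists ((Me2 + Md2) * L). intros dl s y Hdl Hy. destruct (HTW dl Hdl) as [C1 [C2 E]].
  rewrite (proj2 (E s y Hy)), Rplus_0_l.
  eapply Rle_trans; [apply (abs_RInt_strip L _ y (Me2 + Md2)); auto |].
  - apply (SC2_SC L (fun s x => flow_field e2 d2 dl x (T dl s x) (W dl s x))).
    eapply flow_field_SC2; eauto.
  - intros x Hx. assert (Hx' : Rabs x < L) by (unfold strip in Hy; lra). unfold flow_field.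
    eapply Rle_trans; [apply Rabs_triang |]. rewrite Rabs_mult.
    specialize (Be2 dl (T dl s x) x Hdl Hx'). specialize (Bd2 dl (T dl s x) x Hdl Hx').
    generalize (th_bound (W dl s x)) (Rabs_pos (th (W dl s x))) (Rabs_pos (d2 dl (T dl s x) x)). nra.
  - apply Rmult_le_compat_l; [lra |]. unfold strip in Hy; lra.
Qed.

Lemma flow_field_CB k e d : CB D (strip L) k e -> CB D (strip L) k d ->
  CM D (strip L) k T -> CB D (strip L) k W ->
  CB D (strip L) k (fun dl s y => flow_field e d dl y (T dl s y) (W dl s y)).
Proof.
  intros He Hd HT HW. unfold flow_field.
  assert (C : forall f, CB D (strip L) k f -> CB D (strip L) k (fun dl s y => f dl (T dl s y) y)).
  { intros f Hf. apply (CB_comp D (strip L) (strip L) k f T (fun _ _ y => y)); auto using strip_open, CM_y. }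
  apply CB_plus; auto. apply CB_mult; auto. apply CB_th; auto using strip_open.
Qed.

(** Bootstrap: once [T] and [W] have order [k], so do the coefficients of the linearized system, and
    [lin_CB] gives order [k] for the derivatives in [s], that is order [S k] for [T] and [W]. The
    time derivatives of the coefficients must be Lipschitz for the Taylor remainder, which is why at
    least two orders are assumed. [T] itself differs from [s] by a bounded amount only and is
    therefore unbounded, hence [CM]. *)
Lemma flow_regular k : (k <= S (S N))%nat ->
  CM D (strip L) k T /\ CB D (strip L) k W.
Proof.
  induction k as [|k IH]; intros Hk.
  { split; [split; [intros; apply HTW; auto | exact I] | apply flow_CB0]. }
  destruct IH as [IT IW]; [lia |].
  assert (Dec : forall e, CB D (strip L) (S (S N)) e -> exists et,
    (forall dl s y, D dl -> Rabs y < L -> is_derive (fun x => e dl x y) s (et dl s y)) /\ CB D (strip L) (S N) et).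
  { intros e [_ [_ [et [ey [G1 [_ [G3 _]]]]]]]. exists et; auto. }
  destruct (Dec e1 He1) as [e1t [De1 Ce1]]. destruct (Dec d1 Hd1) as [d1t [Dd1 Cd1]].
  destruct (Dec e2 He2) as [e2t [De2 Ce2]]. destruct (Dec d2 Hd2) as [d2t [Dd2 Cd2]].
  assert (Low : forall f, CB D (strip L) (S N) f -> CB D (strip L) k f).
  { intros f Hf. apply CB_le with (S N); auto. lia. }
  assert (Low2 : forall f, CB D (strip L) (S (S N)) f -> CB D (strip L) k f).
  { intros f Hf. apply CB_le with (S (S N)); auto. lia. }
  set (A11 := fun dl s y => flow_field e1t d1t dl y (T dl s y) (W dl s y)).
  set (A12 := fun dl s y => d1 dl (T dl s y) y * (1 - th (W dl s y) ^ 2)).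
  set (A21 := fun dl s y => flow_field e2t d2t dl y (T dl s y) (W dl s y)).
  set (A22 := fun dl s y => d2 dl (T dl s y) y * (1 - th (W dl s y) ^ 2)).
  assert (H11 : CB D (strip L) k A11) by (apply flow_field_CB; auto).
  assert (H21 : CB D (strip L) k A21) by (apply flow_field_CB; auto).
  assert (Hth : CB D (strip L) k (fun dl s y => 1 - th (W dl s y) ^ 2)).
  { apply CB_minus; [apply strip_open | apply CB_const | apply CB_pow, CB_th; auto using strip_open]. }
  assert (H12 : CB D (strip L) k A12).
  { apply CB_mult; auto. apply (CB_comp D (strip L) (strip L) k d1 T (fun _ _ y => y)); auto using strip_open, CM_y. }
  assert (H22 : CB D (strip L) k A22).
  { apply CB_mult; auto. apply (CB_comp D (strip L) (strip L) k d2 T (fun _ _ y => y)); auto using strip_open, CM_y. }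
  (* The initial values 1 and 0 are the derivatives in [s] of the starting point [(s, 0)] of a
     characteristic. *)
  destruct (lin_ex D L HL A11 A12 A21 A22 k (fun _ _ _ => 0) (fun _ _ _ => 0) 1 0) as [x1 [x2 HX]]; auto; try apply CB_const.
  destruct (lin_CB D L HL A11 A12 A21 A22 k (fun _ _ _ => 0) (fun _ _ _ => 0) x1 x2 1 0) as [X1 X2]; auto; try apply CB_const.
  assert (DD : forall dl s y, D dl -> Rabs y < L ->
    is_derive (fun s => T dl s y) s (x1 dl s y) /\ is_derive (fun s => W dl s y) s (x2 dl s y)).
  { intros dl s y Hdl Hy. destruct (HTW dl Hdl) as [CT [CW E]]. destruct (HX dl Hdl) as [Cx1 [Cx2 EX]].
    assert (SCb : forall A s, CB D (strip L) k A -> SC L (A dl s)).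
    { intros A s' HA. apply SC2_SC. eapply SC2_of_CB; eauto. }
    destruct (CB_bound_pos _ _ _ _ H11) as [K11 [P11 B11]].
    destruct (CB_bound_pos _ _ _ _ H12) as [K12 [P12 B12]].
    destruct (CB_bound_pos _ _ _ _ H21) as [K21 [P21 B21]].
    destruct (CB_bound_pos _ _ _ _ H22) as [K22 [P22 B22]].
    destruct (CB_lipschitz D L _ e1t Ce1) as [Ke1 [Pe1 Le1]].
    destruct (CB_lipschitz D L _ e2t Ce2) as [Ke2 [Pe2 Le2]].
    destruct (CB_lipschitz D L _ d1t Cd1) as [Kd1 [Pd1 Ld1]].
    destruct (CB_lipschitz D L _ d2t Cd2) as [Kd2 [Pd2 Ld2]].
    destruct (CB_bound_pos _ _ _ _ Hd1) as [Md1 [Qd1 Bd1]].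
    destruct (CB_bound_pos _ _ _ _ Hd2) as [Md2 [Qd2 Bd2]].
    destruct (CB_bound_pos _ _ _ _ Cd1) as [Mt1 [Qt1 Bt1]].
    destruct (CB_bound_pos _ _ _ _ Cd2) as [Mt2 [Qt2 Bt2]].
    set (Ke := Ke1 + Ke2 + Kd1 + Kd2). set (M := Md1 + Md2 + Mt1 + Mt2).
    assert (HKe : 0 < Ke) by (unfold Ke; lra). assert (HM : 0 < M) by (unfold M; lra).
    set (C := 2 * Ke + 3 * M). assert (HC : 0 < C) by (unfold C; lra).
    apply (ode_param_derive L
      (fun s x => flow_field e1 d1 dl x (T dl s x) (W dl s x))
      (fun s x => flow_field e2 d2 dl x (T dl s x) (W dl s x))
      (T dl) (W dl) (fun s => s) (fun _ => 0) s (A11 dl s) (A12 dl s) (A21 dl s) (A22 dl s)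
      (fun _ => 0) (fun _ => 0) (x1 dl s) (x2 dl s) 1 0 (K11 + K12 + K21 + K22)); auto; try lra;
      try (intros; apply SCb; auto; fail); try (intros; apply SC2_SC; auto; fail); try apply SC_const.
    - intros s'. apply (SC2_SC L (fun s x => flow_field e1 d1 dl x (T dl s x) (W dl s x))). eapply flow_field_SC2; eauto.
    - intros s'. apply (SC2_SC L (fun s x => flow_field e2 d2 dl x (T dl s x) (W dl s x))). eapply flow_field_SC2; eauto.
    - intros s' z Hz. apply E; auto.
    - intros s' z Hz. apply E; auto.
    - intros; ring.
    - intros; ring.
    - intros z Hz. specialize (B11 dl s z Hdl Hz). specialize (B12 dl s z Hdl Hz).
      specialize (B21 dl s z Hdl Hz). specialize (B22 dl s z Hdl Hz). lra.
    - intros z Hz. apply EX; auto.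
    - intros z Hz. apply EX; auto.
    - intros Y eps HY He. assert (He3 : 0 < eps / (2 * C)) by (apply Rdiv_lt_0_compat; lra).
      generalize (filter_and _ _ (unif_cont L (T dl) s Y _ CT HY He3) (unif_cont L (W dl) s Y _ CW HY He3)).
      apply filter_imp. intros h [Q1 Q2] z Hz D1 D2. specialize (Q1 z Hz). specialize (Q2 z Hz).
      fold D1 in Q1. fold D2 in Q2.
      assert (HzL : Rabs z < L) by lra.
      assert (S : C * (Rabs D1 + Rabs D2) * (Rabs D1 + Rabs D2) <= eps * (Rabs h + Rabs D1 + Rabs D2)).
      { apply Rle_trans with (eps * (Rabs D1 + Rabs D2)).
        - apply Rmult_le_compat_r; [generalize (Rabs_pos D1) (Rabs_pos D2); lra |].
          apply Rle_trans with (C * (eps / (2 * C) + eps / (2 * C))).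
          + apply Rmult_le_compat_l; lra.
          + right; field; lra.
        - apply Rmult_le_compat_l; [lra |]. generalize (Rabs_pos h); lra. }
      split.
      + eapply Rle_trans; [| exact S].
        eapply Rle_trans; [| apply (remainder_flow (e1 dl) (d1 dl) (e1t dl) (d1t dl) Ke M z (T dl s z) (W dl s z) (T dl (s + h) z) (W dl (s + h) z)); auto].
        * right. f_equal. unfold A11, A12, flow_field, D1, D2. ring.
        * intros. eapply Rle_trans; [apply Le1; auto |]. apply Rmult_le_compat_r; [apply Rabs_pos | unfold Ke; lra].
        * intros. eapply Rle_trans; [apply Ld1; auto |]. apply Rmult_le_compat_r; [apply Rabs_pos | unfold Ke; lra].
        * intros. eapply Rle_trans; [apply Bd1; auto |]. unfold M; lra.
        * intros. eapply Rle_trans; [apply Bt1; auto |]. unfold M; lra.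
      + eapply Rle_trans; [| exact S].
        eapply Rle_trans; [| apply (remainder_flow (e2 dl) (d2 dl) (e2t dl) (d2t dl) Ke M z (T dl s z) (W dl s z) (T dl (s + h) z) (W dl (s + h) z)); auto].
        * right. f_equal. unfold A21, A22, flow_field, D1, D2. ring.
        * intros. eapply Rle_trans; [apply Le2; auto |]. apply Rmult_le_compat_r; [apply Rabs_pos | unfold Ke; lra].
        * intros. eapply Rle_trans; [apply Ld2; auto |]. apply Rmult_le_compat_r; [apply Rabs_pos | unfold Ke; lra].
        * intros. eapply Rle_trans; [apply Bd2; auto |]. unfold M; lra.
        * intros. eapply Rle_trans; [apply Bt2; auto |]. unfold M; lra. }
  assert (DY : forall dl s y e d (x : R -> R -> R -> R) c, D dl -> Rabs y < L -> CB D (strip L) k e -> CB D (strip L) k d ->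
    (forall y, Rabs y < L -> x dl s y = c + RInt (fun x => flow_field e d dl x (T dl s x) (W dl s x)) 0 y) ->
    is_derive (fun y => x dl s y) y (flow_field e d dl y (T dl s y) (W dl s y))).
  { intros dl s y e d x c Hdl Hy He Hd E.
    apply (is_derive_of_integral L (fun y => flow_field e d dl y (T dl s y) (W dl s y)) _ c); auto.
    destruct (HTW dl Hdl) as [CT [CW _]].
    apply (SC2_SC L (fun s x => flow_field e d dl x (T dl s x) (W dl s x))). eapply flow_field_SC2; eauto. }
  split.
  - split; [intros; apply HTW; auto |].
    exists x1, (fun dl s y => flow_field e1 d1 dl y (T dl s y) (W dl s y)).
    refine (conj _ (conj _ (conj _ _))); auto using flow_field_CB.
    + intros; apply DD; auto.
    + intros dl s y Hdl Hy. apply (DY dl s y e1 d1 T s); auto. intros; apply HTW; auto.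
  - split; [exact (CB_cont _ _ _ _ IW) | split; [exact (CB_bound _ _ _ _ IW) |]].
    exists x2, (fun dl s y => flow_field e2 d2 dl y (T dl s y) (W dl s y)).
    refine (conj _ (conj _ (conj _ _))); auto using flow_field_CB.
    + intros; apply DD; auto.
    + intros dl s y Hdl Hy. apply (DY dl s y e2 d2 W 0); auto. intros; apply HTW; auto.
Qed.

End Regularity.
End Flow.

Lemma integral_of_derive (L : R) (f x : R -> R) (c : R) :
  SC L f -> (forall y, Rabs y < L -> is_derive x y (f y)) -> x 0 = c ->
  forall y, Rabs y < L -> x y = c + RInt f 0 y.
Proof.
  intros Hf Hd H0 y Hy.
  assert (E : is_RInt f 0 y (minus (x y) (x 0))).
  { apply (is_RInt_derive (V := R_CompleteNormedModule)); intros z Hz; apply between_0 in Hz;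
    [apply Hd | apply Hf]; lra. }
  rewrite (is_RInt_unique _ _ _ _ E). unfold minus, plus, opp; simpl. rewrite H0. ring.
Qed.

Lemma CB_param (D : R -> Prop) U k : (exists K, forall d, D d -> Rabs d <= K) -> CB D U k (fun d _ _ => d).
Proof.
  intros HK. assert (HK' : exists K, forall d (s y : R), D d -> U s y -> Rabs d <= K).
  { destruct HK as [K HK]. exists K. auto. }
  destruct k; (split; [intros; apply continuous_const | split; [exact HK' |]]); [exact I |].
  exists (fun _ _ _ => 0), (fun _ _ _ => 0).
  refine (conj _ (conj _ (conj _ _))); try apply CB_const; intros; apply is_derive_const_R.
Qed.

Lemma differentiable_pt_lim_partials (f : R -> R -> R) (x y lx ly : R) :
  differentiable_pt_lim f x y lx ly ->
  is_derive (fun z => f z y) x lx /\ is_derive (fun z => f x z) y ly.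
Proof.
  intro H. split; apply is_derive_Reals.
  - assert (Q := derivable_pt_lim_comp_2d f (fun z => z) (fun _ => y) x lx ly 1 0 H
      (derivable_pt_lim_id x) (derivable_pt_lim_const y x)).
    replace (lx * 1 + ly * 0) with lx in Q by ring. exact Q.
  - assert (Q := derivable_pt_lim_comp_2d f (fun _ => x) (fun z => z) y lx ly 0 1 H
      (derivable_pt_lim_const x y) (derivable_pt_lim_id y)).
    replace (lx * 0 + ly * 1) with ly in Q by ring. exact Q.
Qed.

Lemma Rabs_sub_le (a b : R) : Rabs (a - b) <= Rabs a + Rabs b.
Proof. generalize (Rabs_triang a (- b)). rewrite Rabs_Ropp. trivial. Qed.

(** * Inversion of the characteristic map in time, with [y] as a parameter *)

Section Inverse.
Variables (D : R -> Prop) (L : R) (T Ts Ty : R -> R -> R -> R) (B : R).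
Hypothesis HL : 0 < L.
Hypothesis HTc : forall d s y, D d -> Rabs y < L -> cont2 (T d) s y.
Hypothesis HTs : forall d s y, D d -> Rabs y < L -> is_derive (fun x => T d x y) s (Ts d s y).
Hypothesis HTy : forall d s y, D d -> Rabs y < L -> is_derive (fun x => T d s x) y (Ty d s y).
Hypothesis HB : forall d s y, D d -> Rabs y < L -> Rabs (T d s y - s) <= B.
Hypothesis HI : forall d s s' y, D d -> Rabs y < L -> Rabs (T d s' y - T d s y - (s' - s)) <= / 2 * Rabs (s' - s).

(** The starting time of the characteristic through [(t, y)]. A root exists by the intermediate
    value theorem, because [T - s] is bounded by [B], and it is unique because by [HI] the map
    [T - s] contracts by one half. *)
Definition inv_flow (d t y : R) : R := epsilon (inhabits 0) (fun s => T d s y = t).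

Lemma inv_flow_spec d t y : D d -> Rabs y < L -> T d (inv_flow d t y) y = t.
Proof.
  intros Hd Hy. unfold inv_flow. apply epsilon_spec.
  destruct (IVT_gen (fun s => T d s y) (t - B) (t + B) t) as [s [_ Hs]].
  - intros s. apply continuity_pt_filterlim. apply (cont2_slice_l (T d)). auto.
  - pose proof (HB d (t - B) y Hd Hy) as H1. pose proof (HB d (t + B) y Hd Hy) as H2.
    apply Rabs_le_between in H1. apply Rabs_le_between in H2.
    split; [eapply Rle_trans; [apply Rmin_l |]; lra | eapply Rle_trans; [| apply Rmax_r]; lra].
  - exists s. exact Hs.
Qed.

Lemma flow_expanding d s s' y : D d -> Rabs y < L -> Rabs (s' - s) <= 2 * Rabs (T d s' y - T d s y).
Proof.
  intros Hd Hy. specialize (HI d s s' y Hd Hy).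
  generalize (Rabs_triang (- (T d s' y - T d s y - (s' - s))) (T d s' y - T d s y)).
  rewrite Rabs_Ropp.
  replace (- (T d s' y - T d s y - (s' - s)) + (T d s' y - T d s y)) with (s' - s) by ring. lra.
Qed.

(** By [HI] every difference quotient is at least [/ 2]; settling for [/ 4] leaves room for the
    distance between one quotient and the derivative. *)
Lemma flow_derive_lower d s y : D d -> Rabs y < L -> / 4 <= Ts d s y.
Proof.
  intros Hd Hy. destruct (Rle_dec (/ 4) (Ts d s y)) as [|Hn]; auto. exfalso.
  pose proof (HTs d s y Hd Hy) as H. apply is_derive_Reals in H.
  destruct (H (/ 4)) as [eta Heta]; [lra |].
  specialize (Heta (eta / 2)). generalize (cond_pos eta); intro.
  assert (Q : Rabs ((T d (s + eta / 2) y - T d s y) / (eta / 2) - Ts d s y) < / 4).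
  { apply Heta; [lra |]. rewrite Rabs_right; lra. }
  pose proof (HI d s (s + eta / 2) y Hd Hy) as Q2.
  rewrite Rplus_minus_l in Q2. rewrite (Rabs_right (eta / 2)) in Q2 by lra.
  apply Rabs_le_between in Q2. apply Rabs_def2 in Q.
  assert (Q3 : / 2 <= (T d (s + eta / 2) y - T d s y) / (eta / 2)).
  { apply Rmult_le_reg_r with (eta / 2); [lra |]. unfold Rdiv at 2. rewrite Rmult_assoc, Rinv_l; lra. }
  lra.
Qed.

Section Bounds.
Hypothesis HTsC : CB D (strip L) 0 Ts.
Hypothesis HTyC : CB D (strip L) 0 Ty.

Lemma inv_flow_local_lipschitz : exists K, 0 < K /\ forall d t t' y y', D d -> Rabs y < L -> Rabs (y' - y) < L - Rabs y ->
  Rabs (inv_flow d t' y' - inv_flow d t y) <= K * (Rabs (t' - t) + Rabs (y' - y)).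
Proof.
  destruct (CB_bound_pos _ _ _ _ HTyC) as [K [HK HKb]].
  exists (2 * (1 + K)). split; [lra |]. intros d t t' y y' Hd Hy Hy'.
  assert (Hy'L : Rabs y' < L) by (apply Rabs_near with y; auto).
  eapply Rle_trans; [apply (flow_expanding d _ _ y'); auto |].
  rewrite inv_flow_spec by auto.
  set (s := inv_flow d t y).
  assert (Q : Rabs (T d s y' - T d s y) <= K * Rabs (y' - y)).
  { apply (bounded_variation (fun z => T d s z) (fun z => Ty d s z) K y y').
    intros z Hz. assert (HzL : Rabs z < L) by (apply Rabs_near with y; lra). split; auto. }
  replace (t' - T d s y') with ((t' - t) - (T d s y' - T d s y)).
  2: { unfold s. rewrite inv_flow_spec; auto. ring. }
  eapply Rle_trans; [apply Rmult_le_compat_l; [lra | apply Rabs_sub_le] |].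
  generalize (Rabs_pos (t' - t)) (Rabs_pos (y' - y)). intros.
  assert (0 <= K * Rabs (t' - t)) by (apply Rmult_le_pos; lra).
  apply Rle_trans with (2 * (Rabs (t' - t) + K * Rabs (y' - y))); [apply Rmult_le_compat_l; lra |].
  clear - H H0 H1 HK. lra.
Qed.

Lemma locally_2d_of_ball (P : R -> R -> Prop) x y (e : posreal) :
  (forall u v, Rabs (u - x) < e -> Rabs (v - y) < e -> P u v) -> locally_2d P x y.
Proof. intro H. exists e. auto. Qed.

Lemma inv_flow_cont d t y : D d -> Rabs y < L -> cont2 (inv_flow d) t y.
Proof.
  intros Hd Hy. apply continuity_2d_pt_filterlim. intros eps.
  destruct inv_flow_local_lipschitz as [K [HK H]].
  assert (He : 0 < Rmin (L - Rabs y) (eps / (2 * K))).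
  { apply Rmin_pos; [lra |]. apply Rdiv_lt_0_compat; [apply cond_pos | lra]. }
  apply (locally_2d_of_ball _ t y (mkposreal _ He)). intros t' y' Ht' Hy'. simpl in Ht', Hy'.
  eapply Rle_lt_trans; [apply H; auto |].
  - eapply Rlt_le_trans; [exact Hy' | apply Rmin_l].
  - assert (Rabs (t' - t) < eps / (2 * K)) by (eapply Rlt_le_trans; [exact Ht' | apply Rmin_r]).
    assert (Rabs (y' - y) < eps / (2 * K)) by (eapply Rlt_le_trans; [exact Hy' | apply Rmin_r]).
    apply Rlt_le_trans with (K * (eps / (2 * K) + eps / (2 * K))); [apply Rmult_lt_compat_l; [lra | apply Rplus_lt_compat; assumption] |].
    right; field; lra.
Qed.

(** Inverse function theorem with a parameter. Differentiability of [T d] at [(s, y)] expresses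
    [t' - t] up to an error small against [s' - s] and [y' - y]; the local Lipschitz bound of the
    inverse converts this into an error small against [t' - t] and [y' - y]. *)
Lemma inv_flow_derive d t y : D d -> Rabs y < L ->
  is_derive (fun z => inv_flow d z y) t (/ Ts d (inv_flow d t y) y) /\
  is_derive (fun z => inv_flow d t z) y (- Ty d (inv_flow d t y) y * / Ts d (inv_flow d t y) y).
Proof.
  intros Hd Hy. apply differentiable_pt_lim_partials.
  destruct inv_flow_local_lipschitz as [K [HK H]].
  set (s := inv_flow d t y). set (a := Ts d s y). set (b := Ty d s y).
  assert (Ha : / 4 <= a) by (apply flow_derive_lower; auto).
  assert (DT : differentiable_pt_lim (T d) s y a b).
  { apply filterdiff_differentiable_pt_lim. apply (is_derive_filterdiff (T d) s y (Ts d) b).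
    - generalize (strip_open L s y Hy). apply filter_imp. intros p Hp. apply HTs; auto.
    - apply HTy; auto.
    - apply (CB_cont _ _ _ _ HTsC); auto. }
  intros eps.
  (* The factor 4 bounds the inverse of [Ts], and [2 * K + 1] compares the maximum norm of
     [(s' - s, y' - y)] with that of [(t' - t, y' - y)]. *)
  set (C := 4 * (2 * K + 1)). assert (HC : 0 < C) by (unfold C; lra).
  assert (He : 0 < eps / C) by (apply Rdiv_lt_0_compat; auto; apply cond_pos).
  destruct (DT (mkposreal _ He)) as [eta Heta]. simpl in Heta.
  assert (He' : 0 < Rmin (Rmin (L - Rabs y) eta) (eta / (2 * K))).
  { generalize (cond_pos eta); intro. apply Rmin_pos; [apply Rmin_pos; lra |]. apply Rdiv_lt_0_compat; lra. }
  apply (locally_2d_of_ball _ t y (mkposreal _ He')). intros t' y' Ht' Hy'. simpl in Ht', Hy'.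
  assert (Y1 : Rabs (y' - y) < L - Rabs y).
  { eapply Rlt_le_trans; [exact Hy' |]. eapply Rle_trans; [apply Rmin_l | apply Rmin_l]. }
  assert (Y2 : Rabs (y' - y) < eta).
  { eapply Rlt_le_trans; [exact Hy' |]. eapply Rle_trans; [apply Rmin_l | apply Rmin_r]. }
  assert (Y3 : Rabs (y' - y) < eta / (2 * K)) by (eapply Rlt_le_trans; [exact Hy' | apply Rmin_r]).
  assert (T3 : Rabs (t' - t) < eta / (2 * K)) by (eapply Rlt_le_trans; [exact Ht' | apply Rmin_r]).
  specialize (H d t t' y y' Hd Hy Y1). fold s in H. set (s' := inv_flow d t' y') in *.
  assert (Hs' : Rabs (s' - s) < eta).
  { eapply Rle_lt_trans; [exact H |].
    apply Rlt_le_trans with (K * (eta / (2 * K) + eta / (2 * K))); [apply Rmult_lt_compat_l; lra |].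
    right; field; lra. }
  specialize (Heta s' y' Hs' Y2).
  assert (Hy'L : Rabs y' < L) by (apply Rabs_near with y; auto).
  unfold s' in Heta at 1. rewrite inv_flow_spec in Heta by auto.
  unfold s in Heta at 1. rewrite inv_flow_spec in Heta by auto.
  set (M := Rmax (Rabs (t' - t)) (Rabs (y' - y))).
  assert (M1 : Rabs (t' - t) <= M) by apply Rmax_l. assert (M2 : Rabs (y' - y) <= M) by apply Rmax_r.
  assert (HM : 0 <= M) by (generalize (Rabs_pos (y' - y)); lra).
  assert (M3 : Rmax (Rabs (s' - s)) (Rabs (y' - y)) <= (2 * K + 1) * M).
  { apply Rmax_lub; [| nra]. eapply Rle_trans; [exact H |]. nra. }
  fold s.
  replace (s' - s - (/ a * (t' - t) + - b * / a * (y' - y))) with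
    (- / a * (t' - t - (a * (s' - s) + b * (y' - y)))) by (field; lra).
  rewrite Rabs_mult, Rabs_Ropp, Rabs_right by (left; apply Rinv_0_lt_compat; lra).
  assert (Hia : / a <= 4). { rewrite <- (Rinv_inv 4). apply Rinv_le_contravar; lra. }
  assert (0 < / a) by (apply Rinv_0_lt_compat; lra).
  apply Rle_trans with (4 * (eps / C * ((2 * K + 1) * M))).
  - apply Rmult_le_compat; [lra | apply Rabs_pos | auto |].
    eapply Rle_trans; [exact Heta |]. apply Rmult_le_compat_l; [lra | auto].
  - right. unfold C. field. lra.
Qed.

End Bounds.

(** The derivatives of the inverse are expressions in [Ts] and [Ty] composed with the inverse
    itself, so each order follows from the preceding one. *)
Lemma inv_flow_CM k : CB D (strip L) k Ts -> CB D (strip L) k Ty -> CM D (strip L) (S k) inv_flow.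
Proof.
  intros HTsC HTyC.
  assert (C0 : forall d s y, D d -> strip L s y -> cont2 (inv_flow d) s y).
  { intros. apply inv_flow_cont; auto. apply CB_le with k; auto; lia. }
  assert (Step : forall j, (j <= k)%nat -> CM D (strip L) j inv_flow -> CM D (strip L) (S j) inv_flow).
  { intros j Hj HM. split; [exact C0 |].
    exists (fun d t y => / Ts d (inv_flow d t y) y), (fun d t y => - Ty d (inv_flow d t y) y * / Ts d (inv_flow d t y) y).
    assert (Cs : CB D (strip L) j (fun d t y => Ts d (inv_flow d t y) y)).
    { apply (CB_comp D (strip L) (strip L) j Ts inv_flow (fun _ _ y => y)); auto using strip_open, CM_y.
      apply CB_le with k; auto. }
    assert (Cy : CB D (strip L) j (fun d t y => Ty d (inv_flow d t y) y)).
    { apply (CB_comp D (strip L) (strip L) j Ty inv_flow (fun _ _ y => y)); auto using strip_open, CM_y.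
      apply CB_le with k; auto. }
    assert (Ci : CB D (strip L) j (fun d t y => / Ts d (inv_flow d t y) y)).
    { apply CB_inv; auto using strip_open. exists (/ 4). split; [lra |]. intros d s y Hd Hy.
      eapply Rle_trans; [| apply Rle_abs]. apply flow_derive_lower; auto. }
    refine (conj _ (conj _ (conj _ _))); auto.
    - intros d s y Hd Hy. apply inv_flow_derive; auto; apply CB_le with k; auto; lia.
    - intros d s y Hd Hy. apply inv_flow_derive; auto; apply CB_le with k; auto; lia.
    - apply CB_mult; auto. apply CB_opp; auto using strip_open. }
  assert (All : forall j, (j <= S k)%nat -> CM D (strip L) j inv_flow).
  { induction j as [|j IH]; intros Hj; [split; [exact C0 | exact I] |]. apply Step; [lia | apply IH; lia]. }
  apply All. lia.
Qed.

End Inverse.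

(** Numerical bound for the Gronwall factor in [transport_solution], where the growth rate times [L]
    is at most [/ 16] and [gronwall] doubles it. *)
Lemma exp_eighth : exp (/ 8) <= 8 / 7.
Proof.
  assert (H : 1 + - / 8 < exp (- / 8)) by (apply exp_ineq1; lra).
  rewrite exp_Ropp in H. generalize (exp_pos (/ 8)). intro.
  assert (/ exp (/ 8) * exp (/ 8) = 1) by (field; lra). nra.
Qed.

(* Method of characteristics for [q_y = - (e1 + d1 q) q_t + (1 - q^2) (dl e' + d2 q)], [q = dl w]:
   the characteristic map is inverted for small [dl] with bounds uniform in [dl]. *)
Theorem transport_solution (dl0 L C1 : R) (e1 d1 e' d2 : R -> R -> R -> R) :
  let D0 := fun d => 0 < d < dl0 in
  0 < dl0 -> 0 < L ->
  CB D0 (strip L) 3 e1 -> CB D0 (strip L) 3 d1 -> CB D0 (strip L) 3 e' -> CB D0 (strip L) 3 d2 ->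
  0 <= C1 -> 32 * C1 * L <= 1 ->
  (forall d s s' y, D0 d -> Rabs y < L -> Rabs (e1 d s y - e1 d s' y) <= C1 * Rabs (s - s')) ->
  exists dl1 w wt wy, 0 < dl1 <= dl0 /\ let D1 := fun d => 0 < d < dl1 in
    CB D1 (strip L) 3 w /\ CB D1 (strip L) 2 wt /\ CB D1 (strip L) 2 wy /\
    (forall d t y, D1 d -> Rabs y < L ->
       is_derive (fun x => w d x y) t (wt d t y) /\ is_derive (fun x => w d t x) y (wy d t y) /\
       Rabs (d * w d t y) <= / 2 /\
       wy d t y = - (e1 d t y + d1 d t y * (d * w d t y)) * wt d t y
          + (1 - (d * w d t y) ^ 2) * (e' d t y + d2 d t y * w d t y)).
Proof.
  intros D0 Hdl0 HL He1 Hd1 He' Hd2 HC1 HC1L HLip1.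
  assert (OS := strip_open L).
  assert (HP : CB D0 (strip L) 3 (fun d _ _ => d)).
  { apply CB_param. exists dl0. intros d [Hd0 Hd]. rewrite Rabs_right; lra. }
  (* The source of the rapidity equation carries the factor [d], so the rapidity, which vanishes at
     [y = 0], is of order [d]. *)
  set (e2 := fun d s y => d * e' d s y).
  assert (He2 : CB D0 (strip L) 3 e2) by (apply CB_mult; auto).
  destruct (flow_ex D0 L 1 HL e1 d1 e2 d2 He1 Hd1 He2 Hd2) as [T [W HTW]].
  destruct (flow_regular D0 L 1 HL e1 d1 e2 d2 He1 Hd1 He2 Hd2 T W HTW 3 (Nat.le_refl 3)) as [MT CW].
  set (Q := fun d s y => th (W d s y)).
  assert (CQ : CB D0 (strip L) 3 Q) by (apply CB_th; auto).
  assert (Comp : forall f, CB D0 (strip L) 3 f -> CB D0 (strip L) 3 (fun d s y => f d (T d s y) y)).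
  { intros f Hf. apply (CB_comp D0 (strip L) (strip L) 3 f T (fun _ _ y => y)); auto using CM_y. }
  (* Along a characteristic [Q_y = (1 - Q ^ 2) * (d * e' + d2 * Q)]. Divided by [d], this is the
     linear equation [w_y = A * w + b] for [w = Q / d], the quadratic term [Q ^ 2 * e'] being
     written as [Q * e2 * w]. The coefficients are bounded uniformly in [d], so [w] belongs to [CB]
     although it is defined with a division by [d]. *)
  set (A := fun d s y => (1 - Q d s y ^ 2) * d2 d (T d s y) y - Q d s y * e2 d (T d s y) y).
  set (b := fun d s y => e' d (T d s y) y).
  assert (Cb : CB D0 (strip L) 3 b) by (apply (Comp e'); auto).
  assert (C1Q : CB D0 (strip L) 3 (fun d s y => 1 - Q d s y ^ 2)).
  { apply CB_minus; auto; [apply CB_const | apply CB_pow; auto]. }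
  assert (CA : CB D0 (strip L) 3 A).
  { apply CB_minus; auto; apply CB_mult; auto. }
  set (w := fun d s y => Q d s y * / d).
  assert (Hwq : forall d s y, D0 d -> d * w d s y = Q d s y).
  { intros d s y Hd. unfold w, D0 in *. field. lra. }
  assert (SCff : forall e d dl s, CB D0 (strip L) 3 e -> CB D0 (strip L) 3 d -> D0 dl ->
    SC L (fun x => flow_field e d dl x (T dl s x) (W dl s x))).
  { intros e d dl s He Hd Hdl. destruct (HTW dl Hdl) as [cT [cW _]].
    apply (SC2_SC L (fun s x => flow_field e d dl x (T dl s x) (W dl s x))). eapply flow_field_SC2; eauto. }
  assert (Wy : forall d s y, D0 d -> Rabs y < L ->
    is_derive (fun x => w d s x) y (A d s y * w d s y + b d s y)).
  { intros d s y Hd Hy. destruct (HTW d Hd) as [cT [cW E]].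
    assert (DW : is_derive (fun x => W d s x) y (flow_field e2 d2 d y (T d s y) (W d s y))).
    { apply (is_derive_of_integral L (fun y => flow_field e2 d2 d y (T d s y) (W d s y)) _ 0); auto.
      intros; apply E; auto. }
    replace (A d s y * w d s y + b d s y) with
      (/ d * (flow_field e2 d2 d y (T d s y) (W d s y) * (1 - th (W d s y) ^ 2))).
    - apply (is_derive_ext (fun x => / d * Q d s x)); [intros; unfold w; apply Rmult_comm |].
      apply is_derive_scal.
      apply (is_derive_comp (K := R_AbsRing) (V := R_NormedModule) th (fun x => W d s x)); [apply is_derive_th | exact DW].
    - unfold A, b, w, flow_field, Q, e2. destruct Hd. field. lra. }
  assert (Cw : CB D0 (strip L) 3 w).
  { apply (lin_CB_scalar D0 L HL A b w 0 3); auto.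
    - intros d Hd. apply (SC2_mult L (Q d) (fun _ _ => / d)).
      + eapply SC2_of_CB; eauto.
      + intros s y Hy. apply continuous_const.
    - intros d s y Hd Hy. apply (integral_of_derive L (fun z => A d s z * w d s z + b d s z) (fun y => w d s y) 0); auto.
      + destruct (HTW d Hd) as [cT [cW E]].
        apply SC_plus; [apply SC_mult |]; try (apply SC2_SC; eapply SC2_of_CB; eauto; fail).
        intros x Hx. apply (ex_derive_continuous (K := R_AbsRing) (V := R_NormedModule)). eexists. apply Wy; auto.
      + destruct (HTW d Hd) as [cT [cW E]]. unfold w, Q.
        rewrite (proj2 (E s 0 ltac:(rewrite Rabs_R0; auto))).
        rewrite RInt_point. unfold zero; simpl. rewrite Rplus_0_r, th_0. ring. }
  destruct (CB_lipschitz D0 L _ w Cw) as [Lw [PLw HLw]].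
  destruct (CB_bound_pos _ _ _ _ Cw) as [Kw [PKw HKw]].
  destruct (CB_lipschitz D0 L _ d1 Hd1) as [Kd [PKd HKd]].
  destruct (CB_bound_pos _ _ _ _ Hd1) as [Md [PMd HMd]].
  destruct (CB_bound_pos _ _ _ _ He1) as [Me [PMe HMe]].
  set (K' := Kd * Kw + Md * Lw). assert (PK' : 0 < K') by (unfold K'; nra).
  (* The second bound makes the part of the characteristic slope that depends on [q] too weak to
     spoil invertibility, the third gives [Rabs q <= / 2]. *)
  set (dl1 := Rmin dl0 (Rmin (/ (32 * K' * L)) (/ (2 * Kw)))).
  assert (Pdl1 : 0 < dl1).
  { unfold dl1. repeat apply Rmin_pos; auto; apply Rinv_0_lt_compat; [| lra].
    apply Rmult_lt_0_compat; lra. }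
  assert (Hdl1 : dl1 <= dl0) by apply Rmin_l.
  set (D1 := fun d => 0 < d < dl1).
  assert (HD : forall d, D1 d -> D0 d) by (unfold D0, D1; intros; lra).
  assert (Hsm : forall d, D1 d -> 32 * (d * K') * L <= 1 /\ d * Kw <= / 2).
  { intros d [Hd Hd'].
    assert (d <= / (32 * K' * L)).
    { left. eapply Rlt_le_trans; [exact Hd' |]. eapply Rle_trans; [apply Rmin_r | apply Rmin_l]. }
    assert (d <= / (2 * Kw)).
    { left. eapply Rlt_le_trans; [exact Hd' |]. eapply Rle_trans; [apply Rmin_r | apply Rmin_r]. }
    split.
    - replace (32 * (d * K') * L) with (d * (32 * K' * L)) by ring.
      assert (0 < 32 * K' * L) by (apply Rmult_lt_0_compat; lra).
      rewrite <- (Rinv_l (32 * K' * L)) by lra. apply Rmult_le_compat_r; lra.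
    - apply Rle_trans with (/ (2 * Kw) * Kw); [apply Rmult_le_compat_r; lra | right; field; lra]. }
  pose proof MT as MT'. destruct MT' as [_ [Ts [Ty0 [DTs [DTy0 [CTs CTy0]]]]]].
  assert (Tyeq : forall d s y, D0 d -> Rabs y < L -> Ty0 d s y = e1 d (T d s y) y + d1 d (T d s y) y * Q d s y).
  { intros d s y Hd Hy. destruct (HTW d Hd) as [cT [cW E]].
    rewrite <- (is_derive_unique _ _ _ (DTy0 d s y Hd Hy)). apply is_derive_unique.
    apply (is_derive_of_integral L (fun y => flow_field e1 d1 d y (T d s y) (W d s y)) _ s); auto.
    intros; apply E; auto. }
  (* Two characteristics separate at a rate at most [C1 + d * K'], up to a source [d * K' * h]. The
     smallness of [C1 * L] and of [d * K' * L] gives by Gronwall a distance of at most [3 * h]; fed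
     back into the integral equation, this leaves a deviation from the initial distance well below
     [h / 2]. *)
  assert (HI : forall d s s' y, D1 d -> Rabs y < L -> Rabs (T d s' y - T d s y - (s' - s)) <= / 2 * Rabs (s' - s)).
  { intros d s s' y Hd1' Hy. pose proof (HD d Hd1') as Hd. destruct (Hsm d Hd1') as [S1 _].
    assert (Pd : 0 < d) by (destruct Hd1'; auto).
    destruct (HTW d Hd) as [cT [cW E]].
    set (n := fun x => Rabs (T d s' x - T d s x)). set (h := Rabs (s' - s)).
    assert (Sn : SC L n) by (apply SC_abs, SC_minus; apply SC2_SC; auto).
    assert (Hh : 0 <= h) by apply Rabs_pos.
    assert (HdK : 0 < d * K') by (apply Rmult_lt_0_compat; auto).
    assert (Diff : forall x, Rabs x < L ->
       Rabs (flow_field e1 d1 d x (T d s' x) (W d s' x) - flow_field e1 d1 d x (T d s x) (W d s x))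
         <= (C1 + d * K') * n x + d * K' * h).
    { intros x Hx. unfold flow_field. fold (Q d s' x) (Q d s x).
      rewrite <- !Hwq by auto.
      replace (e1 d (T d s' x) x + d1 d (T d s' x) x * (d * w d s' x) - (e1 d (T d s x) x + d1 d (T d s x) x * (d * w d s x)))
        with ((e1 d (T d s' x) x - e1 d (T d s x) x) + (d1 d (T d s' x) x - d1 d (T d s x) x) * (d * w d s' x)
             + d1 d (T d s x) x * (d * (w d s' x - w d s x))) by ring.
      eapply Rle_trans; [apply Rabs_triang3 |]. rewrite !Rabs_mult, (Rabs_right d) by lra.
      assert (P1 := HLip1 d (T d s' x) (T d s x) x Hd Hx). fold (n x) in P1.
      assert (P2 := HKd d (T d s' x) (T d s x) x Hd Hx). fold (n x) in P2.
      assert (P3 := HMd d (T d s x) x Hd Hx). assert (P4 := HKw d s' x Hd Hx).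
      assert (P5 := HLw d s' s x Hd Hx). fold h in P5.
      assert (0 <= n x) by apply Rabs_pos.
      assert (R1 : Rabs (d1 d (T d s' x) x - d1 d (T d s x) x) * (d * Rabs (w d s' x)) <= (Kd * n x) * (d * Kw)).
      { apply Rmult_le_compat; auto; [apply Rabs_pos | apply Rmult_le_pos; [lra | apply Rabs_pos] |].
        apply Rmult_le_compat_l; lra. }
      assert (R2 : Rabs (d1 d (T d s x) x) * (d * Rabs (w d s' x - w d s x)) <= Md * (d * (Lw * h))).
      { apply Rmult_le_compat; auto; [apply Rabs_pos | apply Rmult_le_pos; [lra | apply Rabs_pos] |].
        apply Rmult_le_compat_l; lra. }
      unfold K'.
      assert (0 <= d * (Md * Lw) * n x) by (repeat apply Rmult_le_pos; lra).
      assert (0 <= d * (Kd * Kw) * h) by (repeat apply Rmult_le_pos; lra).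
      nra. }
    assert (Est : forall x, Rabs x < L ->
       Rabs (T d s' x - T d s x - (s' - s)) <= (C1 + d * K') * Rabs (RInt n 0 x) + d * K' * h * L).
    { intros x Hx. rewrite (proj1 (E s' x Hx)), (proj1 (E s x Hx)).
      replace (s' + RInt (fun z => flow_field e1 d1 d z (T d s' z) (W d s' z)) 0 x
         - (s + RInt (fun z => flow_field e1 d1 d z (T d s z) (W d s z)) 0 x) - (s' - s)) with
        (RInt (fun z => flow_field e1 d1 d z (T d s' z) (W d s' z)) 0 x - RInt (fun z => flow_field e1 d1 d z (T d s z) (W d s z)) 0 x)
        by (set (I1 := RInt (fun z => flow_field e1 d1 d z (T d s' z) (W d s' z)) 0 x : R);
            set (I2 := RInt (fun z => flow_field e1 d1 d z (T d s z) (W d s z)) 0 x : R);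
            apply Rminus_diag_uniq; ring).
      rewrite (RInt_minus_strip L) by auto. apply abs_RInt_strip_affine; auto.
      - apply SC_minus; auto.
      - apply Rmult_le_pos; lra.
      - lra. }
    assert (KL : (C1 + d * K') * L <= / 16) by nra.
    assert (dKL : d * K' * L <= / 32) by nra.
    assert (Gr : forall x, Rabs x < L -> n x <= 2 * (33 / 32 * h) * exp (2 * (C1 + d * K') * Rabs x)).
    { apply (gronwall L); auto; try lra; [intros; apply Rabs_pos |].
      intros x Hx. specialize (Est x Hx). unfold n at 1.
      replace (T d s' x - T d s x) with ((T d s' x - T d s x - (s' - s)) + (s' - s)) by ring.
      eapply Rle_trans; [apply Rabs_triang |]. fold h. nra. }
    assert (Gr2 : forall x, Rabs x <= Rabs y -> Rabs (n x) <= 3 * h).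
    { intros x Hx. assert (HxL : Rabs x < L) by lra. specialize (Gr x HxL).
      rewrite Rabs_right by (apply Rle_ge, Rabs_pos).
      assert (exp (2 * (C1 + d * K') * Rabs x) <= exp (/ 8)).
      { assert (Z : 2 * (C1 + d * K') * Rabs x <= / 8).
        { apply Rle_trans with (2 * (C1 + d * K') * L); [apply Rmult_le_compat_l; lra | lra]. }
        destruct Z as [Z|Z]; [left; apply exp_increasing, Z | rewrite Z; lra]. }
      pose proof exp_eighth. nra. }
    eapply Rle_trans; [apply Est; auto |].
    assert (In : Rabs (RInt n 0 y) <= 3 * h * Rabs y) by (apply (abs_RInt_strip L); auto).
    assert (In2 : Rabs (RInt n 0 y) <= 3 * h * L).
    { eapply Rle_trans; [exact In |]. apply Rmult_le_compat_l; lra. }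
    assert ((C1 + d * K') * Rabs (RInt n 0 y) <= (C1 + d * K') * (3 * h * L)) by (apply Rmult_le_compat_l; lra).
    nra. }
  assert (HB : forall d s y, D1 d -> Rabs y < L -> Rabs (T d s y - s) <= (Me + Md) * L).
  { intros d s y Hd1' Hy. pose proof (HD d Hd1') as Hd. destruct (HTW d Hd) as [cT [cW E]].
    rewrite (proj1 (E s y Hy)), Rplus_minus_l.
    eapply Rle_trans; [apply (abs_RInt_strip L _ y (Me + Md)); auto |].
    - intros x Hx. assert (HxL : Rabs x < L) by lra. unfold flow_field.
      eapply Rle_trans; [apply Rabs_triang |]. rewrite Rabs_mult.
      specialize (HMe d (T d s x) x Hd HxL). specialize (HMd d (T d s x) x Hd HxL).
      generalize (th_bound (W d s x)) (Rabs_pos (th (W d s x))) (Rabs_pos (d1 d (T d s x) x)). nra.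
    - apply Rmult_le_compat_l; lra. }
  assert (R1 : forall k u, CB D0 (strip L) k u -> CB D1 (strip L) k u).
  { intros k u Hu. apply (CB_restrict D0 D1 (strip L) (strip L)); auto. }
  assert (HTc : forall d s y, D1 d -> Rabs y < L -> cont2 (T d) s y).
  { intros. apply (CM_cont D0 (strip L) 3 T MT); auto. }
  assert (HTs' : forall d s y, D1 d -> Rabs y < L -> is_derive (fun x => T d x y) s (Ts d s y)) by (intros; apply DTs; auto).
  assert (HTy' : forall d s y, D1 d -> Rabs y < L -> is_derive (fun x => T d s x) y (Ty0 d s y)) by (intros; apply DTy0; auto).
  set (Sg := inv_flow T).
  assert (HS := fun d t y => inv_flow_spec D1 L T _ HTc HB d t y). fold Sg in HS.
  assert (HM : CM D1 (strip L) 3 Sg).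
  { apply (inv_flow_CM D1 L T Ts Ty0 _ HTc HTs' HTy' HB HI); auto. }
  assert (HSd : forall d t y, D1 d -> Rabs y < L ->
      is_derive (fun z => Sg d z y) t (/ Ts d (Sg d t y) y) /\
      is_derive (fun z => Sg d t z) y (- Ty0 d (Sg d t y) y * / Ts d (Sg d t y) y)).
  { intros d t y Hd Hy. apply (inv_flow_derive D1 L T Ts Ty0 _ HTc HTs' HTy' HB HI); auto;
    apply R1; apply CB_le with 2%nat; auto. }
  (* The passage from the variables of the characteristics to [(t, y)]: the value at [(t, y)] is the
     one carried there from the axis. *)
  set (w' := fun d t y => w d (Sg d t y) y).
  assert (Cw' : CB D1 (strip L) 3 w').
  { apply (CB_comp D1 (strip L) (strip L) 3 w Sg (fun _ _ y => y)); auto using CM_y. }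
  pose proof Cw as Cwx. destruct Cwx as [_ [_ [ws [wy0 [Dws [Dwy0 [Cws Cwy0]]]]]]].
  pose proof Cw' as Cwx. destruct Cwx as [_ [_ [wt [wy [Dwt [Dwy [Cwt Cwy]]]]]]].
  exists dl1, w', wt, wy. split; [lra |]. split; [exact Cw' | split; [exact Cwt | split; [exact Cwy |]]].
  intros d t y Hd1' Hy. pose proof (HD d Hd1') as Hd.
  split; [apply Dwt; auto | split; [apply Dwy; auto |]].
  destruct (Hsm d Hd1') as [_ S2]. assert (Pd : 0 < d) by (destruct Hd1'; auto).
  split.
  - unfold w'. rewrite Rabs_mult, (Rabs_right d) by lra.
    eapply Rle_trans; [| exact S2]. apply Rmult_le_compat_l; [lra |]. apply HKw; auto.
  - assert (LL : locally (Sg d t y, y) (fun p : R * R => is_derive (fun z => w d z (snd p)) (fst p) (ws d (fst p) (snd p)))).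
    { generalize (OS (Sg d t y) y Hy). apply filter_imp. intros p Hp. apply Dws; auto. }
    destruct (HSd d t y Hd1' Hy) as [St Sy].
    (* By the chain rule [wt = ws / Ts] and [wy = wy0 - Ty0 * wt], so [Ts] drops out and only the
       slope [Ty0] of the characteristic and the equation along it remain. *)
    assert (E1 : wt d t y = ws d (Sg d t y) y * / Ts d (Sg d t y) y + wy0 d (Sg d t y) y * 0).
    { rewrite <- (is_derive_unique _ _ _ (Dwt d t y Hd1' Hy)). apply is_derive_unique.
      apply (is_derive_comp2 (w d) (ws d) (wy0 d (Sg d t y) y) (fun x => Sg d x y) (fun _ => y)); auto.
      - apply (CB_cont _ _ _ _ Cws); auto.
      - apply is_derive_const_R. }
    assert (E2 : wy d t y = ws d (Sg d t y) y * (- Ty0 d (Sg d t y) y * / Ts d (Sg d t y) y) + wy0 d (Sg d t y) y * 1).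
    { rewrite <- (is_derive_unique _ _ _ (Dwy d t y Hd1' Hy)). apply is_derive_unique.
      apply (is_derive_comp2 (w d) (ws d) (wy0 d (Sg d t y) y) (fun x => Sg d t x) (fun x => x)); auto.
      - apply (CB_cont _ _ _ _ Cws); auto.
      - apply is_derive_id_R. }
    assert (E3 : wy0 d (Sg d t y) y = A d (Sg d t y) y * w' d t y + b d (Sg d t y) y).
    { rewrite <- (is_derive_unique _ _ _ (Dwy0 d (Sg d t y) y Hd Hy)). apply is_derive_unique. apply Wy; auto. }
    assert (E4 : Ty0 d (Sg d t y) y = e1 d t y + d1 d t y * (d * w' d t y)).
    { rewrite Tyeq by auto. rewrite HS by auto. unfold w'. rewrite Hwq by auto. reflexivity. }
    rewrite E2, E4. rewrite E1, E3. unfold A, b. rewrite HS by auto.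
    replace (Q d (Sg d t y) y) with (d * w' d t y) by (unfold w'; rewrite Hwq; auto).
    unfold e2. ring.
Qed.

(** The trivial parameter set, and below the trivial domain: functions without parameter are treated
    as constant families, so that the same class [CB] serves for them. *)
Definition top1 (_ : R) : Prop := True.
Definition top2 (_ _ : R) : Prop := True.

Lemma CB_time (D : R -> Prop) (U : R -> R -> Prop) k (f : R -> R) :
  CB top1 top2 k (fun _ t _ => f t) -> CB D U k (fun _ t _ => f t).
Proof. apply CB_restrict; unfold top1, top2; auto. Qed.

Ltac cb := repeat first
  [ assumption | apply CB_const | apply CB_plus | apply CB_minus | apply CB_mult | apply CB_opp | apply CB_pow | apply strip_open ].

(** * The mass-shell and continuity equations *)

Section Fluid.
Variables (c a L eps1 Cst : R) (v v1 v2 : R -> R).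
Hypothesis hc : 0 < c.
Hypothesis ha : 0 < a.
Hypothesis hL : 0 < L.
Hypothesis heps : 0 <= eps1 < 1.
Hypothesis hv : forall t, Rabs (v t) <= eps1 * c.
Hypothesis hv1 : forall t, Rabs (v1 t) <= Cst.
Hypothesis dv : forall t, is_derive v t (v1 t).
Hypothesis dv1 : forall t, is_derive v1 t (v2 t).
Hypothesis Cv : CB top1 top2 6 (fun _ t _ => v t).
Hypothesis Cv1 : CB top1 top2 5 (fun _ t _ => v1 t).
Hypothesis Cv2 : CB top1 top2 4 (fun _ t _ => v2 t).

(* [gam] is the Lorentz factor and [lamp = - ln gam / 2]: with amplitude [exp (lamp t - y ^ 2 / (2 a ^ 2))]
   the pair [E = gam], [P = - gam * v / c] solves the continuity equation exactly. [Mass] collects the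
   terms of the mass-shell relation carrying the small factor [/ kap ^ 2]. *)
Definition gap (t : R) : R := c ^ 2 - v t ^ 2.
Definition gam (t : R) : R := c * / sqrt (gap t).
Definition lamp (t : R) : R := / 4 * ln (gap t * / c ^ 2).
Definition lamp1 (t : R) : R := - (v t * v1 t) * / (2 * gap t).
Definition lamp2 (t : R) : R :=
  - ((v1 t ^ 2 + v t * v2 t) * gap t + 2 * v t ^ 2 * v1 t ^ 2) * / (2 * gap t ^ 2).
Definition Mass (t y : R) : R :=
  / c ^ 2 * (lamp2 t + v1 t * (y * / a ^ 2) - v t ^ 2 * / a ^ 2 + (lamp1 t + v t * (y * / a ^ 2)) ^ 2)
  - 2 * lamp t * / a ^ 2.

Lemma gap_lower t : (1 - eps1 ^ 2) * c ^ 2 <= gap t.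
Proof.
  unfold gap. specialize (hv t). assert (v t ^ 2 <= (eps1 * c) ^ 2).
  { rewrite <- (pow2_abs (v t)). apply pow_incr. split; [apply Rabs_pos | auto]. }
  nra.
Qed.

Lemma gap_min_pos : 0 < (1 - eps1 ^ 2) * c ^ 2.
Proof. apply Rmult_lt_0_compat; [nra | apply pow_lt; auto]. Qed.

Lemma gap_pos t : 0 < gap t.
Proof. generalize (gap_lower t) gap_min_pos. lra. Qed.

Lemma is_derive_gap t : is_derive gap t (- (2 * v t * v1 t)).
Proof.
  unfold gap. auto_derive; [eexists; apply dv |].
  rewrite (is_derive_unique (fun x : R => v x) _ _ (dv t)). ring.
Qed.

Lemma gam_sq t : gam t * gam t = c ^ 2 * / gap t.
Proof.
  assert (G := gap_pos t). assert (S : 0 < sqrt (gap t)) by (apply sqrt_lt_R0; auto).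
  unfold gam. rewrite <- (sqrt_sqrt (gap t)) at 3 by lra. field. lra.
Qed.

Lemma is_derive_gam t : is_derive gam t (gam t * (v t * v1 t) * / gap t).
Proof.
  assert (G := gap_pos t). assert (S : 0 < sqrt (gap t)) by (apply sqrt_lt_R0; auto).
  assert (E : sqrt (gap t) ^ 2 = gap t) by (rewrite <- (sqrt_sqrt (gap t)) at 2 by lra; ring).
  evar_last.
  - apply is_derive_scal. apply is_derive_inv; [| lra]. apply is_derive_sqrt; [apply is_derive_gap | auto].
  - cbv beta. rewrite E. unfold gam. field. lra.
Qed.

Lemma is_derive_lamp t : is_derive lamp t (lamp1 t).
Proof.
  assert (G := gap_pos t). unfold lamp, lamp1. auto_derive.
  - split; [eexists; apply is_derive_gap | split; auto].
    apply Rmult_lt_0_compat; auto. apply Rinv_0_lt_compat. nra.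
  - rewrite (is_derive_unique (fun x : R => gap x) _ _ (is_derive_gap t)). field. split; lra.
Qed.

Lemma is_derive_lamp1 t : is_derive lamp1 t (lamp2 t).
Proof.
  assert (G := gap_pos t). unfold lamp1, lamp2. auto_derive.
  - split; [eexists; apply dv | split; [eexists; apply dv1 | split; [eexists; apply is_derive_gap | split; auto; lra]]].
  - rewrite (is_derive_unique (fun x : R => gap x) _ _ (is_derive_gap t)).
    rewrite (is_derive_unique (fun x : R => v x) _ _ (dv t)), (is_derive_unique (fun x : R => v1 x) _ _ (dv1 t)). field. lra.
Qed.

Lemma top_open : open2 top2.
Proof. intros s y _. apply filter_forall. intros; exact I. Qed.

Lemma CB_gap : CB top1 top2 6 (fun _ t _ => gap t).
Proof. unfold gap. cb; apply top_open. Qed.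

Lemma CB_inv_gap : CB top1 top2 6 (fun _ t _ => / gap t).
Proof.
  apply (CB_inv top1 top2 top_open 6 (fun _ t _ => gap t)); [apply CB_gap |].
  exists ((1 - eps1 ^ 2) * c ^ 2). split; [apply gap_min_pos |]. intros.
  eapply Rle_trans; [apply (gap_lower s) | apply Rle_abs].
Qed.

Lemma CB_gam : CB top1 top2 6 (fun _ t _ => gam t).
Proof.
  unfold gam. apply CB_mult; [apply CB_const |].
  apply (CB_inv top1 top2 top_open 6 (fun _ t _ => sqrt (gap t))).
  - apply (CB_sqrt top1 top2 top_open 6 (fun _ t _ => gap t)); [apply CB_gap |].
    exists ((1 - eps1 ^ 2) * c ^ 2). split; [apply gap_min_pos |]. intros; apply gap_lower.
  - exists (sqrt ((1 - eps1 ^ 2) * c ^ 2)). split; [apply sqrt_lt_R0, gap_min_pos |]. intros.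
    eapply Rle_trans; [| apply Rle_abs]. apply sqrt_le_1_alt, gap_lower.
Qed.

Lemma CB_lamp : CB top1 top2 6 (fun _ t _ => lamp t).
Proof.
  unfold lamp. apply CB_mult; [apply CB_const |].
  apply (CB_ln top1 top2 top_open 6 (fun _ t _ => gap t * / c ^ 2)).
  - apply CB_mult; [apply CB_gap | apply CB_const].
  - exists ((1 - eps1 ^ 2) * c ^ 2 * / c ^ 2). split.
    + apply Rmult_lt_0_compat; [apply gap_min_pos | apply Rinv_0_lt_compat, pow_lt, hc].
    + intros. apply Rmult_le_compat_r; [| apply gap_lower]. left. apply Rinv_0_lt_compat, pow_lt, hc.
Qed.

Lemma CB_time4 k f : (4 <= k)%nat -> CB top1 top2 k (fun _ t _ => f t) ->
  forall D, CB D (strip L) 4 (fun _ t _ => f t).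
Proof. intros Hk H D. apply CB_time. apply CB_le with k; auto. Qed.

Lemma CB_inv_2gap n : CB top1 top2 6 (fun _ t _ => / (2 * gap t ^ n)).
Proof.
  apply (CB_ext top1 top2 top_open 6 (fun _ t _ => / 2 * (/ gap t) ^ n)).
  - intros. rewrite pow_inv, <- Rinv_mult. reflexivity.
  - apply CB_mult; [apply CB_const | apply CB_pow, CB_inv_gap].
Qed.

Lemma CB_Mass D : CB D (strip L) 4 (fun _ t y => Mass t y).
Proof.
  assert (Lo : forall k f, (4 <= k)%nat -> CB top1 top2 k f -> CB top1 top2 4 f) by (intros k f; apply CB_le).
  assert (Lv := Lo 6%nat _ ltac:(lia) Cv). assert (Lv1 := Lo 5%nat _ ltac:(lia) Cv1).
  assert (Lg := Lo 6%nat _ ltac:(lia) CB_gap). assert (Lg1 := Lo 6%nat _ ltac:(lia) (CB_inv_2gap 1)).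
  assert (Lg2 := Lo 6%nat _ ltac:(lia) (CB_inv_2gap 2)).
  assert (H1 : CB D (strip L) 4 (fun _ t _ => lamp2 t)).
  { apply (CB_time4 4); auto. unfold lamp2. cb; apply top_open. }
  assert (H2 : CB D (strip L) 4 (fun _ t _ => lamp1 t)).
  { apply (CB_time4 4); auto.
    apply (CB_ext top1 top2 top_open 4 (fun _ t _ => - (v t * v1 t) * / (2 * gap t ^ 1)));
    [intros; unfold lamp1; rewrite pow_1; auto |]. cb; apply top_open. }
  assert (H3 : CB D (strip L) 4 (fun _ t _ => lamp t)) by (apply (CB_time4 6); [lia | apply CB_lamp]).
  assert (H4 : CB D (strip L) 4 (fun _ t _ => v t)) by (apply (CB_time4 6); [lia | auto]).
  assert (H5 : CB D (strip L) 4 (fun _ t _ => v1 t)) by (apply (CB_time4 5); [lia | auto]).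
  assert (H6 := CB_y D L 4).
  unfold Mass. cb.
Qed.

(** Supplies the constant [C1] of [transport_solution]. At [d = 0] the characteristics have slope
    [v / gap], whose time derivative is bounded by the acceleration; this is where the admissible
    width [L] comes from. *)
Lemma speed_lipschitz s s' :
  Rabs (v s * / gap s - v s' * / gap s') <= 2 * Cst * c ^ 2 * / ((1 - eps1 ^ 2) * c ^ 2) ^ 2 * Rabs (s - s').
Proof.
  apply (lipschitz_of_derive (fun t => v t * / gap t) (fun t => v1 t * (c ^ 2 + v t ^ 2) * / gap t ^ 2)).
  - intros t. assert (G := gap_pos t). auto_derive.
    + split; [eexists; apply dv | split; [eexists; apply is_derive_gap | split; [lra | auto]]].
    + rewrite (is_derive_unique (fun x : R => v x) _ _ (dv t)), (is_derive_unique (fun x : R => gap x) _ _ (is_derive_gap t)).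
      unfold gap in *. field. lra.
  - intros t. assert (G := gap_lower t). assert (G0 := gap_min_pos).
    rewrite !Rabs_mult, (Rabs_right (/ _)) by (left; apply Rinv_0_lt_compat, pow_lt; lra).
    apply Rmult_le_compat; [apply Rmult_le_pos; apply Rabs_pos | left; apply Rinv_0_lt_compat, pow_lt; lra | |].
    + rewrite (Rmult_comm 2), Rmult_assoc. apply Rmult_le_compat; try apply Rabs_pos; auto.
      rewrite Rabs_right by nra. assert (0 < gap t) by lra. unfold gap in *. nra.
    + apply Rinv_le_contravar; [apply pow_lt; lra | apply pow_incr; lra].
Qed.

(* [E] and [P] are the boost by [- v] of [(X, X * q)] with [X ^ 2 * (1 - q ^ 2) = 1 + d * Mass]: the mass-shell
   relation holds automatically, and the continuity equation becomes a scalar transport equation for [q = d * w]. *)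
Theorem fluid_solution :
  32 * (2 * Cst * c ^ 2 * / ((1 - eps1 ^ 2) * c ^ 2) ^ 2) * L <= 1 ->
  exists dl1 E1 P1, 0 < dl1 /\ let D := fun d => 0 < d < dl1 in
    CB D (strip L) 3 E1 /\ CB D (strip L) 3 P1 /\
    forall d t y, D d -> Rabs y < L ->
      let E := fun t y => gam t + d * E1 d t y in
      let P := fun t y => - (gam t * (v t * / c)) + d * P1 d t y in
      0 < 1 + d * Mass t y /\
      E t y ^ 2 - P t y ^ 2 = 1 + d * Mass t y /\
      forall Et Ey Py, is_derive (fun x => E x y) t Et -> is_derive (fun x => E t x) y Ey ->
        is_derive (fun x => P t x) y Py ->
        2 * (lamp1 t + v t * (y * / a ^ 2)) * E t y + Et - v t * Ey = c * (Py - 2 * (y * / a ^ 2) * P t y).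
Proof.
  intros HC1.
  assert (OS := strip_open L).
  assert (CM0 := CB_Mass top1).
  destruct (CB_bound_pos _ _ _ _ CM0) as [KM [PKM HKM]].
  (* Keeps [d * Mass] within [/ 2] of zero, so that [1 + d * Mass] stays away from zero. *)
  set (dl0 := Rmin 1 (/ (2 * KM))).
  assert (Hdl0 : 0 < dl0) by (apply Rmin_pos; [lra | apply Rinv_0_lt_compat; lra]).
  set (D0 := fun d => 0 < d < dl0).
  assert (Hk : forall d t y, D0 d -> strip L t y -> / 2 <= 1 + d * Mass t y).
  { intros d t y [Hd Hd'] Hy. specialize (HKM 0 t y I Hy). apply Rabs_le_between in HKM.
    assert (d <= / (2 * KM)) by (left; eapply Rlt_le_trans; [exact Hd' | apply Rmin_r]).
    assert (d * KM <= / 2). { apply Rle_trans with (/ (2 * KM) * KM); [apply Rmult_le_compat_r; lra | right; field; lra]. }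
    nra. }
  assert (CMass := CB_Mass D0). pose proof CMass as [_ [_ [Mt [My [DMt [DMy [CMt CMy]]]]]]].
  assert (HP : forall k, CB D0 (strip L) k (fun d _ _ => d)).
  { intro k. apply CB_param. exists dl0. intros d [Hd0 Hd]. rewrite Rabs_right; lra. }
  assert (Lo : forall u, CB D0 (strip L) 4 u -> CB D0 (strip L) 3 u) by (intros; apply CB_S; auto).
  assert (CMass3 := Lo _ CMass). assert (HP3 := HP 3%nat).
  assert (CV : CB D0 (strip L) 4 (fun _ t _ => v t)) by (apply (CB_time4 6); [lia | auto]).
  assert (CV3 := Lo _ CV).
  assert (CV13 : CB D0 (strip L) 3 (fun _ t _ => v1 t)) by (apply Lo, (CB_time4 5); [lia | auto]).
  assert (CG : CB D0 (strip L) 4 (fun _ t _ => / gap t)) by (apply (CB_time4 6); [lia | apply CB_inv_gap]).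
  assert (CG3 := Lo _ CG).
  assert (Cgam3 : CB D0 (strip L) 3 (fun _ t _ => gam t)) by (apply Lo, (CB_time4 6); [lia | apply CB_gam]).
  assert (CK : CB D0 (strip L) 3 (fun d t y => / (1 + d * Mass t y))).
  { apply (CB_inv D0 (strip L) OS 3 (fun d t y => 1 + d * Mass t y)); [cb |].
    exists (/ 2). split; [lra |]. intros d t y Hd Hy. eapply Rle_trans; [apply (Hk d t y Hd Hy) | apply Rle_abs]. }
  assert (Cy := CB_y D0 L 3).
  (* The coefficients result from inserting the boosted pair in the continuity equation and solving
     for [q_y]. The factor [/ 2 * / (1 + d * Mass)] is due to the logarithmic derivative of
     [sqrt (1 + d * Mass)], and the term with [v1] to the changing rapidity of the frame. *)
  set (e1 := fun (_ t _ : R) => v t * / gap t).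
  set (d1 := fun (_ t _ : R) => - (c * / gap t)).
  set (e' := fun d t y => c * / gap t * (Mt d t y * (/ 2 * / (1 + d * Mass t y)))).
  set (d2 := fun d t y => - (c * / gap t * (v t * / c * (d * (Mt d t y * (/ 2 * / (1 + d * Mass t y)))) + v1 t * / c))
       - d * (My d t y * (/ 2 * / (1 + d * Mass t y))) + 2 * (y * / a ^ 2)).
  assert (He1 : CB D0 (strip L) 3 e1) by (unfold e1; cb).
  assert (Hd1 : CB D0 (strip L) 3 d1) by (unfold d1; cb).
  assert (He' : CB D0 (strip L) 3 e') by (unfold e'; cb).
  assert (Hd2 : CB D0 (strip L) 3 d2) by (unfold d2; cb).
  destruct (transport_solution dl0 L (2 * Cst * c ^ 2 * / ((1 - eps1 ^ 2) * c ^ 2) ^ 2) e1 d1 e' d2 Hdl0 hL He1 Hd1 He' Hd2)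
    as [dl1 [w [wt [wy [Hdl1 [Cw [Cwt [Cwy HW]]]]]]]]; auto.
  { assert (0 <= Cst) by (eapply Rle_trans; [apply Rabs_pos | apply (hv1 0)]).
    apply Rmult_le_pos; [nra | left; apply Rinv_0_lt_compat, pow_lt, gap_min_pos]. }
  { intros d s s' y Hd Hy. unfold e1. apply speed_lipschitz. }
  set (D1 := fun d => 0 < d < dl1) in *.
  assert (HD : forall d, D1 d -> D0 d) by (unfold D0, D1; intros; lra).
  assert (Rs : forall u, CB D0 (strip L) 3 u -> CB D1 (strip L) 3 u).
  { intros u. apply CB_restrict; auto. }
  apply Rs in CMass3, HP3, CV3, Cgam3, Cy, CG3.
  assert (Hq : forall d t y, D1 d -> strip L t y -> / 2 <= 1 - (d * w d t y) ^ 2).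
  { intros d t y Hd Hy. destruct (HW d t y Hd Hy) as [_ [_ [Q _]]]. apply Rabs_le_between in Q. nra. }
  assert (CIq : CB D1 (strip L) 3 (fun d t y => / (1 - (d * w d t y) ^ 2))).
  { apply (CB_inv D1 (strip L) OS 3 (fun d t y => 1 - (d * w d t y) ^ 2)); [cb |].
    exists (/ 2). split; [lra |]. intros d t y Hd Hy. eapply Rle_trans; [apply (Hq d t y Hd Hy) | apply Rle_abs]. }
  set (Y := fun d t y => (1 + d * Mass t y) * / (1 - (d * w d t y) ^ 2)).
  assert (HY : forall d t y, D1 d -> strip L t y -> / 2 <= Y d t y).
  { intros d t y Hd Hy. unfold Y. pose proof (Hk d t y (HD d Hd) Hy). pose proof (Hq d t y Hd Hy).
    assert (1 <= / (1 - (d * w d t y) ^ 2)).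
    { rewrite <- Rinv_1. apply Rinv_le_contravar; [lra |]. generalize (pow2_ge_0 (d * w d t y)); lra. }
    nra. }
  set (X := fun d t y => sqrt (Y d t y)).
  assert (CX : CB D1 (strip L) 3 X).
  { apply CB_sqrt; auto; [unfold Y; cb |]. exists (/ 2). split; [lra | exact HY]. }
  assert (PX : forall d t y, D1 d -> strip L t y -> 0 < X d t y).
  { intros. apply sqrt_lt_R0. generalize (HY d t y H H0). lra. }
  assert (CIX : CB D1 (strip L) 3 (fun d t y => / (X d t y + 1))).
  { apply (CB_inv D1 (strip L) OS 3 (fun d t y => X d t y + 1)); [cb |].
    exists 1. split; [lra |]. intros d t y Hd Hy. pose proof (PX d t y Hd Hy). rewrite Rabs_right; lra. }
  (* This is [(X - 1) / d]: one has [X ^ 2 - 1 = d * (Mass + d * w ^ 2) / (1 - q ^ 2)], and division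
     by [X + 1] avoids the division by [d], so the bounds are uniform. *)
  set (X1 := fun d t y => (Mass t y + d * w d t y ^ 2) * / (1 - (d * w d t y) ^ 2) * / (X d t y + 1)).
  assert (CX1 : CB D1 (strip L) 3 X1) by (unfold X1; cb).
  assert (EX1 : forall d t y, D1 d -> strip L t y -> X d t y = 1 + d * X1 d t y).
  { intros d t y Hd Hy. pose proof (PX d t y Hd Hy). pose proof (Hq d t y Hd Hy).
    assert (S : X d t y * X d t y = Y d t y) by (apply sqrt_sqrt; generalize (HY d t y Hd Hy); lra).
    apply Rmult_eq_reg_r with (X d t y + 1); [| lra].
    replace ((1 + d * X1 d t y) * (X d t y + 1)) with
       (X d t y + 1 + d * (Mass t y + d * w d t y ^ 2) * / (1 - (d * w d t y) ^ 2)) by (unfold X1; field; lra).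
    replace (X d t y * (X d t y + 1)) with (X d t y * X d t y + X d t y) by ring.
    rewrite S. unfold Y. field. lra. }
  (* Read off from [E = gam * X * (1 - v / c * q)] and [P = gam * X * (q - v / c)] with
     [X = 1 + d * X1] and [q = d * w]. *)
  exists dl1, (fun d t y => gam t * (X1 d t y - v t * / c * (w d t y * X d t y))),
             (fun d t y => gam t * (X d t y * w d t y - v t * / c * X1 d t y)).
  split; [lra |]. split; [cb | split; [cb |]].
  intros d t y Hd Hy E P.
  assert (Hk' := fun t => Hk d t y (HD d Hd) Hy). assert (Hq' := fun t => Hq d t y Hd Hy).
  assert (EE : forall t y, Rabs y < L -> E t y = gam t * X d t y * (1 - v t * / c * (d * w d t y))).
  { intros t' y' Hy'. unfold E. rewrite (EX1 d t' y' Hd Hy'). ring. }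
  assert (EP : forall t y, Rabs y < L -> P t y = gam t * X d t y * (d * w d t y - v t * / c)).
  { intros t' y' Hy'. unfold P. rewrite (EX1 d t' y' Hd Hy'). ring. }
  assert (G0 := gap_pos t). assert (PXt := PX d t y Hd Hy).
  assert (S : X d t y * X d t y = Y d t y) by (apply sqrt_sqrt; generalize (HY d t y Hd Hy); lra).
  split; [generalize (Hk' t); lra |]. split.
  - rewrite EE, EP by auto.
    replace ((gam t * X d t y * (1 - v t * / c * (d * w d t y))) ^ 2 - (gam t * X d t y * (d * w d t y - v t * / c)) ^ 2)
      with ((gam t * gam t) * (X d t y * X d t y) * (1 - (v t * / c) ^ 2) * (1 - (d * w d t y) ^ 2)) by ring.
    rewrite S, gam_sq. unfold Y. specialize (Hq' t). unfold gap in *. field. repeat split; lra.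
  - intros Et Ey Py DEt DEy DPy.
    destruct (HW d t y Hd Hy) as [Dwt [Dwy [_ PDE]]].
    assert (DMt' := DMt d t y (HD d Hd) Hy). assert (DMy' := DMy d t y (HD d Hd) Hy).
    set (q := d * w d t y) in *.
    (* The logarithmic derivatives of [X] in [t] and, below, in [y]. With them the square root
       occurs only as a common factor [X]. *)
    set (kt := d * Mt d t y * / (2 * (1 + d * Mass t y)) + q * (d * wt d t y) * / (1 - q ^ 2)).
    set (ky := d * My d t y * / (2 * (1 + d * Mass t y)) + q * (d * wy d t y) * / (1 - q ^ 2)).
    assert (DX : forall (f g : R -> R) x0 f' g', is_derive f x0 f' -> is_derive g x0 g' ->
       0 < 1 + d * f x0 -> 0 < 1 - (d * g x0) ^ 2 ->
       is_derive (fun x => sqrt ((1 + d * f x) * / (1 - (d * g x) ^ 2))) x0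
         (sqrt ((1 + d * f x0) * / (1 - (d * g x0) ^ 2)) *
           (d * f' * / (2 * (1 + d * f x0)) + d * g x0 * (d * g') * / (1 - (d * g x0) ^ 2)))).
    { intros f g x0 f' g' Df Dg H1 H2.
      assert (Pq : 0 < (1 + d * f x0) * / (1 - (d * g x0) ^ 2)) by (apply Rmult_lt_0_compat; auto; apply Rinv_0_lt_compat; auto).
      assert (Sq := sqrt_lt_R0 _ Pq).
      evar_last.
      - apply (is_derive_sqrt (fun x => (1 + d * f x) * / (1 - (d * g x) ^ 2))
          x0 (d * f' * / (1 - (d * g x0) ^ 2) + (1 + d * f x0) * (2 * (d * g x0) * (d * g') * / (1 - (d * g x0) ^ 2) ^ 2))); auto.
        auto_derive.
        + split; [eexists; exact Df | split; [eexists; exact Dg | split; [lra | auto]]].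
        + rewrite (is_derive_unique (fun x : R => f x) _ _ Df), (is_derive_unique (fun x : R => g x) _ _ Dg). field. lra.
      - set (s := sqrt ((1 + d * f x0) * / (1 - (d * g x0) ^ 2))) in *.
        assert (Ss : s * s = (1 + d * f x0) * / (1 - (d * g x0) ^ 2)) by (apply sqrt_sqrt; lra).
        apply Rmult_eq_reg_r with (2 * s); [| lra]. unfold Rdiv. rewrite Rmult_assoc, Rinv_l, Rmult_1_r by lra.
        replace (s * (d * f' * / (2 * (1 + d * f x0)) + d * g x0 * (d * g') * / (1 - (d * g x0) ^ 2)) * (2 * s)) with
          (2 * (s * s) * (d * f' * / (2 * (1 + d * f x0)) + d * g x0 * (d * g') * / (1 - (d * g x0) ^ 2))) by ring.
        rewrite Ss. field. split; lra. }
    assert (Kp : 0 < 1 + d * Mass t y) by (generalize (Hk' t); lra).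
    assert (Qp : 0 < 1 - q ^ 2) by (generalize (Hq' t); fold q; lra).
    assert (DXt : is_derive (fun x => X d x y) t (X d t y * kt)).
    { apply (DX (fun x => Mass x y) (fun x => w d x y) t (Mt d t y) (wt d t y)); auto. }
    assert (DXy : is_derive (fun x => X d t x) y (X d t y * ky)).
    { apply (DX (fun x => Mass t x) (fun x => w d t x) y (My d t y) (wy d t y)); auto. }
    assert (Hloc : locally y (fun x => Rabs x < L)) by (apply (open2_slice_r (strip L) 0 y OS Hy)).
    assert (Dg := is_derive_gam t).
    assert (Et1 : Et = gam t * (v t * v1 t) * / gap t * X d t y * (1 - v t * / c * q) + gam t * (X d t y * kt) * (1 - v t * / c * q)
        + gam t * X d t y * (- (v1 t * / c * q) - v t * / c * (d * wt d t y))).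
    { rewrite <- (is_derive_unique _ _ _ DEt). apply is_derive_unique.
      apply (is_derive_ext (fun x => gam x * X d x y * (1 - v x * / c * (d * w d x y)))); [intros; symmetry; apply EE; auto |].
      auto_derive.
      - repeat split; eexists; eauto.
      - rewrite (is_derive_unique (fun x : R => gam x) _ _ Dg), (is_derive_unique (fun x : R => v x) _ _ (dv t)),
          (is_derive_unique (fun x : R => w d x y) _ _ Dwt), (is_derive_unique (fun x : R => X d x y) _ _ DXt).
        unfold q. ring. }
    assert (Ey1 : Ey = gam t * (X d t y * ky) * (1 - v t * / c * q) - gam t * X d t y * (v t * / c * (d * wy d t y))).
    { rewrite <- (is_derive_unique _ _ _ DEy). apply is_derive_unique.
      apply (is_derive_ext_loc (fun x => gam t * X d t x * (1 - v t * / c * (d * w d t x)))).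
      { revert Hloc. apply filter_imp. intros; symmetry; apply EE; auto. }
      auto_derive.
      - repeat split; eexists; eauto.
      - rewrite (is_derive_unique (fun x : R => w d t x) _ _ Dwy), (is_derive_unique (fun x : R => X d t x) _ _ DXy).
        unfold q. ring. }
    assert (Py1 : Py = gam t * (X d t y * ky) * (q - v t * / c) + gam t * X d t y * (d * wy d t y)).
    { rewrite <- (is_derive_unique _ _ _ DPy). apply is_derive_unique.
      apply (is_derive_ext_loc (fun x => gam t * X d t x * (d * w d t x - v t * / c))).
      { revert Hloc. apply filter_imp. intros; symmetry; apply EP; auto. }
      auto_derive.
      - repeat split; eexists; eauto.
      - rewrite (is_derive_unique (fun x : R => w d t x) _ _ Dwy), (is_derive_unique (fun x : R => X d t x) _ _ DXy).
        unfold q. ring. }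
    rewrite Et1, Ey1, Py1, EE, EP by auto. fold q.
    (* The transport equation times [d], in which only [q] and its derivatives occur. Eliminating
       [q_y] leaves a rational identity. *)
    assert (PDE' : d * wy d t y = - (e1 d t y + d1 d t y * q) * (d * wt d t y) + (1 - q ^ 2) * (d * e' d t y + d2 d t y * q)).
    { rewrite PDE. unfold q. ring. }
    unfold kt, ky. rewrite PDE'. unfold e1, d1, e', d2, lamp1.
    set (qt := d * wt d t y). unfold gap in *.
    field. repeat split; lra.
Qed.

End Fluid.

Definition cont (f : R -> R) : Prop := forall t, continuous f t.
(** * Mollification of the trajectory *)

(** The Steklov average. It gains one derivative, commutes with differentiation, does not increase a
    uniform bound, and moves a function by at most [h] times the bound on its derivative; a smooth
    kernel would give nothing more that is used here. *)
Definition avg (h : R) (f : R -> R) (t : R) : R := / h * RInt f t (t + h).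

Lemma cont_of_derive (f f' : R -> R) : (forall t, is_derive f t (f' t)) -> cont f.
Proof.
  intros H t. apply (ex_derive_continuous (K := R_AbsRing) (V := R_NormedModule)). eexists; apply H.
Qed.

Section Average.
Variable h : R.
Hypothesis hh : 0 < h.

Lemma cont_ex_RInt f a b : cont f -> ex_RInt f a b.
Proof. intro H. apply (ex_RInt_continuous (V := R_CompleteNormedModule)). intros; apply H. Qed.

Lemma avg_bound f B t : cont f -> (forall t, Rabs (f t) <= B) -> Rabs (avg h f t) <= B.
Proof.
  intros Hf HB. unfold avg. rewrite Rabs_mult, Rabs_right by (left; apply Rinv_0_lt_compat; auto).
  assert (Q : Rabs (RInt f t (t + h)) <= (t + h - t) * B).
  { apply abs_RInt_le_const; auto; [lra | apply cont_ex_RInt; auto]. }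
  rewrite Rplus_minus_l in Q.
  apply Rle_trans with (/ h * (h * B)); [apply Rmult_le_compat_l; auto; left; apply Rinv_0_lt_compat; auto |].
  right; field; lra.
Qed.

Lemma is_derive_avg f t : cont f -> is_derive (avg h f) t (/ h * (f (t + h) - f t)).
Proof.
  intro Hf. unfold avg. apply is_derive_scal.
  evar_last.
  - apply (is_derive_RInt_bound_comp (V := R_NormedModule) f (fun a b => RInt f a b) (fun t => t) (fun t => t + h) 1 1 t).
    + apply filter_forall. intros u. apply (RInt_correct (V := R_CompleteNormedModule)), cont_ex_RInt, Hf.
    + apply Hf.
    + apply Hf.
    + apply is_derive_id_R.
    + replace 1 with (1 + 0) by ring. apply (is_derive_plus (V := R_NormedModule) (fun t => t) (fun _ => h));
      [apply is_derive_id_R | apply is_derive_const_R].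
  - unfold minus, plus, opp, scal; simpl. unfold mult; simpl. ring.
Qed.

Lemma avg_cont f : cont f -> cont (avg h f).
Proof. intro Hf. apply (cont_of_derive _ (fun t => / h * (f (t + h) - f t))). intro; apply is_derive_avg, Hf. Qed.

Lemma is_derive_avg_comm f f1 t : (forall t, is_derive f t (f1 t)) -> cont f1 -> is_derive (avg h f) t (avg h f1 t).
Proof.
  intros Hd Hc. replace (avg h f1 t) with (/ h * (f (t + h) - f t)).
  - apply is_derive_avg, (cont_of_derive f f1 Hd).
  - unfold avg. apply Rmult_eq_compat_l. symmetry. apply is_RInt_unique.
    apply (is_RInt_derive (V := R_CompleteNormedModule) f f1); intros; auto.
Qed.

Lemma avg_close f f1 B t : (forall t, is_derive f t (f1 t)) -> (forall t, Rabs (f1 t) <= B) ->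
  Rabs (avg h f t - f t) <= h * B.
Proof.
  intros Hd HB. assert (Hf := cont_of_derive f f1 Hd).
  assert (E : avg h f t - f t = / h * RInt (fun s => f s - f t) t (t + h)).
  { unfold avg. rewrite (RInt_minus (V := R_CompleteNormedModule) f (fun _ => f t)).
    - rewrite (RInt_const (V := R_CompleteNormedModule)). unfold minus, plus, opp, scal; simpl. unfold mult; simpl. field. lra.
    - apply cont_ex_RInt; auto.
    - apply (ex_RInt_const (V := R_NormedModule)). }
  rewrite E, Rabs_mult, Rabs_right by (left; apply Rinv_0_lt_compat; auto).
  assert (Q : Rabs (RInt (fun s => f s - f t) t (t + h)) <= (t + h - t) * (B * h)).
  { apply abs_RInt_le_const; [lra | |].
    - apply cont_ex_RInt. intros s. apply (continuous_minus (V := R_NormedModule) f (fun _ => f t)); auto. apply continuous_const.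
    - intros s Hs. eapply Rle_trans; [apply (lipschitz_of_derive f f1 B); auto |].
      assert (0 <= B) by (eapply Rle_trans; [apply Rabs_pos | apply (HB 0)]).
      apply Rmult_le_compat_l; auto. rewrite Rabs_right; lra. }
  rewrite Rplus_minus_l in Q.
  apply Rle_trans with (/ h * (h * (B * h))); [apply Rmult_le_compat_l; auto; left; apply Rinv_0_lt_compat; auto |].
  right; field; lra.
Qed.

Lemma CB_cont_time k f : CB top1 top2 k (fun _ t _ => f t) -> cont f.
Proof.
  intros H t. apply (cont2_slice_l (fun t _ => f t) t 0). apply (CB_cont _ _ _ _ H 0 t 0 I I).
Qed.

(** The derivative of the average is a difference quotient of [f], hence as regular as [f]. Its
    bound contains [/ h], the price for the gained order. *)
Lemma CB_avg k f : CB top1 top2 k (fun _ t _ => f t) -> CB top1 top2 (S k) (fun _ t _ => avg h f t).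
Proof.
  intro H. assert (Hf := CB_cont_time k f H).
  destruct (CB_bound _ _ _ _ H) as [B HB].
  split; [intros; apply (continuous_pair_l (avg h f)), avg_cont, Hf | split].
  - exists B. intros. apply avg_bound; auto. intros; apply (HB 0 t 0); exact I.
  - exists (fun _ t _ => / h * (f (t + h) - f t)), (fun _ _ _ => 0).
    refine (conj _ (conj _ (conj _ _))).
    + intros; apply is_derive_avg, Hf.
    + intros; apply is_derive_const_R.
    + apply CB_mult; [apply CB_const |]. apply CB_minus; auto using top_open.
      apply (CB_comp top1 top2 top2 k (fun _ t _ => f t) (fun _ t _ => t + h) (fun _ _ y => y)); auto using top_open, CM_y.
      split; [intros; apply (continuous_pair_l (fun t => t + h)) |].
      * apply (continuous_plus (V := R_NormedModule) (fun t => t) (fun _ => h)); [apply continuous_id | apply continuous_const].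
      * destruct k; [exact I |]. exists (fun _ _ _ => 1), (fun _ _ _ => 0).
        refine (conj _ (conj _ (conj _ _))); try apply CB_const.
        -- intros. replace 1 with (1 + 0) by ring. apply (is_derive_plus (V := R_NormedModule) (fun t => t) (fun _ => h));
           [apply is_derive_id_R | apply is_derive_const_R].
        -- intros; apply is_derive_const_R.
    + apply CB_const.
Qed.

Fixpoint avgn (n : nat) (f : R -> R) : R -> R := match n with O => f | S n => avg h (avgn n f) end.

Lemma avgn_cont n f : cont f -> cont (avgn n f).
Proof. intro H; induction n; [exact H | apply avg_cont, IHn]. Qed.

Lemma avgn_bound n f B : cont f -> (forall t, Rabs (f t) <= B) -> forall t, Rabs (avgn n f t) <= B.
Proof. intros H HB; induction n; [exact HB |]. intro t. apply avg_bound; auto. apply avgn_cont, H. Qed.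

Lemma is_derive_avgn n f f1 : (forall t, is_derive f t (f1 t)) -> cont f1 ->
  forall t, is_derive (avgn n f) t (avgn n f1 t).
Proof.
  intros Hd Hc; induction n; [exact Hd |]. intro t. apply is_derive_avg_comm; auto. apply avgn_cont, Hc.
Qed.

Lemma avgn_close n f f1 B : (forall t, is_derive f t (f1 t)) -> cont f1 -> (forall t, Rabs (f1 t) <= B) ->
  forall t, Rabs (avgn n f t - f t) <= INR n * (h * B).
Proof.
  intros Hd Hc HB t. induction n as [|n IH].
  - simpl. rewrite Rminus_diag, Rabs_R0. lra.
  - rewrite S_INR. replace (avgn (S n) f t - f t) with ((avg h (avgn n f) t - avgn n f t) + (avgn n f t - f t)) by (simpl; ring).
    eapply Rle_trans; [apply Rabs_triang |].
    assert (Rabs (avg h (avgn n f) t - avgn n f t) <= h * B).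
    { apply (avg_close _ (avgn n f1)); [apply is_derive_avgn; auto | apply avgn_bound; auto]. }
    lra.
Qed.

Lemma CB_avgn n k f : CB top1 top2 k (fun _ t _ => f t) -> CB top1 top2 (n + k) (fun _ t _ => avgn n f t).
Proof. intro H; induction n; [exact H | apply CB_avg, IHn]. Qed.

End Average.

Lemma CB_time_S k f f1 B : (forall t, is_derive f t (f1 t)) -> (forall t, Rabs (f t) <= B) ->
  CB top1 top2 k (fun _ t _ => f1 t) -> CB top1 top2 (S k) (fun _ t _ => f t).
Proof.
  intros Hd HB H. split; [intros; apply (continuous_pair_l f), (cont_of_derive f f1 Hd) | split; [exists B; auto |]].
  exists (fun _ t _ => f1 t), (fun _ _ _ => 0). refine (conj _ (conj _ (conj _ _))); auto; try apply CB_const.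
  intros; apply is_derive_const_R.
Qed.

(** Four averages, because [Mass] contains [v2] and has to be of order 4. The same average is
    applied to the whole chain [r], [v], [v1], [v2], which therefore remains a chain of derivatives.
    There is no closeness for [v2], whose derivative need not exist; only its bound is kept. *)
Lemma mollify (r v v1 v2 : R -> R) (B V h : R) : 0 < h ->
  (forall t, is_derive r t (v t)) -> (forall t, is_derive v t (v1 t)) -> (forall t, is_derive v1 t (v2 t)) ->
  cont v2 -> (forall t, Rabs (v t) <= B /\ Rabs (v1 t) <= B /\ Rabs (v2 t) <= B) -> (forall t, Rabs (v t) <= V) ->
  exists rh vh vh1 vh2,
    (forall t, is_derive rh t (vh t)) /\ (forall t, is_derive vh t (vh1 t)) /\ (forall t, is_derive vh1 t (vh2 t)) /\
    CB top1 top2 6 (fun _ t _ => vh t) /\ CB top1 top2 5 (fun _ t _ => vh1 t) /\ CB top1 top2 4 (fun _ t _ => vh2 t) /\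
    forall t, Rabs (rh t - r t) <= 4 * (h * B) /\ Rabs (vh t - v t) <= 4 * (h * B) /\ Rabs (vh1 t - v1 t) <= 4 * (h * B) /\
      Rabs (vh t) <= V /\ Rabs (vh1 t) <= B /\ Rabs (vh2 t) <= B.
Proof.
  intros Hh D0 D1 D2 C2 HB HV.
  assert (C1 := cont_of_derive v1 v2 D2). assert (C0 := cont_of_derive v v1 D1).
  assert (K2 : CB top1 top2 0 (fun _ t _ => v2 t)).
  { split; [intros; apply (continuous_pair_l v2), C2 | split; [exists B; intros; apply HB | exact I]]. }
  assert (K1 : CB top1 top2 1 (fun _ t _ => v1 t)) by (apply (CB_time_S 0 v1 v2 B); auto; apply HB).
  assert (K0 : CB top1 top2 2 (fun _ t _ => v t)) by (apply (CB_time_S 1 v v1 B); auto; apply HB).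
  exists (avgn h 4 r), (avgn h 4 v), (avgn h 4 v1), (avgn h 4 v2).
  refine (conj _ (conj _ (conj _ (conj _ (conj _ (conj _ _)))))).
  - apply is_derive_avgn; auto.
  - apply is_derive_avgn; auto.
  - apply is_derive_avgn; auto.
  - apply (CB_avgn h Hh 4 2); auto.
  - apply (CB_avgn h Hh 4 1); auto.
  - apply (CB_avgn h Hh 4 0); auto.
  - intro t. replace 4 with (INR 4) by (simpl; ring).
    repeat split; try (apply avgn_bound; auto; apply HB).
    + apply (avgn_close h Hh 4 r v); auto; apply HB.
    + apply (avgn_close h Hh 4 v v1); auto; apply HB.
    + apply (avgn_close h Hh 4 v1 v2); auto; apply HB.
Qed.

Lemma CB_fix (D : R -> Prop) (U : R -> R -> Prop) k u d0 : CB D U k u -> D d0 -> CB top1 U k (fun _ => u d0).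
Proof.
  revert u; induction k as [|k IH]; intros u [Hc [[K HK] H]] Hd;
  (split; [intros; apply Hc; auto | split; [exists K; auto |]]).
  - exact I.
  - destruct H as [us [uy [H1 [H2 [H3 H4]]]]]. exists (fun _ => us d0), (fun _ => uy d0).
    refine (conj _ (conj _ (conj _ _))); auto.
Qed.

Lemma p1_le_norm3 x : Rabs (p1 x) <= norm3 x.
Proof.
  unfold norm3, dot3. rewrite <- sqrt_Rsqr_abs. apply sqrt_le_1_alt. unfold Rsqr.
  nra.
Qed.
Lemma p2_le_norm3 x : Rabs (p2 x) <= norm3 x.
Proof.
  unfold norm3, dot3. rewrite <- sqrt_Rsqr_abs. apply sqrt_le_1_alt. unfold Rsqr.
  nra.
Qed.
Lemma p3_le_norm3 x : Rabs (p3 x) <= norm3 x.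
Proof.
  unfold norm3, dot3. rewrite <- sqrt_Rsqr_abs. apply sqrt_le_1_alt. unfold Rsqr.
  nra.
Qed.

Lemma is_derive_ext_R (f g : R -> R) (x l : R) : (forall t, f t = g t :> R) -> is_derive f x l -> is_derive g x l.
Proof. intros H. apply is_derive_ext. exact H. Qed.

(** * Functions on space-time and integrals over balls *)

Section Separated.
Variables (L : R) (U : R -> R -> Prop).
Hypothesis HU : open2 U.

Definition sep_dom (t : R) (x : P3) : Prop := Rabs (p1 x) < L /\ Rabs (p2 x) < L /\ U t (p3 x).

(** All functions whose smoothness on space-time is needed have this product form, which each
    [partial] preserves. Regularity in four variables is thereby reduced to [CB], with one or two
    variables at a time. *)
Definition separated (k : nat) (f : R -> P3 -> R) : Prop :=
  exists (G1 G2 : R -> R) (Q : R -> R -> R),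
    CB top1 (strip L) k (fun _ _ y => G1 y) /\ CB top1 (strip L) k (fun _ _ y => G2 y) /\
    CB top1 U k (fun _ => Q) /\
    forall t x, sep_dom t x -> f t x = G1 (p1 x) * G2 (p2 x) * Q t (p3 x).

(** The derivative supplied by [CB] still carries the dummy parameter and the time; uniqueness of
    derivatives removes them. *)
Lemma sep_profile_derive k (G : R -> R) : CB top1 (strip L) (S k) (fun _ _ y => G y) ->
  exists G', (forall y, Rabs y < L -> is_derive G y (G' y)) /\ CB top1 (strip L) k (fun _ _ y => G' y).
Proof.
  intros [_ [_ [us [uy [_ [H2 [_ H4]]]]]]]. exists (uy 0 0). split.
  - intros y Hy. apply (H2 0 0 y I Hy).
  - apply CB_ext with uy; auto using strip_open. intros d s y _ Hy.
    rewrite <- (is_derive_unique _ _ _ (H2 d s y I Hy)). apply is_derive_unique, (H2 0 0 y I Hy).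
Qed.

Lemma strip_locally y : Rabs y < L -> locally y (fun x => Rabs x < L).
Proof. intro Hy. apply (open2_slice_r (strip L) 0 y (strip_open L) Hy). Qed.

Lemma separated_partial k f i : (i <= 3)%nat -> separated (S k) f ->
  (forall t x, sep_dom t x -> ex_partial i f t x) /\ separated k (partial i f).
Proof.
  intros Hi [G1 [G2 [Q [H1 [H2 [H3 E]]]]]].
  destruct (sep_profile_derive k G1 H1) as [G1' [D1 C1]].
  destruct (sep_profile_derive k G2 H2) as [G2' [D2 C2]].
  apply CB_S in H1. apply CB_S in H2.
  assert (H3' := CB_S _ _ _ _ H3). destruct H3 as [_ [_ [Qt [Qz [Dt [Dz [Ct Cz]]]]]]].
  assert (Ct' : CB top1 U k (fun _ => Qt 0)) by (apply CB_fix with (D := top1); auto; exact I).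
  assert (Cz' : CB top1 U k (fun _ => Qz 0)) by (apply CB_fix with (D := top1); auto; exact I).
  assert (Case : forall (v : R -> P3 -> R),
    (forall t x, sep_dom t x -> match i with
       | O => is_derive (fun s => f s x) t (v t x)
       | _ => is_derive (fun s => f t (setc i x s)) (getc i x) (v t x) end) ->
    (forall t x, sep_dom t x -> ex_partial i f t x) /\ forall t x, sep_dom t x -> partial i f t x = v t x).
  { intros v Hv. split; intros t x Hx; specialize (Hv t x Hx); destruct i;
    try (eexists; exact Hv); apply is_derive_unique; exact Hv. }
  destruct i as [|[|[|[|i]]]]; [| | | | lia].
  - destruct (Case (fun t x => G1 (p1 x) * G2 (p2 x) * Qt 0 t (p3 x))) as [Ex Eq].
    { intros t x Hx. pose proof Hx as [X1 [X2 X3]].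
      apply (is_derive_ext_loc (fun s => G1 (p1 x) * G2 (p2 x) * Q s (p3 x))).
      - generalize (open2_slice_l U t (p3 x) HU X3). apply filter_imp. intros s Hs. symmetry. apply E. repeat split; auto.
      - apply is_derive_scal. apply (Dt 0); auto; exact I. }
    split; [exact Ex |]. exists G1, G2, (Qt 0). repeat split; auto.
  - destruct (Case (fun t x => G1' (p1 x) * G2 (p2 x) * Q t (p3 x))) as [Ex Eq].
    { intros t x Hx. pose proof Hx as [X1 [X2 X3]].
      apply (is_derive_ext_loc (fun s => G1 s * G2 (p2 x) * Q t (p3 x))).
      - generalize (strip_locally _ X1). apply filter_imp. intros s Hs. symmetry.
        apply (E t (setc 1 x s)). repeat split; auto.
      - apply (is_derive_ext_R (fun s => (G2 (p2 x) * Q t (p3 x)) * G1 s)); [intros; ring |].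
        replace (G1' (p1 x) * G2 (p2 x) * Q t (p3 x)) with ((G2 (p2 x) * Q t (p3 x)) * G1' (p1 x)) by ring.
        apply is_derive_scal. apply D1; auto. }
    split; [exact Ex |]. exists G1', G2, Q. repeat split; auto.
  - destruct (Case (fun t x => G1 (p1 x) * G2' (p2 x) * Q t (p3 x))) as [Ex Eq].
    { intros t x Hx. pose proof Hx as [X1 [X2 X3]].
      apply (is_derive_ext_loc (fun s => G1 (p1 x) * G2 s * Q t (p3 x))).
      - generalize (strip_locally _ X2). apply filter_imp. intros s Hs. symmetry.
        apply (E t (setc 2 x s)). repeat split; auto.
      - apply (is_derive_ext_R (fun s => (G1 (p1 x) * Q t (p3 x)) * G2 s)); [intros; ring |].
        replace (G1 (p1 x) * G2' (p2 x) * Q t (p3 x)) with ((G1 (p1 x) * Q t (p3 x)) * G2' (p2 x)) by ring.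
        apply is_derive_scal. apply D2; auto. }
    split; [exact Ex |]. exists G1, G2', Q. repeat split; auto.
  - destruct (Case (fun t x => G1 (p1 x) * G2 (p2 x) * Qz 0 t (p3 x))) as [Ex Eq].
    { intros t x Hx. pose proof Hx as [X1 [X2 X3]].
      apply (is_derive_ext_loc (fun s => G1 (p1 x) * G2 (p2 x) * Q t s)).
      - generalize (open2_slice_r U t (p3 x) HU X3). apply filter_imp. intros s Hs. symmetry.
        apply (E t (setc 3 x s)). repeat split; auto.
      - apply is_derive_scal. apply (Dz 0); auto; exact I. }
    split; [exact Ex |]. exists G1, G2, (Qz 0). repeat split; auto.
Qed.

Lemma separated_cont_within k f S : (forall t x, S t x -> sep_dom t x) -> separated k f -> cont_within S f.
Proof.
  intros HS [G1 [G2 [Q [H1 [H2 [H3 E]]]]]] t x Hx eps Heps.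
  pose proof (HS t x Hx) as [X1 [X2 X3]]. destruct x as [[y1 y2] y3]. set (x := (y1, y2, y3) : P3) in *.
  assert (K1 : continuous G1 (p1 x)) by (apply (cont2_slice_r (fun _ y => G1 y) 0); apply (CB_cont _ _ _ _ H1 0 0 (p1 x) I X1)).
  assert (K2 : continuous G2 (p2 x)) by (apply (cont2_slice_r (fun _ y => G2 y) 0); apply (CB_cont _ _ _ _ H2 0 0 (p2 x) I X2)).
  assert (K3 : cont2 Q t (p3 x)) by (apply (CB_cont _ _ _ _ H3 0 t (p3 x) I X3)).
  assert (C : continuous (fun p : R * P3 => G1 (p1 (snd p)) * G2 (p2 (snd p)) * Q (fst p) (p3 (snd p))) (t, x)).
  { assert (Csnd : continuous (fun p : R * P3 => snd p) (t, x)) by apply continuous_snd.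
    assert (Cp : continuous (fun p : R * P3 => fst (snd p)) (t, x)).
    { apply (continuous_comp (fun p : R * P3 => snd p) (fun q : P3 => fst q)); [exact Csnd |].
      exact (continuous_fst (U := prod_UniformSpace R_UniformSpace R_UniformSpace) (V := R_UniformSpace) (y1, y2) y3). }
    apply (continuous_mult (K := R_AbsRing) (fun p : R * P3 => G1 (p1 (snd p)) * G2 (p2 (snd p))) (fun p => Q (fst p) (p3 (snd p)))).
    - apply (continuous_mult (K := R_AbsRing) (fun p : R * P3 => G1 (p1 (snd p))) (fun p => G2 (p2 (snd p)))).
      + apply (continuous_comp (fun p : R * P3 => p1 (snd p)) G1); [| exact K1].
        apply (continuous_comp (fun p : R * P3 => fst (snd p)) (fun q : R * R => fst q)); [exact Cp | apply continuous_fst].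
      + apply (continuous_comp (fun p : R * P3 => p2 (snd p)) G2); [| exact K2].
        apply (continuous_comp (fun p : R * P3 => fst (snd p)) (fun q : R * R => snd q)); [exact Cp | apply continuous_snd].
    - apply (continuous_comp_2 (fun p : R * P3 => fst p) (fun p => p3 (snd p)) Q); [apply continuous_fst | | exact K3].
      apply (continuous_comp (fun p : R * P3 => snd p) (fun q : P3 => snd q)); [exact Csnd |].
      exact (continuous_snd (U := prod_UniformSpace R_UniformSpace R_UniformSpace) (V := R_UniformSpace) (y1, y2) y3). }
  destruct (proj1 (filterlim_locally _ _) C (mkposreal eps Heps)) as [d Hd].
  exists d. split; [apply cond_pos |]. intros t' x' Hx' Ht' Hn.
  rewrite !E by auto.
  refine (Hd (t', x') _).
  assert (N1 := p1_le_norm3 (sub3 x' x)). assert (N2 := p2_le_norm3 (sub3 x' x)). assert (N3 := p3_le_norm3 (sub3 x' x)).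
  destruct x' as [[z1 z2] z3]. unfold x in N1, N2, N3, Hn. unfold sub3, mk3, p1, p2, p3 in N1, N2, N3. simpl in N1, N2, N3.
  unfold sub3, mk3, p1, p2, p3 in Hn. simpl in Hn.
  split; [exact Ht' | split; [split |]].
  - exact (Rle_lt_trans _ _ _ N1 Hn).
  - exact (Rle_lt_trans _ _ _ N2 Hn).
  - exact (Rle_lt_trans _ _ _ N3 Hn).
Qed.

Lemma separated_C2_on f S : (forall t x, S t x -> sep_dom t x) -> separated 2 f -> C2_on S f.
Proof.
  intros HS Hf. split; [apply (separated_cont_within 2); auto | split].
  - intros i Hi. destruct (separated_partial 1 f i Hi Hf) as [P1 P2].
    split; [auto | apply (separated_cont_within 1); auto].
  - intros i j Hi Hj. destruct (separated_partial 1 f i Hi Hf) as [_ P2].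
    destruct (separated_partial 0 _ j Hj P2) as [P3 P4].
    split; [auto | apply (separated_cont_within 0); auto].
Qed.

End Separated.

(** * Continuity of integrals with parameters, and estimates of integrals over balls and spheres *)

Lemma continuous_unif_param {T : UniformSpace} (G : T -> R -> R) (u0 : T) (a b eps : R) :
  (forall s, continuous (fun p : T * R => G (fst p) (snd p)) (u0, s)) -> 0 < eps ->
  locally u0 (fun u => forall s, a <= s <= b -> Rabs (G u s - G u0 s) < eps).
Proof.
  intros HG He. assert (He2 : 0 < eps / 2) by lra.
  assert (C : forall s, exists e : posreal, forall u z, ball u0 e u -> Rabs (z - s) < e -> Rabs (G u z - G u0 s) < eps / 2).
  { intros s. destruct (proj1 (filterlim_locally _ _) (HG s) (mkposreal _ He2)) as [e He'].
    exists e. intros u z Hu Hz. exact (He' (u, z) (conj Hu Hz)). }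
  set (dl := fun s => proj1_sig (constructive_indefinite_description _ (C s))).
  assert (Hdl : forall s u z, ball u0 (dl s) u -> Rabs (z - s) < dl s -> Rabs (G u z - G u0 s) < eps / 2).
  { intros s. exact (proj2_sig (constructive_indefinite_description _ (C s))). }
  destruct (compactness_value_1d a b dl) as [d Hd].
  (* Compactness provides one radius [d] below some gauge value [dl t] near each [s], but only in
     doubly negated form, so the inequality is proved by contradiction. The point [(u0, s)] lies in
     the same neighbourhood of [(u0, t)], whence two errors of [eps / 2]. *)
  exists d. intros u Hu s Hs. destruct (Rlt_dec (Rabs (G u s - G u0 s)) eps) as [|N]; auto. exfalso.
  apply (Hd s Hs). intros [t [_ [Ht1 Ht2]]]. apply N.
  assert (Q1 := Hdl t u s (ball_le u0 d (dl t) Ht2 u Hu) Ht1).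
  assert (Q2 := Hdl t u0 s (ball_center u0 (dl t)) Ht1).
  replace (G u s - G u0 s) with ((G u s - G u0 t) - (G u0 s - G u0 t)) by ring.
  eapply Rle_lt_trans; [apply Rabs_sub_le |]. lra.
Qed.

Lemma continuous_RInt_bounds (g : R -> R) : cont g -> forall a b, continuous (fun p : R * R => RInt g (fst p) (snd p)) (a, b).
Proof.
  intros Hg a b. apply (continuous_RInt (V := R_NormedModule) g a b (fun x y => RInt g x y)).
  apply filter_forall. intros [x y]. apply (RInt_correct (V := R_CompleteNormedModule)), cont_ex_RInt, Hg.
Qed.

(** The endpoints stay within distance 1 of their limits, so on a fixed interval the integrand
    converges uniformly; the moving endpoints are then dealt with for the fixed integrand [G u0]. *)
Lemma continuous_RInt_param {T : UniformSpace} (G : T -> R -> R) (lo hi : T -> R) (u0 : T) :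
  (forall u s, continuous (fun p : T * R => G (fst p) (snd p)) (u, s)) ->
  continuous lo u0 -> continuous hi u0 -> continuous (fun u => RInt (G u) (lo u) (hi u)) u0.
Proof.
  intros HG Hlo Hhi.
  assert (Gc : forall u, cont (G u)).
  { intros u s. apply (continuous_comp_2 (fun _ : R => u) (fun z : R => z) G s);
    [apply continuous_const | apply continuous_id | apply HG]. }
  set (a := Rmin (lo u0) (hi u0) - 1). set (b := Rmax (lo u0) (hi u0) + 1).
  assert (Hab : a < b). { unfold a, b. generalize (Rmin_l (lo u0) (hi u0)) (Rmax_l (lo u0) (hi u0)). lra. }
  apply (filterlim_locally (F := locally u0)). intros eps.
  assert (He : 0 < eps / 2) by (generalize (cond_pos eps); lra).
  assert (He2 : 0 < eps / 2 / (b - a)) by (apply Rdiv_lt_0_compat; lra).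
  assert (L1 := continuous_unif_param G u0 a b _ (HG u0) He2).
  assert (C2 : continuous (fun u => RInt (G u0) (lo u) (hi u)) u0).
  { apply (continuous_comp_2 lo hi (fun x y => RInt (G u0) x y)); auto. apply continuous_RInt_bounds, Gc. }
  assert (L2 := proj1 (filterlim_locally _ _) C2 (mkposreal _ He)).
  assert (L3 := proj1 (filterlim_locally _ _) Hlo (mkposreal _ Rlt_0_1)).
  assert (L4 := proj1 (filterlim_locally _ _) Hhi (mkposreal _ Rlt_0_1)).
  generalize (filter_and _ _ (filter_and _ _ L1 L2) (filter_and _ _ L3 L4)). apply filter_imp.
  intros u [[Q1 Q2] [Q3 Q4]].
  assert (Q2' : Rabs (RInt (G u0) (lo u) (hi u) - RInt (G u0) (lo u0) (hi u0)) < eps / 2) by exact Q2.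
  assert (Q3' : Rabs (lo u - lo u0) < 1) by exact Q3. assert (Q4' : Rabs (hi u - hi u0) < 1) by exact Q4.
  apply Rabs_def2 in Q3'. apply Rabs_def2 in Q4'.
  assert (R1 : a < lo u < b). { unfold a, b. generalize (Rmin_l (lo u0) (hi u0)) (Rmax_l (lo u0) (hi u0)). lra. }
  assert (R2 : a < hi u < b). { unfold a, b. generalize (Rmin_r (lo u0) (hi u0)) (Rmax_r (lo u0) (hi u0)). lra. }
  assert (E1 : forall u a b, ex_RInt (G u) a b) by (intros; apply cont_ex_RInt, Gc).
  assert (B0 : forall x y, a < x -> x <= y -> y < b -> Rabs (RInt (G u) x y - RInt (G u0) x y) <= eps / 2).
  { intros x y H1 H2 H3.
    assert (E : RInt (G u) x y - RInt (G u0) x y = RInt (fun s => G u s - G u0 s) x y).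
    { symmetry. apply (RInt_minus (V := R_CompleteNormedModule)); auto. }
    rewrite E. eapply Rle_trans.
    - apply (abs_RInt_le_const _ x y (eps / 2 / (b - a))); auto.
      + apply (ex_RInt_minus (V := R_NormedModule)); auto.
      + intros t Ht. left. apply Q1. lra.
    - apply Rle_trans with ((b - a) * (eps / 2 / (b - a))); [apply Rmult_le_compat_r; lra | right; field; lra]. }
  assert (B : Rabs (RInt (G u) (lo u) (hi u) - RInt (G u0) (lo u) (hi u)) <= eps / 2).
  { destruct (Rle_dec (lo u) (hi u)); [apply B0; lra |].
    rewrite <- (opp_RInt_swap (V := R_CompleteNormedModule) (G u)), <- (opp_RInt_swap (V := R_CompleteNormedModule) (G u0)) by auto.
    unfold opp; simpl.
    assert (B' := B0 (hi u) (lo u) ltac:(lra) ltac:(lra) ltac:(lra)).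
    rewrite <- Rabs_Ropp. eapply Rle_trans; [| exact B']. right. f_equal.
    set (I1 := RInt (G u) (hi u) (lo u) : R). set (I2 := RInt (G u0) (hi u) (lo u) : R). ring. }
  assert (Main : Rabs (RInt (G u) (lo u) (hi u) - RInt (G u0) (lo u0) (hi u0)) < eps); [| exact Main].
  replace (RInt (G u) (lo u) (hi u) - RInt (G u0) (lo u0) (hi u0)) with
    ((RInt (G u) (lo u) (hi u) - RInt (G u0) (lo u) (hi u)) + (RInt (G u0) (lo u) (hi u) - RInt (G u0) (lo u0) (hi u0))).
  - eapply Rle_lt_trans; [apply Rabs_triang |]. lra.
  - set (I1 := RInt (G u) (lo u) (hi u) : R). set (I2 := RInt (G u0) (lo u) (hi u) : R).
    set (I3 := RInt (G u0) (lo u0) (hi u0) : R). ring.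
Qed.

(** The nearest-point projection onto [[lo, hi]], in a form whose continuity is evident. *)
Definition clamp (lo hi y : R) : R := (lo + hi) / 2 + (Rabs (y - lo) - Rabs (y - hi)) / 2.

Lemma clamp_id lo hi y : lo <= y <= hi -> clamp lo hi y = y.
Proof. intro H. unfold clamp. rewrite Rabs_right, Rabs_left1 by lra. lra. Qed.

Lemma clamp_range lo hi y : lo <= hi -> lo <= clamp lo hi y <= hi.
Proof.
  intro H. unfold clamp. destruct (Rle_dec lo y), (Rle_dec y hi).
  - rewrite Rabs_right, Rabs_left1 by lra. lra.
  - rewrite Rabs_right, Rabs_right by lra. lra.
  - rewrite Rabs_left1, Rabs_left1 by lra. lra.
  - lra.
Qed.

Lemma clamp_cont lo hi : cont (clamp lo hi).
Proof.
  intro y. unfold clamp.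
  assert (A : forall b, continuous (fun y => Rabs (y - b)) y).
  { intro b. apply (continuous_comp (fun y => y - b) Rabs); [| apply continuous_Rabs].
    apply (continuous_minus (V := R_NormedModule) (fun y => y) (fun _ => b)); [apply continuous_id | apply continuous_const]. }
  apply (continuous_plus (V := R_NormedModule) (fun _ => (lo + hi) / 2)); [apply continuous_const |].
  apply (continuous_mult (K := R_AbsRing) (fun y => Rabs (y - lo) - Rabs (y - hi)) (fun _ => / 2)); [| apply continuous_const].
  apply (continuous_minus (V := R_NormedModule) (fun y => Rabs (y - lo)) (fun y => Rabs (y - hi))); auto.
Qed.

(** Retraction onto the cube circumscribed about the ball. The integrands are continuous only near
    the ball; composed with this map they become continuous on the whole space, as the lemmas on
    iterated integrals assume, and keep their values on the ball. *)
Definition clamp3 (x0 : P3) (rr : R) (x : P3) : P3 :=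
  mk3 (clamp (p1 x0 - rr) (p1 x0 + rr) (p1 x)) (clamp (p2 x0 - rr) (p2 x0 + rr) (p2 x)) (clamp (p3 x0 - rr) (p3 x0 + rr) (p3 x)).

Definition in_box (x0 : P3) (rr : R) (x : P3) : Prop :=
  Rabs (p1 x - p1 x0) <= rr /\ Rabs (p2 x - p2 x0) <= rr /\ Rabs (p3 x - p3 x0) <= rr.

Lemma continuous_p1 (x : P3) : continuous (fun x : P3 => p1 x) x.
Proof.
  destruct x as [[y1 y2] y3].
  apply (continuous_comp (fun q : P3 => fst q) (fun q : R * R => fst q)).
  - exact (continuous_fst (U := prod_UniformSpace R_UniformSpace R_UniformSpace) (V := R_UniformSpace) (y1, y2) y3).
  - exact (continuous_fst (U := R_UniformSpace) (V := R_UniformSpace) y1 y2).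
Qed.

Lemma continuous_p2 (x : P3) : continuous (fun x : P3 => p2 x) x.
Proof.
  destruct x as [[y1 y2] y3].
  apply (continuous_comp (fun q : P3 => fst q) (fun q : R * R => snd q)).
  - exact (continuous_fst (U := prod_UniformSpace R_UniformSpace R_UniformSpace) (V := R_UniformSpace) (y1, y2) y3).
  - exact (continuous_snd (U := R_UniformSpace) (V := R_UniformSpace) y1 y2).
Qed.

Lemma continuous_p3 (x : P3) : continuous (fun x : P3 => p3 x) x.
Proof.
  destruct x as [[y1 y2] y3].
  exact (continuous_snd (U := prod_UniformSpace R_UniformSpace R_UniformSpace) (V := R_UniformSpace) (y1, y2) y3).
Qed.

Lemma continuous_mk3 {T : UniformSpace} (f g h : T -> R) (u : T) :
  continuous f u -> continuous g u -> continuous h u -> continuous (fun u => mk3 (f u) (g u) (h u) : P3) u.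
Proof.
  intros Hf Hg Hh P [e He].
  assert (L1 := proj1 (filterlim_locally _ _) Hf e). assert (L2 := proj1 (filterlim_locally _ _) Hg e).
  assert (L3 := proj1 (filterlim_locally _ _) Hh e).
  generalize (filter_and _ _ L1 (filter_and _ _ L2 L3)). unfold filtermap. apply filter_imp.
  intros z [Q1 [Q2 Q3]]. apply He. split; [split; [exact Q1 | exact Q2] | exact Q3].
Qed.

Lemma clamp3_continuous x0 rr x : continuous (clamp3 x0 rr : P3 -> P3) x.
Proof.
  apply (continuous_mk3 (T := prod_UniformSpace (prod_UniformSpace R_UniformSpace R_UniformSpace) R_UniformSpace)).
  - apply (continuous_comp (fun x : P3 => p1 x)); [apply continuous_p1 | apply clamp_cont].
  - apply (continuous_comp (fun x : P3 => p2 x)); [apply continuous_p2 | apply clamp_cont].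
  - apply (continuous_comp (fun x : P3 => p3 x)); [apply continuous_p3 | apply clamp_cont].
Qed.

Lemma clamp3_in_box x0 rr x : 0 <= rr -> in_box x0 rr (clamp3 x0 rr x).
Proof.
  intro H. unfold in_box, clamp3, mk3, p1, p2, p3. simpl.
  repeat split; apply Rabs_le; match goal with |- context [clamp ?a ?b ?c] => generalize (clamp_range a b c) end; lra.
Qed.

Lemma clamp3_id x0 rr x : in_box x0 rr x -> clamp3 x0 rr x = x.
Proof.
  intros [H1 [H2 H3]]. apply Rabs_le_between in H1. apply Rabs_le_between in H2. apply Rabs_le_between in H3.
  unfold clamp3. rewrite !clamp_id by lra. destruct x as [[? ?] ?]. reflexivity.
Qed.

Lemma ball_in_box x0 rr x : norm3 (sub3 x x0) <= rr -> in_box x0 rr x.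
Proof.
  intro H. assert (N1 := p1_le_norm3 (sub3 x x0)). assert (N2 := p2_le_norm3 (sub3 x x0)). assert (N3 := p3_le_norm3 (sub3 x x0)).
  unfold sub3, mk3, p1, p2, p3 in *. simpl in *. unfold in_box, p1, p2, p3. lra.
Qed.

Definition continuous_P3 (f : P3 -> R) : Prop := forall x, continuous f x.

Lemma continuous_clamped (f : P3 -> R) x0 rr : 0 <= rr ->
  (forall x, in_box x0 rr x -> continuous f x) -> continuous_P3 (fun x => f (clamp3 x0 rr x)).
Proof.
  intros Hr H x. apply (continuous_comp (clamp3 x0 rr) f); [apply clamp3_continuous | apply H, clamp3_in_box, Hr].
Qed.

Lemma sqrt_le_iff_sq (a b : R) : 0 <= b -> Rabs a <= sqrt b -> a ^ 2 <= b.
Proof.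
  intros Hb H. rewrite <- (pow2_abs a), <- (pow2_sqrt b Hb). apply pow_incr. split; [apply Rabs_pos | auto].
Qed.

Lemma ball_mem (x0 : P3) (rr y1 y2 y3 : R) : 0 <= rr ->
  p1 x0 - rr <= y1 <= p1 x0 + rr ->
  p2 x0 - sqrt (rr ^ 2 - (y1 - p1 x0) ^ 2) <= y2 <= p2 x0 + sqrt (rr ^ 2 - (y1 - p1 x0) ^ 2) ->
  p3 x0 - sqrt (rr ^ 2 - (y1 - p1 x0) ^ 2 - (y2 - p2 x0) ^ 2) <= y3 <= p3 x0 + sqrt (rr ^ 2 - (y1 - p1 x0) ^ 2 - (y2 - p2 x0) ^ 2) ->
  norm3 (sub3 (mk3 y1 y2 y3) x0) <= rr.
Proof.
  intros Hr H1 H2 H3.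
  assert (A1 : 0 <= rr ^ 2 - (y1 - p1 x0) ^ 2) by nra.
  assert (A2 : (y2 - p2 x0) ^ 2 <= rr ^ 2 - (y1 - p1 x0) ^ 2) by (apply sqrt_le_iff_sq; auto; apply Rabs_le; lra).
  assert (A3 : (y3 - p3 x0) ^ 2 <= rr ^ 2 - (y1 - p1 x0) ^ 2 - (y2 - p2 x0) ^ 2).
  { apply sqrt_le_iff_sq; [lra |]. apply Rabs_le; lra. }
  unfold norm3. rewrite <- (sqrt_pow2 rr Hr). apply sqrt_le_1_alt.
  unfold dot3, sub3, mk3, p1, p2, p3 in *. simpl in *. lra.
Qed.

Lemma ball_int_ext (x0 : P3) (rr : R) (f g : P3 -> R) : 0 <= rr ->
  (forall x, norm3 (sub3 x x0) <= rr -> f x = g x) -> ball_int x0 rr f = ball_int x0 rr g.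
Proof.
  intros Hr H. unfold ball_int.
  apply RInt_ext. intros y1 Hy1. rewrite Rmin_left, Rmax_right in Hy1 by lra.
  assert (0 <= sqrt (rr ^ 2 - (y1 - p1 x0) ^ 2)) by apply sqrt_pos.
  apply RInt_ext. intros y2 Hy2. rewrite Rmin_left, Rmax_right in Hy2 by lra.
  assert (0 <= sqrt (rr ^ 2 - (y1 - p1 x0) ^ 2 - (y2 - p2 x0) ^ 2)) by apply sqrt_pos.
  apply RInt_ext. intros y3 Hy3. rewrite Rmin_left, Rmax_right in Hy3 by lra.
  apply H. apply ball_mem; lra.
Qed.

Section BallIntegral.
Variables (x0 : P3) (rr : R) (f : P3 -> R).
Hypothesis hr : 0 < rr.
Hypothesis hf : continuous_P3 f.

Definition inner2 (u : R * R) : R :=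
  RInt (fun y3 => f (mk3 (fst u) (snd u) y3))
    (p3 x0 - sqrt (rr ^ 2 - (fst u - p1 x0) ^ 2 - (snd u - p2 x0) ^ 2))
    (p3 x0 + sqrt (rr ^ 2 - (fst u - p1 x0) ^ 2 - (snd u - p2 x0) ^ 2)).

Definition inner1 (y1 : R) : R :=
  RInt (fun y2 => inner2 (y1, y2))
    (p2 x0 - sqrt (rr ^ 2 - (y1 - p1 x0) ^ 2)) (p2 x0 + sqrt (rr ^ 2 - (y1 - p1 x0) ^ 2)).

Lemma ball_int_inner : ball_int x0 rr f = RInt inner1 (p1 x0 - rr) (p1 x0 + rr).
Proof. reflexivity. Qed.

Lemma continuous_slice3 y1 y2 : cont (fun y3 => f (mk3 y1 y2 y3)).
Proof.
  intro y3. apply (continuous_comp (fun y3 : R => mk3 y1 y2 y3 : P3) f); [| apply hf].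
  apply continuous_mk3; [apply continuous_const | apply continuous_const | apply continuous_id].
Qed.

Lemma continuous_pm {T : UniformSpace} (s : T -> R) (b : R) u : continuous s u ->
  continuous (fun u => b - sqrt (s u)) u /\ continuous (fun u => b + sqrt (s u)) u.
Proof.
  intro H. assert (Q : continuous (fun u => sqrt (s u)) u) by (apply (continuous_comp s sqrt); [exact H | apply continuous_sqrt]).
  split; [apply (continuous_minus (V := R_NormedModule) (fun _ => b)) | apply (continuous_plus (V := R_NormedModule) (fun _ => b))];
  auto; apply continuous_const.
Qed.

Lemma continuous_sq_diff {T : UniformSpace} (s : T -> R) (b : R) u : continuous s u -> continuous (fun u => (s u - b) ^ 2) u.
Proof.
  intro H. apply (continuous_comp s (fun z => (z - b) ^ 2)); [exact H |].
  apply (ex_derive_continuous (K := R_AbsRing) (V := R_NormedModule)). auto_derive; auto.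
Qed.

Lemma inner2_cont u : continuous inner2 u.
Proof.
  assert (Hs : continuous (fun u : R * R => rr ^ 2 - (fst u - p1 x0) ^ 2 - (snd u - p2 x0) ^ 2) u).
  { destruct u as [u1 u2].
    apply (continuous_minus (V := R_NormedModule) (fun u : R * R => rr ^ 2 - (fst u - p1 x0) ^ 2)).
    - apply (continuous_minus (V := R_NormedModule) (fun _ : R * R => rr ^ 2)); [apply continuous_const |].
      apply (continuous_sq_diff (fun u : R * R => fst u)), continuous_fst.
    - apply (continuous_sq_diff (fun u : R * R => snd u)), continuous_snd. }
  apply (continuous_RInt_param (T := prod_UniformSpace R_UniformSpace R_UniformSpace) (fun u y3 => f (mk3 (fst u) (snd u) y3))).
  - intros [u1 u2] s. apply continuous_ext with f; [intros [[? ?] ?]; reflexivity | apply hf].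
  - apply (continuous_pm (fun u : R * R => rr ^ 2 - (fst u - p1 x0) ^ 2 - (snd u - p2 x0) ^ 2)), Hs.
  - apply (continuous_pm (fun u : R * R => rr ^ 2 - (fst u - p1 x0) ^ 2 - (snd u - p2 x0) ^ 2)), Hs.
Qed.

Lemma inner2_slice_cont y1 : cont (fun y2 => inner2 (y1, y2)).
Proof.
  intro y2. apply (continuous_comp_2 (fun _ : R => y1) (fun y2 : R => y2) (fun a b => inner2 (a, b)));
  [apply continuous_const | apply continuous_id |].
  apply continuous_ext with inner2; [intros [? ?]; reflexivity | apply inner2_cont].
Qed.

Lemma inner1_cont : cont inner1.
Proof.
  intro y1.
  assert (Hs : continuous (fun u : R => rr ^ 2 - (u - p1 x0) ^ 2) y1).
  { apply (continuous_minus (V := R_NormedModule) (fun _ : R => rr ^ 2)); [apply continuous_const |].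
    apply (continuous_sq_diff (fun u : R => u)), continuous_id. }
  apply (continuous_RInt_param (T := R_UniformSpace) (fun y1 y2 => inner2 (y1, y2))).
  - intros u s. apply continuous_ext with inner2; [intros [? ?]; reflexivity | apply inner2_cont].
  - apply (continuous_pm (fun u : R => rr ^ 2 - (u - p1 x0) ^ 2)), Hs.
  - apply (continuous_pm (fun u : R => rr ^ 2 - (u - p1 x0) ^ 2)), Hs.
Qed.

(** The Cauchy density up to the factor [PI]. It dominates a Gaussian of width [a], and its integral
    over any interval is a difference of arctangents, at most [PI]; so no Gaussian integral has to
    be computed. *)
Definition cauchy_weight (a ctr y : R) : R := a / (a ^ 2 + (y - ctr) ^ 2).

Lemma sq_sum_pos (a z : R) : 0 < a -> 0 < a ^ 2 + z ^ 2.
Proof. intro H. generalize (pow_lt a 2 H) (pow2_ge_0 z). lra. Qed.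

Lemma cauchy_weight_pos a ctr y : 0 < a -> 0 < cauchy_weight a ctr y.
Proof. intro H. apply Rdiv_lt_0_compat; auto. apply sq_sum_pos, H. Qed.

Lemma cauchy_weight_int a ctr lo hi : 0 < a -> lo <= hi ->
  ex_RInt (cauchy_weight a ctr) lo hi /\ RInt (cauchy_weight a ctr) lo hi <= PI.
Proof.
  intros Ha Hl.
  assert (H : is_RInt (cauchy_weight a ctr) lo hi (minus (atan ((hi - ctr) / a)) (atan ((lo - ctr) / a)))).
  { apply (is_RInt_derive (V := R_CompleteNormedModule) (fun y => atan ((y - ctr) / a))).
    - intros y _. assert (Q := sq_sum_pos a (y - ctr) Ha).
      unfold cauchy_weight. auto_derive; auto. unfold Rsqr. field. split; [nra | lra].
    - intros y _. apply (ex_derive_continuous (K := R_AbsRing) (V := R_NormedModule)). unfold cauchy_weight. auto_derive.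
      generalize (sq_sum_pos a (y - ctr) Ha). simpl. unfold Rminus. lra. }
  split; [eexists; exact H |]. rewrite (is_RInt_unique _ _ _ _ H).
  unfold minus, plus, opp; simpl. generalize (atan_bound ((hi - ctr) / a)) (atan_bound ((lo - ctr) / a)). lra.
Qed.

Lemma RInt_le_weight (g : R -> R) (K a ctr lo hi : R) : cont g -> 0 < a -> lo <= hi -> 0 <= K ->
  (forall y, lo <= y <= hi -> g y <= K * cauchy_weight a ctr y) -> RInt g lo hi <= K * PI.
Proof.
  intros Hg Ha Hl HK H. destruct (cauchy_weight_int a ctr lo hi Ha Hl) as [E1 E2].
  apply Rle_trans with (RInt (fun y => K * cauchy_weight a ctr y) lo hi).
  - apply RInt_le; auto.
    + apply cont_ex_RInt, Hg.
    + apply (ex_RInt_scal (V := R_NormedModule)), E1.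
    + intros; apply H; lra.
  - assert (E : RInt (fun y => K * cauchy_weight a ctr y) lo hi = K * RInt (cauchy_weight a ctr) lo hi)
      by (apply (RInt_scal (V := R_CompleteNormedModule)), E1).
    rewrite E. apply Rmult_le_compat_l; auto.
Qed.

Lemma ball_int_upper (K a c1 c2 c3 : R) : 0 < a -> 0 <= K ->
  (forall x, norm3 (sub3 x x0) <= rr ->
     f x <= K * cauchy_weight a c1 (p1 x) * cauchy_weight a c2 (p2 x) * cauchy_weight a c3 (p3 x)) ->
  ball_int x0 rr f <= K * PI * PI * PI.
Proof.
  intros Ha HK H. rewrite ball_int_inner. assert (HP := PI_RGT_0).
  replace (K * PI * PI * PI) with ((K * PI * PI) * PI) by ring.
  apply (RInt_le_weight inner1 _ a c1); auto using inner1_cont; [lra | apply Rmult_le_pos; [apply Rmult_le_pos |]; lra |].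
  intros y1 Hy1. assert (W1 := cauchy_weight_pos a c1 y1 Ha).
  assert (0 <= sqrt (rr ^ 2 - (y1 - p1 x0) ^ 2)) by apply sqrt_pos.
  replace (K * PI * PI * cauchy_weight a c1 y1) with ((K * cauchy_weight a c1 y1 * PI) * PI) by ring.
  assert (K1 : 0 <= K * cauchy_weight a c1 y1) by (apply Rmult_le_pos; lra).
  apply (RInt_le_weight _ _ a c2); auto using inner2_slice_cont; [lra | apply Rmult_le_pos; lra |].
  intros y2 Hy2. assert (W2 := cauchy_weight_pos a c2 y2 Ha).
  assert (0 <= sqrt (rr ^ 2 - (y1 - p1 x0) ^ 2 - (y2 - p2 x0) ^ 2)) by apply sqrt_pos.
  replace (K * cauchy_weight a c1 y1 * PI * cauchy_weight a c2 y2) with ((K * cauchy_weight a c1 y1 * cauchy_weight a c2 y2) * PI) by ring.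
  apply (RInt_le_weight _ _ a c3); auto; [apply continuous_slice3 | cbn [fst snd]; lra | apply Rmult_le_pos; lra |].
  intros y3 Hy3. cbn [fst snd] in Hy3. apply (H (mk3 y1 y2 y3)). apply ball_mem; lra.
Qed.

Lemma RInt_ge_sub (g : R -> R) (lo hi p q K : R) : cont g -> lo <= p -> p <= q -> q <= hi ->
  (forall y, lo <= y <= hi -> 0 <= g y) -> (forall y, p <= y <= q -> K <= g y) -> K * (q - p) <= RInt g lo hi.
Proof.
  intros Hg H1 H2 H3 H4 H5.
  assert (E : forall a b, ex_RInt g a b) by (intros; apply cont_ex_RInt, Hg).
  assert (C1 : RInt g lo p + RInt g p hi = RInt g lo hi) by (apply (RInt_Chasles (V := R_CompleteNormedModule)); auto).
  assert (C2 : RInt g p q + RInt g q hi = RInt g p hi) by (apply (RInt_Chasles (V := R_CompleteNormedModule)); auto).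
  assert (P1 : 0 <= RInt g lo p) by (apply RInt_ge_0; auto; intros; apply H4; lra).
  assert (P2 : 0 <= RInt g q hi) by (apply RInt_ge_0; auto; intros; apply H4; lra).
  assert (P3 : RInt (fun _ => K) p q <= RInt g p q).
  { apply RInt_le; auto; [apply (ex_RInt_const (V := R_NormedModule)) |]. intros; apply H5; lra. }
  rewrite (RInt_const (V := R_CompleteNormedModule)) in P3. unfold scal in P3; simpl in P3; unfold mult in P3; simpl in P3. lra.
Qed.

(** Only the concentric cube of side [a] is kept; it lies in the ball since half its diagonal is
    less than [a]. *)
Lemma ball_int_lower (K a : R) : 0 < a -> a <= rr ->
  (forall x, norm3 (sub3 x x0) <= rr -> 0 <= f x) ->
  (forall x, in_box x0 (a / 2) x -> K <= f x) ->
  K * a * a * a <= ball_int x0 rr f.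
Proof.
  intros Ha Har H0 HK. rewrite ball_int_inner.
  assert (Sq : forall s, (a / 2) ^ 2 <= s -> a / 2 <= sqrt s).
  { intros s Hs. rewrite <- (sqrt_pow2 (a / 2)) by lra. apply sqrt_le_1_alt, Hs. }
  assert (I2 : forall y1 y2, p1 x0 - rr <= y1 <= p1 x0 + rr ->
     p2 x0 - sqrt (rr ^ 2 - (y1 - p1 x0) ^ 2) <= y2 <= p2 x0 + sqrt (rr ^ 2 - (y1 - p1 x0) ^ 2) -> 0 <= inner2 (y1, y2)).
  { intros y1 y2 Hy1 Hy2. assert (0 <= sqrt (rr ^ 2 - (y1 - p1 x0) ^ 2 - (y2 - p2 x0) ^ 2)) by apply sqrt_pos.
    apply RInt_ge_0; [cbn [fst snd]; lra | apply cont_ex_RInt, continuous_slice3 |].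
    intros y3 Hy3. cbn [fst snd] in Hy3. apply (H0 (mk3 y1 y2 y3)). apply ball_mem; lra. }
  assert (I1 : forall y1, p1 x0 - rr <= y1 <= p1 x0 + rr -> 0 <= inner1 y1).
  { intros y1 Hy1. assert (0 <= sqrt (rr ^ 2 - (y1 - p1 x0) ^ 2)) by apply sqrt_pos.
    apply RInt_ge_0; [lra | apply cont_ex_RInt, inner2_slice_cont |]. intros y2 Hy2. apply I2; lra. }
  replace (K * a * a * a) with ((K * a * a) * ((p1 x0 + a / 2) - (p1 x0 - a / 2))) by field.
  apply RInt_ge_sub; auto using inner1_cont; try lra.
  intros y1 Hy1.
  assert (S1 : (y1 - p1 x0) ^ 2 <= (a / 2) ^ 2) by nra.
  assert (A1 : a / 2 <= sqrt (rr ^ 2 - (y1 - p1 x0) ^ 2)) by (apply Sq; nra).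
  replace (K * a * a) with ((K * a) * ((p2 x0 + a / 2) - (p2 x0 - a / 2))) by field.
  apply RInt_ge_sub; auto using inner2_slice_cont; try lra.
  { intros; apply I2; lra. }
  intros y2 Hy2.
  assert (S2 : (y2 - p2 x0) ^ 2 <= (a / 2) ^ 2) by nra.
  assert (A2 : a / 2 <= sqrt (rr ^ 2 - (y1 - p1 x0) ^ 2 - (y2 - p2 x0) ^ 2)) by (apply Sq; nra).
  replace (K * a) with (K * ((p3 x0 + a / 2) - (p3 x0 - a / 2))) by field.
  apply RInt_ge_sub; auto using continuous_slice3; cbn [fst snd]; try lra.
  - intros y3 Hy3. apply (H0 (mk3 y1 y2 y3)). apply ball_mem; lra.
  - intros y3 Hy3. apply (HK (mk3 y1 y2 y3)). unfold in_box, mk3, p1, p2, p3 in *; simpl in *. repeat split; apply Rabs_le; lra.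
Qed.

Lemma sphere_point_norm (th ph : R) :
  norm3 (sub3 (add3 x0 (scal3 rr (mk3 (sin th * cos ph) (sin th * sin ph) (cos th)))) x0) = rr.
Proof.
  transitivity (sqrt (rr ^ 2)); [unfold norm3; f_equal | apply sqrt_pow2; lra].
  unfold dot3, sub3, add3, scal3, mk3, p1, p2, p3. simpl.
  generalize (sin2_cos2 th) (sin2_cos2 ph). unfold Rsqr. intros E1 E2.
  transitivity (rr * rr * (sin th * sin th * (sin ph * sin ph + cos ph * cos ph) + cos th * cos th)); [ring |].
  rewrite E2, Rmult_1_r, E1. ring.
Qed.

(** The weight [sin th] is merely bounded by 1, so [2 * PI ^ 2] stands in place of the area factor
    [4 * PI]. *)
Lemma sphere_int_upper (K : R) : 0 <= K ->
  (forall x, norm3 (sub3 x x0) = rr -> f x <= K) ->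
  sphere_int x0 rr f <= rr ^ 2 * K * (2 * PI) * PI.
Proof.
  intros HK H. unfold sphere_int. assert (HP := PI_RGT_0).
  set (F := fun th ph => rr ^ 2 * sin th * f (add3 x0 (scal3 rr (mk3 (sin th * cos ph) (sin th * sin ph) (cos th))))).
  assert (Csin : forall {T : UniformSpace} (s : T -> R) u, continuous s u -> continuous (fun u => sin (s u)) u).
  { intros T s u Hs. apply (continuous_comp s sin); [exact Hs | apply continuous_sin]. }
  assert (Ccos : forall {T : UniformSpace} (s : T -> R) u, continuous s u -> continuous (fun u => cos (s u)) u).
  { intros T s u Hs. apply (continuous_comp s cos); [exact Hs | apply continuous_cos]. }
  assert (Cm : forall (s s' : R * R -> R) u, continuous s u -> continuous s' u -> continuous (fun u => s u * s' u) u).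
  { intros s s' u H1 H2. apply (continuous_mult (K := R_AbsRing) s s'); auto. }
  assert (Cp : forall (b : R) (s : R * R -> R) u, continuous s u -> continuous (fun u => b + rr * s u) u).
  { intros b s u H1. apply (continuous_plus (V := R_NormedModule) (fun _ => b)); [apply continuous_const |].
    apply Cm; auto. apply continuous_const. }
  assert (CF : forall u s, continuous (fun p : R * R => F (fst p) (snd p)) (u, s)).
  { intros u s. assert (F1 : continuous (fun p : R * R => fst p) (u, s)) by apply continuous_fst.
    assert (F2 : continuous (fun p : R * R => snd p) (u, s)) by apply continuous_snd.
    unfold F. apply (Cm (fun p => rr ^ 2 * sin (fst p)) (fun p => f (add3 x0 (scal3 rr (mk3 (sin (fst p) * cos (snd p)) (sin (fst p) * sin (snd p)) (cos (fst p))))))).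
    - apply Cm; [apply continuous_const | apply Csin; auto].
    - apply (continuous_comp (fun p : R * R => add3 x0 (scal3 rr (mk3 (sin (fst p) * cos (snd p)) (sin (fst p) * sin (snd p)) (cos (fst p)))) : P3) f); [| apply hf].
      apply (continuous_mk3 (T := prod_UniformSpace R_UniformSpace R_UniformSpace)); simpl; apply Cp; auto;
      apply (Cm (fun u => sin (fst u))); auto. }
  assert (C1 : forall th, cont (F th)).
  { intros th s. apply (continuous_comp_2 (fun _ : R => th) (fun z : R => z) F s);
    [apply continuous_const | apply continuous_id | apply CF]. }
  assert (C2 : cont (fun th => RInt (F th) 0 (2 * PI))).
  { intro th. apply (continuous_RInt_param (T := R_UniformSpace) F (fun _ => 0) (fun _ => 2 * PI)); auto; apply continuous_const. }
  assert (Cst : forall A lo hi, RInt (fun _ => A) lo hi = (hi - lo) * A :> R).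
  { intros. rewrite (RInt_const (V := R_CompleteNormedModule)). reflexivity. }
  apply Rle_trans with (RInt (fun _ => rr ^ 2 * K * (2 * PI)) 0 PI).
  - apply RInt_le; [lra | apply cont_ex_RInt, C2 | apply (ex_RInt_const (V := R_NormedModule)) |].
    intros th Hth. apply Rle_trans with (RInt (fun _ => rr ^ 2 * K) 0 (2 * PI)).
    + apply RInt_le; [lra | apply cont_ex_RInt, (C1 th) | apply (ex_RInt_const (V := R_NormedModule)) |].
      intros ph Hph. assert (0 <= sin th) by (apply sin_ge_0; lra). assert (sin th <= 1) by apply SIN_bound.
      assert (Q := H _ (sphere_point_norm th ph)).
      rewrite Rmult_assoc. apply Rmult_le_compat_l; [apply pow2_ge_0 |].
      apply Rle_trans with (sin th * K); [apply Rmult_le_compat_l; auto | nra].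
    + rewrite Cst. lra.
  - rewrite Cst. lra.
Qed.

End BallIntegral.

Lemma sphere_int_ext (x0 : P3) (rr : R) (f g : P3 -> R) : 0 < rr ->
  (forall x, norm3 (sub3 x x0) = rr -> f x = g x) -> sphere_int x0 rr f = sphere_int x0 rr g.
Proof.
  intros Hr H. unfold sphere_int.
  apply RInt_ext. intros th _. apply RInt_ext. intros ph _.
  apply Rmult_eq_compat_l, H, sphere_point_norm, Hr.
Qed.

(** * The Klein-Gordon solution *)

Section KleinGordon.
Variables (c m qe a chi L eps1 : R) (rh v v1 v2 : R -> R) (E P : R -> R -> R).
Hypothesis hc : 0 < c.
Hypothesis hm : 0 < m.
Hypothesis hq : qe <> 0.
Hypothesis ha : 0 < a.
Hypothesis hchi : 0 < chi.
Hypothesis hL : 0 < L.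
Hypothesis heps : 0 <= eps1 < 1.
Hypothesis hv : forall t, Rabs (v t) <= eps1 * c.
Hypothesis dr : forall t, is_derive rh t (v t).
Hypothesis dv : forall t, is_derive v t (v1 t).
Hypothesis dv1 : forall t, is_derive v1 t (v2 t).
Hypothesis Cv : CB top1 top2 6 (fun _ t _ => v t).
Hypothesis Cv1 : CB top1 top2 5 (fun _ t _ => v1 t).
Hypothesis Cv2 : CB top1 top2 4 (fun _ t _ => v2 t).
Hypothesis CE : CB top1 (strip L) 3 (fun _ => E).
Hypothesis CP : CB top1 (strip L) 3 (fun _ => P).

Notation kap := (m * c / chi).
Notation lamp := (lamp c v).
Notation lamp1 := (lamp1 c v v1).
Notation lamp2 := (lamp2 c v v1 v2).

Hypothesis Hshell : forall t y, Rabs y < L -> E t y ^ 2 - P t y ^ 2 = 1 + / kap ^ 2 * Mass c a v v1 v2 t y.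
Hypothesis Hcont : forall t y, Rabs y < L -> forall Et Ey Py,
  is_derive (fun x => E x y) t Et -> is_derive (fun x => E t x) y Ey -> is_derive (fun x => P t x) y Py ->
  2 * (lamp1 t + v t * (y * / a ^ 2)) * E t y + Et - v t * Ey = c * (Py - 2 * (y * / a ^ 2) * P t y).

Definition tube (t z : R) : Prop := Rabs (z - rh t) < L.
Definition comoving (u : R -> R -> R) (t z : R) : R := u t (z - rh t).

Lemma continuous_rh t : continuous rh t.
Proof. apply (cont_of_derive rh v dr). Qed.

Lemma cont2_shift t z : cont2 (fun t z => z - rh t) t z.
Proof.
  apply (continuous_minus (V := R_NormedModule) (fun p : R * R => snd p) (fun p => rh (fst p))).
  - apply continuous_snd.
  - apply continuous_pair_l, continuous_rh.
Qed.

Lemma is_derive_shift_t (t z : R) : is_derive (fun x : R => z - rh x) t (- v t).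
Proof.
  auto_derive; [eexists; apply dr |]. rewrite (is_derive_unique (fun x : R => rh x) _ _ (dr t)). ring.
Qed.

Lemma is_derive_shift_z (b z : R) : is_derive (fun x : R => x - b) z 1.
Proof. auto_derive; auto. Qed.

Lemma tube_open : open2 tube.
Proof.
  intros t z H. unfold tube in *.
  assert (He : 0 < L - Rabs (z - rh t)) by lra.
  generalize (proj1 (filterlim_locally _ _) (cont2_shift t z) (mkposreal _ He)).
  apply filter_imp. intros [t' z'] Hp. exact (Rabs_near (z - rh t) (z' - rh t') L Hp).
Qed.

Lemma CB_rate k : (k <= 6)%nat -> CB top1 tube k (fun _ t _ => v t).
Proof. intro Hk. apply CB_le with 6%nat; auto. apply CB_time, Cv. Qed.

Lemma CM_shift k : (k <= 6)%nat -> CM top1 tube k (fun _ t z => z - rh t).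
Proof.
  intro Hk. split; [intros; apply cont2_shift |]. destruct k; [exact I |].
  exists (fun _ t _ => - v t), (fun _ _ _ => 1). refine (conj _ (conj _ (conj _ _))).
  - intros; apply is_derive_shift_t.
  - intros; apply is_derive_shift_z.
  - apply CB_opp; [apply tube_open | apply CB_rate; lia].
  - apply CB_const.
Qed.

Lemma CM_time D U k : CM D U k (fun _ t _ => t).
Proof.
  split; [intros; apply continuous_fst |]. destruct k; [exact I |].
  exists (fun _ _ _ => 1), (fun _ _ _ => 0).
  refine (conj _ (conj _ (conj _ _))); try apply CB_const; intros; [apply is_derive_id_R | apply is_derive_const_R].
Qed.

Lemma CB_comoving k u : (k <= 6)%nat -> CB top1 (strip L) k (fun _ => u) -> CB top1 tube k (fun _ => comoving u).
Proof.
  intros Hk Hu. apply (CB_comp top1 tube (strip L) k (fun _ => u) (fun _ t _ => t) (fun _ t z => z - rh t));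
  auto using tube_open, strip_open, CM_time, CM_shift.
Qed.

Lemma is_derive_comoving k u : CB top1 (strip L) (S k) (fun _ => u) ->
  exists ut uy, CB top1 (strip L) k (fun _ => ut) /\ CB top1 (strip L) k (fun _ => uy) /\
   forall t y, Rabs y < L -> is_derive (fun x => u x y) t (ut t y) /\ is_derive (fun x => u t x) y (uy t y) /\
    forall z, y = z - rh t ->
    is_derive (fun x => comoving u x z) t (ut t y - v t * uy t y) /\ is_derive (fun x => comoving u t x) z (uy t y).
Proof.
  intros [_ [_ [us [uy [H1 [H2 [H3 H4]]]]]]]. exists (us 0), (uy 0).
  assert (C3 : CB top1 (strip L) k (fun _ => us 0)) by (apply CB_fix with (D := top1); auto; exact I).
  split; [exact C3 | split; [apply CB_fix with (D := top1); auto; exact I |]].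
  intros t y Hy. split; [apply (H1 0); auto; exact I | split; [apply (H2 0); auto; exact I |]].
  intros z ->.
  assert (LL : locally (t, z - rh t) (fun p : R * R => is_derive (fun z => u z (snd p)) (fst p) (us 0 (fst p) (snd p)))).
  { generalize (strip_open L t _ Hy). apply filter_imp. intros p Hp. apply (H1 0); auto; exact I. }
  assert (Cs : cont2 (us 0) t (z - rh t)) by (apply (CB_cont _ _ _ _ C3 0); auto; exact I).
  split.
  - replace (us 0 t (z - rh t) - v t * uy 0 t (z - rh t)) with (us 0 t (z - rh t) * 1 + uy 0 t (z - rh t) * - v t) by ring.
    apply (is_derive_comp2 u (us 0) (uy 0 t (z - rh t)) (fun x => x) (fun x => z - rh x)); auto.
    + apply (H2 0); auto; exact I.
    + apply is_derive_id_R.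
    + apply is_derive_shift_t.
  - replace (uy 0 t (z - rh t)) with (us 0 t (z - rh t) * 0 + uy 0 t (z - rh t) * 1) by ring.
    apply (is_derive_comp2 u (us 0) (uy 0 t (z - rh t)) (fun _ => t) (fun x => x - rh t)); auto.
    + apply (H2 0); auto; exact I.
    + apply is_derive_const_R.
    + apply is_derive_shift_z.
Qed.

(** The phase function [S], with [P] as its [y]-derivative. The free function of time is fixed by
    letting [S] vanish on the trajectory. *)
Definition primitive (t y : R) : R := RInt (P t) 0 y.

Lemma CB_primitive : CB top1 (strip L) 3 (fun _ => primitive).
Proof. apply (CB_RInt top1 L hL (fun _ => P)), CP. Qed.

Variable Jt : R -> R -> R.
Hypothesis HJt : forall t y, Rabs y < L -> is_derive (fun x => primitive x y) t (Jt t y).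

Lemma CB_Jt : CB top1 (strip L) 2 (fun _ => Jt).
Proof.
  destruct (is_derive_comoving 2 primitive CB_primitive) as [ut [uy [Ct [_ H]]]].
  apply CB_ext with (fun _ => ut); auto using strip_open. intros d t y _ Hy.
  destruct (H t y Hy) as [Q _]. rewrite <- (is_derive_unique _ _ _ Q). apply is_derive_unique, HJt, Hy.
Qed.

Definition profile (y : R) : R := exp (- y ^ 2 * / (2 * a ^ 2)).
(** The factor that makes the squared Gaussian of width [a] a probability density. It also cancels
    the constant inside the logarithm of [dGa], which is adapted to this normalization. *)
Definition Nn : R := / sqrt (Rpower PI (3 / 2) * a ^ 3).
Definition amp (t z : R) : R := exp (lamp t - (z - rh t) ^ 2 * / (2 * a ^ 2)).
Definition phase (t z : R) : R := kap * comoving primitive t z.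
(** Solved from the requirement that the covariant phase velocity be [kap * c * E]: in the moving
    frame the phase contributes [kap * (Jt - v * P)] and the potential [qe * phi / chi], while
    [chi * kap = m * c]. *)
Definition phi_sol (t : R) (x : P3) : R :=
  m * c / qe * (c * comoving E t (p3 x) + v t * comoving P t (p3 x) - comoving Jt t (p3 x)).
Definition psi_sol (t : R) (x : P3) : C :=
  (Nn * profile (p1 x) * profile (p2 x) * (amp t (p3 x) * cos (phase t (p3 x))),
   Nn * profile (p1 x) * profile (p2 x) * (amp t (p3 x) * sin (phase t (p3 x)))).
(** The logarithmic time derivative of [amp]. *)
Definition rate (t z : R) : R := lamp1 t + v t * ((z - rh t) * / a ^ 2).

Lemma CB_profile k : CB top1 (strip L) k (fun _ _ y => profile y).
Proof.
  unfold profile. apply CB_exp. apply CB_mult; [| apply CB_const].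
  apply CB_opp; [apply strip_open |]. apply CB_pow, CB_y.
Qed.

Lemma CB_amp : CB top1 tube 3 (fun _ => amp).
Proof.
  unfold amp. apply CB_exp. apply CB_minus; [apply tube_open | |].
  - apply CB_time. apply CB_le with 6%nat; [lia | apply (CB_lamp c eps1 v hc heps hv Cv)].
  - apply CB_mult; [| apply CB_const].
    apply (CB_comoving 3 (fun _ y => y ^ 2)); [lia |]. apply (CB_pow top1 (strip L) 3 (fun _ _ y => y)), CB_y.
Qed.

Lemma CB_phase : CB top1 tube 3 (fun _ => phase).
Proof.
  unfold phase. apply CB_mult; [apply CB_const |]. apply (CB_comoving 3); [lia | apply CB_primitive].
Qed.

Lemma psi_sol_C2 S : (forall t x, S t x -> sep_dom L tube t x) -> C2_on_C S psi_sol.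
Proof.
  intro HS.
  assert (H : forall Q, CB top1 tube 2 (fun _ => Q) ->
    C2_on S (fun t x => Nn * profile (p1 x) * profile (p2 x) * Q t (p3 x))).
  { intros Q HQ. apply (separated_C2_on L tube tube_open); auto.
    exists (fun y => Nn * profile y), profile, Q.
    refine (conj _ (conj (CB_profile 2) (conj HQ _))); [| reflexivity || auto].
    apply CB_mult; [apply CB_const | apply CB_profile]. }
  destruct (CB_sin_cos top1 tube tube_open 3 (fun _ => phase) CB_phase) as [Hs Hco].
  assert (Ha := CB_amp).
  split; [apply (H (fun t z => amp t z * cos (phase t z))) | apply (H (fun t z => amp t z * sin (phase t z)))];
  apply (CB_S top1 tube 2); apply CB_mult; assumption.
Qed.

Lemma CB_phi_profile : CB top1 tube 2 (fun _ t z => m * c / qe * (c * comoving E t z + v t * comoving P t z - comoving Jt t z)).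
Proof.
  apply CB_mult; [apply CB_const |].
  apply CB_minus; [apply tube_open | | apply (CB_comoving 2); [lia | apply CB_Jt]].
  apply CB_plus; apply CB_mult.
  - apply CB_const.
  - apply (CB_comoving 2); [lia | apply CB_S, CE].
  - apply CB_rate; lia.
  - apply (CB_comoving 2); [lia | apply CB_S, CP].
Qed.

Lemma phi_sol_C2 S : (forall t x, S t x -> sep_dom L tube t x) -> C2_on S phi_sol.
Proof.
  intro HS. apply (separated_C2_on L tube tube_open); auto.
  exists (fun _ => 1), (fun _ => 1), (fun t z => m * c / qe * (c * comoving E t z + v t * comoving P t z - comoving Jt t z)).
  refine (conj (CB_const _ _ _ _) (conj (CB_const _ _ _ _) (conj CB_phi_profile _))).
  intros. unfold phi_sol. ring.
Qed.

Lemma is_derive_exp_comp (f : R -> R) (x l : R) : is_derive f x l -> is_derive (fun x => exp (f x)) x (exp (f x) * l).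
Proof.
  intro H. rewrite Rmult_comm.
  apply (is_derive_comp (K := R_AbsRing) (V := R_NormedModule) exp f); [apply is_derive_exp | exact H].
Qed.

Lemma is_derive_amp_t t z : is_derive (fun s => amp s z) t (amp t z * rate t z).
Proof.
  apply (is_derive_exp_comp (fun s => lamp s - (z - rh s) ^ 2 * / (2 * a ^ 2))). unfold rate. auto_derive.
  - split; [eexists; apply (is_derive_lamp c eps1 v v1 hc heps hv dv) | split; [eexists; apply dr | auto]].
  - rewrite (is_derive_unique (fun x : R => lamp x) _ _ (is_derive_lamp c eps1 v v1 hc heps hv dv t)),
      (is_derive_unique (fun x : R => rh x) _ _ (dr t)). field. lra.
Qed.

Lemma is_derive_amp_z (t z : R) : is_derive (fun s => amp t s) z (amp t z * - ((z - rh t) * / a ^ 2)).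
Proof.
  apply (is_derive_exp_comp (fun s => lamp t - (s - rh t) ^ 2 * / (2 * a ^ 2))). auto_derive; auto. field. lra.
Qed.

Lemma is_derive_rate_t t z : is_derive (fun s => rate s z) t (lamp2 t + v1 t * ((z - rh t) * / a ^ 2) - v t ^ 2 * / a ^ 2).
Proof.
  unfold rate. auto_derive.
  - split; [eexists; apply (is_derive_lamp1 c eps1 v v1 v2 hc heps hv dv dv1) | split; [eexists; apply dv | split; [eexists; apply dr | auto]]].
  - rewrite (is_derive_unique (fun x : R => lamp1 x) _ _ (is_derive_lamp1 c eps1 v v1 v2 hc heps hv dv dv1 t)),
      (is_derive_unique (fun x : R => rh x) _ _ (dr t)), (is_derive_unique (fun x : R => v x) _ _ (dv t)). field. lra.
Qed.

Lemma is_derive_profile (y : R) : is_derive profile y (profile y * - (y * / a ^ 2)).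
Proof.
  apply (is_derive_exp_comp (fun y => - y ^ 2 * / (2 * a ^ 2))). auto_derive; auto. field. lra.
Qed.

Lemma is_derive_primitive_y t y : Rabs y < L -> is_derive (fun x => primitive t x) y (P t y).
Proof.
  intro Hy. apply (is_derive_RInt_strip L); auto. intros x Hx.
  apply (cont2_slice_r P), (CB_cont _ _ _ _ CP 0); auto; exact I.
Qed.

Lemma is_derive_phase_t t z : tube t z ->
  is_derive (fun s => phase s z) t (kap * (comoving Jt t z - v t * comoving P t z)).
Proof.
  intro H. unfold phase. apply is_derive_scal.
  destruct (is_derive_comoving 2 primitive CB_primitive) as [ut [uy [_ [_ Q]]]].
  destruct (Q t (z - rh t) H) as [Q1 [Q2 Q3]]. destruct (Q3 z eq_refl) as [Q4 _].
  unfold comoving at 2 3.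
  replace (Jt t (z - rh t)) with (ut t (z - rh t)). replace (P t (z - rh t)) with (uy t (z - rh t)). exact Q4.
  - rewrite <- (is_derive_unique _ _ _ Q2). apply is_derive_unique, is_derive_primitive_y, H.
  - rewrite <- (is_derive_unique _ _ _ Q1). apply is_derive_unique, HJt, H.
Qed.

Lemma is_derive_phase_z t z : tube t z -> is_derive (fun s => phase t s) z (kap * comoving P t z).
Proof.
  intro H. unfold phase. apply is_derive_scal.
  destruct (is_derive_comoving 2 primitive CB_primitive) as [ut [uy [_ [_ Q]]]].
  destruct (Q t (z - rh t) H) as [Q1 [Q2 Q3]]. destruct (Q3 z eq_refl) as [_ Q4].
  unfold comoving at 2. replace (P t (z - rh t)) with (uy t (z - rh t)). exact Q4.
  rewrite <- (is_derive_unique _ _ _ Q2). apply is_derive_unique, is_derive_primitive_y, H.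
Qed.

Lemma tube_near_t t z : tube t z -> locally t (fun s => tube s z).
Proof. apply (open2_slice_l tube t z tube_open). Qed.

Lemma tube_near_z t z : tube t z -> locally z (fun s => tube t s).
Proof. apply (open2_slice_r tube t z tube_open). Qed.

Lemma is_derive_re (B S : R -> R) (x b s g : R) : is_derive B x b -> is_derive S x s ->
  is_derive (fun x => g * (B x * cos (S x))) x (g * (b * cos (S x) - B x * s * sin (S x))).
Proof.
  intros HB HS. auto_derive.
  - split; [eexists; exact HB | split; [eexists; exact HS | auto]].
  - rewrite (is_derive_unique (fun x : R => B x) _ _ HB), (is_derive_unique (fun x : R => S x) _ _ HS). ring.
Qed.

Lemma is_derive_im (B S : R -> R) (x b s g : R) : is_derive B x b -> is_derive S x s ->
  is_derive (fun x => g * (B x * sin (S x))) x (g * (b * sin (S x) + B x * s * cos (S x))).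
Proof.
  intros HB HS. auto_derive.
  - split; [eexists; exact HB | split; [eexists; exact HS | auto]].
  - rewrite (is_derive_unique (fun x : R => B x) _ _ HB), (is_derive_unique (fun x : R => S x) _ _ HS). ring.
Qed.

Lemma covdt_psi t x : tube t (p3 x) ->
  let g := Nn * profile (p1 x) * profile (p2 x) in let z := p3 x in
  let ph := kap * c * comoving E t z in
  covdt qe chi phi_sol psi_sol t x =
   (g * (amp t z * (rate t z * cos (phase t z) - ph * sin (phase t z))),
    g * (amp t z * (rate t z * sin (phase t z) + ph * cos (phase t z)))).
Proof.
  intros H g z ph.
  set (St := kap * (comoving Jt t z - v t * comoving P t z)).
  assert (D1 : partial 0 (fun t x => Re (psi_sol t x)) t x =
     g * (amp t z * rate t z * cos (phase t z) - amp t z * St * sin (phase t z))).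
  { apply is_derive_unique.
    exact (is_derive_re (fun s => amp s z) (fun s => phase s z) t _ _ g (is_derive_amp_t t z) (is_derive_phase_t t z H)). }
  assert (D2 : partial 0 (fun t x => Im (psi_sol t x)) t x =
     g * (amp t z * rate t z * sin (phase t z) + amp t z * St * cos (phase t z))).
  { apply is_derive_unique.
    exact (is_derive_im (fun s => amp s z) (fun s => phase s z) t _ _ g (is_derive_amp_t t z) (is_derive_phase_t t z H)). }
  unfold covdt, cpartial. rewrite D1, D2.
  unfold psi_sol, phi_sol, Cplus, Cmult. simpl. fold z. fold g.
  apply injective_projections; simpl; unfold ph, St; field; repeat split; lra.
Qed.

(** The covariant derivative multiplies [psi] by [rate + i ph]; a second application gives
    [rate_t + rate ^ 2 - ph ^ 2] as real part and [2 * rate * ph + ph_t] as imaginary part of the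
    factor. *)
Lemma covdt2_psi t x (Et : R) : tube t (p3 x) -> is_derive (fun s => comoving E s (p3 x)) t Et ->
  let g := Nn * profile (p1 x) * profile (p2 x) in let z := p3 x in
  let ph := kap * c * comoving E t z in
  let y := z - rh t in
  let s1t := lamp2 t + v1 t * (y * / a ^ 2) - v t ^ 2 * / a ^ 2 in
  let re := s1t + rate t z ^ 2 - ph ^ 2 in
  let im := 2 * rate t z * ph + kap * c * Et in
  covdt qe chi phi_sol (covdt qe chi phi_sol psi_sol) t x =
   (g * (amp t z * (re * cos (phase t z) - im * sin (phase t z))),
    g * (amp t z * (re * sin (phase t z) + im * cos (phase t z)))).
Proof.
  intros H HE g z ph y s1t re im. unfold covdt at 1, cpartial.
  assert (Da := is_derive_amp_t t z). assert (Dp := is_derive_phase_t t z H). assert (Dr := is_derive_rate_t t z).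
  set (St := kap * (comoving Jt t z - v t * comoving P t z)) in *.
  assert (D1 : is_derive (fun s => fst (covdt qe chi phi_sol psi_sol s x)) t
     (g * (amp t z * (rate t z * (rate t z * cos (phase t z) - ph * sin (phase t z))
        + s1t * cos (phase t z) - rate t z * St * sin (phase t z) - kap * c * Et * sin (phase t z) - ph * St * cos (phase t z))))).
  { apply is_derive_ext_loc with (fun s => g * (amp s z * (rate s z * cos (phase s z) - kap * c * comoving E s z * sin (phase s z)))).
    - generalize (tube_near_t t z H). apply filter_imp. intros s Hs. rewrite (covdt_psi s x Hs). reflexivity.
    - auto_derive.
      + repeat split; eexists; eauto.
      + rewrite (is_derive_unique (fun x : R => amp x z) _ _ Da), (is_derive_unique (fun x : R => phase x z) _ _ Dp),
          (is_derive_unique (fun x : R => rate x z) _ _ Dr), (is_derive_unique (fun x : R => comoving E x z) _ _ HE).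
        unfold ph, s1t, y. field. lra. }
  assert (D2 : is_derive (fun s => snd (covdt qe chi phi_sol psi_sol s x)) t
     (g * (amp t z * (rate t z * (rate t z * sin (phase t z) + ph * cos (phase t z))
        + s1t * sin (phase t z) + rate t z * St * cos (phase t z) + kap * c * Et * cos (phase t z) - ph * St * sin (phase t z))))).
  { apply is_derive_ext_loc with (fun s => g * (amp s z * (rate s z * sin (phase s z) + kap * c * comoving E s z * cos (phase s z)))).
    - generalize (tube_near_t t z H). apply filter_imp. intros s Hs. rewrite (covdt_psi s x Hs). reflexivity.
    - auto_derive.
      + repeat split; eexists; eauto.
      + rewrite (is_derive_unique (fun x : R => amp x z) _ _ Da), (is_derive_unique (fun x : R => phase x z) _ _ Dp),
          (is_derive_unique (fun x : R => rate x z) _ _ Dr), (is_derive_unique (fun x : R => comoving E x z) _ _ HE).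
        unfold ph, s1t, y. field. lra. }
  assert (X1 : partial 0 (fun t x => Re (covdt qe chi phi_sol psi_sol t x)) t x = _) by exact (is_derive_unique _ _ _ D1).
  assert (X2 : partial 0 (fun t x => Im (covdt qe chi phi_sol psi_sol t x)) t x = _) by exact (is_derive_unique _ _ _ D2).
  rewrite X1, X2.
  rewrite (covdt_psi t x H). unfold phi_sol, Cplus, Cmult. simpl. fold z. fold g.
  unfold re, im, St, ph. apply injective_projections; simpl; field; repeat split; lra.
Qed.
Lemma is_derive_profile2 (y : R) : is_derive (fun y => profile y * - (y * / a ^ 2)) y (profile y * (y ^ 2 * / a ^ 4 - / a ^ 2)).
Proof.
  auto_derive; [eexists; apply is_derive_profile |].
  rewrite (is_derive_unique (fun x : R => profile x) _ _ (is_derive_profile y)). field. lra.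
Qed.

(** The common form of the real and the imaginary part of [psi_sol], with [Q] equal to [amp] times
    the cosine or sine of [phase]. *)
Definition sepf (Q : R -> R -> R) (t : R) (x : P3) : R := Nn * profile (p1 x) * profile (p2 x) * Q t (p3 x).

Lemma sepf_11 Q t x : partial 1 (partial 1 (sepf Q)) t x = sepf Q t x * (p1 x ^ 2 * / a ^ 4 - / a ^ 2).
Proof.
  assert (H : forall t x, partial 1 (sepf Q) t x = Nn * profile (p2 x) * Q t (p3 x) * (profile (p1 x) * - (p1 x * / a ^ 2))).
  { intros t' x'. apply is_derive_unique.
    apply (is_derive_ext_R (fun s => Nn * profile (p2 x') * Q t' (p3 x') * profile s)).
    - intros s. unfold sepf, setc, mk3, p1, p2, p3; simpl. ring.
    - apply is_derive_scal, is_derive_profile. }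
  apply is_derive_unique.
  apply (is_derive_ext_R (fun s => Nn * profile (p2 x) * Q t (p3 x) * (profile s * - (s * / a ^ 2)))).
  - intros s. rewrite H. reflexivity.
  - replace (sepf Q t x * (p1 x ^ 2 * / a ^ 4 - / a ^ 2)) with
      (Nn * profile (p2 x) * Q t (p3 x) * (profile (p1 x) * (p1 x ^ 2 * / a ^ 4 - / a ^ 2))) by (unfold sepf; ring).
    apply is_derive_scal, is_derive_profile2.
Qed.

Lemma sepf_22 Q t x : partial 2 (partial 2 (sepf Q)) t x = sepf Q t x * (p2 x ^ 2 * / a ^ 4 - / a ^ 2).
Proof.
  assert (H : forall t x, partial 2 (sepf Q) t x = Nn * profile (p1 x) * Q t (p3 x) * (profile (p2 x) * - (p2 x * / a ^ 2))).
  { intros t' x'. apply is_derive_unique.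
    apply (is_derive_ext_R (fun s => Nn * profile (p1 x') * Q t' (p3 x') * profile s)).
    - intros s. unfold sepf, setc, mk3, p1, p2, p3; simpl. ring.
    - apply is_derive_scal, is_derive_profile. }
  apply is_derive_unique.
  apply (is_derive_ext_R (fun s => Nn * profile (p1 x) * Q t (p3 x) * (profile s * - (s * / a ^ 2)))).
  - intros s. rewrite H. reflexivity.
  - replace (sepf Q t x * (p2 x ^ 2 * / a ^ 4 - / a ^ 2)) with
      (Nn * profile (p1 x) * Q t (p3 x) * (profile (p2 x) * (p2 x ^ 2 * / a ^ 4 - / a ^ 2))) by (unfold sepf; ring).
    apply is_derive_scal, is_derive_profile2.
Qed.

Lemma sepf_33 Q Q' t x l : tube t (p3 x) ->
  (forall z, tube t z -> is_derive (Q t) z (Q' z)) -> is_derive Q' (p3 x) l ->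
  partial 3 (partial 3 (sepf Q)) t x = Nn * profile (p1 x) * profile (p2 x) * l.
Proof.
  intros Hx H1 H2. apply is_derive_unique.
  apply (is_derive_ext_loc (fun s => Nn * profile (p1 x) * profile (p2 x) * Q' s)).
  - generalize (tube_near_z t (p3 x) Hx). apply filter_imp. intros s Hs. symmetry.
    apply is_derive_unique.
    apply (is_derive_ext_R (fun z => Nn * profile (p1 x) * profile (p2 x) * Q t z)).
    + intros z. reflexivity.
    + apply (is_derive_scal (Q t) s (Nn * profile (p1 x) * profile (p2 x)) (Q' s)), H1, Hs.
  - apply (is_derive_scal Q' (p3 x) (Nn * profile (p1 x) * profile (p2 x)) l), H2.
Qed.

Lemma Nn_sq : Rpower PI (3 / 2) * a ^ 3 * (Nn * Nn) = 1.
Proof.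
  assert (H : 0 < Rpower PI (3 / 2) * a ^ 3) by (apply Rmult_lt_0_compat; [apply exp_pos | apply pow_lt; auto]).
  unfold Nn. assert (Q := sqrt_lt_R0 _ H). rewrite <- (sqrt_sqrt (Rpower PI (3 / 2) * a ^ 3)) at 1 by lra.
  field. lra.
Qed.

Lemma Cmod_psi_sq t x : Cmod (psi_sol t x) ^ 2 = Nn * Nn *
  exp (2 * lamp t - (p1 x ^ 2 + p2 x ^ 2 + (p3 x - rh t) ^ 2) * / a ^ 2).
Proof.
  unfold Cmod. rewrite pow2_sqrt by (apply Rplus_le_le_0_compat; apply pow2_ge_0).
  unfold psi_sol. simpl fst; simpl snd. set (g := Nn * profile (p1 x) * profile (p2 x)).
  replace ((g * (amp t (p3 x) * cos (phase t (p3 x)))) ^ 2 + (g * (amp t (p3 x) * sin (phase t (p3 x)))) ^ 2)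
    with (g ^ 2 * amp t (p3 x) ^ 2 * (Rsqr (sin (phase t (p3 x))) + Rsqr (cos (phase t (p3 x))))) by (unfold Rsqr; ring).
  rewrite sin2_cos2, Rmult_1_r. unfold g, profile, amp.
  replace (2 * lamp t - (p1 x ^ 2 + p2 x ^ 2 + (p3 x - rh t) ^ 2) * / a ^ 2) with
    ((- p1 x ^ 2 * / (2 * a ^ 2) + - p1 x ^ 2 * / (2 * a ^ 2)) + (- p2 x ^ 2 * / (2 * a ^ 2) + - p2 x ^ 2 * / (2 * a ^ 2))
     + ((lamp t - (p3 x - rh t) ^ 2 * / (2 * a ^ 2)) + (lamp t - (p3 x - rh t) ^ 2 * / (2 * a ^ 2)))) by (field; lra).
  rewrite !exp_plus. ring.
Qed.

Lemma dGa_psi t x : dGa a (Cmod (psi_sol t x) ^ 2) =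
  - / a ^ 2 * (2 * lamp t - (p1 x ^ 2 + p2 x ^ 2 + (p3 x - rh t) ^ 2) * / a ^ 2) - 3 / a ^ 2.
Proof.
  unfold dGa. rewrite Cmod_psi_sq.
  replace (Rpower PI (3 / 2) * a ^ 3 * (Nn * Nn * exp (2 * lamp t - (p1 x ^ 2 + p2 x ^ 2 + (p3 x - rh t) ^ 2) * / a ^ 2)))
    with (Rpower PI (3 / 2) * a ^ 3 * (Nn * Nn) * exp (2 * lamp t - (p1 x ^ 2 + p2 x ^ 2 + (p3 x - rh t) ^ 2) * / a ^ 2)) by ring.
  rewrite Nn_sq, Rmult_1_l, ln_exp. reflexivity.
Qed.

Theorem psi_sol_KG S : (forall t x, S t x -> tube t (p3 x)) ->
  solves_KG c m qe chi a phi_sol psi_sol S.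
Proof.
  intros HS t x Hx. specialize (HS t x Hx). set (z := p3 x). set (y := z - rh t).
  destruct (is_derive_comoving 2 E CE) as [Et [Ey [_ [_ HE]]]].
  destruct (is_derive_comoving 2 P CP) as [Pt [Py [_ [_ HP]]]].
  destruct (HE t y HS) as [E1 [E2 E3]]. destruct (E3 z eq_refl) as [E4 _].
  destruct (HP t y HS) as [_ [P2 P3']]. destruct (P3' z eq_refl) as [_ P5].
  assert (Hc := Hcont t y HS _ _ _ E1 E2 P2). assert (Hs := Hshell t y HS).
  rewrite (covdt2_psi t x (Et t y - v t * Ey t y) HS E4).
  rewrite dGa_psi.
  assert (Dphi := is_derive_phase_z t z HS). assert (Damp := is_derive_amp_z t z).
  set (Y := fun z => (z - rh t) * / a ^ 2).
  assert (L1 : partial 3 (partial 3 (sepf (fun t z => amp t z * cos (phase t z)))) t x =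
    Nn * profile (p1 x) * profile (p2 x) * (amp t z *
      ((Y z ^ 2 - / a ^ 2 - (kap * P t y) ^ 2) * cos (phase t z) - (- 2 * Y z * (kap * P t y) + kap * Py t y) * sin (phase t z)))).
  { apply (sepf_33 _ (fun z => amp t z * (- Y z * cos (phase t z) - kap * comoving P t z * sin (phase t z)))); auto.
    - intros z' Hz'. assert (Q := is_derive_re (amp t) (phase t) z' _ _ 1 (is_derive_amp_z t z') (is_derive_phase_z t z' Hz')).
      replace (amp t z' * (- Y z' * cos (phase t z') - kap * comoving P t z' * sin (phase t z'))) with
       (1 * (amp t z' * - ((z' - rh t) * / a ^ 2) * cos (phase t z') - amp t z' * (kap * comoving P t z') * sin (phase t z'))) by (unfold Y; ring).
      apply (is_derive_ext_R (fun x => 1 * (amp t x * cos (phase t x)))); [intros; ring | exact Q].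
    - fold z. unfold Y. auto_derive.
      + repeat split; eexists; eauto.
      + rewrite (is_derive_unique (fun x : R => amp t x) _ _ Damp), (is_derive_unique (fun x : R => phase t x) _ _ Dphi),
          (is_derive_unique (fun x : R => comoving P t x) _ _ P5). unfold comoving. fold y.
        change (z + - rh t) with y. field. lra. }
  assert (L2 : partial 3 (partial 3 (sepf (fun t z => amp t z * sin (phase t z)))) t x =
    Nn * profile (p1 x) * profile (p2 x) * (amp t z *
      ((Y z ^ 2 - / a ^ 2 - (kap * P t y) ^ 2) * sin (phase t z) + (- 2 * Y z * (kap * P t y) + kap * Py t y) * cos (phase t z)))).
  { apply (sepf_33 _ (fun z => amp t z * (- Y z * sin (phase t z) + kap * comoving P t z * cos (phase t z)))); auto.
    - intros z' Hz'. assert (Q := is_derive_im (amp t) (phase t) z' _ _ 1 (is_derive_amp_z t z') (is_derive_phase_z t z' Hz')).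
      replace (amp t z' * (- Y z' * sin (phase t z') + kap * comoving P t z' * cos (phase t z'))) with
       (1 * (amp t z' * - ((z' - rh t) * / a ^ 2) * sin (phase t z') + amp t z' * (kap * comoving P t z') * cos (phase t z'))) by (unfold Y; ring).
      apply (is_derive_ext_R (fun x => 1 * (amp t x * sin (phase t x)))); [intros; ring | exact Q].
    - fold z. unfold Y. auto_derive.
      + repeat split; eexists; eauto.
      + rewrite (is_derive_unique (fun x : R => amp t x) _ _ Damp), (is_derive_unique (fun x : R => phase t x) _ _ Dphi),
          (is_derive_unique (fun x : R => comoving P t x) _ _ P5). unfold comoving. fold y.
        change (z + - rh t) with y. field. lra. }
  assert (LR : Re (lap psi_sol t x) = partial 1 (partial 1 (sepf (fun t z => amp t z * cos (phase t z)))) t x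
     + (partial 2 (partial 2 (sepf (fun t z => amp t z * cos (phase t z)))) t x
       + partial 3 (partial 3 (sepf (fun t z => amp t z * cos (phase t z)))) t x)) by reflexivity.
  assert (LI : Im (lap psi_sol t x) = partial 1 (partial 1 (sepf (fun t z => amp t z * sin (phase t z)))) t x
     + (partial 2 (partial 2 (sepf (fun t z => amp t z * sin (phase t z)))) t x
       + partial 3 (partial 3 (sepf (fun t z => amp t z * sin (phase t z)))) t x)) by reflexivity.
  rewrite sepf_11, sepf_22, L1 in LR. rewrite sepf_11, sepf_22, L2 in LI.
  unfold sepf in LR, LI. fold z in LR, LI.
  destruct (lap psi_sol t x) as [lr li]. simpl in LR, LI. subst lr li.
  unfold psi_sol, RtoC, Cplus, Cmult, Copp. simpl fst. simpl snd. fold z. fold y.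
  set (g := Nn * profile (p1 x) * profile (p2 x)).
  set (A := amp t z). set (Co := cos (phase t z)). set (Si := sin (phase t z)).
  assert (Hy : Y z = y * / a ^ 2) by reflexivity. rewrite Hy.
  (* The equation is [psi] times [RE + i IM]. In [RE] the squares of all coordinates and the
     constants [3 / a ^ 2] cancel between Laplacian and nonlinearity, and what remains is [Hshell]
     times [kap ^ 2]; [IM] is a multiple of [Hcont]. *)
  set (RE := - / c ^ 2 * (lamp2 t + v1 t * (y * / a ^ 2) - v t ^ 2 * / a ^ 2 + rate t z ^ 2 - (kap * c * E t y) ^ 2)
     + ((y * / a ^ 2) ^ 2 - / a ^ 2 - (kap * P t y) ^ 2) + (p1 x ^ 2 * / a ^ 4 - / a ^ 2) + (p2 x ^ 2 * / a ^ 4 - / a ^ 2)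
     + / a ^ 2 * (2 * lamp t - (p1 x ^ 2 + p2 x ^ 2 + y ^ 2) * / a ^ 2) + 3 / a ^ 2 - kap ^ 2).
  set (IM := - / c ^ 2 * (2 * rate t z * (kap * c * E t y) + kap * c * (Et t y - v t * Ey t y))
     - 2 * (y * / a ^ 2) * (kap * P t y) + kap * Py t y).
  assert (HRE : RE = 0).
  { unfold RE.
    transitivity (kap ^ 2 * (E t y ^ 2 - P t y ^ 2 - 1) - / c ^ 2 * (lamp2 t + v1 t * (y * / a ^ 2) - v t ^ 2 * / a ^ 2 + rate t z ^ 2)
       + 2 * lamp t * / a ^ 2); [field; repeat split; lra |].
    rewrite Hs. unfold Mass, rate. fold y. field. repeat split; lra. }
  assert (HIM : IM = 0).
  { unfold IM.
    transitivity (- kap * / c * (2 * rate t z * E t y + Et t y - v t * Ey t y) + kap * (Py t y - 2 * (y * / a ^ 2) * P t y));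
    [field; repeat split; lra |].
    unfold rate. fold z. fold y. rewrite Hc. field. repeat split; lra. }
  apply injective_projections; simpl; unfold comoving; fold z; fold y.
  - transitivity (g * A * (RE * Co - IM * Si)); [unfold RE, IM; field; repeat split; lra | rewrite HRE, HIM; ring].
  - transitivity (g * A * (RE * Si + IM * Co)); [unfold RE, IM; field; repeat split; lra | rewrite HRE, HIM; ring].
Qed.

(** * Concentration and energy estimates for the explicit solution *)

Definition density (t : R) (x : P3) : R :=
  Nn * Nn * exp (2 * lamp t - (p1 x ^ 2 + p2 x ^ 2 + (p3 x - rh t) ^ 2) * / a ^ 2).
(** The bracket of [Ga] evaluated at [density]. *)
Definition log_density (t : R) (x : P3) : R :=
  2 * lamp t - (p1 x ^ 2 + p2 x ^ 2 + (p3 x - rh t) ^ 2) * / a ^ 2 + 2.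

Lemma Nn_sq_pos : 0 < Nn * Nn.
Proof.
  assert (H : 0 < Rpower PI (3 / 2) * a ^ 3) by (apply Rmult_lt_0_compat; [apply exp_pos | apply pow_lt; auto]).
  generalize Nn_sq. intro. nra.
Qed.

Lemma density_pos t x : 0 < density t x.
Proof. apply Rmult_lt_0_compat; [apply Nn_sq_pos | apply exp_pos]. Qed.

Lemma Ga_psi t x : Ga a (Cmod (psi_sol t x) ^ 2) = - (/ a ^ 2 * density t x * log_density t x).
Proof.
  unfold Ga. rewrite Cmod_psi_sq. fold (density t x). unfold log_density.
  assert (Hp : 0 < Rpower PI (3 / 2)) by apply exp_pos.
  assert (Ha3 : 0 < a ^ 3) by (apply pow_lt; auto). assert (Hd := density_pos t x).
  rewrite <- ln_mult; [| apply Rmult_lt_0_compat; auto | auto].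
  replace (a ^ 3 * density t x * Rpower PI (3 / 2)) with
    (Rpower PI (3 / 2) * a ^ 3 * (Nn * Nn) * exp (2 * lamp t - (p1 x ^ 2 + p2 x ^ 2 + (p3 x - rh t) ^ 2) * / a ^ 2))
    by (unfold density; ring).
  rewrite Nn_sq, Rmult_1_l, ln_exp. ring.
Qed.

(** The squared modulus of [(A + i B) psi]. Every first derivative of [psi], ordinary or covariant,
    is [psi] times such a factor, so all quadratic quantities reduce to [density] times a
    polynomial. *)
Lemma sepf_sq t x (A B : R) :
  (Nn * profile (p1 x) * profile (p2 x) * (amp t (p3 x) * (A * cos (phase t (p3 x)) - B * sin (phase t (p3 x))))) ^ 2
  + (Nn * profile (p1 x) * profile (p2 x) * (amp t (p3 x) * (A * sin (phase t (p3 x)) + B * cos (phase t (p3 x))))) ^ 2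
  = density t x * (A ^ 2 + B ^ 2).
Proof.
  unfold density. rewrite <- Cmod_psi_sq. unfold Cmod. rewrite pow2_sqrt by (apply Rplus_le_le_0_compat; apply pow2_ge_0).
  unfold psi_sol. simpl fst; simpl snd. set (g := Nn * profile (p1 x) * profile (p2 x)). set (M := amp t (p3 x)).
  set (Co := cos (phase t (p3 x))). set (Si := sin (phase t (p3 x))). ring_simplify.
  assert (ECo : Co ^ 2 = 1 - Si ^ 2). { generalize (sin2_cos2 (phase t (p3 x))). fold Co Si. unfold Rsqr. nra. }
  replace (Co ^ 4) with ((Co ^ 2) ^ 2) by ring. replace (Si ^ 4) with ((Si ^ 2) ^ 2) by ring. rewrite ?ECo. ring.
Qed.

Lemma Cmod_sq (z : C) : Cmod z ^ 2 = fst z ^ 2 + snd z ^ 2.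
Proof. unfold Cmod. apply pow2_sqrt. apply Rplus_le_le_0_compat; apply pow2_ge_0. Qed.

Lemma cmod_t t x : tube t (p3 x) ->
  Cmod (cpartial 0 psi_sol t x) ^ 2 =
    density t x * (rate t (p3 x) ^ 2 + (kap * (comoving Jt t (p3 x) - v t * comoving P t (p3 x))) ^ 2).
Proof.
  intros H. set (St := kap * (comoving Jt t (p3 x) - v t * comoving P t (p3 x))).
  set (g := Nn * profile (p1 x) * profile (p2 x)). set (z := p3 x).
  assert (D1 : partial 0 (fun t x => Re (psi_sol t x)) t x =
     g * (amp t z * rate t z * cos (phase t z) - amp t z * St * sin (phase t z))).
  { apply is_derive_unique.
    exact (is_derive_re (fun s => amp s z) (fun s => phase s z) t _ _ g (is_derive_amp_t t z) (is_derive_phase_t t z H)). }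
  assert (D2 : partial 0 (fun t x => Im (psi_sol t x)) t x =
     g * (amp t z * rate t z * sin (phase t z) + amp t z * St * cos (phase t z))).
  { apply is_derive_unique.
    exact (is_derive_im (fun s => amp s z) (fun s => phase s z) t _ _ g (is_derive_amp_t t z) (is_derive_phase_t t z H)). }
  rewrite Cmod_sq. unfold cpartial. cbn [fst snd]. rewrite D1, D2. rewrite <- sepf_sq. fold z g. ring.
Qed.

Lemma cmod_3 t x : tube t (p3 x) ->
  Cmod (cpartial 3 psi_sol t x) ^ 2 =
    density t x * (((p3 x - rh t) * / a ^ 2) ^ 2 + (kap * comoving P t (p3 x)) ^ 2).
Proof.
  intros H. set (g := Nn * profile (p1 x) * profile (p2 x)). set (z := p3 x). set (k := kap * comoving P t z).
  set (Y := (z - rh t) * / a ^ 2).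
  assert (D1 : partial 3 (fun t x => Re (psi_sol t x)) t x =
     g * (amp t z * - Y * cos (phase t z) - amp t z * k * sin (phase t z))).
  { apply is_derive_unique.
    exact (is_derive_re (fun s => amp t s) (fun s => phase t s) z _ _ g (is_derive_amp_z t z) (is_derive_phase_z t z H)). }
  assert (D2 : partial 3 (fun t x => Im (psi_sol t x)) t x =
     g * (amp t z * - Y * sin (phase t z) + amp t z * k * cos (phase t z))).
  { apply is_derive_unique.
    exact (is_derive_im (fun s => amp t s) (fun s => phase t s) z _ _ g (is_derive_amp_z t z) (is_derive_phase_z t z H)). }
  rewrite Cmod_sq. unfold cpartial. cbn [fst snd]. rewrite D1, D2.
  replace (Y ^ 2) with ((- Y) ^ 2) by ring. rewrite <- sepf_sq. fold z g. ring.
Qed.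

Lemma partial1_sepf Q t x : partial 1 (sepf Q) t x = sepf Q t x * - (p1 x * / a ^ 2).
Proof.
  apply is_derive_unique.
  apply (is_derive_ext_R (fun s => Nn * profile (p2 x) * Q t (p3 x) * profile s)).
  - intros s. unfold sepf, setc, mk3, p1, p2, p3; simpl. ring.
  - replace (sepf Q t x * - (p1 x * / a ^ 2)) with (Nn * profile (p2 x) * Q t (p3 x) * (profile (p1 x) * - (p1 x * / a ^ 2)))
      by (unfold sepf; ring). apply is_derive_scal, is_derive_profile.
Qed.

Lemma partial2_sepf Q t x : partial 2 (sepf Q) t x = sepf Q t x * - (p2 x * / a ^ 2).
Proof.
  apply is_derive_unique.
  apply (is_derive_ext_R (fun s => Nn * profile (p1 x) * Q t (p3 x) * profile s)).
  - intros s. unfold sepf, setc, mk3, p1, p2, p3; simpl. ring.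
  - replace (sepf Q t x * - (p2 x * / a ^ 2)) with (Nn * profile (p1 x) * Q t (p3 x) * (profile (p2 x) * - (p2 x * / a ^ 2)))
      by (unfold sepf; ring). apply is_derive_scal, is_derive_profile.
Qed.

Lemma cmod_1 t x : Cmod (cpartial 1 psi_sol t x) ^ 2 = density t x * (p1 x * / a ^ 2) ^ 2.
Proof.
  rewrite Cmod_sq. unfold cpartial. cbn [fst snd].
  change (fun (t : R) (x : P3) => Re (psi_sol t x)) with (sepf (fun t z => amp t z * cos (phase t z))).
  change (fun (t : R) (x : P3) => Im (psi_sol t x)) with (sepf (fun t z => amp t z * sin (phase t z))).
  rewrite !partial1_sepf. replace (density t x) with (density t x * (1 ^ 2 + 0 ^ 2)) by ring.
  rewrite <- sepf_sq. unfold sepf. ring.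
Qed.

Lemma cmod_2 t x : Cmod (cpartial 2 psi_sol t x) ^ 2 = density t x * (p2 x * / a ^ 2) ^ 2.
Proof.
  rewrite Cmod_sq. unfold cpartial. cbn [fst snd].
  change (fun (t : R) (x : P3) => Re (psi_sol t x)) with (sepf (fun t z => amp t z * cos (phase t z))).
  change (fun (t : R) (x : P3) => Im (psi_sol t x)) with (sepf (fun t z => amp t z * sin (phase t z))).
  rewrite !partial2_sepf. replace (density t x) with (density t x * (1 ^ 2 + 0 ^ 2)) by ring.
  rewrite <- sepf_sq. unfold sepf. ring.
Qed.

Lemma cmod_covdt t x : tube t (p3 x) ->
  Cmod (covdt qe chi phi_sol psi_sol t x) ^ 2 = density t x * (rate t (p3 x) ^ 2 + (kap * c * comoving E t (p3 x)) ^ 2).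
Proof. intros H. rewrite Cmod_sq, (covdt_psi t x H). cbn [fst snd]. apply sepf_sq. Qed.

(* The integrands divided by the density, after multiplication by the squared Compton length. *)
Definition spatial_factor (t : R) (x : P3) : R :=
  / kap ^ 2 * ((p1 x * / a ^ 2) ^ 2 + (p2 x * / a ^ 2) ^ 2 + ((p3 x - rh t) * / a ^ 2) ^ 2) + comoving P t (p3 x) ^ 2.
Definition nonlinear_factor (t : R) (x : P3) : R := / kap ^ 2 * / a ^ 2 * log_density t x.
Definition conc_factor (t : R) (x : P3) : R :=
  / c ^ 2 * (/ kap ^ 2 * rate t (p3 x) ^ 2 + (comoving Jt t (p3 x) - v t * comoving P t (p3 x)) ^ 2)
  + spatial_factor t x + Rabs (nonlinear_factor t x) + 1.
Definition energy_factor (t : R) (x : P3) : R :=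
  / c ^ 2 * (/ kap ^ 2 * rate t (p3 x) ^ 2) + comoving E t (p3 x) ^ 2 + spatial_factor t x - nonlinear_factor t x + 1.

Lemma kap_pos : 0 < kap.
Proof. apply Rdiv_lt_0_compat; auto. apply Rmult_lt_0_compat; auto. Qed.

Lemma conc_factorization t x : tube t (p3 x) ->
  conc_integrand c m chi a psi_sol t x = density t x * conc_factor t x.
Proof.
  intro H. unfold conc_integrand, grad0_sq, grad_sq.
  replace ((Cmod (cpartial 0 psi_sol t x) / c) ^ 2) with (Cmod (cpartial 0 psi_sol t x) ^ 2 * / c ^ 2) by (field; lra).
  rewrite cmod_t, cmod_1, cmod_2, cmod_3 by auto. rewrite Ga_psi, Rabs_Ropp, Cmod_psi_sq. fold (density t x).
  assert (Hd := density_pos t x). assert (Ha2 : 0 < / a ^ 2) by (apply Rinv_0_lt_compat, pow_lt, ha).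
  assert (Hk := kap_pos). assert (Hk2 : 0 < / kap ^ 2) by (apply Rinv_0_lt_compat, pow_lt, Hk).
  unfold conc_factor, nonlinear_factor, spatial_factor.
  rewrite !Rabs_mult, (Rabs_right (density t x)), (Rabs_right (/ a ^ 2)), (Rabs_right (/ kap ^ 2)) by lra.
  field. repeat split; lra.
Qed.

Lemma energy_factorization t x : tube t (p3 x) ->
  energy_density c m qe chi a phi_sol psi_sol t x = m * c ^ 2 / 2 * density t x * energy_factor t x.
Proof.
  intro H. unfold energy_density, grad_sq.
  replace ((Cmod (covdt qe chi phi_sol psi_sol t x) / c) ^ 2) with (Cmod (covdt qe chi phi_sol psi_sol t x) ^ 2 * / c ^ 2) by (field; lra).
  rewrite cmod_covdt, cmod_1, cmod_2, cmod_3 by auto. rewrite Ga_psi, Cmod_psi_sq. fold (density t x).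
  unfold energy_factor, nonlinear_factor, spatial_factor. field. repeat split; lra.
Qed.

Section Bounds.
Variables (K K1 KE KP KJ kq : R).
Hypothesis ha1 : a <= 1.
Hypothesis hK : forall t, Rabs (lamp t) <= K.
Hypothesis hK1 : forall t, Rabs (lamp1 t) <= K1.
Hypothesis hKE : forall t y, Rabs y < L -> Rabs (E t y) <= KE.
Hypothesis hKP : forall t y, Rabs y < L -> Rabs (P t y) <= KP.
Hypothesis hKJ : forall t y, Rabs y < L -> Rabs (Jt t y) <= KJ.
Hypothesis hkq : 0 < kq <= 1 /\ kq * (2 * K + 5) <= / 2.
Hypothesis hkap : / kap ^ 2 <= a ^ 4 * kq.

Definition unit_box (t : R) (x : P3) : Prop :=
  Rabs (p1 x) <= 1 /\ Rabs (p2 x) <= 1 /\ Rabs (p3 x - rh t) <= 1 /\ tube t (p3 x).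

Lemma sq_le_of_abs (x B : R) : Rabs x <= B -> x ^ 2 <= B ^ 2.
Proof. intro H. rewrite <- (pow2_abs x). apply pow_incr. split; [apply Rabs_pos | auto]. Qed.

(** The reason for comparing [/ kap ^ 2] with [a ^ 4]: on the unit box the gradient of the Gaussian
    exponent and the logarithm are of size [/ a ^ 2], so the spatial and the nonlinear terms carry
    at worst this product. *)
Lemma kap_a4 : / kap ^ 2 * / a ^ 4 <= kq.
Proof.
  apply Rmult_le_reg_r with (a ^ 4); [apply pow_lt, ha |].
  rewrite Rmult_assoc, Rinv_l, Rmult_1_r by (apply pow_nonzero; lra). lra.
Qed.

Lemma inv_kap_pos : 0 < / kap ^ 2.
Proof. apply Rinv_0_lt_compat, pow_lt, kap_pos. Qed.

Lemma v_le_c t : Rabs (v t) <= c.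
Proof. eapply Rle_trans; [apply hv |]. nra. Qed.

Lemma rate_bound t x : unit_box t x -> 0 <= / kap ^ 2 * rate t (p3 x) ^ 2 <= (K1 + c) ^ 2.
Proof.
  intros [_ [_ [B3 _]]]. assert (Ik := inv_kap_pos). assert (Pa : 0 < a ^ 2) by (apply pow_lt, ha).
  split; [apply Rmult_le_pos; [lra | apply pow2_ge_0] |].
  assert (R1 : Rabs (a ^ 2 * rate t (p3 x)) <= K1 + c).
  { unfold rate. replace (a ^ 2 * (lamp1 t + v t * ((p3 x - rh t) * / a ^ 2))) with (a ^ 2 * lamp1 t + v t * (p3 x - rh t)) by (field; lra).
    eapply Rle_trans; [apply Rabs_triang |]. rewrite !Rabs_mult, (Rabs_right (a ^ 2)) by lra.
    generalize (hK1 t) (v_le_c t) (Rabs_pos (lamp1 t)) (Rabs_pos (v t)) (Rabs_pos (p3 x - rh t)). intros.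
    assert (a ^ 2 <= 1) by nra.
    assert (a ^ 2 * Rabs (lamp1 t) <= 1 * K1) by (apply Rmult_le_compat; lra).
    assert (Rabs (v t) * Rabs (p3 x - rh t) <= c * 1) by (apply Rmult_le_compat; lra). lra. }
  apply sq_le_of_abs in R1. eapply Rle_trans; [| exact R1].
  replace ((a ^ 2 * rate t (p3 x)) ^ 2) with (a ^ 4 * rate t (p3 x) ^ 2) by ring.
  apply Rmult_le_compat_r; [apply pow2_ge_0 |]. assert (0 < a ^ 4) by (apply pow_lt, ha). nra.
Qed.

Lemma spatial_bound t x : unit_box t x -> 0 <= spatial_factor t x <= 3 + KP ^ 2.
Proof.
  intros [B1 [B2 [B3 B4]]]. assert (Ik := inv_kap_pos). unfold spatial_factor.
  replace (/ kap ^ 2 * ((p1 x * / a ^ 2) ^ 2 + (p2 x * / a ^ 2) ^ 2 + ((p3 x - rh t) * / a ^ 2) ^ 2)) with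
    ((/ kap ^ 2 * / a ^ 4) * (p1 x ^ 2 + p2 x ^ 2 + (p3 x - rh t) ^ 2)) by (field; repeat split; lra).
  apply sq_le_of_abs in B1, B2, B3. assert (Q := hKP t _ B4). apply sq_le_of_abs in Q.
  fold (comoving P t (p3 x)) in Q.
  assert (K4 := kap_a4). assert (0 < / kap ^ 2 * / a ^ 4) by (apply Rmult_lt_0_compat; [lra | apply Rinv_0_lt_compat, pow_lt, ha]).
  generalize (pow2_ge_0 (p1 x)) (pow2_ge_0 (p2 x)) (pow2_ge_0 (p3 x - rh t)) (pow2_ge_0 (comoving P t (p3 x))). intros.
  split; [nra |]. apply Rplus_le_compat; [| exact Q]. destruct hkq. nra.
Qed.

(** The nonlinear part of the energy has no sign. The choice of [kq] keeps it below half of the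
    rest-energy term 1, which is what makes the energy density positive. *)
Lemma nonlinear_bound t x : unit_box t x -> Rabs (nonlinear_factor t x) <= / 2.
Proof.
  intros [B1 [B2 [B3 _]]]. assert (Ik := inv_kap_pos). unfold nonlinear_factor, log_density.
  apply sq_le_of_abs in B1, B2, B3.
  replace (/ kap ^ 2 * / a ^ 2 * (2 * lamp t - (p1 x ^ 2 + p2 x ^ 2 + (p3 x - rh t) ^ 2) * / a ^ 2 + 2)) with
    ((/ kap ^ 2 * / a ^ 4) * (a ^ 2 * (2 * lamp t + 2) - (p1 x ^ 2 + p2 x ^ 2 + (p3 x - rh t) ^ 2))) by (field; repeat split; lra).
  assert (K4 := kap_a4). assert (K5 : 0 < / kap ^ 2 * / a ^ 4) by (apply Rmult_lt_0_compat; [lra | apply Rinv_0_lt_compat, pow_lt, ha]).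
  rewrite Rabs_mult, (Rabs_right (/ kap ^ 2 * / a ^ 4)) by lra.
  assert (Q : Rabs (a ^ 2 * (2 * lamp t + 2) - (p1 x ^ 2 + p2 x ^ 2 + (p3 x - rh t) ^ 2)) <= 2 * K + 5).
  { generalize (pow2_ge_0 (p1 x)) (pow2_ge_0 (p2 x)) (pow2_ge_0 (p3 x - rh t)). intros.
    assert (H2 := hK t). assert (Pa : 0 < a ^ 2 <= 1) by (split; [apply pow_lt, ha | nra]).
    eapply Rle_trans; [apply Rabs_sub_le |]. rewrite Rabs_mult, (Rabs_right (a ^ 2)), (Rabs_right (p1 x ^ 2 + p2 x ^ 2 + (p3 x - rh t) ^ 2)) by lra.
    assert (Rabs (2 * lamp t + 2) <= 2 * K + 2).
    { eapply Rle_trans; [apply Rabs_triang |]. rewrite Rabs_mult, (Rabs_right 2) by lra. lra. }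
    generalize (Rabs_pos (2 * lamp t + 2)). nra. }
  destruct hkq as [[h1 h2] h3]. eapply Rle_trans; [| exact h3].
  apply Rmult_le_compat; [lra | apply Rabs_pos | auto | auto].
Qed.

Definition conc_const : R := / c ^ 2 * ((K1 + c) ^ 2 + (KJ + c * KP) ^ 2) + (3 + KP ^ 2) + / 2 + 1.
Definition energy_const : R := / c ^ 2 * (K1 + c) ^ 2 + KE ^ 2 + (3 + KP ^ 2) + / 2 + 1.

Lemma conc_factor_bound t x : unit_box t x -> 0 <= conc_factor t x <= conc_const.
Proof.
  intros H. pose proof H as [_ [_ [_ B4]]]. assert (R1 := rate_bound t x H). assert (R2 := spatial_bound t x H). assert (R3 := nonlinear_bound t x H).
  assert (Ic : 0 < / c ^ 2) by (apply Rinv_0_lt_compat, pow_lt, hc).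
  assert (R4 : (comoving Jt t (p3 x) - v t * comoving P t (p3 x)) ^ 2 <= (KJ + c * KP) ^ 2).
  { apply sq_le_of_abs. eapply Rle_trans; [apply Rabs_sub_le |]. rewrite Rabs_mult.
    assert (Q1 := hKP t _ B4). assert (Q2 := hKJ t _ B4). fold (comoving P t (p3 x)) in Q1. fold (comoving Jt t (p3 x)) in Q2.
    apply Rplus_le_compat; auto. apply Rmult_le_compat; auto using Rabs_pos, v_le_c. }
  generalize (pow2_ge_0 (comoving Jt t (p3 x) - v t * comoving P t (p3 x))) (Rabs_pos (nonlinear_factor t x)). intros.
  unfold conc_factor, conc_const. split; [nra |].
  assert (/ c ^ 2 * (/ kap ^ 2 * rate t (p3 x) ^ 2 + (comoving Jt t (p3 x) - v t * comoving P t (p3 x)) ^ 2)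
     <= / c ^ 2 * ((K1 + c) ^ 2 + (KJ + c * KP) ^ 2)) by (apply Rmult_le_compat_l; lra). lra.
Qed.

Lemma energy_factor_bound t x : unit_box t x -> / 2 <= energy_factor t x <= energy_const.
Proof.
  intros H. pose proof H as [_ [_ [_ B4]]]. assert (R1 := rate_bound t x H). assert (R2 := spatial_bound t x H). assert (R3 := nonlinear_bound t x H).
  assert (Ic : 0 < / c ^ 2) by (apply Rinv_0_lt_compat, pow_lt, hc).
  assert (R4 := hKE t _ B4). apply sq_le_of_abs in R4. fold (comoving E t (p3 x)) in R4.
  apply Rabs_le_between in R3. generalize (pow2_ge_0 (comoving E t (p3 x))). intro.
  unfold energy_factor, energy_const. split.
  - assert (0 <= / c ^ 2 * (/ kap ^ 2 * rate t (p3 x) ^ 2)) by (apply Rmult_le_pos; lra). lra.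
  - assert (/ c ^ 2 * (/ kap ^ 2 * rate t (p3 x) ^ 2) <= / c ^ 2 * (K1 + c) ^ 2) by (apply Rmult_le_compat_l; lra). lra.
Qed.

Definition kpi : R := / Rpower PI (3 / 2).

Lemma Nn_kpi : Nn * Nn = kpi * / a ^ 3.
Proof.
  assert (H := Nn_sq). assert (0 < Rpower PI (3 / 2)) by apply exp_pos. assert (0 < a ^ 3) by (apply pow_lt, ha).
  unfold kpi. apply Rmult_eq_reg_l with (Rpower PI (3 / 2) * a ^ 3); [| nra]. rewrite H. field. lra.
Qed.

Lemma kpi_pos : 0 < kpi.
Proof. apply Rinv_0_lt_compat, exp_pos. Qed.

Lemma exp_neg_le (u : R) : 0 <= u -> exp (- u) <= / (1 + u).
Proof.
  intros Hu. rewrite exp_Ropp. apply Rinv_le_contravar; [lra |].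
  destruct (Req_dec u 0) as [->|]; [rewrite exp_0; lra | left; apply exp_ineq1; auto].
Qed.

Lemma exp_mono (u w : R) : u <= w -> exp u <= exp w.
Proof. intros [H | ->]; [left; apply exp_increasing, H | lra]. Qed.

Lemma gaussian_weight (z : R) : exp (- (z ^ 2 * / a ^ 2)) <= a * cauchy_weight a 0 z.
Proof.
  assert (0 < / a ^ 2) by (apply Rinv_0_lt_compat, pow_lt, ha).
  eapply Rle_trans; [apply exp_neg_le; apply Rmult_le_pos; [apply pow2_ge_0 | lra] |].
  right. assert (Q := sq_sum_pos a z ha). unfold cauchy_weight. rewrite Rminus_0_r. field. split; lra.
Qed.

Lemma density_upper t x :
  density t x <= kpi * exp (2 * K) * cauchy_weight a 0 (p1 x) * cauchy_weight a 0 (p2 x) * cauchy_weight a (rh t) (p3 x).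
Proof.
  unfold density. rewrite Nn_kpi.
  replace (2 * lamp t - (p1 x ^ 2 + p2 x ^ 2 + (p3 x - rh t) ^ 2) * / a ^ 2) with
    (2 * lamp t + - (p1 x ^ 2 * / a ^ 2) + - (p2 x ^ 2 * / a ^ 2) + - ((p3 x - rh t) ^ 2 * / a ^ 2)) by ring.
  rewrite !exp_plus.
  assert (W1 := gaussian_weight (p1 x)). assert (W2 := gaussian_weight (p2 x)). assert (W3 := gaussian_weight (p3 x - rh t)).
  replace (cauchy_weight a 0 (p3 x - rh t)) with (cauchy_weight a (rh t) (p3 x)) in W3 by (unfold cauchy_weight; rewrite Rminus_0_r; auto).
  assert (Q : exp (2 * lamp t) <= exp (2 * K)).
  { apply exp_mono. generalize (hK t) (Rle_abs (lamp t)). lra. }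
  assert (Pk := kpi_pos). assert (Pa : 0 < a ^ 3) by (apply pow_lt, ha).
  apply Rle_trans with (kpi * / a ^ 3 * (exp (2 * K) * (a * cauchy_weight a 0 (p1 x)) * (a * cauchy_weight a 0 (p2 x)) * (a * cauchy_weight a (rh t) (p3 x)))).
  - apply Rmult_le_compat_l; [apply Rmult_le_pos; [lra | left; apply Rinv_0_lt_compat, Pa] |].
    generalize (exp_pos (2 * lamp t)) (exp_pos (- (p1 x ^ 2 * / a ^ 2))) (exp_pos (- (p2 x ^ 2 * / a ^ 2))) (exp_pos (- ((p3 x - rh t) ^ 2 * / a ^ 2))). intros.
    repeat apply Rmult_le_compat; auto; try lra; try (left; repeat apply Rmult_lt_0_compat; auto; fail).
  - right. field. lra.
Qed.

(** The constant [3 / 2] belongs to the cube of side [a] about the true position: the transversal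
    coordinates are at most [a / 2], and the longitudinal one, measured from [rh], is at most
    [a]. *)
Lemma density_lower t x : p1 x ^ 2 + p2 x ^ 2 + (p3 x - rh t) ^ 2 <= 3 / 2 * a ^ 2 ->
  kpi * / a ^ 3 * exp (- (2 * K) - 3 / 2) <= density t x.
Proof.
  intros H. unfold density. rewrite Nn_kpi. assert (Pk := kpi_pos). assert (Pa : 0 < a ^ 3) by (apply pow_lt, ha).
  apply Rmult_le_compat_l; [apply Rmult_le_pos; [lra | left; apply Rinv_0_lt_compat, Pa] |].
  apply exp_mono.
  assert ((p1 x ^ 2 + p2 x ^ 2 + (p3 x - rh t) ^ 2) * / a ^ 2 <= 3 / 2).
  { apply Rmult_le_reg_r with (a ^ 2); [apply pow_lt, ha |]. rewrite Rmult_assoc, Rinv_l by (apply pow_nonzero; lra). lra. }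
  generalize (hK t) (Rle_abs (- lamp t)). rewrite Rabs_Ropp. lra.
Qed.

Lemma density_far t x B : B * a ^ 2 <= p1 x ^ 2 + p2 x ^ 2 + (p3 x - rh t) ^ 2 ->
  density t x <= kpi * / a ^ 3 * exp (2 * K) * exp (- B).
Proof.
  intros H. unfold density. rewrite Nn_kpi. assert (Pk := kpi_pos). assert (Pa : 0 < a ^ 3) by (apply pow_lt, ha).
  replace (kpi * / a ^ 3 * exp (2 * K) * exp (- B)) with (kpi * / a ^ 3 * exp (2 * K + - B)) by (rewrite exp_plus; ring).
  apply Rmult_le_compat_l; [apply Rmult_le_pos; [lra | left; apply Rinv_0_lt_compat, Pa] |].
  apply exp_mono.
  assert (B <= (p1 x ^ 2 + p2 x ^ 2 + (p3 x - rh t) ^ 2) * / a ^ 2).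
  { apply Rmult_le_reg_r with (a ^ 2); [apply pow_lt, ha |]. rewrite Rmult_assoc, Rinv_l by (apply pow_nonzero; lra). lra. }
  generalize (hK t) (Rle_abs (lamp t)). lra.
Qed.

Variables (r : R -> R) (Rr : R).
Hypothesis hr : forall t, Rabs (rh t - r t) <= a / 2.
Hypothesis hR : a <= Rr /\ Rr + a / 2 <= 1 /\ Rr + a / 2 < L.

(** The balls are centred on the given trajectory [r], the solution on its average [rh]; the margin
    [a / 2] in [hR] pays for the difference. *)
Lemma box_unit_box t x : in_box (rhat r t) Rr x -> unit_box t x.
Proof.
  intros [B1 [B2 B3]]. unfold rhat, mk3, p1, p2, p3 in B1, B2, B3. cbn [fst snd] in B1, B2, B3.
  fold (p1 x) in B1. fold (p2 x) in B2. fold (p3 x) in B3. rewrite Rminus_0_r in B1, B2. specialize (hr t).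
  assert (Rabs (p3 x - rh t) <= Rr + a / 2).
  { replace (p3 x - rh t) with ((p3 x - r t) - (rh t - r t)) by ring.
    eapply Rle_trans; [apply Rabs_sub_le |]. lra. }
  unfold unit_box, tube. lra.
Qed.

Lemma box_norm t x : norm3 (sub3 x (rhat r t)) <= Rr -> unit_box t x.
Proof. intro H. apply box_unit_box, ball_in_box, H. Qed.

Lemma continuous_comoving k u t (x : P3) : CB top1 (strip L) k (fun _ => u) -> (k <= 6)%nat -> tube t (p3 x) ->
  continuous (fun x : P3 => comoving u t (p3 x)) x.
Proof.
  intros Hu Hk Hx. apply (continuous_comp (fun x : P3 => p3 x) (comoving u t)); [apply continuous_p3 |].
  apply (cont2_slice_r (comoving u)). apply (CB_cont top1 tube k (fun _ => comoving u) (CB_comoving k u Hk Hu) 0); auto; exact I.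
Qed.

Lemma continuous_poly_p (i : P3 -> R) (f : R -> R) (x : P3) : continuous i x -> ex_derive f (i x) ->
  continuous (fun x => f (i x)) x.
Proof.
  intros Hi Hf. apply (continuous_comp i f); [exact Hi |].
  apply (ex_derive_continuous (K := R_AbsRing) (V := R_NormedModule)), Hf.
Qed.

Lemma continuous_plus_R (f g : P3 -> R) x : continuous f x -> continuous g x -> continuous (fun x => f x + g x) x.
Proof. apply (continuous_plus (V := R_NormedModule) f g). Qed.

Lemma continuous_minus_R (f g : P3 -> R) x : continuous f x -> continuous g x -> continuous (fun x => f x - g x) x.
Proof. apply (continuous_minus (V := R_NormedModule) f g). Qed.

Lemma continuous_mult_R (f g : P3 -> R) x : continuous f x -> continuous g x -> continuous (fun x => f x * g x) x.
Proof. apply (continuous_mult (K := R_AbsRing) f g). Qed.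

Lemma continuous_sq_R (f : P3 -> R) x : continuous f x -> continuous (fun x => f x ^ 2) x.
Proof. intro H. apply (continuous_poly_p f (fun z => z ^ 2)); [exact H | auto_derive; auto]. Qed.

Lemma tube_near_x t x : tube t (p3 x) -> locally x (fun x' : P3 => tube t (p3 x')).
Proof. intro H. exact (continuous_p3 x _ (tube_near_z t (p3 x) H)). Qed.

Lemma continuous_quad t (x : P3) : continuous (fun x : P3 => p1 x ^ 2 + p2 x ^ 2 + (p3 x - rh t) ^ 2) x.
Proof.
  apply continuous_plus_R; [apply continuous_plus_R |]; apply continuous_sq_R; [apply continuous_p1 | apply continuous_p2 |].
  apply continuous_minus_R; [apply continuous_p3 | apply continuous_const].
Qed.

Lemma continuous_density t x : continuous (density t) x.
Proof.
  apply continuous_mult_R; [apply continuous_const |].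
  apply (continuous_poly_p (fun x => 2 * lamp t - (p1 x ^ 2 + p2 x ^ 2 + (p3 x - rh t) ^ 2) * / a ^ 2) exp).
  - apply continuous_minus_R; [apply continuous_const |]. apply continuous_mult_R; [apply continuous_quad | apply continuous_const].
  - auto_derive; auto.
Qed.

Lemma continuous_nonlinear t x : continuous (nonlinear_factor t) x.
Proof.
  apply continuous_mult_R; [apply continuous_const |]. apply continuous_plus_R; [| apply continuous_const].
  apply continuous_minus_R; [apply continuous_const |]. apply continuous_mult_R; [apply continuous_quad | apply continuous_const].
Qed.

Lemma continuous_spatial t x : tube t (p3 x) -> continuous (spatial_factor t) x.
Proof.
  intro H. apply continuous_plus_R.
  - apply continuous_mult_R; [apply continuous_const |].
    apply continuous_plus_R; [apply continuous_plus_R |]; apply continuous_sq_R;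
    (apply continuous_mult_R; [| apply continuous_const]); [apply continuous_p1 | apply continuous_p2 |].
    apply continuous_minus_R; [apply continuous_p3 | apply continuous_const].
  - apply continuous_sq_R. apply (continuous_comoving 3); first [assumption | lia].
Qed.

Lemma continuous_rate t (x : P3) : continuous (fun x : P3 => rate t (p3 x)) x.
Proof.
  apply (continuous_poly_p (fun x : P3 => p3 x) (rate t)); [apply continuous_p3 |]. unfold rate. auto_derive; auto.
Qed.

(** Continuity is transferred from the factored form, which is valid in a neighbourhood of [x]
    because [tube] is open. *)
Lemma continuous_conc t x : tube t (p3 x) -> continuous (conc_integrand c m chi a psi_sol t) x.
Proof.
  intro H. apply continuous_ext_loc with (fun x => density t x * conc_factor t x).
  - generalize (tube_near_x t x H). apply filter_imp. intros x' Hx'. symmetry. apply conc_factorization, Hx'.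
  - apply continuous_mult_R; [apply continuous_density |]. unfold conc_factor.
    apply continuous_plus_R; [| apply continuous_const].
    apply continuous_plus_R; [| apply (continuous_comp (nonlinear_factor t) Rabs); [apply continuous_nonlinear | apply continuous_Rabs]].
    apply continuous_plus_R; [| apply continuous_spatial, H].
    apply continuous_mult_R; [apply continuous_const |]. apply continuous_plus_R.
    + apply continuous_mult_R; [apply continuous_const |]. apply continuous_sq_R, continuous_rate.
    + apply continuous_sq_R. apply continuous_minus_R; [apply (continuous_comoving 2); [apply CB_Jt | lia | exact H] |].
      apply continuous_mult_R; [apply continuous_const |]. apply (continuous_comoving 3); first [assumption | lia].
Qed.

Lemma continuous_energy t x : tube t (p3 x) -> continuous (energy_density c m qe chi a phi_sol psi_sol t) x.
Proof.
  intro H. apply continuous_ext_loc with (fun x => m * c ^ 2 / 2 * density t x * energy_factor t x).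
  - generalize (tube_near_x t x H). apply filter_imp. intros x' Hx'. symmetry. apply energy_factorization, Hx'.
  - apply continuous_mult_R; [apply continuous_mult_R; [apply continuous_const | apply continuous_density] |].
    apply continuous_plus_R; [| apply continuous_const]. apply continuous_minus_R; [| apply continuous_nonlinear].
    apply continuous_plus_R; [| apply continuous_spatial, H]. apply continuous_plus_R.
    + apply continuous_mult_R; [apply continuous_const |]. apply continuous_mult_R; [apply continuous_const |].
      apply continuous_sq_R, continuous_rate.
    + apply continuous_sq_R. apply (continuous_comoving 3); first [assumption | lia].
Qed.

Lemma Rr_pos : 0 < Rr.
Proof. lra. Qed.

Lemma ball_int_clamped t (f : P3 -> R) :
  ball_int (rhat r t) Rr f = ball_int (rhat r t) Rr (fun x => f (clamp3 (rhat r t) Rr x)).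
Proof.
  assert (H := Rr_pos). apply ball_int_ext; [lra |]. intros x Hx. rewrite clamp3_id; auto. apply ball_in_box, Hx.
Qed.

Lemma ball_int_density_upper t (f : P3 -> R) (M : R) : 0 <= M ->
  (forall x, unit_box t x -> continuous f x) -> (forall x, unit_box t x -> f x <= M * density t x) ->
  ball_int (rhat r t) Rr f <= M * (kpi * exp (2 * K)) * PI * PI * PI.
Proof.
  intros HM Hc Hf. assert (HR := Rr_pos). rewrite ball_int_clamped.
  assert (Kp : 0 < kpi * exp (2 * K)) by (apply Rmult_lt_0_compat; [apply kpi_pos | apply exp_pos]).
  apply (ball_int_upper (rhat r t) Rr (fun x => f (clamp3 (rhat r t) Rr x)) HR) with (a := a) (c1 := 0) (c2 := 0) (c3 := rh t); auto.
  - apply continuous_clamped; [lra |]. intros x Hx. apply Hc, box_unit_box, Hx.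
  - apply Rmult_le_pos; lra.
  - intros x Hx. rewrite clamp3_id by (apply ball_in_box, Hx).
    eapply Rle_trans; [apply Hf, box_norm, Hx |]. rewrite !Rmult_assoc. apply Rmult_le_compat_l; auto.
    eapply Rle_trans; [apply density_upper |]. right; ring.
Qed.

Lemma conc_nonneg_const : 0 <= conc_const.
Proof.
  assert (H : unit_box 0 (mk3 0 0 (rh 0))).
  { unfold unit_box, tube, mk3, p1, p2, p3. cbn [fst snd]. rewrite Rminus_diag, Rabs_R0. lra. }
  generalize (conc_factor_bound 0 _ H). lra.
Qed.

Lemma energy_nonneg_const : 0 <= energy_const.
Proof.
  assert (H : unit_box 0 (mk3 0 0 (rh 0))).
  { unfold unit_box, tube, mk3, p1, p2, p3. cbn [fst snd]. rewrite Rminus_diag, Rabs_R0. lra. }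
  generalize (energy_factor_bound 0 _ H). lra.
Qed.

Lemma conc_ball_bound t :
  ball_int (rhat r t) Rr (conc_integrand c m chi a psi_sol t) <= conc_const * (kpi * exp (2 * K)) * PI * PI * PI.
Proof.
  apply ball_int_density_upper; [apply conc_nonneg_const | intros x Hx; apply continuous_conc, Hx |].
  intros x Hx. rewrite conc_factorization by apply Hx. rewrite Rmult_comm.
  apply Rmult_le_compat_r; [left; apply density_pos | apply conc_factor_bound, Hx].
Qed.

Lemma energy_ball_upper t :
  ball_int (rhat r t) Rr (energy_density c m qe chi a phi_sol psi_sol t)
    <= m * c ^ 2 / 2 * energy_const * (kpi * exp (2 * K)) * PI * PI * PI.
Proof.
  assert (Hm : 0 < m * c ^ 2 / 2) by (apply Rdiv_lt_0_compat; [apply Rmult_lt_0_compat; [auto | apply pow_lt; auto] | lra]).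
  apply ball_int_density_upper; [apply Rmult_le_pos; [lra | apply energy_nonneg_const] | intros x Hx; apply continuous_energy, Hx |].
  intros x Hx. rewrite energy_factorization by apply Hx.
  replace (m * c ^ 2 / 2 * density t x * energy_factor t x) with (m * c ^ 2 / 2 * energy_factor t x * density t x) by ring.
  apply Rmult_le_compat_r; [left; apply density_pos |]. apply Rmult_le_compat_l; [lra | apply energy_factor_bound, Hx].
Qed.

(** The density is of size [/ a ^ 3] on a cube of volume [a ^ 3], so the bound is independent of
    [a]. *)
Lemma energy_ball_lower t :
  m * c ^ 2 / 4 * kpi * exp (- (2 * K) - 3 / 2) <= ball_int (rhat r t) Rr (energy_density c m qe chi a phi_sol psi_sol t).
Proof.
  assert (HR := Rr_pos). rewrite ball_int_clamped.
  assert (Hm : 0 < m * c ^ 2 / 2) by (apply Rdiv_lt_0_compat; [apply Rmult_lt_0_compat; [auto | apply pow_lt; auto] | lra]).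
  assert (Kp : 0 < kpi * exp (- (2 * K) - 3 / 2)) by (apply Rmult_lt_0_compat; [apply kpi_pos | apply exp_pos]).
  assert (Low : forall x, unit_box t x -> m * c ^ 2 / 4 * density t x <= energy_density c m qe chi a phi_sol psi_sol t x).
  { intros x Hx. rewrite energy_factorization by apply Hx. assert (Q := energy_factor_bound t x Hx). assert (Dp := density_pos t x).
    assert (0 < m * c ^ 2 / 2 * density t x) by (apply Rmult_lt_0_compat; auto). nra. }
  assert (Pa : 0 < a ^ 3) by (apply pow_lt, ha).
  replace (m * c ^ 2 / 4 * kpi * exp (- (2 * K) - 3 / 2)) with
    ((m * c ^ 2 / 4 * (kpi * / a ^ 3 * exp (- (2 * K) - 3 / 2))) * a * a * a) by (field; lra).
  apply (ball_int_lower (rhat r t) Rr (fun x => energy_density c m qe chi a phi_sol psi_sol t (clamp3 (rhat r t) Rr x)) HR); auto; try lra.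
  - apply continuous_clamped; [lra |]. intros x Hx. apply continuous_energy, box_unit_box, Hx.
  - intros x Hx. rewrite clamp3_id by (apply ball_in_box, Hx).
    eapply Rle_trans; [| apply Low, box_norm, Hx]. apply Rmult_le_pos; [lra | left; apply density_pos].
  - intros x Hx.
    assert (Hx' : in_box (rhat r t) Rr x) by (destruct Hx as [? [? ?]]; unfold in_box; lra).
    rewrite clamp3_id by exact Hx'.
    eapply Rle_trans; [| apply Low, box_unit_box, Hx']. apply Rmult_le_compat_l; [lra |]. apply density_lower.
    destruct Hx as [B1 [B2 B3]]. unfold rhat, mk3, p1, p2, p3 in B1, B2, B3. cbn [fst snd] in B1, B2, B3.
    fold (p1 x) in B1. fold (p2 x) in B2. fold (p3 x) in B3. rewrite Rminus_0_r in B1, B2.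
    assert (B4 : Rabs (p3 x - rh t) <= a).
    { replace (p3 x - rh t) with ((p3 x - r t) - (rh t - r t)) by ring. specialize (hr t).
      eapply Rle_trans; [apply Rabs_sub_le |]. lra. }
    apply sq_le_of_abs in B1, B2, B4. lra.
Qed.

(** The centre of the Gaussian is within [a / 2 <= Rr / 2] of the centre of the sphere, so on the
    sphere the squared distance from it is at least [Rr ^ 2 / 4], which gives the exponent. *)
Lemma conc_sphere_bound t :
  sphere_int (rhat r t) Rr (conc_integrand c m chi a psi_sol t) <=
    Rr ^ 2 * (conc_const * (kpi * / a ^ 3 * exp (2 * K) * exp (- (Rr ^ 2 / (4 * a ^ 2))))) * (2 * PI) * PI.
Proof.
  assert (HR := Rr_pos). assert (Pa : 0 < a ^ 3) by (apply pow_lt, ha).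
  assert (P4 : 0 < kpi * / a ^ 3 * exp (2 * K) * exp (- (Rr ^ 2 / (4 * a ^ 2)))).
  { repeat apply Rmult_lt_0_compat; try apply exp_pos; [apply kpi_pos | apply Rinv_0_lt_compat, Pa]. }
  assert (In : forall x, norm3 (sub3 x (rhat r t)) = Rr -> in_box (rhat r t) Rr x) by (intros x Hx; apply ball_in_box; lra).
  rewrite (sphere_int_ext (rhat r t) Rr _ (fun x => conc_integrand c m chi a psi_sol t (clamp3 (rhat r t) Rr x)) HR).
  2: { intros x Hx. rewrite clamp3_id; auto. }
  apply (sphere_int_upper (rhat r t) Rr (fun x => conc_integrand c m chi a psi_sol t (clamp3 (rhat r t) Rr x)) HR).
  - apply continuous_clamped; [lra |]. intros x Hx. apply continuous_conc, box_unit_box, Hx.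
  - apply Rmult_le_pos; [apply conc_nonneg_const | lra].
  - intros x Hx. specialize (In x Hx). rewrite clamp3_id by exact In. assert (Hu := box_unit_box t x In).
    rewrite conc_factorization by apply Hu. rewrite Rmult_comm. assert (Q := conc_factor_bound t x Hu). assert (Dp := density_pos t x).
    apply Rmult_le_compat; try lra. apply density_far.
    assert (N : Rr ^ 2 = p1 x ^ 2 + p2 x ^ 2 + (p3 x - r t) ^ 2).
    { rewrite <- Hx. unfold norm3. rewrite pow2_sqrt.
      - unfold dot3, sub3, rhat, mk3, p1, p2, p3. simpl. ring.
      - unfold dot3. nra. }
    specialize (hr t). apply sq_le_of_abs in hr.
    replace (Rr ^ 2 / (4 * a ^ 2) * a ^ 2) with (Rr ^ 2 / 4) by (field; lra).
    assert ((p3 x - r t) ^ 2 <= 2 * (p3 x - rh t) ^ 2 + 2 * (rh t - r t) ^ 2).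
    { generalize (pow2_ge_0 ((p3 x - rh t) - (rh t - r t))). intro Z. nra. }
    assert (a ^ 2 <= Rr ^ 2) by (apply pow_incr; lra).
    generalize (pow2_ge_0 (p1 x)) (pow2_ge_0 (p2 x)). lra.
Qed.

End Bounds.

End KleinGordon.

(** * The limit potential *)

Section LipschitzBox.
Variables (V B : R).

Definition vbox (p q : R) : Prop := Rabs p <= V /\ Rabs q <= B.

(** Bounded and Lipschitz on the box of admissible pairs of velocity and acceleration. This algebra
    of functions yields constants before any trajectory is named. *)
Definition lip (F : R -> R -> R) : Prop :=
  exists K, 0 < K /\ (forall p q, vbox p q -> Rabs (F p q) <= K) /\
    forall p q p' q', vbox p q -> vbox p' q' -> Rabs (F p q - F p' q') <= K * (Rabs (p - p') + Rabs (q - q')).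

Lemma lip_const k : lip (fun _ _ => k).
Proof.
  exists (1 + Rabs k). generalize (Rabs_pos k). intro. split; [lra | split; [intros; lra |]].
  intros p q p' q' _ _. rewrite Rminus_diag, Rabs_R0. apply Rmult_le_pos; [lra |].
  apply Rplus_le_le_0_compat; apply Rabs_pos.
Qed.

Lemma lip_fst : lip (fun p _ => p).
Proof.
  exists (1 + Rabs V). generalize (Rabs_pos V) (Rle_abs V). intros. split; [lra | split].
  - intros p q [h _]. lra.
  - intros p q p' q' _ _. generalize (Rabs_pos (p - p')) (Rabs_pos (q - q')). intros. nra.
Qed.

Lemma lip_snd : lip (fun _ q => q).
Proof.
  exists (1 + Rabs B). generalize (Rabs_pos B) (Rle_abs B). intros. split; [lra | split].
  - intros p q [_ h]. lra.
  - intros p q p' q' _ _. generalize (Rabs_pos (p - p')) (Rabs_pos (q - q')). intros. nra.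
Qed.

Lemma lip_plus F G : lip F -> lip G -> lip (fun p q => F p q + G p q).
Proof.
  intros [K [k0 [k1 k2]]] [M [m0 [m1 m2]]]. exists (K + M). split; [lra | split].
  - intros p q h. eapply Rle_trans; [apply Rabs_triang |]. apply Rplus_le_compat; auto.
  - intros p q p' q' h h'. replace (F p q + G p q - (F p' q' + G p' q')) with ((F p q - F p' q') + (G p q - G p' q')) by ring.
    eapply Rle_trans; [apply Rabs_triang |]. rewrite Rmult_plus_distr_r. apply Rplus_le_compat; auto.
Qed.

Lemma lip_mult F G : lip F -> lip G -> lip (fun p q => F p q * G p q).
Proof.
  intros [K [k0 [k1 k2]]] [M [m0 [m1 m2]]]. exists (K * M + K * M). assert (0 < K * M) by (apply Rmult_lt_0_compat; auto).
  split; [lra | split].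
  - intros p q h. rewrite Rabs_mult. apply Rle_trans with (K * M); [| lra]. apply Rmult_le_compat; auto using Rabs_pos.
  - intros p q p' q' h h'. set (n := Rabs (p - p') + Rabs (q - q')).
    replace (F p q * G p q - F p' q' * G p' q') with (F p q * (G p q - G p' q') + (F p q - F p' q') * G p' q') by ring.
    eapply Rle_trans; [apply Rabs_triang |]. rewrite !Rabs_mult.
    replace ((K * M + K * M) * n) with (K * (M * n) + (K * n) * M) by ring.
    apply Rplus_le_compat; apply Rmult_le_compat; try apply Rabs_pos; auto.
Qed.

Lemma lip_ext F G : (forall p q, F p q = G p q) -> lip F -> lip G.
Proof.
  intros E [K [k0 [k1 k2]]]. exists K. split; [auto | split]; intros; rewrite <- !E; auto.
Qed.

Lemma lip_pow F n : lip F -> lip (fun p q => F p q ^ n).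
Proof. intro H. induction n as [|n IH]; [exact (lip_const 1) | exact (lip_mult F _ H IH)]. Qed.

End LipschitzBox.

Section Potential.
Variables (c eps1 B : R).
Hypothesis hc : 0 < c.
Hypothesis heps : 0 <= eps1 < 1.
Notation lip := (lip (eps1 * c) B).

(** The Lorentz factor divided by [c]. Here and below [p], [q], [s] stand for the velocity, the
    acceleration and the derivative of the latter. *)
Definition isq (p : R) : R := / sqrt (c ^ 2 - p ^ 2).
(** The value of [c * E + v * P] for [E = gam], [P = - gam * v / c], which equals [c / gam]. Times
    [- m * c] it is the Lagrangian of a free relativistic particle. *)
Definition rest_pot (p q : R) : R := (c ^ 2 - p ^ 2) * isq p.
Definition rest_pot1 (p q : R) : R := - (p * q) * isq p.
(** The time derivative of [gam * v], divided by [c], as [is_derive_momentum] confirms. *)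
Definition force (p q : R) : R := c ^ 2 * q * isq p ^ 3.
Definition force1 (p q s : R) : R := c ^ 2 * isq p ^ 3 * s + 3 * c ^ 2 * (isq p ^ 5 * p * q ^ 2).

Let g0 : R := (1 - eps1 ^ 2) * c ^ 2.
Let g0_pos : 0 < g0 := gap_min_pos c eps1 hc heps.

Lemma gap_box p : Rabs p <= eps1 * c -> g0 <= c ^ 2 - p ^ 2.
Proof.
  intro H. assert (p ^ 2 <= (eps1 * c) ^ 2). { rewrite <- (pow2_abs p). apply pow_incr. split; [apply Rabs_pos | auto]. }
  unfold g0. nra.
Qed.

Lemma isq_pos p : Rabs p <= eps1 * c -> 0 < isq p.
Proof. intro H. apply Rinv_0_lt_compat, sqrt_lt_R0. generalize (gap_box p H) g0_pos. lra. Qed.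

Lemma isq_sq p : Rabs p <= eps1 * c -> (c ^ 2 - p ^ 2) * isq p ^ 2 = 1.
Proof.
  intro H. assert (G : 0 < c ^ 2 - p ^ 2) by (generalize (gap_box p H) g0_pos; lra).
  unfold isq. rewrite pow_inv. rewrite pow2_sqrt by lra. field. lra.
Qed.

Lemma isq_le p : Rabs p <= eps1 * c -> isq p <= / sqrt g0.
Proof.
  intro H. apply Rinv_le_contravar; [apply sqrt_lt_R0, g0_pos | apply sqrt_le_1_alt, gap_box, H].
Qed.

Lemma lip_isq : lip (fun p _ => isq p).
Proof.
  set (k := / sqrt g0). assert (k0 : 0 < k) by (apply Rinv_0_lt_compat, sqrt_lt_R0, g0_pos).
  assert (P3 : 0 < c * k ^ 3) by (apply Rmult_lt_0_compat; auto; apply pow_lt; auto).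
  exists (k + c * k ^ 3). split; [lra | split].
  - intros p q [h _]. rewrite Rabs_right by (generalize (isq_pos p h); lra). generalize (isq_le p h). fold k. lra.
  - intros p q p' q' [h _] [h' _]. assert (I1 := isq_pos p h). assert (I2 := isq_pos p' h').
    assert (S1 := isq_sq p h). assert (S2 := isq_sq p' h'). assert (L1 := isq_le p h). assert (L2 := isq_le p' h'). fold k in L1, L2.
    set (s := isq p) in *. set (s' := isq p') in *.
    (* A consequence of [isq_sq] at both points; it replaces a differentiation of the square root
       and leaves only products of quantities bounded by [k] and [c]. *)
    assert (Q : (s - s') * (s + s') = (s * s') ^ 2 * ((p - p') * (p + p'))).
    { replace ((s - s') * (s + s')) with (s ^ 2 * ((c ^ 2 - p' ^ 2) * s' ^ 2) - ((c ^ 2 - p ^ 2) * s ^ 2) * s' ^ 2) by (rewrite S1, S2; ring). ring. }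
    assert (P2 : Rabs (p + p') <= 2 * c).
    { eapply Rle_trans; [apply Rabs_triang |]. nra. }
    assert (Q2 : Rabs (s - s') * (s + s') = (s * s') ^ 2 * (Rabs (p - p') * Rabs (p + p'))).
    { rewrite <- (Rabs_right (s + s')) by lra. rewrite <- Rabs_mult, Q, !Rabs_mult. f_equal. apply Rabs_right. apply Rle_ge, pow2_ge_0. }
    assert (Q3 : Rabs (s - s') <= c * k ^ 3 * Rabs (p - p')).
    { apply Rmult_le_reg_r with (s + s'); [lra |]. rewrite Q2.
      assert (s * s' * 2 <= k * (s + s')) by nra.
      assert (s * s' <= k * k) by (apply Rmult_le_compat; lra).
      assert (0 < s * s') by (apply Rmult_lt_0_compat; auto).
      assert (A1 : (s * s') ^ 2 * 2 <= k ^ 3 * (s + s')).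
      { replace ((s * s') ^ 2 * 2) with ((s * s') * (s * s' * 2)) by ring. replace (k ^ 3 * (s + s')) with ((k * k) * (k * (s + s'))) by ring.
        apply Rmult_le_compat; lra. }
      apply Rle_trans with ((s * s') ^ 2 * (Rabs (p - p') * (2 * c))).
      - apply Rmult_le_compat_l; [apply pow2_ge_0 |]. apply Rmult_le_compat_l; [apply Rabs_pos | auto].
      - replace (c * k ^ 3 * Rabs (p - p') * (s + s')) with (Rabs (p - p') * c * (k ^ 3 * (s + s'))) by ring.
        replace ((s * s') ^ 2 * (Rabs (p - p') * (2 * c))) with (Rabs (p - p') * c * ((s * s') ^ 2 * 2)) by ring.
        apply Rmult_le_compat_l; auto. apply Rmult_le_pos; [apply Rabs_pos | lra]. }
    generalize (Rabs_pos (p - p')) (Rabs_pos (q - q')). intros. nra.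
Qed.

Lemma lip_rest_pot : lip rest_pot.
Proof.
  apply (lip_ext _ _ (fun p _ => (c ^ 2 + -1 * p ^ 2) * isq p)); [intros; unfold rest_pot; ring |].
  apply (lip_mult _ _ (fun p _ => c ^ 2 + -1 * p ^ 2)); [| apply lip_isq].
  apply (lip_plus _ _ (fun _ _ => c ^ 2) (fun p _ => -1 * p ^ 2)); [apply lip_const |].
  apply (lip_mult _ _ (fun _ _ => -1) (fun p _ => p ^ 2)); [apply lip_const | apply (lip_pow _ _ (fun p _ => p)), lip_fst].
Qed.

Lemma lip_rest_pot1 : lip rest_pot1.
Proof.
  apply (lip_ext _ _ (fun p q => (-1 * (p * q)) * isq p)); [intros; unfold rest_pot1; ring |].
  apply (lip_mult _ _ (fun p q => -1 * (p * q))); [| apply lip_isq].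
  apply (lip_mult _ _ (fun _ _ => -1)); [apply lip_const | apply lip_mult; [apply lip_fst | apply lip_snd]].
Qed.

Lemma lip_force : lip force.
Proof.
  apply (lip_mult _ _ (fun p q => c ^ 2 * q)).
  - apply (lip_mult _ _ (fun _ _ => c ^ 2)); [apply lip_const | apply lip_snd].
  - apply (lip_pow _ _ (fun p _ => isq p)), lip_isq.
Qed.

Lemma force1_bound : exists W, 0 < W /\ forall p q s, vbox (eps1 * c) B p q -> Rabs s <= B -> Rabs (force1 p q s) <= W.
Proof.
  assert (Ls := lip_isq).
  assert (L1 : lip (fun p q => c ^ 2 * isq p ^ 3)).
  { apply (lip_mult _ _ (fun _ _ => c ^ 2)); [apply lip_const | apply (lip_pow _ _ (fun p _ => isq p)), Ls]. }
  assert (L2 : lip (fun p q => 3 * c ^ 2 * (isq p ^ 5 * p * q ^ 2))).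
  { apply (lip_mult _ _ (fun _ _ => 3 * c ^ 2)); [apply lip_const |].
    apply (lip_mult _ _ (fun p _ => isq p ^ 5 * p)); [apply (lip_mult _ _ (fun p _ => isq p ^ 5)) |].
    - apply (lip_pow _ _ (fun p _ => isq p)), Ls.
    - apply lip_fst.
    - apply (lip_pow _ _ (fun _ q => q)), lip_snd. }
  destruct L1 as [K1 [k1 [h1 _]]], L2 as [K2 [k2 [h2 _]]].
  exists (K1 * (1 + Rabs B) + K2). generalize (Rabs_pos B) (Rle_abs B). intros. split; [nra |].
  intros p q s hb hs. unfold force1. eapply Rle_trans; [apply Rabs_triang |]. apply Rplus_le_compat; [| apply (h2 p q hb)].
  rewrite Rabs_mult. apply Rmult_le_compat; try apply Rabs_pos; [apply (h1 p q hb) | lra].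
Qed.

Section Trajectory.
Variables v v1 v2 : R -> R.
Hypothesis hv : forall t, Rabs (v t) <= eps1 * c.
Hypothesis dv : forall t, is_derive v t (v1 t).
Hypothesis dv1 : forall t, is_derive v1 t (v2 t).

Lemma is_derive_isq t : is_derive (fun t => isq (v t)) t (v t * v1 t * isq (v t) ^ 3).
Proof.
  assert (G : 0 < c ^ 2 - v t ^ 2) by (generalize (gap_box _ (hv t)) g0_pos; lra).
  assert (S : 0 < sqrt (c ^ 2 - v t ^ 2)) by (apply sqrt_lt_R0; auto).
  assert (E : sqrt (c ^ 2 - v t ^ 2) ^ 2 = c ^ 2 - v t ^ 2) by (apply pow2_sqrt; lra).
  assert (D : is_derive (fun t => c ^ 2 - v t ^ 2) t (- (2 * v t * v1 t))).
  { auto_derive; [eexists; apply dv |]. rewrite (is_derive_unique (fun x : R => v x) _ _ (dv t)). ring. }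
  unfold isq. evar_last.
  - apply is_derive_inv; [| lra]. apply is_derive_sqrt; [exact D | auto].
  - match goal with |- ?l = ?r => change (l = r :> R) end. set (S0 := sqrt (c ^ 2 - v t ^ 2)) in *. field. lra.
Qed.

Lemma is_derive_rest_pot t : is_derive (fun t => rest_pot (v t) (v1 t)) t (rest_pot1 (v t) (v1 t)).
Proof.
  unfold rest_pot, rest_pot1.
  (* Only the algebraic relation of [isq (v t)] and its derivative matter, so it is generalized to a
     function [S] with these two properties. *)
  refine ((fun (S : R -> R) (Q : (c ^ 2 - v t ^ 2) * S t ^ 2 = 1) (DS : is_derive S t (v t * v1 t * S t ^ 3)) => _ :
    is_derive (fun t => (c ^ 2 - v t ^ 2) * S t) t (- (v t * v1 t) * S t)) (fun t => isq (v t)) (isq_sq _ (hv t)) (is_derive_isq t)).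
  auto_derive.
  - split; [eexists; apply dv | split; [eexists; apply DS | auto]].
  - rewrite (is_derive_unique (fun x : R => v x) _ _ (dv t)), (is_derive_unique (fun x : R => S x) _ _ DS).
    transitivity (- (2 * v t * v1 t * S t) + ((c ^ 2 - v t ^ 2) * S t ^ 2) * (v t * v1 t * S t)); [ring |].
    rewrite Q. ring.
Qed.

Lemma is_derive_force t : is_derive (fun t => force (v t) (v1 t)) t (force1 (v t) (v1 t) (v2 t)).
Proof.
  unfold force, force1.
  refine ((fun (S : R -> R) (DS : is_derive S t (v t * v1 t * S t ^ 3)) => _ :
    is_derive (fun t => c ^ 2 * v1 t * S t ^ 3) t (c ^ 2 * S t ^ 3 * v2 t + 3 * c ^ 2 * (S t ^ 5 * v t * v1 t ^ 2)))
    (fun t => isq (v t)) (is_derive_isq t)).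
  auto_derive.
  - split; [eexists; apply dv1 | split; [eexists; apply DS | auto]].
  - rewrite (is_derive_unique (fun x : R => v1 x) _ _ (dv1 t)), (is_derive_unique (fun x : R => S x) _ _ DS). ring.
Qed.

Lemma is_derive_momentum t : is_derive (fun t => isq (v t) * v t) t (force (v t) (v1 t)).
Proof.
  unfold force.
  refine ((fun (S : R -> R) (Q : (c ^ 2 - v t ^ 2) * S t ^ 2 = 1) (DS : is_derive S t (v t * v1 t * S t ^ 3)) => _ :
    is_derive (fun t => S t * v t) t (c ^ 2 * v1 t * S t ^ 3)) (fun t => isq (v t)) (isq_sq _ (hv t)) (is_derive_isq t)).
  auto_derive.
  - split; [eexists; apply DS | split; [eexists; apply dv | auto]].
  - rewrite (is_derive_unique (fun x : R => v x) _ _ (dv t)), (is_derive_unique (fun x : R => S x) _ _ DS).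
    transitivity (v1 t * S t * ((c ^ 2 - v t ^ 2) * S t ^ 2) + v1 t * v t ^ 2 * S t ^ 3); [rewrite Q; ring | ring].
Qed.

End Trajectory.
End Potential.

Lemma grad0_bound c (f : R -> P3 -> R) (Q : R -> R -> R) t x Dt Dz : 0 < c ->
  (forall s y, f s y = Q s (p3 y)) -> is_derive (fun s => Q s (p3 x)) t Dt -> is_derive (Q t) (p3 x) Dz ->
  grad0_norm c f t x <= Rabs Dt * / c + Rabs Dz.
Proof.
  intros hc Hf Ht Hz. unfold grad0_norm.
  assert (E0 : partial 0 f t x = Dt).
  { apply is_derive_unique. apply (is_derive_ext_R (fun s => Q s (p3 x))); auto. }
  assert (E1 : partial 1 f t x = 0).
  { apply is_derive_unique. apply (is_derive_ext_R (fun s => Q t (p3 x))); [intro s; rewrite Hf; auto | apply is_derive_const_R]. }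
  assert (E2 : partial 2 f t x = 0).
  { apply is_derive_unique. apply (is_derive_ext_R (fun s => Q t (p3 x))); [intro s; rewrite Hf; auto | apply is_derive_const_R]. }
  assert (E3 : partial 3 f t x = Dz).
  { apply is_derive_unique. apply (is_derive_ext_R (Q t)); [intro s; rewrite Hf; auto | exact Hz]. }
  rewrite E0, E1, E2, E3. assert (Ic : 0 < / c) by (apply Rinv_0_lt_compat; auto).
  assert (P0 : 0 <= Rabs Dt * / c + Rabs Dz).
  { apply Rplus_le_le_0_compat; [apply Rmult_le_pos; [apply Rabs_pos | lra] | apply Rabs_pos]. }
  rewrite <- (sqrt_pow2 _ P0). apply sqrt_le_1_alt.
  replace ((Dt / c) ^ 2) with ((Rabs Dt * / c) ^ 2) by (rewrite Rpow_mult_distr, pow2_abs; unfold Rdiv; ring).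
  rewrite <- (pow2_abs Dz). assert (0 <= Rabs Dt * / c) by (apply Rmult_le_pos; [apply Rabs_pos | lra]).
  generalize (Rabs_pos Dz). nra.
Qed.

Section PotentialEstimate.
Variables (c eps1 B k : R).
Hypothesis hc : 0 < c.
Hypothesis heps : 0 <= eps1 < 1.

(** Affine in [z], with [k] standing for [m * c / q]. The same formula serves for the given
    trajectory, where it is the limit potential, and for the averaged one, where it is the leading
    part of [phi]. *)
Definition limit_profile (r v v1 : R -> R) (t z : R) : R :=
  k * (rest_pot c (v t) (v1 t) + force c (v t) (v1 t) * (z - r t)).

Lemma is_derive_limit_t r v v1 v2 t z : (forall t, Rabs (v t) <= eps1 * c) ->
  is_derive r t (v t) -> (forall t, is_derive v t (v1 t)) -> (forall t, is_derive v1 t (v2 t)) ->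
  is_derive (fun s => limit_profile r v v1 s z) t
    (k * (rest_pot1 c (v t) (v1 t) + (force1 c (v t) (v1 t) (v2 t) * (z - r t) - force c (v t) (v1 t) * v t))).
Proof.
  intros hv dr dv dv1. unfold limit_profile.
  assert (D1 := is_derive_rest_pot c eps1 hc heps v v1 hv dv t).
  assert (D2 := is_derive_force c eps1 hc heps v v1 v2 hv dv dv1 t).
  set (S1 := fun t => rest_pot c (v t) (v1 t)) in *. set (S2 := fun t => force c (v t) (v1 t)) in *.
  change (is_derive (fun s => k * (S1 s + S2 s * (z - r s))) t
    (k * (rest_pot1 c (v t) (v1 t) + (force1 c (v t) (v1 t) (v2 t) * (z - r t) - S2 t * v t)))).
  clearbody S1 S2. auto_derive.
  - split; [eexists; apply D1 | split; [eexists; apply D2 | split; [eexists; apply dr | auto]]].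
  - rewrite (is_derive_unique (fun x : R => S1 x) _ _ D1), (is_derive_unique (fun x : R => S2 x) _ _ D2),
      (is_derive_unique (fun x : R => r x) _ _ dr). ring.
Qed.

Lemma is_derive_limit_z r v v1 t z :
  is_derive (fun z => limit_profile r v v1 t z) z (k * force c (v t) (v1 t)).
Proof. unfold limit_profile. auto_derive; [auto | ring]. Qed.

(* [M] is chosen before the trajectories, because the mollified one changes along the sequence. *)
Lemma potential_estimate : exists M, 0 < M /\
  forall r v v1 v2, (forall t, Rabs (v t) <= eps1 * c) -> (forall t, Rabs (v1 t) <= B) -> (forall t, Rabs (v2 t) <= B) ->
  (forall t, is_derive r t (v t)) -> (forall t, is_derive v t (v1 t)) -> (forall t, is_derive v1 t (v2 t)) ->
  (forall t, Rabs (k * rest_pot c (v t) (v1 t)) <= M /\ Rabs (k * force c (v t) (v1 t)) <= M /\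
     Rabs (k * force1 c (v t) (v1 t) (v2 t)) <= M) /\
  forall rh vh vh1 vh2, (forall t, Rabs (vh t) <= eps1 * c) -> (forall t, Rabs (vh1 t) <= B) -> (forall t, Rabs (vh2 t) <= B) ->
  (forall t, is_derive rh t (vh t)) -> (forall t, is_derive vh t (vh1 t)) -> (forall t, is_derive vh1 t (vh2 t)) ->
  forall (X : R -> R -> R) (A1 A2 d e rho t : R) (x : P3), 0 <= e <= 1 -> 0 <= rho <= 1 ->
  is_derive (fun s => X s (p3 x - rh s)) t A1 -> is_derive (fun z => X t (z - rh t)) (p3 x) A2 ->
  Rabs (d * X t (p3 x - rh t)) <= e -> Rabs (d * A1) <= e -> Rabs (d * A2) <= e ->
  Rabs (p3 x - rh t) <= rho -> Rabs (p3 x - r t) <= rho -> Rabs (vh t - v t) <= e -> Rabs (vh1 t - v1 t) <= e ->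
  forall phi phiinf, (forall t x, phi t x = limit_profile rh vh vh1 t (p3 x) + k * (d * X t (p3 x - rh t))) ->
  (forall t x, phiinf t x = limit_profile r v v1 t (p3 x)) ->
  Rabs (phi t x) + grad0_norm c phi t x <= M /\
  Rabs (phi t x - phiinf t x) + grad0_norm c (fun t x => phi t x - phiinf t x) t x <= M * (e + rho).
Proof.
  destruct (lip_rest_pot c eps1 B hc heps) as [K0 [K0p [K0b K0l]]].
  destruct (lip_rest_pot1 c eps1 B hc heps) as [K1 [K1p [K1b K1l]]].
  destruct (lip_force c eps1 B hc heps) as [K2 [K2p [K2b K2l]]].
  (* The product of force and velocity arises when the affine term is differentiated in time at a
     fixed point of space. *)
  destruct (lip_mult _ _ _ _ (lip_force c eps1 B hc heps) (lip_fst _ _)) as [K3 [K3p [K3b K3l]]].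
  destruct (force1_bound c eps1 B hc heps) as [W [Wp Wb]].
  set (N := 4 * (K0 + K1 + K2 + K3 + W + 1)). set (M := Rabs k * (2 * N + N * / c) + 1).
  assert (Ic : 0 < / c) by (apply Rinv_0_lt_compat; auto).
  assert (Np : 0 < N) by (unfold N; lra). assert (Pk := Rabs_pos k).
  assert (Nc : 0 < N * / c) by (apply Rmult_lt_0_compat; auto).
  assert (Mp : 0 < M) by (unfold M; nra).
  assert (small : forall u, Rabs u <= N -> Rabs (k * u) <= M).
  { intros u hu. rewrite Rabs_mult. unfold M. assert (Rabs k * Rabs u <= Rabs k * N) by (apply Rmult_le_compat_l; auto). nra. }
  assert (total : forall a b u w : R, 0 <= w -> Rabs a <= N * w -> Rabs b <= N * w -> Rabs u <= N * w ->
    Rabs (k * a) + (Rabs (k * b) * / c + Rabs (k * u)) <= M * w).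
  { intros a b u w hw ha hb hu. rewrite !Rabs_mult.
    assert (Rabs k * Rabs a <= Rabs k * (N * w)) by (apply Rmult_le_compat_l; auto).
    assert (Rabs k * Rabs u <= Rabs k * (N * w)) by (apply Rmult_le_compat_l; auto).
    assert (Rabs k * Rabs b * / c <= Rabs k * (N * w) * / c) by (apply Rmult_le_compat_r; [lra | apply Rmult_le_compat_l; auto]).
    unfold M. nra. }
  exists M. split; [exact Mp |]. intros r v v1 v2 hv hv1 hv2 dr dv dv1. split.
  { intro t. assert (Bx : vbox (eps1 * c) B (v t) (v1 t)) by (split; auto).
    generalize (K0b _ _ Bx) (K2b _ _ Bx) (Wb _ _ (v2 t) Bx (hv2 t)). intros.
    refine (conj _ (conj _ _)); apply small; unfold N; lra. }
  intros rh vh vh1 vh2 hvh hvh1 hvh2 drh dvh dvh1 X A1 A2 d e rho t x He Hr DX1 DX2 hX hA1 hA2 hy hy0 hdv hdv1 phi phiinf Ephi Einf.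
  set (z := p3 x) in *.
  assert (Bx : vbox (eps1 * c) B (v t) (v1 t)) by (split; auto).
  assert (Bh : vbox (eps1 * c) B (vh t) (vh1 t)) by (split; auto).
  assert (T1 := is_derive_limit_t rh vh vh1 vh2 t z hvh (drh t) dvh dvh1).
  assert (T2 := is_derive_limit_t r v v1 v2 t z hv (dr t) dv dv1).
  assert (Z1 := is_derive_limit_z rh vh vh1 t z). assert (Z2 := is_derive_limit_z r v v1 t z).
  generalize (K0b _ _ Bh) (K1b _ _ Bh) (K2b _ _ Bh) (K3b _ _ Bh) (Wb _ _ (vh2 t) Bh (hvh2 t)).
  generalize (K0b _ _ Bx) (K1b _ _ Bx) (K2b _ _ Bx) (K3b _ _ Bx) (Wb _ _ (v2 t) Bx (hv2 t)).
  generalize (K0l _ _ _ _ Bh Bx) (K1l _ _ _ _ Bh Bx) (K2l _ _ _ _ Bh Bx) (K3l _ _ _ _ Bh Bx).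
  assert (nb : Rabs (vh t - v t) + Rabs (vh1 t - v1 t) <= 2 * e) by lra.
  set (n := Rabs (vh t - v t) + Rabs (vh1 t - v1 t)) in *.
  set (F0 := rest_pot c (v t) (v1 t)) in *. set (G0 := rest_pot c (vh t) (vh1 t)) in *.
  set (F1 := rest_pot1 c (v t) (v1 t)) in *. set (G1 := rest_pot1 c (vh t) (vh1 t)) in *.
  set (F2 := force c (v t) (v1 t)) in *. set (G2 := force c (vh t) (vh1 t)) in *.
  set (F3 := force1 c (v t) (v1 t) (v2 t)) in *. set (G3 := force1 c (vh t) (vh1 t) (vh2 t)) in *.
  set (y := z - rh t) in *. set (y0 := z - r t) in *.
  intros l0 l1 l2 l3 b0 b1 b2 b3 b4 h0 h1 h2 h3 h4.
  assert (prod : forall u w a b : R, Rabs u <= a -> Rabs w <= b -> Rabs (u * w) <= a * b).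
  { intros. rewrite Rabs_mult. apply Rmult_le_compat; auto using Rabs_pos. }
  assert (q1 := prod _ _ _ _ h2 hy). assert (q2 := prod _ _ _ _ b2 hy0).
  (* [force1] contains the second derivative of the velocity, for which the two trajectories are not
     known to be close. Its values are therefore only bounded; smallness comes from the distances
     [y] and [y0], which are at most [rho]. *)
  assert (q3 := prod _ _ _ _ h4 hy). assert (q4 := prod _ _ _ _ b4 hy0).
  assert (i0 : K0 * n <= K0 * (2 * e)) by (apply Rmult_le_compat_l; lra).
  assert (i1 : K1 * n <= K1 * (2 * e)) by (apply Rmult_le_compat_l; lra).
  assert (i2 : K2 * n <= K2 * (2 * e)) by (apply Rmult_le_compat_l; lra).
  assert (i3 : K3 * n <= K3 * (2 * e)) by (apply Rmult_le_compat_l; lra).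
  apply Rabs_le_between in q1, q2, q3, q4, hX, hA1, hA2, h0, h1, h2, h3, h4, l0, l1, l2, l3.
  assert (r2 : K2 * rho <= K2 * 1) by (apply Rmult_le_compat_l; lra).
  assert (r4 : W * rho <= W * 1) by (apply Rmult_le_compat_l; lra).
  assert (p0 : 0 <= K0 * e) by (apply Rmult_le_pos; lra). assert (p1 : 0 <= K1 * e) by (apply Rmult_le_pos; lra).
  assert (p2 : 0 <= K2 * e) by (apply Rmult_le_pos; lra). assert (p3 : 0 <= K3 * e) by (apply Rmult_le_pos; lra).
  assert (p4 : 0 <= W * e) by (apply Rmult_le_pos; lra).
  assert (s0 : 0 <= K0 * rho) by (apply Rmult_le_pos; lra). assert (s1 : 0 <= K1 * rho) by (apply Rmult_le_pos; lra).
  assert (s2 : 0 <= K2 * rho) by (apply Rmult_le_pos; lra). assert (s3 : 0 <= K3 * rho) by (apply Rmult_le_pos; lra).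
  assert (s4 : 0 <= W * rho) by (apply Rmult_le_pos; lra).
  split.
  - assert (Gr : grad0_norm c phi t x <= Rabs (k * (G1 + (G3 * y - G2 * vh t) + d * A1)) * / c + Rabs (k * (G2 + d * A2))).
    { apply (grad0_bound c phi (fun t z => limit_profile rh vh vh1 t z + k * (d * X t (z - rh t)))); auto.
      - replace (k * (G1 + (G3 * y - G2 * vh t) + d * A1)) with (k * (G1 + (G3 * y - G2 * vh t)) + k * (d * A1)) by ring.
        apply (is_derive_plus (V := R_NormedModule)); [exact T1 |]. apply is_derive_scal, is_derive_scal, DX1.
      - rewrite Rmult_plus_distr_l. apply (is_derive_plus (V := R_NormedModule)); [exact Z1 |]. apply is_derive_scal, is_derive_scal, DX2. }
    eapply Rle_trans; [apply Rplus_le_compat_l, Gr |]. rewrite Ephi. unfold limit_profile. fold z y G0 G2. rewrite <- Rmult_plus_distr_l.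
    rewrite <- (Rmult_1_r M). apply total; [lra | ..]; rewrite Rmult_1_r; apply Rabs_le_between; unfold N; lra.
  - assert (Gr : grad0_norm c (fun t x => phi t x - phiinf t x) t x <=
      Rabs (k * (G1 + (G3 * y - G2 * vh t) + d * A1 - (F1 + (F3 * y0 - F2 * v t)))) * / c + Rabs (k * (G2 + d * A2 - F2))).
    { apply (grad0_bound c _ (fun t z => limit_profile rh vh vh1 t z + k * (d * X t (z - rh t)) - limit_profile r v v1 t z)); auto.
      - intros. rewrite Ephi, Einf. reflexivity.
      - replace (k * (G1 + (G3 * y - G2 * vh t) + d * A1 - (F1 + (F3 * y0 - F2 * v t)))) with
          (k * (G1 + (G3 * y - G2 * vh t)) + k * (d * A1) - k * (F1 + (F3 * y0 - F2 * v t))) by ring.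
        apply (is_derive_minus (V := R_NormedModule)); [| exact T2].
        apply (is_derive_plus (V := R_NormedModule)); [exact T1 |]. apply is_derive_scal, is_derive_scal, DX1.
      - replace (k * (G2 + d * A2 - F2)) with (k * G2 + k * (d * A2) - k * F2) by ring.
        apply (is_derive_minus (V := R_NormedModule)); [| exact Z2].
        apply (is_derive_plus (V := R_NormedModule)); [exact Z1 |]. apply is_derive_scal, is_derive_scal, DX2. }
    eapply Rle_trans; [apply Rplus_le_compat_l, Gr |]. rewrite Ephi, Einf. unfold limit_profile. fold z y y0 G0 G2 F0 F2.
    replace (k * (G0 + G2 * y) + k * (d * X t y) - k * (F0 + F2 * y0)) with (k * (G0 + G2 * y + d * X t y - (F0 + F2 * y0))) by ring.
    apply total; [lra | ..]; apply Rabs_le_between; unfold N; lra.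
Qed.

End PotentialEstimate.

(** * Constants common to all averaged trajectories, and the fluid for one of them *)

Section Uniform.
Variables (c L eps1 B : R).
Hypothesis hc : 0 < c.
Hypothesis hL : 0 < L.
Hypothesis heps : 0 <= eps1 < 1.

Lemma gam_isq v t : gam c v t = c * isq c (v t).
Proof. reflexivity. Qed.

(** One constant that will serve as each of [K], [K1], [KE], [KP], [KJ] in the energy estimates,
    whatever the averaged trajectory. The added 1 leaves room for the perturbation of order [d]. *)
Lemma trajectory_bounds : exists K, 0 < K /\ forall v v1,
  (forall t, Rabs (v t) <= eps1 * c) -> (forall t, Rabs (v1 t) <= B) ->
  forall t, Rabs (lamp c v t) <= K /\ Rabs (lamp1 c v v1 t) <= K /\ Rabs (gam c v t) + 1 <= K /\
    Rabs (gam c v t * (v t * / c)) + 1 <= K /\ Rabs (force c (v t) (v1 t)) * L + 1 <= K.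
Proof.
  assert (Ls := lip_isq c eps1 B hc heps).
  destruct (lip_mult _ _ _ _ (lip_mult _ _ _ _ (lip_fst (eps1 * c) B) (lip_snd _ _)) (lip_pow _ _ _ 2 Ls)) as [K1 [k1 [b1 _]]].
  destruct Ls as [K2 [k2 [b2 _]]]. destruct (lip_force c eps1 B hc heps) as [K3 [k3 [b3 _]]].
  set (l := - ln (1 - eps1 ^ 2)).
  assert (l0 : 0 <= l).
  { unfold l. assert (ln (1 - eps1 ^ 2) <= 0); [| lra]. rewrite <- ln_1. destruct (Req_dec (eps1 ^ 2) 0) as [-> | ne]; [rewrite Rminus_0_r; lra |].
    left. apply ln_increasing; nra. }
  assert (p1 : 0 < c * K2) by (apply Rmult_lt_0_compat; auto). assert (p2 : 0 < K3 * L) by (apply Rmult_lt_0_compat; auto).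
  exists (l + K1 + c * K2 + K3 * L + 1). split; [lra |]. intros v v1 hv hv1 t.
  assert (Bx : vbox (eps1 * c) B (v t) (v1 t)) by (split; auto).
  specialize (b1 _ _ Bx). specialize (b2 _ _ Bx). specialize (b3 _ _ Bx).
  assert (G := gap_lower c eps1 v hv t). assert (G0 := gap_min_pos c eps1 hc heps).
  assert (c2 : 0 < c ^ 2) by (apply pow_lt; auto).
  assert (Gm : Rabs (gam c v t) <= c * K2).
  { rewrite gam_isq, Rabs_mult, (Rabs_right c) by lra. apply Rmult_le_compat_l; lra. }
  refine (conj _ (conj _ (conj _ (conj _ _)))).
  - apply Rle_trans with l; [| lra]. unfold lamp. set (w := gap c v t * / c ^ 2).
    assert (w1 : 1 - eps1 ^ 2 <= w).
    { unfold w. apply Rmult_le_reg_r with (c ^ 2); auto. rewrite Rmult_assoc, Rinv_l by lra. lra. }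
    assert (w2 : w <= 1).
    { unfold w. apply Rmult_le_reg_r with (c ^ 2); auto. rewrite Rmult_assoc, Rinv_l by lra. unfold gap. generalize (pow2_ge_0 (v t)). lra. }
    assert (w0 : 0 < 1 - eps1 ^ 2) by nra.
    assert (- l <= ln w) by (unfold l; rewrite Ropp_involutive; destruct w1 as [w1 | <-]; [left; apply ln_increasing; auto | lra]).
    assert (ln w <= 0) by (rewrite <- ln_1; destruct w2 as [w2 | ->]; [left; apply ln_increasing; lra | lra]).
    apply Rabs_le_between. lra.
  - apply Rle_trans with K1; [| lra].
    replace (lamp1 c v v1 t) with (- / 2 * (v t * v1 t * isq c (v t) ^ 2)).
    + rewrite Rabs_mult, Rabs_Ropp, (Rabs_right (/ 2)) by lra. generalize (Rabs_pos (v t * v1 t * isq c (v t) ^ 2)). lra.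
    + unfold lamp1. assert (Q := isq_sq c eps1 hc heps _ (hv t)). fold (gap c v t) in Q.
      assert (gp : 0 < gap c v t) by lra.
      apply Rmult_eq_reg_l with (gap c v t); [| lra].
      transitivity (- / 2 * (v t * v1 t) * (gap c v t * isq c (v t) ^ 2)); [ring | rewrite Q; field; lra].
  - lra.
  - assert (Rabs (gam c v t * (v t * / c)) <= c * K2 * 1); [| lra].
    rewrite Rabs_mult. apply Rmult_le_compat; auto using Rabs_pos.
    rewrite Rabs_mult, (Rabs_right (/ c)) by (left; apply Rinv_0_lt_compat; auto).
    apply Rmult_le_reg_r with c; auto. rewrite Rmult_assoc, Rinv_l by lra. specialize (hv t). nra.
  - assert (Rabs (force c (v t) (v1 t)) * L <= K3 * L) by (apply Rmult_le_compat_r; lra). lra.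
Qed.

Section Perturb.
Variables (a : R) (rh v v1 v2 : R -> R).
Hypothesis ha : 0 < a.
Hypothesis hv : forall t, Rabs (v t) <= eps1 * c.
Hypothesis hv1 : forall t, Rabs (v1 t) <= B.
Hypothesis dr : forall t, is_derive rh t (v t).
Hypothesis dv : forall t, is_derive v t (v1 t).
Hypothesis Cv : CB top1 top2 6 (fun _ t _ => v t).
Hypothesis Cv1 : CB top1 top2 5 (fun _ t _ => v1 t).
Hypothesis Cv2 : CB top1 top2 4 (fun _ t _ => v2 t).
Hypothesis hLB : 32 * (2 * B * c ^ 2 * / ((1 - eps1 ^ 2) * c ^ 2) ^ 2) * L <= 1.

(* [d] plays the role of [/ kap ^ 2], and [d * X] is the deviation of the potential from an affine one. *)
Lemma fluid_small s : 0 < s <= 1 -> exists d E P J X, 0 < d <= s /\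
  CB top1 (strip L) 3 (fun _ => E) /\ CB top1 (strip L) 3 (fun _ => P) /\
  (forall t y, Rabs y < L -> E t y ^ 2 - P t y ^ 2 = 1 + d * Mass c a v v1 v2 t y /\
    forall Et Ey Py, is_derive (fun x => E x y) t Et -> is_derive (fun x => E t x) y Ey -> is_derive (fun x => P t x) y Py ->
    2 * (lamp1 c v v1 t + v t * (y * / a ^ 2)) * E t y + Et - v t * Ey = c * (Py - 2 * (y * / a ^ 2) * P t y)) /\
  (forall t y, Rabs y < L -> is_derive (fun x => primitive P x y) t (J t y)) /\
  (forall t y, Rabs y < L -> Rabs (E t y) <= Rabs (gam c v t) + 1 /\ Rabs (P t y) <= Rabs (gam c v t * (v t * / c)) + 1 /\
    Rabs (J t y) <= Rabs (force c (v t) (v1 t)) * L + 1) /\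
  (forall t y, c * E t y + v t * P t y - J t y = rest_pot c (v t) (v1 t) + force c (v t) (v1 t) * y + d * X t y) /\
  (forall t z, Rabs (z - rh t) < L -> exists A1 A2, is_derive (fun s => X s (z - rh s)) t A1 /\
    is_derive (fun z => X t (z - rh t)) z A2 /\ Rabs (d * X t (z - rh t)) <= s /\ Rabs (d * A1) <= s /\ Rabs (d * A2) <= s).
Proof.
  intros hs.
  destruct (fluid_solution c a L eps1 B v v1 v2 hc ha hL heps hv hv1 dv Cv Cv1 Cv2 hLB) as [dl1 [E1 [P1 [Hd1 [CE1 [CP1 HF]]]]]].
  set (D := fun d => 0 < d < dl1) in *.
  assert (CI := CB_RInt D L hL P1 3 CP1). pose proof CI as [_ [_ [J1 [Iy [DJ [_ [CJ _]]]]]]].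
  assert (CV2 : CB D (strip L) 2 (fun _ t _ => v t)) by (apply CB_time; apply CB_le with 6%nat; auto).
  assert (OS := strip_open L).
  set (X := fun d t y => c * E1 d t y + v t * P1 d t y - J1 d t y).
  assert (CX : CB D (strip L) 2 X).
  { unfold X. apply CB_minus; auto. apply CB_plus; auto; apply CB_mult; auto; try apply CB_const; apply CB_S; auto. }
  pose proof CX as [_ [_ [Xt [Xy [DXt [DXy [CXt CXy]]]]]]].
  destruct (CB_bound_pos _ _ _ _ CE1) as [M1 [m1 B1]]. destruct (CB_bound_pos _ _ _ _ CP1) as [M2 [m2 B2]].
  destruct (CB_bound_pos _ _ _ _ CJ) as [M3 [m3 B3]]. destruct (CB_bound_pos _ _ _ _ CX) as [M4 [m4 B4]].
  destruct (CB_bound_pos _ _ _ _ CXt) as [M5 [m5 B5]]. destruct (CB_bound_pos _ _ _ _ CXy) as [M6 [m6 B6]].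
  set (M := M1 + M2 + M3 + M4 + M5 + c * M6 + M6 + 1).
  assert (cM : 0 < c * M6) by (apply Rmult_lt_0_compat; auto).
  assert (Mp : 1 <= M) by (unfold M; lra).
  (* [M] bounds everything that is multiplied by [d]. It depends on [a] and on high derivatives of
     the trajectory, so [d] can only be chosen here. *)
  set (d := Rmin (dl1 / 2) (s * / M)).
  assert (sM : 0 < s * / M) by (apply Rmult_lt_0_compat; [lra | apply Rinv_0_lt_compat; lra]).
  assert (d0 : 0 < d) by (apply Rmin_pos; lra).
  assert (Dd : D d) by (split; auto; generalize (Rmin_l (dl1 / 2) (s * / M)); fold d; lra).
  assert (dM : d * M <= s).
  { apply Rle_trans with (s * / M * M); [apply Rmult_le_compat_r; [lra | apply Rmin_r] | right; field; lra]. }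
  assert (small : forall u, Rabs u <= M -> Rabs (d * u) <= s).
  { intros u hu. rewrite Rabs_mult, (Rabs_right d) by lra. eapply Rle_trans; [| exact dM]. apply Rmult_le_compat_l; lra. }
  set (E := fun t y => gam c v t + d * E1 d t y). set (P := fun t y => - (gam c v t * (v t * / c)) + d * P1 d t y).
  set (J := fun t y => - (force c (v t) (v1 t) * y) + d * J1 d t y).
  assert (Cg : CB top1 (strip L) 3 (fun _ t _ => gam c v t)).
  { apply CB_time. apply CB_le with 6%nat; [lia |]. apply (CB_gam c eps1); auto. }
  assert (CV3 : CB top1 (strip L) 3 (fun _ t _ => v t)) by (apply CB_time; apply CB_le with 6%nat; [lia | auto]).
  assert (CE : CB top1 (strip L) 3 (fun _ => E)).
  { apply (CB_plus top1 (strip L) 3 (fun _ t _ => gam c v t) (fun _ t y => d * E1 d t y)); auto.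
    apply CB_mult; auto; [apply CB_const | apply CB_fix with D; auto]. }
  assert (CP : CB top1 (strip L) 3 (fun _ => P)).
  { apply (CB_plus top1 (strip L) 3 (fun _ t _ => - (gam c v t * (v t * / c))) (fun _ t y => d * P1 d t y)).
    - apply CB_opp; auto. apply CB_mult; auto. apply CB_mult; auto. apply CB_const.
    - apply CB_mult; auto; [apply CB_const | apply CB_fix with D; auto]. }
  assert (mom : forall t, gam c v t * (v t * / c) = isq c (v t) * v t) by (intro t; rewrite gam_isq; field; lra).
  assert (HD : forall t y, Rabs y < L -> is_derive (fun x => primitive P x y) t (J t y)).
  (* The leading part of [P] does not depend on [y], so its primitive is linear in [y], and the time
     derivative of that is minus the force times [y]. *)
  { intros t y Hy. apply (is_derive_ext_R (fun x => - y * (isq c (v x) * v x) + d * RInt (P1 d x) 0 y)).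
    - intros x. unfold primitive, P. symmetry.
      assert (S1 : SC L (P1 d x)) by (apply (SC2_SC L (P1 d)); eapply SC2_of_CB; eauto).
      rewrite (RInt_ext_R _ (fun z => - (isq c (v x) * v x) + d * P1 d x z)) by (intros; rewrite mom; reflexivity).
      assert (I2 := SC_ex_RInt L _ y S1 Hy).
      assert (R1 := RInt_plus (V := R_CompleteNormedModule) (fun _ => - (isq c (v x) * v x)) (fun z => d * P1 d x z) 0 y
        (ex_RInt_const 0 y _) (ex_RInt_scal (V := R_NormedModule) (P1 d x) 0 y d I2)).
      assert (R2 := RInt_scal (V := R_CompleteNormedModule) (P1 d x) 0 y d I2).
      assert (R3 := RInt_const (V := R_CompleteNormedModule) 0 y (- (isq c (v x) * v x))).
      unfold plus, scal in *; simpl in *. unfold mult in *; simpl in *.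
      eapply eq_trans; [exact R1 |]. eapply eq_trans; [apply f_equal2; [exact R3 | exact R2] |].
      set (I0 := RInt (P1 d x) 0 y : R). match goal with |- ?l = ?r => change (l = r :> R) end. ring.
    - unfold J. replace (- (force c (v t) (v1 t) * y)) with (- y * force c (v t) (v1 t)) by ring.
      apply (is_derive_plus (V := R_NormedModule)).
      + apply is_derive_scal. apply (is_derive_momentum c eps1); auto.
      + apply is_derive_scal. apply DJ; auto. }
  exists d, E, P, J, (X d).
  assert (ds : d <= s) by nra.
  refine (conj (conj d0 ds) (conj CE (conj CP (conj _ (conj HD (conj _ (conj _ _))))))).
  - intros t y Hy. destruct (HF d t y Dd Hy) as [_ [H2 H3]]. split; [exact H2 | exact H3].
  - intros t y Hy. specialize (B1 d t y Dd Hy). specialize (B2 d t y Dd Hy). specialize (B3 d t y Dd Hy).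
    unfold E, P, J. refine (conj _ (conj _ _)); (eapply Rle_trans; [apply Rabs_triang |]); rewrite ?Rabs_Ropp; apply Rplus_le_compat; try lra.
    + eapply Rle_trans; [apply small; unfold M; lra | lra].
    + eapply Rle_trans; [apply small; unfold M; lra | lra].
    + rewrite Rabs_mult. apply Rmult_le_compat_l; [apply Rabs_pos | lra].
    + eapply Rle_trans; [apply small; unfold M; lra | lra].
  - intros t y. unfold E, P, J, X. rewrite mom, gam_isq. unfold rest_pot. ring.
  - intros t z Hz. assert (CX1 := CB_fix D (strip L) 2 X d CX Dd).
    specialize (B4 d t _ Dd Hz). specialize (B5 d t _ Dd Hz). specialize (B6 d t _ Dd Hz).
    destruct (is_derive_comoving L rh v dr 1 (X d) CX1) as [ut [uy [_ [_ H]]]].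
    destruct (H t _ Hz) as [H1 [H2 H3]]. destruct (H3 z eq_refl) as [H4 H5].
    assert (U1 : ut t (z - rh t) = Xt d t (z - rh t)).
    { rewrite <- (is_derive_unique _ _ _ H1). apply is_derive_unique, DXt; auto. }
    assert (U2 : uy t (z - rh t) = Xy d t (z - rh t)).
    { rewrite <- (is_derive_unique _ _ _ H2). apply is_derive_unique, DXy; auto. }
    rewrite U1, U2 in *. eexists; eexists. refine (conj H4 (conj H5 (conj _ (conj _ _)))).
    + apply small. unfold M. lra.
    + apply small. eapply Rle_trans; [apply Rabs_sub_le |]. rewrite Rabs_mult.
      assert (Rabs (v t) * Rabs (Xy d t (z - rh t)) <= c * M6).
      { apply Rmult_le_compat; try apply Rabs_pos; auto. specialize (hv t). nra. }
      unfold M. lra.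
    + apply small. unfold M. lra.
Qed.

End Perturb.
End Uniform.

(** The sphere bound contains [b ^ 2 / a ^ 3 = / b ^ 4] for [a = b ^ 2], and the exponent is
    [u = / (4 * b ^ 2)]. The square of [/ u] would just compensate this; the cube leaves a factor
    [b ^ 2]. *)
Lemma exp_neg_cube u : 0 < u -> exp (- u) <= 27 * / u ^ 3.
Proof.
  intro hu. assert (H : (u / 3) ^ 3 <= exp u).
  { replace (exp u) with (exp (u / 3) ^ 3) by (simpl; rewrite Rmult_1_r, <- !exp_plus; f_equal; field).
    apply pow_incr. generalize (exp_ineq1 (u / 3)). lra. }
  assert (0 < u ^ 3) by (apply pow_lt; auto).
  rewrite exp_Ropp. replace (27 * / u ^ 3) with (/ (u / 3) ^ 3) by (field; lra).
  apply Rinv_le_contravar; auto. apply pow_lt. lra.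
Qed.

(** * Construction of the sequence *)

Section Core.
Variables (c m q : R).
Hypothesis hc : 0 < c.
Hypothesis hm : 0 < m.
Hypothesis hq : q <> 0.
Variables (r v v1 v2 : R -> R) (B eps1 : R).
Hypothesis heps : 0 <= eps1 < 1.
Hypothesis dr : forall t, is_derive r t (v t).
Hypothesis dv : forall t, is_derive v t (v1 t).
Hypothesis dv1 : forall t, is_derive v1 t (v2 t).
Hypothesis cv2 : forall t, continuous v2 t.
Hypothesis hB : forall t, Rabs (v t) <= B /\ Rabs (v1 t) <= B /\ Rabs (v2 t) <= B.
Hypothesis hv : forall t, Rabs (v t) <= eps1 * c.

Definition pot_value (t : R) : R := m * c / q * rest_pot c (v t) (v1 t).
Definition pot_slope (t : R) : P3 := mk3 0 0 (m * c / q * force c (v t) (v1 t)).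
Definition pot_limit (t : R) (x : P3) : R := pot_value t + dot3 (sub3 x (rhat r t)) (pot_slope t).

Lemma pot_limit_profile t x : pot_limit t x = limit_profile c (m * c / q) r v v1 t (p3 x).
Proof.
  unfold pot_limit, pot_value, pot_slope, limit_profile, dot3, sub3, rhat, mk3, p1, p2, p3. cbn [fst snd]. ring.
Qed.

(** One solution for each accuracy [e], with [M] and [c0] chosen before [e]. All bounds hold for
    every real time, so the interval of the theorem does not enter. *)
Lemma approximate_solutions : exists M c0, 0 < c0 /\
  (forall t, Rabs (pot_value t) <= M /\ norm3 (pot_slope t) <= M /\
    norm3 (mk3 (Derive (fun s => p1 (pot_slope s)) t) (Derive (fun s => p2 (pot_slope s)) t)
      (Derive (fun s => p3 (pot_slope s)) t)) <= M) /\
  forall e, 0 < e <= 1 -> exists a Rr chi phi psi,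
    (0 < a <= e /\ 0 < chi <= e /\ 0 < Rr <= e /\ / e <= Rr / a /\ chi / (m * c) / a <= 1) /\
    (forall S, (forall t x, S t x -> norm3 (sub3 x (rhat r t)) <= Rr) ->
      C2_on S phi /\ C2_on_C S psi /\ solves_KG c m q chi a phi psi S) /\
    (forall t x, norm3 (sub3 x (rhat r t)) <= Rr ->
      Rabs (phi t x) + grad0_norm c phi t x <= M /\
      Rabs (phi t x - pot_limit t x) + grad0_norm c (fun t x => phi t x - pot_limit t x) t x <= e) /\
    (forall t, ball_int (rhat r t) Rr (conc_integrand c m chi a psi t) <= M /\
      sphere_int (rhat r t) Rr (conc_integrand c m chi a psi t) <= e /\
      c0 <= ball_int (rhat r t) Rr (energy_density c m q chi a phi psi t) <= M).
Proof.
  assert (B0 : 0 <= B) by (eapply Rle_trans; [apply Rabs_pos | apply (hB 0)]).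
  assert (g0 := gap_min_pos c eps1 hc heps).
  set (C1 := 2 * B * c ^ 2 * / ((1 - eps1 ^ 2) * c ^ 2) ^ 2).
  assert (C10 : 0 <= C1).
  { apply Rmult_le_pos; [apply Rmult_le_pos; [lra | apply pow2_ge_0] | left; apply Rinv_0_lt_compat, pow_lt, g0]. }
  (* Meets the width condition of [fluid_small] for every averaged trajectory, since averaging
     preserves the bounds [eps1 * c] and [B] that enter [C1]. *)
  set (L := / (1 + 32 * C1)). assert (L0 : 0 < L) by (apply Rinv_0_lt_compat; lra).
  assert (L1 : L <= 1) by (rewrite <- Rinv_1; apply Rinv_le_contravar; lra).
  assert (LC : 32 * C1 * L <= 1).
  { apply Rle_trans with ((1 + 32 * C1) * L); [nra | right; unfold L; field; lra]. }
  destruct (potential_estimate c eps1 B (m * c / q) hc heps) as [Mp [Mp0 HP]].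
  destruct (trajectory_bounds c L eps1 B hc L0 heps) as [K [K0 HK]].
  destruct (HP r v v1 v2 hv ltac:(apply hB) ltac:(apply hB) dr dv dv1) as [HP1 HP2].
  set (cc := conc_const c K K K). set (ec := energy_const c K K K).
  set (Mc := cc * (kpi * exp (2 * K)) * PI * PI * PI). set (Me := m * c ^ 2 / 2 * ec * (kpi * exp (2 * K)) * PI * PI * PI).
  set (M := Rmax Mp (Rmax Mc Me)).
  assert (M1 : Mp <= M) by apply Rmax_l. assert (M2 : Mc <= M) by (eapply Rle_trans; [apply Rmax_l | apply Rmax_r]).
  assert (M3 : Me <= M) by (eapply Rle_trans; [apply Rmax_r | apply Rmax_r]).
  exists M, (m * c ^ 2 / 4 * kpi * exp (- (2 * K) - 3 / 2)).
  assert (Hk := kpi_pos). assert (c2 : 0 < c ^ 2) by (apply pow_lt; auto).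
  split; [apply Rmult_lt_0_compat; [apply Rmult_lt_0_compat; auto; nra | apply exp_pos] |].
  assert (norm_axis : forall u, norm3 (mk3 0 0 u) = Rabs u).
  { intro u. unfold norm3, dot3, mk3, p1, p2, p3. cbn [fst snd]. rewrite <- sqrt_Rsqr_abs. f_equal. unfold Rsqr. ring. }
  split.
  { intro t. destruct (HP1 t) as [h1 [h2 h3]]. refine (conj _ (conj _ _)).
    - unfold pot_value. lra.
    - unfold pot_slope. rewrite norm_axis. lra.
    - unfold pot_slope, mk3, p1, p2, p3. cbn [fst snd]. rewrite !Derive_const. fold (mk3 0 0 (Derive (fun s => m * c / q * force c (v s) (v1 s)) t)).
      rewrite norm_axis, (Derive_scal (fun s => force c (v s) (v1 s))).
      assert (DF : Derive (fun s : R => force c (v s) (v1 s)) t = force1 c (v t) (v1 t) (v2 t))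
        by exact (is_derive_unique _ _ _ (is_derive_force c eps1 hc heps v v1 v2 hv dv dv1 t)).
      rewrite DF. lra. }
  intros e He.
  assert (cc0 : 0 < cc).
  { unfold cc, conc_const. assert (0 < / c ^ 2) by (apply Rinv_0_lt_compat; auto).
    generalize (pow2_ge_0 (K + c)) (pow2_ge_0 (K + c * K)) (pow2_ge_0 K). intros.
    assert (0 <= / c ^ 2 * ((K + c) ^ 2 + (K + c * K) ^ 2)) by (apply Rmult_le_pos; lra). lra. }
  (* The constant of the sphere estimate; [1728 = 27 * 4 ^ 3] comes from [exp_neg_cube] at
     [b ^ 2 / (4 * a ^ 2)]. *)
  set (Q := cc * (kpi * exp (2 * K)) * (2 * PI) * PI * 1728).
  assert (Q0 : 0 < Q).
  { assert (0 < kpi * exp (2 * K)) by (apply Rmult_lt_0_compat; [auto | apply exp_pos]). generalize PI_RGT_0. intro.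
    unfold Q. assert (0 < cc * (kpi * exp (2 * K))) by (apply Rmult_lt_0_compat; auto).
    assert (0 < 2 * PI) by lra. apply Rmult_lt_0_compat; [| lra]. apply Rmult_lt_0_compat; auto. apply Rmult_lt_0_compat; auto. }
  (* [b] is the radius of the ball. The conditions are, in this order: accuracy, room inside the
     strip also for the shift [a / 2], the error [Mp * (b + 2 * b)] of the potential, and the
     surface integral. *)
  set (b := Rmin (Rmin e (L / 4)) (Rmin (e * / (3 * Mp)) (e * / Q))).
  assert (b1 : b <= e) by (eapply Rle_trans; [apply Rmin_l | apply Rmin_l]).
  assert (b2 : b <= L / 4) by (eapply Rle_trans; [apply Rmin_l | apply Rmin_r]).
  assert (b3 : b * (3 * Mp) <= e).
  { apply Rle_trans with (e * / (3 * Mp) * (3 * Mp)); [| right; field; lra]. apply Rmult_le_compat_r; [lra |].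
    eapply Rle_trans; [apply Rmin_r | apply Rmin_l]. }
  assert (b4 : b * Q <= e).
  { apply Rle_trans with (e * / Q * Q); [| right; field; lra]. apply Rmult_le_compat_r; [lra |].
    eapply Rle_trans; [apply Rmin_r | apply Rmin_r]. }
  assert (b0 : 0 < b).
  { repeat apply Rmin_pos; try lra; apply Rmult_lt_0_compat; try lra; apply Rinv_0_lt_compat; lra. }
  clearbody b. set (a := b ^ 2). assert (a0 : 0 < a) by (apply pow_lt; auto).
  assert (ab : a <= b / 4) by (unfold a; nra).
  (* Makes every error [4 * (h * B)] of the averaging at most [a / 2]. *)
  set (h := a / 2 * / (4 * (B + 1))).
  assert (h0 : 0 < h) by (apply Rmult_lt_0_compat; [lra | apply Rinv_0_lt_compat; lra]).
  assert (hh : 4 * (h * B) <= a / 2).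
  { apply Rle_trans with (4 * (h * (B + 1))); [nra | right; unfold h; field; lra]. }
  destruct (mollify r v v1 v2 B (eps1 * c) h h0 dr dv dv1 cv2 hB hv)
    as [rh [vh [vh1 [vh2 [drh [dvh [dvh1 [Ch [Ch1 [Ch2 Hm]]]]]]]]]].
  assert (hvh : forall t, Rabs (vh t) <= eps1 * c) by apply Hm.
  assert (hvh1 : forall t, Rabs (vh1 t) <= B) by apply Hm. assert (hvh2 : forall t, Rabs (vh2 t) <= B) by apply Hm.
  assert (hrh : forall t, Rabs (rh t - r t) <= a / 2) by (intro t; eapply Rle_trans; [apply Hm | exact hh]).
  set (kq := / (2 * (2 * K + 5))).
  assert (hkq : 0 < kq <= 1 /\ kq * (2 * K + 5) <= / 2).
  { split; [split; [apply Rinv_0_lt_compat; lra | rewrite <- Rinv_1; apply Rinv_le_contravar; lra] | right; unfold kq; field; lra]. }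
  assert (mc : 0 < m * c) by (apply Rmult_lt_0_compat; auto).
  assert (a4 : 0 < a ^ 4) by (apply pow_lt; auto).
  assert (e2 : 0 < (e / (m * c)) ^ 2) by (apply pow_lt, Rdiv_lt_0_compat; lra).
  (* The bound for [d = / kap ^ 2]: [b] for the error of the potential, [a ^ 4 * kq] for the energy
     estimates, and the last one for [chi = m * c * sqrt d] to be at most [e]. *)
  set (s := Rmin b (Rmin (a ^ 4 * kq) ((e / (m * c)) ^ 2))).
  assert (s0 : 0 < s <= 1).
  { split; [| generalize (Rmin_l b (Rmin (a ^ 4 * kq) ((e / (m * c)) ^ 2))); fold s; lra].
    repeat apply Rmin_pos; auto. apply Rmult_lt_0_compat; lra. }
  assert (s1 : s <= b) by apply Rmin_l.
  assert (s2 : s <= a ^ 4 * kq) by (eapply Rle_trans; [apply Rmin_r | apply Rmin_l]).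
  assert (s3 : s <= (e / (m * c)) ^ 2) by (eapply Rle_trans; [apply Rmin_r | apply Rmin_r]).
  clearbody s.
  destruct (fluid_small c L eps1 B hc L0 heps a rh vh vh1 vh2 a0 hvh hvh1 drh dvh Ch Ch1 Ch2 LC s s0)
    as [d [E [P [J [X [Hd [CE [CP [HEP [HJ [Hb [HX HXd]]]]]]]]]]]].
  set (chi := m * c * sqrt d).
  assert (sd : 0 < sqrt d) by (apply sqrt_lt_R0; lra). assert (sdd : sqrt d * sqrt d = d) by (apply sqrt_sqrt; lra).
  assert (chi0 : 0 < chi) by (apply Rmult_lt_0_compat; auto).
  assert (kapd : / (m * c / chi) ^ 2 = d).
  { rewrite <- sdd. unfold chi. field. lra. }
  assert (hshell : forall t y, Rabs y < L -> E t y ^ 2 - P t y ^ 2 = 1 + / (m * c / chi) ^ 2 * Mass c a vh vh1 vh2 t y)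
    by (intros; rewrite kapd; apply HEP; auto).
  assert (hcont := fun t y Hy => proj2 (HEP t y Hy)). cbv beta in hcont.
  assert (hkap : / (m * c / chi) ^ 2 <= a ^ 4 * kq) by (rewrite kapd; lra).
  assert (hR : a <= b /\ b + a / 2 <= 1 /\ b + a / 2 < L) by lra.
  assert (HK' := HK vh vh1 hvh hvh1).
  assert (hKl : forall t, Rabs (lamp c vh t) <= K) by apply HK'. assert (hKl1 : forall t, Rabs (lamp1 c vh vh1 t) <= K) by apply HK'.
  assert (hKE : forall t y, Rabs y < L -> Rabs (E t y) <= K) by (intros t y Hy; eapply Rle_trans; [apply (Hb t y Hy) | apply HK']).
  assert (hKP : forall t y, Rabs y < L -> Rabs (P t y) <= K) by (intros t y Hy; eapply Rle_trans; [apply (Hb t y Hy) | apply HK']).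
  assert (hKJ : forall t y, Rabs y < L -> Rabs (J t y) <= K) by (intros t y Hy; eapply Rle_trans; [apply (Hb t y Hy) | apply HK']).
  assert (a1 : a <= 1) by lra.
  exists a, b, chi, (phi_sol c m q rh vh E P J), (psi_sol c m a chi rh vh P).
  assert (near : forall t x, norm3 (sub3 x (rhat r t)) <= b ->
    Rabs (p1 x) <= b /\ Rabs (p2 x) <= b /\ Rabs (p3 x - r t) <= b /\ Rabs (p3 x - rh t) <= b + a / 2).
  { intros t x Hx. destruct (ball_in_box _ _ _ Hx) as [B1 [B2 B3]]. unfold rhat, mk3, p1, p2, p3 in B1, B2, B3. cbn [fst snd] in B1, B2, B3.
    fold (p1 x) in B1. fold (p2 x) in B2. fold (p3 x) in B3. rewrite Rminus_0_r in B1, B2.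
    refine (conj B1 (conj B2 (conj B3 _))). specialize (hrh t).
    replace (p3 x - rh t) with ((p3 x - r t) - (rh t - r t)) by ring. eapply Rle_trans; [apply Rabs_sub_le |]. lra. }
  split; [| split; [| split]].
  - refine (conj _ (conj _ (conj _ (conj _ _)))).
    + lra.
    + split; auto. unfold chi. apply Rle_trans with (m * c * (e / (m * c))); [| right; field; lra].
      apply Rmult_le_compat_l; [lra |]. rewrite <- (sqrt_pow2 (e / (m * c))) by (left; apply Rdiv_lt_0_compat; lra).
      apply sqrt_le_1_alt. lra.
    + lra.
    + unfold a. replace (b / b ^ 2) with (/ b) by (field; lra). apply Rinv_le_contravar; lra.
    + unfold chi. replace (m * c * sqrt d / (m * c) / a) with (sqrt d * / a) by (field; lra).
      apply Rmult_le_reg_r with a; auto. rewrite Rmult_assoc, Rinv_l, Rmult_1_r, Rmult_1_l by lra.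
      rewrite <- (sqrt_pow2 a) by lra. apply sqrt_le_1_alt. assert (a ^ 2 <= 1 ^ 2) by (apply pow_incr; lra). rewrite pow1 in *. assert (0 < a ^ 2) by (apply pow_lt; auto).
      assert (a ^ 4 * kq <= a ^ 4 * 1) by (apply Rmult_le_compat_l; lra).
      replace (a ^ 4) with (a ^ 2 * a ^ 2) in * by ring. nra.
  - intros S HS.
    assert (HT : forall t x, S t x -> sep_dom L (tube L rh) t x).
    { intros t x Hx. destruct (near t x (HS t x Hx)) as [n1 [n2 [n3 n4]]]. unfold sep_dom, tube. lra. }
    refine (conj _ (conj _ _)).
    + apply (phi_sol_C2 c m q L); auto.
    + apply (psi_sol_C2 c m a chi L eps1); auto.
    + apply (psi_sol_KG c m q a chi L eps1 rh vh vh1 vh2); auto. intros t x Hx. apply HT, Hx.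
  - intros t x Hx. destruct (near t x Hx) as [n1 [n2 [n3 n4]]].
    assert (tb : Rabs (p3 x - rh t) < L) by lra.
    destruct (HXd t (p3 x) tb) as [A1 [A2 [DA1 [DA2 [x1 [x2 x3]]]]]].
    destruct (Hm t) as [m1 [m2 [m3 _]]].
    (* The errors are at most [b], and points of the ball are within [b + a / 2 <= 2 * b] of both
       trajectories. *)
    destruct (HP2 rh vh vh1 vh2 hvh hvh1 hvh2 drh dvh dvh1 X A1 A2 d b (2 * b) t x) with (phi := phi_sol c m q rh vh E P J) (phiinf := pot_limit) as [G1 G2]; auto; try lra.
    + intros t' x'. unfold phi_sol, comoving, limit_profile. rewrite HX. ring.
    + apply pot_limit_profile.
  - intros t. refine (conj _ (conj _ (conj _ _))).
    + eapply Rle_trans; [| exact M2]. unfold Mc, cc.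
      apply (conc_ball_bound c m a chi L eps1 rh vh vh1 P hc hm a0 chi0 L0 heps hvh drh dvh Ch CP J HJ K K K K kq); auto.
    + eapply Rle_trans; [apply (conc_sphere_bound c m a chi L eps1 rh vh vh1 P hc hm a0 chi0 L0 heps hvh drh dvh Ch CP J HJ K K K K kq); auto |].
      fold cc. eapply Rle_trans; [| exact b4].
      assert (u0 : 0 < b ^ 2 / (4 * a ^ 2)) by (apply Rdiv_lt_0_compat; [auto | apply Rmult_lt_0_compat; [lra | apply pow_lt; auto]]).
      assert (X1 := exp_neg_cube _ u0). assert (Pp := PI_RGT_0).
      assert (ek : 0 < exp (2 * K)) by apply exp_pos. assert (ia : 0 < / a ^ 3) by (apply Rinv_0_lt_compat, pow_lt; auto).
      assert (Hpos : 0 < b ^ 2 * cc * kpi * / a ^ 3 * exp (2 * K) * (2 * PI) * PI) by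
        (assert (0 < b ^ 2) by (apply pow_lt; auto); assert (0 < 2 * PI) by lra; do 6 (apply Rmult_lt_0_compat; [| assumption]); assumption).
      apply Rle_trans with (b ^ 2 * cc * kpi * / a ^ 3 * exp (2 * K) * (2 * PI) * PI * (27 * / (b ^ 2 / (4 * a ^ 2)) ^ 3)).
      * replace (b ^ 2 * (cc * (kpi * / a ^ 3 * exp (2 * K) * exp (- (b ^ 2 / (4 * a ^ 2))))) * (2 * PI) * PI) with
          (b ^ 2 * cc * kpi * / a ^ 3 * exp (2 * K) * (2 * PI) * PI * exp (- (b ^ 2 / (4 * a ^ 2)))) by ring.
        apply Rmult_le_compat_l; lra.
      * replace (b ^ 2 * cc * kpi * / a ^ 3 * exp (2 * K) * (2 * PI) * PI * (27 * / (b ^ 2 / (4 * a ^ 2)) ^ 3)) with (b * b * Q)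
          by (unfold Q, a; field; lra).
        assert (b * b <= b) by nra. apply Rmult_le_compat_r; lra.
    + apply (energy_ball_lower c m q a chi L eps1 rh vh vh1 E P hc hm hq a0 chi0 L0 heps hvh drh dvh Ch CE CP J HJ K K K K kq); auto.
    + eapply Rle_trans; [| exact M3]. unfold Me, ec.
      apply (energy_ball_upper c m q a chi L eps1 rh vh vh1 E P hc hm hq a0 chi0 L0 heps hvh drh dvh Ch CE CP J HJ K K K K kq); auto.
Qed.

End Core.

(** * From arbitrary accuracy to a sequence *)

Lemma choice_nat {A : Type} (Q : nat -> A -> Prop) : (forall n, exists x, Q n x) -> exists f, forall n, Q n (f n).
Proof.
  intro H. exists (fun n => proj1_sig (constructive_indefinite_description _ (H n))).
  intro n. apply (proj2_sig (constructive_indefinite_description _ (H n))).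
Qed.

Lemma inv_succ_pos n : 0 < / (INR n + 1).
Proof. apply Rinv_0_lt_compat. generalize (pos_INR n). lra. Qed.

Lemma inv_succ_mono n p : (n <= p)%nat -> / (INR p + 1) <= / (INR n + 1).
Proof.
  intro H. apply Rinv_le_contravar; [generalize (pos_INR n); lra |]. apply le_INR in H. lra.
Qed.

Lemma inv_succ_le_1 n : / (INR n + 1) <= 1.
Proof. rewrite <- Rinv_1. apply Rinv_le_contravar; generalize (pos_INR n); lra. Qed.

Lemma inv_succ_small e : 0 < e -> exists N, forall n, (N <= n)%nat -> / (INR n + 1) < e.
Proof.
  intro He. destruct (archimed_cor1 e He) as [N [H1 H2]]. exists N. intros n Hn.
  eapply Rle_lt_trans; [| exact H1]. apply le_INR in Hn. apply lt_INR in H2. apply Rinv_le_contravar; simpl in *; lra.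
Qed.

Lemma lim_of_inv_succ (w : nat -> R) (l : R) : (forall n, Rabs (w n - l) <= / (INR n + 1)) -> is_lim_seq w l.
Proof.
  intros H. apply is_lim_seq_spec. intros e. destruct (inv_succ_small e (cond_pos e)) as [N HN].
  exists N. intros n Hn. eapply Rle_lt_trans; [apply H | apply HN, Hn].
Qed.

Lemma convergent_subsequence (u : nat -> R) (lo hi : R) : (forall n, lo <= u n <= hi) ->
  exists p : nat -> nat, (forall n, (n <= p n)%nat) /\ ex_finite_lim_seq (fun n => u (p n)).
Proof.
  intros H. destruct (Bolzano_Weierstrass u (fun x => lo <= x <= hi) (compact_P3 lo hi) H) as [l Hl].
  destruct (choice_nat (fun n k => (n <= k)%nat /\ Rabs (u k - l) <= / (INR n + 1))) as [p Hp].
  { intro n. destruct (Hl (fun y => Rabs (y - l) < / (INR n + 1)) n) as [k [h1 h2]].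
    - exists (mkposreal _ (inv_succ_pos n)). intros y Hy. exact Hy.
    - exists k. split; [auto | lra]. }
  exists p. split; [apply Hp |]. exists l. apply lim_of_inv_succ. apply Hp.
Qed.

Theorem theorem4 (c m q : R) (hc : 0 < c) (hm : 0 < m) (hq : q <> 0)
  (r v v1 v2 : R -> R) (Cst betacheck eps1 : R)
  (hr : forall t, is_derive r t (v t))
  (hv : forall t, is_derive v t (v1 t))
  (hv1 : forall t, is_derive v1 t (v2 t))
  (hv2 : forall t, continuous v2 t)
  (hbound : forall t, Rabs (v t) + Rabs (v1 t) + Rabs (v2 t) <= Cst)
  (hbc : 0 < betacheck) (heps : eps1 < 1)
  (hbeta : forall t, betacheck <= Rabs (v t / c) <= eps1) :
  forall Tm Tp : R, Tm < Tp ->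
    exists (a Rs chi : nat -> R) (phi : nat -> R -> P3 -> R),
      localized_KG c m r Tm Tp a Rs chi phi /\
      exists psi : nat -> R -> P3 -> C,
        concentrating c m q r Tm Tp a Rs chi phi psi.
Proof.
  intros Tm Tp HT.
  assert (he : 0 <= eps1 < 1) by (specialize (hbeta 0); lra).
  assert (hB : forall t, Rabs (v t) <= Cst /\ Rabs (v1 t) <= Cst /\ Rabs (v2 t) <= Cst).
  { intro t. specialize (hbound t). generalize (Rabs_pos (v t)) (Rabs_pos (v1 t)) (Rabs_pos (v2 t)). lra. }
  assert (hvc : forall t, Rabs (v t) <= eps1 * c).
  { intro t. replace (v t) with (v t / c * c) by (field; lra). rewrite Rabs_mult, (Rabs_right c) by lra.
    apply Rmult_le_compat_r; [lra | apply hbeta]. }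
  destruct (approximate_solutions c m q hc hm hq r v v1 v2 Cst eps1 he hr hv hv1 hv2 hB hvc) as [M [c0 [Hc0 [HL HA]]]].
  assert (HA' := fun n => HA (/ (INR n + 1)) (conj (inv_succ_pos n) (inv_succ_le_1 n))).
  destruct (choice_nat _ HA') as [a Ha]. destruct (choice_nat _ Ha) as [Rr Hb]. destruct (choice_nat _ Hb) as [chi Hch].
  destruct (choice_nat _ Hch) as [phi Hph]. destruct (choice_nat _ Hph) as [psi H]. clear HA HA' Ha Hb Hch Hph.
  (* The time [t0] is [Tm], where the energies lie in [[c0, M]]. Parameters, potentials and
     solutions are reindexed together, so each remains a solution of its own equation. *)
  destruct (convergent_subsequence (fun n => ball_int (rhat r Tm) (Rr n) (energy_density c m q (chi n) (a n) (phi n) (psi n) Tm)) c0 M)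
    as [p [Hp Hlim]]; [intro n; destruct (H n) as [_ [_ [_ h1]]]; destruct (h1 Tm) as [_ [_ h2]]; exact h2 |].
  set (e := fun n => / (INR (p n) + 1)).
  assert (He : forall n, e n <= / (INR n + 1)) by (intro n; apply inv_succ_mono, Hp).
  assert (Hsmall : forall eps, 0 < eps -> exists N, forall n, (N <= n)%nat -> e n <= eps).
  { intros eps Heps. destruct (inv_succ_small eps Heps) as [N HN]. exists N. intros n Hn. specialize (HN n Hn). specialize (He n). lra. }
  assert (Hzero : forall w : nat -> R, (forall n, 0 < w (p n) <= e n) -> is_lim_seq (fun n => w (p n)) 0).
  { intros w Hw. apply lim_of_inv_succ. intro n. specialize (Hw n). specialize (He n). rewrite Rminus_0_r, Rabs_right; lra. }
  exists (fun n => a (p n)), (fun n => Rr (p n)), (fun n => chi (p n)), (fun n => phi (p n)). split.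
  - unfold localized_KG. refine (conj _ (conj _ (conj _ (conj _ (conj _ _))))).
    + intro n. destruct (H (p n)) as [[h1 [h2 [h3 _]]] _]. lra.
    + apply Hzero. intro n. destruct (H (p n)) as [[h1 [h2 [h3 _]]] _]. exact h3.
    + apply Hzero. intro n. destruct (H (p n)) as [[h1 [h2 [h3 _]]] _]. exact h1.
    + apply Hzero. intro n. destruct (H (p n)) as [[h1 [h2 [h3 _]]] _]. exact h2.
    + apply (is_lim_seq_le_p_loc INR); [| apply is_lim_seq_INR]. exists 0%nat. intros n _.
      destruct (H (p n)) as [[h1 [h2 [h3 [h4 _]]]] _]. rewrite Rinv_inv in h4. specialize (Hp n). apply le_INR in Hp. lra.
    + exists (Rmax 1 M). refine (conj _ (conj _ (conj _ _))).
      * intro n. destruct (H (p n)) as [[h1 [h2 [h3 [h4 h5]]]] _]. eapply Rle_trans; [exact h5 | apply Rmax_l].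
      * intro n. destruct (H (p n)) as [_ [h1 _]]. apply h1. intros t x [_ Hx]. exact Hx.
      * intros n t x [_ Hx]. destruct (H (p n)) as [_ [_ [h1 _]]]. eapply Rle_trans; [apply h1, Hx | apply Rmax_r].
      * exists (pot_limit c m q r v v1), (pot_value c m q v v1), (pot_slope c m q v v1).
        split; [| split; [| split]].
        -- reflexivity.
        -- intro t. unfold pot_value, pot_slope, mk3, p1, p2, p3. cbn [fst snd].
           refine (conj _ (conj _ (conj _ _))); try apply ex_derive_const; apply ex_derive_scal; eexists.
           ++ apply (is_derive_rest_pot c eps1); auto.
           ++ apply (is_derive_force c eps1 hc he v v1 v2); auto.
        -- intros t _. destruct (HL t) as [h1 [h2 h3]]. generalize (Rmax_r 1 M). lra.
        -- intros eps Heps. destruct (Hsmall eps Heps) as [N HN]. exists N. intros n Hn t x [_ Hx].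
           destruct (H (p n)) as [_ [_ [h1 _]]]. eapply Rle_trans; [apply h1, Hx | apply HN, Hn].
  - exists (fun n => psi (p n)). unfold concentrating. split; [| split; [| split; [| split]]].
    + intro n. destruct (H (p n)) as [_ [h1 _]]. specialize (h1 (Omega_hat r Tm Tp (Rr (p n)))).
      split; apply h1; intros t x [_ Hx]; exact Hx.
    + exists M. intros n t _. destruct (H (p n)) as [_ [_ [_ h1]]]. destruct (h1 t) as [h2 _]. exact h2.
    + intros eps Heps. destruct (Hsmall eps Heps) as [N HN]. exists N. intros n Hn t _.
      destruct (H (p n)) as [_ [_ [_ h1]]]. destruct (h1 t) as [_ [h2 _]]. eapply Rle_trans; [exact h2 | apply HN, Hn].
    + exists c0, 0%nat. split; [exact Hc0 |]. intros n t _ _. destruct (H (p n)) as [_ [_ [_ h1]]]. destruct (h1 t) as [_ [_ [h2 _]]]. exact h2.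
    + exists Tm. split; [lra | exact Hlim].
Qed.
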